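(* There exists a modular form of weight $1$ on $G_3[\sqrt{-3}]$ (with some character) whose zero divisor consists of three $G_3[\sqrt{-3}]$-orbits, with representatives in the ball $\mathcal{B}_3=\{(w_1,w_2,w_3):|w_1|^2+|w_2|^2+|w_3|^2<1\}$ given by the three divisors $w_1=0$, $w_2=0$, $w_3=0$, each with multiplicity one.
   Context: $\zeta=(-1+\sqrt{-3})/2$, $\mathcal{E}=\mathbb{Z}[\zeta]$. On $\mathbb{C}^4$, $h(z,w)=\bar z_0w_0-\bar z_1w_1-\bar z_2w_2-\bar z_3w_3$; $G_3=\{g\in\mathrm{GL}(4,\mathcal{E}):h(gz,gw)=h(z,w)\}$, $G_3[a]=\ker(G_3\to\mathrm{GL}(4,\mathcal{E}/a\mathcal{E}))$. $\tilde{\mathcal B}=\{z:h(z,z)>0\}$; each positive line contains a unique $z$ with $z_0=1$, identifying the set of positive lines with the ball $\mathcal{B}_3$ via $w_i=z_i/z_0$. A modular form of weight $k$ on finite-index $\Gamma\subset G_3$ with character $v$: holomorphic $f$ on $\tilde{\mathcal B}$, $f(tz)=t^{-k}f(z)$ ($t\in\mathbb{C}^\times$), $f(\gamma z)=v(\gamma)f(z)$ ($\gamma\in\Gamma$), regular at cusps. *)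

(* Defs.v *)
(* Complex numbers are `R[i]`
   (mathcomp-real-closed `complex`) over an arbitrary `R : realType`;
   `R[i]` carries its numFieldType norm (the complex modulus), hence the
   usual topology, and `'cV[R[i]]_4` is a normed module over `R[i]`, so
   `differentiable` below is complex (Frechet) differentiability. *)
From HB Require Import structures.
From mathcomp Require Import all_boot all_order all_algebra.
From mathcomp Require Import complex.
From mathcomp Require Import all_classical all_reals all_analysis.

Set Implicit Arguments.
Unset Strict Implicit.
Unset Printing Implicit Defensive.

Import Order.TTheory GRing.Theory Num.Theory.
Import numFieldNormedType.Exports.
Local Open Scope ring_scope.
Local Open Scope complex_scope.

Section Defs.
Variable R : realType.
Local Notation C := (R[i]).

Definition zeta : C := Complex (- (1 / 2)) (Num.sqrt 3 / 2).

Definition sqrtm3 : C := 'i * (Num.sqrt (3 : R))%:C.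

Definition is_eis (x : C) : Prop :=
  exists a b : int, x = a%:~R + b%:~R * zeta.

Definition in_ideal (a x : C) : Prop := exists y, is_eis y /\ x = a * y.

Definition hform (z w : 'cV[C]_4) : C :=
  (z ord0 ord0)^* * w ord0 ord0
  - \sum_(k < 4 | k != ord0) (z k ord0)^* * w k ord0.

Definition G3 (g : 'M[C]_4) : Prop :=
  [/\ forall k l, is_eis (g k l),
      g \in unitmx,
      forall k l, is_eis (invmx g k l) &
      forall z w : 'cV[C]_4, hform (g *m z) (g *m w) = hform z w].

Definition G3cong (a : C) (g : 'M[C]_4) : Prop :=
  G3 g /\ forall k l, in_ideal a (g k l - (k == l)%:R).

Definition ballcone : set 'cV[C]_4 := [set z | 0 < hform z z].

Definition holo_on (U : set 'cV[C]_4) (f : 'cV[C]_4 -> C) : Prop :=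
  forall z : 'cV[(C : numFieldType)]_4, U z ->
    differentiable (f : 'cV[C]_4 -> C^o) z.

Definition is_character (Gam : 'M[C]_4 -> Prop) (v : 'M[C]_4 -> C) : Prop :=
  (forall g, Gam g -> v g != 0) /\
  (forall g g', Gam g -> Gam g' -> v (g *m g') = v g * v g').

(* regularity at the cusps: for every cusp (nonzero isotropic E-vector c),
   f is bounded on some horoball { z : h(c,z) = 1, h(z,z) > N } *)
Definition regular_at_cusps (f : 'cV[C]_4 -> C) : Prop :=
  forall c : 'cV[C]_4, (forall k, is_eis (c k ord0)) -> c != 0 ->
    hform c c = 0 ->
    exists N M : R, forall z, ballcone z -> hform c z = 1 ->
      N%:C < hform z z -> `|f z| <= M%:C.

Definition modular_form (Gam : 'M[C]_4 -> Prop) (k : nat)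
    (v : 'M[C]_4 -> C) (f : 'cV[C]_4 -> C) : Prop :=
  [/\ holo_on ballcone f,
      forall (t : C) z, t != 0 -> ballcone z -> f (t *: z) = t ^- k * f z,
      forall g z, Gam g -> ballcone z -> f (g *m z) = v g * f z &
      regular_at_cusps f].

End Defs.

(* Main.v *)
(** Let [th = sqrt(-3)] and, for a vector [p],
      [N_p(z) = sum_l exp (2 pi / sqrt 3 ((1 + zeta) h(l,l) + h(l,p) - h(p,l)
                                           - |h(l,z)|^2 / h(z,z)))],
    where [l] runs over the lattice [E^4].  This sum is invariant under the
    diagonal action of [G_3] on [(p, z)] and periodic in [p] modulo [E^4].
    Poisson summation along the cusp [e = (1,1,0,0)] factors it as
    [N_p(z) = c h(z,z) |F_p(z)|^2], where [F_p] is a theta series, holomorphic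
    and homogeneous of degree -1; the form is [f = F_p] for [p = e_0 / th].

    An element [g] of [G_3[th]] fixes [p] modulo [E^4], so [|f(gz)| = |f(z)|],
    and the holomorphic function [f(gz) / f(z)], of modulus one, is constant.
    The symmetry of [N_p] makes [F_p] vanish on the mirrors [r^perp] of the
    vectors [r] of the orbit of [e_2] with [th | h(th p, r)].  It has no other
    zeros: [G_3] moves every point either high into the cusp or near the
    segment [tau = 1 + zeta, u = 0], where the leading terms of the theta series
    dominate; at a critical point the comparison is made with the known zero of
    the same series on a mirror.  Reduction modulo [th] shows that the mirrors
    of [e_0 / th] form the three orbits of [w_k = 0].  Multiplicity one holds
    because [f] decreases only linearly along a sequence tending to a point of
    the mirror, and boundedness at the cusps follows from the same reduction. *)
Require Import Defs.
From HB Require Import structures.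
From mathcomp Require Import all_boot all_order all_algebra.
From mathcomp Require Import complex.
From mathcomp Require Import all_classical all_reals all_analysis.
From mathcomp Require Import zify ring lra.
Import Order.TTheory GRing.Theory Num.Theory.
Import numFieldNormedType.Exports.
Local Open Scope ring_scope.
Local Open Scope complex_scope.
Local Notation Re := (@complex.Re _).
Local Notation Im := (@complex.Im _).

Set Implicit Arguments. Unset Strict Implicit. Unset Printing Implicit Defensive.

(** In the exponent of [N_p] the factor [1 + zeta] has real part 1/2 and imaginary part sqrt 3 / 2.
    The first, with the term in [z], makes the sum a Gaussian in a positive majorant of [h]; the
    second contributes the sign [(-1)^h(l,l)]. This sign makes the transverse theta function [sg]
    odd (up to a constant it is the Weierstrass sigma function of the Eisenstein lattice), whence
    the zeros on mirrors. The obstacle is to exclude further zeros: this is done by numerical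
    domination, so every bound is explicit. All of them depend on [q0 = exp(- pi / sqrt 3)], which
    is located by [sg 0 = 0], read as the nearly algebraic equation [1 - 6 q0 - 6 q0^3 = small].
    Modulo [th] two shapes of [p] remain in the coordinates of [cusp4]: type I, [(s, 0, 1, 1) / th],
    with a single constant leading term, and type II, [(-1, 1, 0, 0) / th], with three equal leading
    terms. Poisson summation comes from Polya's finite binomial identity; its constant stays
    unevaluated, since only its positivity matters. *)

Definition cj (R : realType) (z : R[i]) : R[i] := Complex (Re z) (- Im z).
Notation "z ^*" := (cj z) : ring_scope.
Notation "z ^*" := (cj z) : complex_scope.

(** * Real coordinates, modulus and exponential of complex numbers *)

Section ComplexBasics.
Variable R : realType.
Local Notation C := R[i].
Implicit Types (x y z : C) (a b t : R).

Lemma ReD x y : Re (x + y) = Re x + Re y. Proof. by case: x y => [? ?] [? ?]. Qed.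
Lemma ImD x y : Im (x + y) = Im x + Im y. Proof. by case: x y => [? ?] [? ?]. Qed.
Lemma ReN x : Re (- x) = - Re x. Proof. by case: x. Qed.
Lemma ImN x : Im (- x) = - Im x. Proof. by case: x. Qed.
Lemma ReM x y : Re (x * y) = Re x * Re y - Im x * Im y.
Proof. by case: x y => [? ?] [? ?]. Qed.
Lemma ImM x y : Im (x * y) = Re x * Im y + Im x * Re y.
Proof. by case: x y => [? ?] [? ?]. Qed.
Lemma ReJ x : Re x^* = Re x. Proof. by case: x. Qed.
Lemma ImJ x : Im x^* = - Im x. Proof. by case: x. Qed.
Lemma ReC a : Re (a%:C : C) = a :> R. Proof. by []. Qed.
Lemma ImC a : Im (a%:C : C) = 0 :> R. Proof. by []. Qed.
Definition iu : C := Complex 0 1.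
Lemma ReI : Re iu = 0. Proof. by []. Qed.
Lemma ImI : Im iu = 1. Proof. by []. Qed.
Lemma Re0 : Re (0 : C) = 0. Proof. by []. Qed.
Lemma Im0 : Im (0 : C) = 0. Proof. by []. Qed.
Lemma Re1 : Re (1 : C) = 1. Proof. by []. Qed.
Lemma Im1 : Im (1 : C) = 0. Proof. by []. Qed.
Lemma natC n : (n%:R : C) = (n%:R : R)%:C. Proof. by rewrite rmorph_nat. Qed.
Lemma intC (n : int) : (n%:~R : C) = (n%:~R : R)%:C. Proof. by rewrite rmorph_int. Qed.
Lemma Re_nat n : Re (n%:R : C) = n%:R. Proof. by rewrite natC. Qed.
Lemma Im_nat n : Im (n%:R : C) = 0. Proof. by rewrite natC. Qed.
Lemma Re_int (n : int) : Re (n%:~R : C) = n%:~R. Proof. by rewrite intC. Qed.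
Lemma Im_int (n : int) : Im (n%:~R : C) = 0. Proof. by rewrite intC. Qed.

Definition ReIm := (ReD, ImD, ReN, ImN, ReM, ImM, ReJ, ImJ, ReC, ImC, ReI, ImI,
  (Re0, Im0, Re1, Im1, Re_nat, Im_nat, Re_int, Im_int)).

Lemma complexP x y : Re x = Re y -> Im x = Im y -> x = y.
Proof. by case: x y => [? ?] [? ?] /= -> ->. Qed.

Lemma Re_sum (I : Type) (s : seq I) (f : I -> C) :
  Re (\sum_(i <- s) f i) = \sum_(i <- s) Re (f i).
Proof. by elim/big_rec2: _ => // i y1 y2 _ <-; rewrite ReD. Qed.

Lemma Im_sum (I : Type) (s : seq I) (f : I -> C) :
  Im (\sum_(i <- s) f i) = \sum_(i <- s) Im (f i).
Proof. by elim/big_rec2: _ => // i y1 y2 _ <-; rewrite ImD. Qed.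

(** The modulus takes its values in [R] and not in [R[i]], so that the order is total and [lra] and
    [nra] apply. *)
Definition cabs (z : C) : R := Num.sqrt (Re z ^+ 2 + Im z ^+ 2).

Lemma cabsE z : `|z| = (cabs z)%:C. Proof. exact: normc_def. Qed.
Lemma cabs_ge0 z : 0 <= cabs z. Proof. exact: sqrtr_ge0. Qed.
Lemma cabs_sqr z : cabs z ^+ 2 = Re z ^+ 2 + Im z ^+ 2.
Proof. by rewrite sqr_sqrtr// addr_ge0// sqr_ge0. Qed.
Lemma cabsM x y : cabs (x * y) = cabs x * cabs y.
Proof. by apply: complexI; rewrite rmorphM/= -!cabsE normrM. Qed.
Lemma cabsD x y : cabs (x + y) <= cabs x + cabs y.
Proof. by rewrite -lecR rmorphD/= -!cabsE ler_normD. Qed.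
Lemma cabsN x : cabs (- x) = cabs x.
Proof. by apply: complexI; rewrite -!cabsE normrN. Qed.
Lemma cabsB x y : cabs (x - y) = cabs (y - x).
Proof. by rewrite -cabsN opprB. Qed.
Lemma cabs0 : cabs 0 = 0.
Proof. by rewrite /cabs /= expr0n/= addr0 sqrtr0. Qed.
Lemma cabs1 : cabs 1 = 1.
Proof. by apply: complexI; rewrite -cabsE normr1. Qed.
Lemma cabs_eq0 z : (cabs z == 0) = (z == 0).
Proof. by rewrite -(normr_eq0 z) cabsE -(inj_eq (@complexI R)). Qed.
Lemma cabs_gt0 z : (0 < cabs z) = (z != 0).
Proof. by rewrite lt_neqAle cabs_ge0 andbT eq_sym cabs_eq0. Qed.
Lemma cabsC a : cabs a%:C = `|a|.
Proof. by rewrite /cabs/= expr0n/= addr0 sqrtr_sqr. Qed.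
Lemma cabsJ z : cabs z^* = cabs z.
Proof. by rewrite /cabs ReJ ImJ sqrrN. Qed.
Lemma cabsX z n : cabs (z ^+ n) = cabs z ^+ n.
Proof. by elim: n => [|n ih]; rewrite ?expr0 ?cabs1// !exprS cabsM ih. Qed.
Lemma cabsV z : cabs z^-1 = (cabs z)^-1.
Proof.
have [->|z0] := eqVneq z 0; first by rewrite invr0 cabs0 invr0.
apply: (mulfI (x := cabs z)); first by rewrite cabs_eq0.
by rewrite -cabsM !mulfV ?cabs_eq0// cabs1.
Qed.
Lemma cabs_leD x y : cabs x - cabs y <= cabs (x + y).
Proof. by have := cabsD (x + y) (- y); rewrite addrK cabsN; lra. Qed.
Lemma cabs_leB x y : cabs x - cabs y <= cabs (x - y).
Proof. by have := cabs_leD x (- y); rewrite cabsN. Qed.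
Lemma Re_le_cabs z : `|Re z| <= cabs z.
Proof.
rewrite -(@ler_pXn2r _ 2) ?nnegrE ?cabs_ge0// cabs_sqr real_normK ?num_real//.
by rewrite lerDl sqr_ge0.
Qed.
Lemma Im_le_cabs z : `|Im z| <= cabs z.
Proof.
rewrite -(@ler_pXn2r _ 2) ?nnegrE ?cabs_ge0// cabs_sqr real_normK ?num_real//.
by rewrite lerDr sqr_ge0.
Qed.
Lemma cabs_leRI z : cabs z <= `|Re z| + `|Im z|.
Proof.
have e : z = (Re z)%:C + iu * (Im z)%:C.
  by apply: complexP; rewrite !ReIm; ring.
rewrite {1}e (le_trans (cabsD _ _))// cabsM !cabsC.
suff -> : cabs iu = 1 by rewrite mul1r.
by rewrite /cabs /= expr0n/= add0r expr1n sqrtr1.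
Qed.
Lemma cabs_sum (I : Type) (s : seq I) (f : I -> C) :
  cabs (\sum_(i <- s) f i) <= \sum_(i <- s) cabs (f i).
Proof.
elim/big_rec2: _ => [|i y1 y2 _ h]; first by rewrite cabs0.
by rewrite (le_trans (cabsD _ _))// lerD2l.
Qed.
Lemma mulcJ z : z * z^* = (cabs z ^+ 2)%:C.
Proof. by rewrite cabs_sqr; apply: complexP; rewrite !ReIm; ring. Qed.

Definition cexp (z : C) : C :=
  Complex (expR (Re z) * cos (Im z)) (expR (Re z) * sin (Im z)).

Lemma cexpD x y : cexp (x + y) = cexp x * cexp y.
Proof.
by apply: complexP; rewrite ?ReM ?ImM /= ?ReD ?ImD expRD ?cosD ?sinD; ring.
Qed.
Lemma cexp0 : cexp 0 = 1.
Proof. by apply: complexP; rewrite /= expR0 ?cos0 ?sin0 mul1r. Qed.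
Lemma cexpR a : cexp a%:C = (expR a)%:C.
Proof. by apply: complexP; rewrite /= ?cos0 ?sin0 ?mulr1 ?mulr0. Qed.
Lemma cabs_cexp z : cabs (cexp z) = expR (Re z).
Proof.
rewrite /cabs /= !exprMn -mulrDr cos2Dsin2 mulr1 sqrtr_sqr.
by rewrite ger0_norm// expR_ge0.
Qed.
Lemma cexp_neq0 z : cexp z != 0.
Proof. by rewrite -cabs_gt0 cabs_cexp expR_gt0. Qed.
Lemma cexpN z : cexp (- z) = (cexp z)^-1.
Proof.
apply: (mulfI (cexp_neq0 z)).
by rewrite mulfV ?cexp_neq0// -cexpD subrr cexp0.
Qed.
Lemma cexpJ z : (cexp z)^* = cexp z^*.
Proof. by apply: complexP; rewrite ?ReJ ?ImJ /= ?cosN ?sinN// mulrN. Qed.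
Lemma cexpMn z n : cexp (z *+ n) = cexp z ^+ n.
Proof. by elim: n => [|n ih]; rewrite ?mulr0n ?cexp0// mulrS cexpD ih exprS. Qed.
Lemma cexp2piI : cexp (iu * (2 * pi)%:C) = 1.
Proof.
have -> : 2 * pi = pi *+ 2 :> R by rewrite mulr_natl.
by apply: complexP; rewrite /= !(mul0r, mul1r, subr0, add0r, addr0, expR0, oppr0) ?cos2pi ?sin2pi.
Qed.
Lemma cexp2piIn (n : int) : cexp (iu * (2 * pi * n%:~R)%:C) = 1.
Proof.
have aux m : cexp (iu * (2 * pi * m%:R)%:C) = 1.
  have -> : iu * (2 * pi * m%:R)%:C = (iu * (2 * pi)%:C) *+ m :> C.
    by rewrite -[RHS]mulr_natr natC -[RHS]mulrA -rmorphM.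
  by rewrite cexpMn cexp2piI expr1n.
case: n => m; first exact: aux.
by rewrite NegzE mulrNz mulrN rmorphN mulrN cexpN aux invr1.
Qed.
Lemma cexp_piI : cexp (iu * pi%:C) = -1.
Proof.
by apply: complexP; rewrite /= !(mul0r, mul1r, subr0, add0r, addr0, expR0, oppr0) ?cospi ?sinpi.
Qed.

(** Bridge to the conjugation inside [hform]; elsewhere [^*] denotes the coordinatewise [cj]. *)
Lemma cjNum z : Num.conj z = z^*. Proof. by case: z. Qed.
Lemma conjD x y : (x + y)^* = x^* + y^*.
Proof. by apply: complexP; rewrite !ReIm; ring. Qed.
Lemma conjM x y : (x * y)^* = x^* * y^*.
Proof. by apply: complexP; rewrite !ReIm; ring. Qed.
Lemma conjN x : (- x)^* = - x^*.
Proof. by apply: complexP; rewrite !ReIm; ring. Qed.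
Lemma conjR a : (a%:C)^* = a%:C :> C.
Proof. by apply: complexP; rewrite !ReIm; ring. Qed.
Lemma conjn n : (n%:R : C)^* = n%:R.
Proof. by apply: complexP; rewrite !ReIm ?oppr0. Qed.
Lemma conjz (k : int) : (k%:~R : C)^* = k%:~R.
Proof. by apply: complexP; rewrite !ReIm ?oppr0. Qed.
Lemma conj0 : (0 : C)^* = 0.
Proof. by apply: complexP; rewrite !ReIm ?oppr0. Qed.
Lemma conj1 : (1 : C)^* = 1.
Proof. by apply: complexP; rewrite !ReIm ?oppr0. Qed.
Lemma conjKc x : (x^*)^* = x.
Proof. by apply: complexP; rewrite !ReIm ?opprK. Qed.
Lemma conjX x n : (x ^+ n)^* = x^* ^+ n.
Proof. by elim: n => [|n ih]; rewrite ?expr0 ?conj1// !exprS conjM ih. Qed.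
Lemma conjV x : (x^-1)^* = (x^*)^-1.
Proof. by rewrite -!cjNum fmorphV. Qed.
Lemma conj_sum (I : Type) (s : seq I) (f : I -> C) :
  (\sum_(i <- s) f i)^* = \sum_(i <- s) (f i)^*.
Proof. by elim/big_rec2: _ => [|i y1 y2 _ <-]; rewrite ?conj0// conjD. Qed.

Lemma CM a b : (a * b)%:C = a%:C * b%:C :> C. Proof. exact: rmorphM. Qed.
Lemma CD a b : (a + b)%:C = a%:C + b%:C :> C. Proof. exact: rmorphD. Qed.
Lemma CN a : (- a)%:C = - a%:C :> C. Proof. exact: rmorphN. Qed.
Lemma CV a : (a^-1)%:C = a%:C^-1 :> C. Proof. exact: fmorphV. Qed.
Lemma CX a n : (a ^+ n)%:C = a%:C ^+ n :> C. Proof. exact: rmorphXn. Qed.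
Lemma Cnat n : (n%:R)%:C = n%:R :> C. Proof. exact: rmorph_nat. Qed.
Lemma Cint (n : int) : (n%:~R)%:C = n%:~R :> C. Proof. exact: rmorph_int. Qed.
Lemma C0 : (0 : R)%:C = 0 :> C. Proof. by []. Qed.
Lemma C1 : (1 : R)%:C = 1 :> C. Proof. by []. Qed.
Definition toC := (CM, CD, CN, CV, CX, Cint, Cnat, (C0, C1)).

End ComplexBasics.

(** * Unconditional summation over arbitrary index types *)

Section UnconditionalSums.
Variable R : realType.
Local Notation C := R[i].
Implicit Types T U : choiceType.

(** For nonnegative families this is convergence with an explicit bound; the same predicate serves
    existence proofs, domination and numerical estimates. *)
Definition bsum T (g : T -> R) (M : R) :=
  forall s : seq T, uniq s -> \sum_(i <- s) g i <= M.

(** Limit along the directed set of finite duplicate-free lists: lattices are reindexed and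
    regrouped without choosing an order on them. *)
Definition has_sum T (f : T -> C) (S : C) :=
  forall e : R, 0 < e -> exists2 s0 : seq T, uniq s0 &
    forall s, uniq s -> {subset s0 <= s} -> cabs (\sum_(i <- s) f i - S) <= e.

Definition csum T (f : T -> C) : C := xget 0 [set S | has_sum f S]%classic.

Lemma ler_sum_subset T (g : T -> R) (s t : seq T) :
  (forall i, 0 <= g i) -> uniq s -> uniq t -> {subset s <= t} ->
  \sum_(i <- s) g i <= \sum_(i <- t) g i.
Proof.
move=> g0 us ut st.
rewrite [leRHS](bigID (mem s))/= -[X in _ <= X + _]big_filter.
have /(perm_big _) -> : perm_eq [seq i <- t | i \in s] s.
  apply: uniq_perm; rewrite ?filter_uniq// => i.
  by rewrite mem_filter; case: (boolP (i \in s)) => //= /st.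
by rewrite lerDl sumr_ge0.
Qed.

Lemma uniq_catD T (s0 s : seq T) : uniq s0 -> uniq s -> {subset s0 <= s} ->
  perm_eq s (s0 ++ [seq i <- s | i \notin s0]).
Proof.
move=> u0 u ss; apply: uniq_perm => //.
  rewrite cat_uniq u0 filter_uniq//= andbT; apply/hasPn => i.
  by rewrite mem_filter => /andP[].
move=> i; rewrite mem_cat mem_filter.
by case: (boolP (i \in s0)) => [/ss ->|].
Qed.

(** A finite list whose sum nearly reaches the supremum of all finite sums leaves at most [e] for
    everything outside it. *)
Lemma bsum_tail T (g : T -> R) M : (forall i, 0 <= g i) -> bsum g M ->
  forall e, 0 < e -> exists2 s0 : seq T, uniq s0 &
    bsum (fun i => if i \in s0 then 0 else g i) e.
Proof.
move=> g0 gM e e0.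
set A := [set x | exists2 s : seq T, uniq s & x = \sum_(i <- s) g i]%classic.
have hA : has_sup A.
  split; first by exists 0, [::]; rewrite ?big_nil.
  by exists M => x [s us ->]; apply: gM.
have [x [s0 us0 ->] hx] := sup_adherent e0 hA.
exists s0 => // s us.
rewrite (bigID (mem s0))/= big1 ?add0r; last by move=> i ->.
under eq_bigr => i /negPf -> do over.
rewrite -big_filter -(lerD2l (\sum_(i <- s0) g i)) -big_cat/=.
have : \sum_(i <- s0 ++ [seq i <- s | i \notin s0]) g i <= sup A.
  apply: ub_le_sup; first by case: hA.
  eexists; last by reflexivity.
  rewrite cat_uniq us0 filter_uniq//= andbT; apply/hasPn => i.
  by rewrite mem_filter => /andP[].
by move: hx; lra.
Qed.

Lemma bsum_le T (g g' : T -> R) M : (forall i, g' i <= g i) -> bsum g M -> bsum g' M.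
Proof. by move=> le gM s us; rewrite (le_trans _ (gM s us))// ler_sum. Qed.

Lemma bsum_weaken T (g : T -> R) M M' : M <= M' -> bsum g M -> bsum g M'.
Proof. by move=> le gM s us; rewrite (le_trans (gM s us)). Qed.

Lemma bsum_ge0 T (g : T -> R) M : bsum g M -> 0 <= M.
Proof. by move=> /(_ [::] isT); rewrite big_nil. Qed.

Lemma bsumD T (g g' : T -> R) M M' : bsum g M -> bsum g' M' ->
  bsum (fun i => g i + g' i) (M + M').
Proof. by move=> gM gM' s us; rewrite big_split/= lerD ?gM ?gM'. Qed.

Lemma bsumZ T (g : T -> R) M c : 0 <= c -> bsum g M -> bsum (fun i => c * g i) (c * M).
Proof. by move=> c0 gM s us; rewrite -mulr_sumr ler_wpM2l ?gM. Qed.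

Lemma has_sum_unique T (f : T -> C) S S' : has_sum f S -> has_sum f S' -> S = S'.
Proof.
move=> h h'; apply/eqP; rewrite -subr_eq0 -cabs_eq0; apply/negPn/negP => n0.
have d0 : 0 < cabs (S - S') / 3 by rewrite divr_gt0// lt_neqAle eq_sym n0 cabs_ge0.
have [s us hs] := h _ d0; have [s' us' hs'] := h' _ d0.
have ut : uniq (undup (s ++ s')) by exact: undup_uniq.
set t := \sum_(i <- undup (s ++ s')) f i.
have h1 : cabs (t - S') <= cabs (S - S') / 3.
  by apply: hs' => // x xs; rewrite mem_undup mem_cat xs orbT.
have h2 : cabs (t - S) <= cabs (S - S') / 3.
  by apply: hs => // x xs; rewrite mem_undup mem_cat xs.
have : cabs (S - S') <= cabs (t - S) + cabs (t - S').
  have -> : S - S' = (t - S') - (t - S) by ring.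
  by rewrite addrC (le_trans (cabsD _ _))// cabsN.
move: h1 h2 d0; lra.
Qed.

Lemma csumE T (f : T -> C) S : has_sum f S -> csum f = S.
Proof.
move=> h; apply: (@has_sum_unique _ f) => //.
by rewrite /csum; case: xgetP => [x -> //|/(_ S)].
Qed.

Lemma has_sum_bound T (f : T -> C) S M : has_sum f S -> bsum (fun i => cabs (f i)) M ->
  cabs S <= M.
Proof.
move=> h b; apply/ler_addgt0Pr => e e0; have [s us hs] := h _ e0.
have := hs s us (fun x xs => xs); set t := \sum_(_ <- _) _ => ht.
have : cabs t <= M by rewrite (le_trans (cabs_sum _ _))// b.
have : cabs S <= cabs t + cabs (t - S).
  have {1}-> : S = t - (t - S) by ring.
  by rewrite (le_trans (cabsD _ _))// cabsN.
lra.
Qed.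

Lemma has_sumD T (f g : T -> C) S S' : has_sum f S -> has_sum g S' ->
  has_sum (fun i => f i + g i) (S + S').
Proof.
move=> h h' e e0; have e2 : 0 < e / 2 by lra.
have [s us hs] := h _ e2; have [s' us' hs'] := h' _ e2.
exists (undup (s ++ s')); rewrite ?undup_uniq// => t ut st.
have h1 : cabs (\sum_(i <- t) f i - S) <= e / 2.
  by apply: hs => // x xs; apply: st; rewrite mem_undup mem_cat xs.
have h2 : cabs (\sum_(i <- t) g i - S') <= e / 2.
  by apply: hs' => // x xs; apply: st; rewrite mem_undup mem_cat xs orbT.
rewrite big_split/=.
have -> : \sum_(i <- t) f i + \sum_(i <- t) g i - (S + S') =
  (\sum_(i <- t) f i - S) + (\sum_(i <- t) g i - S') by ring.
by rewrite (le_trans (cabsD _ _))//; lra.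
Qed.

Lemma has_sumZ T (f : T -> C) S c : has_sum f S -> has_sum (fun i => c * f i) (c * S).
Proof.
move=> h e e0; have e2 : 0 < e / (cabs c + 1).
  by rewrite divr_gt0// ltr_wpDl// cabs_ge0.
have [s us hs] := h _ e2; exists s => // t ut st.
rewrite -mulr_sumr -mulrBr cabsM.
apply: (@le_trans _ _ ((cabs c + 1) * (e / (cabs c + 1)))).
  by rewrite ler_pM ?cabs_ge0 ?hs//; lra.
by rewrite mulrC divfK// gt_eqF// ltr_wpDl// cabs_ge0.
Qed.

Lemma has_sumN T (f : T -> C) S : has_sum f S -> has_sum (fun i => - f i) (- S).
Proof.
by move=> /(has_sumZ (-1)); rewrite mulN1r; under eq_fun => i do rewrite mulN1r.
Qed.

Lemma eq_has_sum T (f g : T -> C) S : f =1 g -> has_sum f S -> has_sum g S.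
Proof. by move=> /funext ->. Qed.

Lemma has_sumJ T (f : T -> C) S : has_sum f S -> has_sum (fun i => (f i)^*) (S^*).
Proof.
move=> h e e0; have [s us hs] := h _ e0; exists s => // t ut st.
by rewrite -conj_sum -conjN -conjD cabsJ hs.
Qed.

Lemma has_sum_fin T (f : T -> C) (s : seq T) : uniq s ->
  (forall i, i \notin s -> f i = 0) -> has_sum f (\sum_(i <- s) f i).
Proof.
move=> us f0 e e0; exists s => // t ut st.
rewrite (perm_big _ (uniq_catD us ut st))/= big_cat/= [X in _ + X - _]big1_seq.
  by rewrite addr0 subrr cabs0 ltW.
by move=> i; rewrite mem_filter => /andP[_ /andP[/f0]].
Qed.

Lemma has_sum_off T (f : T -> C) S (s : seq T) : uniq s -> has_sum f S ->
  has_sum (fun i => if i \in s then 0 else f i) (S - \sum_(i <- s) f i).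
Proof.
move=> us h.
have h1 : has_sum (fun i => if i \in s then - f i else 0) (- \sum_(i <- s) f i).
  have -> : - \sum_(i <- s) f i = \sum_(i <- s) (if i \in s then - f i else 0).
    by rewrite -sumrN big_seq [RHS]big_seq; apply: eq_bigr => i ->.
  by apply: has_sum_fin => // i /negPf ->.
apply: eq_has_sum (has_sumD h h1) => i /=.
by case: ifP => _; rewrite ?subrr ?addr0.
Qed.

Lemma has_sum_real T (g : T -> R) M : (forall i, 0 <= g i) -> bsum g M ->
  exists S, has_sum (fun i => (g i)%:C) S.
Proof.
move=> g0 gM.
set A := [set x | exists2 s : seq T, uniq s & x = \sum_(i <- s) g i]%classic.
have hA : has_sup A.
  split; first by exists 0, [::]; rewrite ?big_nil.
  by exists M => x [s us ->]; apply: gM.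
exists (sup A)%:C => e e0; have [x [s0 us0 ->] hx] := sup_adherent e0 hA.
exists s0 => // s us ss.
rewrite -rmorph_sum -rmorphB cabsC ler_distl.
have h1 : \sum_(i <- s) g i <= sup A.
  by apply: ub_le_sup; [case: hA|exists s].
have h2 := ler_sum_subset g0 us0 us ss.
by apply/andP; split; lra.
Qed.

Lemma has_sum_ex T (f : T -> C) M : bsum (fun i => cabs (f i)) M ->
  exists S, has_sum f S.
Proof.
move=> b.
have pos (g : T -> R) : (forall i, `|g i| <= cabs (f i)) ->
    exists S, has_sum (fun i => (g i)%:C) S.
  move=> gf.
  (* A real family is the difference of the nonnegative families [|g| + g] and [|g|]. *)
  have [S1 h1] : exists S, has_sum (fun i => (`|g i| + g i)%:C) S.
    apply: (@has_sum_real _ _ (2 * M)) => [i|].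
      by have := ler_norm (- g i); rewrite normrN; lra.
    apply: bsum_le (bsumZ _ b) => // i.
    by have := ler_norm (g i); have := gf i; lra.
  have [S2 h2] : exists S, has_sum (fun i => (`|g i|)%:C) S.
    by apply: (@has_sum_real _ _ M) => //; apply: bsum_le b.
  exists (S1 - S2); apply: eq_has_sum (has_sumD h1 (has_sumN h2)) => i /=.
  by rewrite -rmorphB/=; congr (_%:C); ring.
have [S1 h1] := pos (fun i => Re (f i)) (fun i => Re_le_cabs (f i)).
have [S2 h2] := pos (fun i => Im (f i)) (fun i => Im_le_cabs (f i)).
exists (S1 + iu R * S2); apply: eq_has_sum (has_sumD h1 (has_sumZ (iu R) h2)) => i.
by apply: complexP; rewrite !ReIm; ring.
Qed.

Lemma csumP T (f : T -> C) M : bsum (fun i => cabs (f i)) M -> has_sum f (csum f).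
Proof. by move=> /has_sum_ex[S h]; rewrite (csumE h). Qed.

Lemma has_sum_bij T U (phi : U -> T) (psi : T -> U) (f : T -> C) S :
  cancel phi psi -> cancel psi phi -> has_sum f S -> has_sum (f \o phi) S.
Proof.
move=> k1 k2 h e e0; have [s us hs] := h e e0.
exists (map psi s); first by rewrite map_inj_uniq//; exact: can_inj k2.
move=> t ut st; have := hs (map phi t).
rewrite big_map; apply; first by rewrite map_inj_uniq//; exact: can_inj k1.
move=> x xs; apply/mapP; exists (psi x); last by rewrite k2.
by apply: st; apply: map_f.
Qed.

Lemma bsum_inj T U (phi : U -> T) (g : T -> R) M :
  injective phi -> bsum g M -> bsum (g \o phi) M.
Proof.
by move=> ip b s us; have := b (map phi s); rewrite big_map; apply; rewrite map_inj_uniq.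
Qed.

Lemma bsum_prod T U (g : T * U -> R) (m : T -> R) M : (forall i, 0 <= g i) ->
  (forall x, bsum (fun y => g (x, y)) (m x)) -> bsum m M -> bsum g M.
Proof.
move=> g0 gm mM s us.
set t := undup (map fst s); set u := undup (map snd s).
apply: (@le_trans _ _ (\sum_(p <- [seq (x, y) | x <- t, y <- u]) g p)).
  apply: ler_sum_subset => //; first by apply: allpairs_uniq; rewrite ?undup_uniq// => -[? ?] [? ?].
  move=> [x y] xy; apply/allpairsP; exists (x, y); split => //.
    by rewrite mem_undup; apply/mapP; exists (x, y).
  by rewrite mem_undup; apply/mapP; exists (x, y).
rewrite big_allpairs; apply: (@le_trans _ _ (\sum_(x <- t) m x)).
  by apply: ler_sum => x _; apply: gm; rewrite undup_uniq.
by apply: mM; rewrite undup_uniq.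
Qed.

Lemma bsum_slice T U (g : T * U -> R) M x : bsum g M -> bsum (fun y => g (x, y)) M.
Proof. by move=> b; apply: (@bsum_inj _ _ (fun y => (x, y)) g M _ b) => y y' []. Qed.

Lemma has_sum_big T U (t : seq T) (f : T * U -> C) (F : T -> C) :
  (forall x, has_sum (fun y => f (x, y)) (F x)) ->
  has_sum (fun y => \sum_(x <- t) f (x, y)) (\sum_(x <- t) F x).
Proof.
move=> h; elim: t => [|x t ih].
  rewrite big_nil => e e0; exists [::] => // s us _; rewrite subr0.
  by rewrite big1 ?cabs0 ?ltW// => i _; rewrite big_nil.
rewrite big_cons; apply: eq_has_sum (has_sumD (h x) ih) => y /=.
by rewrite big_cons.
Qed.

(** For a finite set [t] of rows containing those of a good list [s], a finite set [v] of columns is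
    taken so large that the rectangle contains [s] and nearly exhausts each of the rows in [t]. *)
Lemma has_sum_fubini T U (f : T * U -> C) S (F : T -> C) :
  has_sum f S -> (forall x, has_sum (fun y => f (x, y)) (F x)) -> has_sum F S.
Proof.
move=> h hF e e0; have e2 : 0 < e / 2 by lra.
have [s us hs] := h _ e2.
exists (undup (map fst s)); first exact: undup_uniq.
move=> t ut st.
have [u uu hu] : exists2 u : seq U, uniq u &
    forall v, uniq v -> {subset u <= v} ->
    cabs (\sum_(x <- t) \sum_(y <- v) f (x, y) - \sum_(x <- t) F x) <= e / 2.
  have [u uu hu] := has_sum_big t hF e2; exists u => // v uv su.
  by rewrite exchange_big/= hu.
pose v := undup (u ++ map snd s).
have uv : uniq v by exact: undup_uniq.
have hv : cabs (\sum_(x <- t) \sum_(y <- v) f (x, y) - \sum_(x <- t) F x) <= e / 2.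
  by apply: hu => // y yu; rewrite mem_undup mem_cat yu.
have : cabs (\sum_(p <- [seq (x, y) | x <- t, y <- v]) f p - S) <= e / 2.
  apply: hs; first by apply: allpairs_uniq => // -[? ?] [? ?].
  move=> [x y] xy; apply/allpairsP; exists (x, y); split => //=.
    by apply: st; rewrite mem_undup; apply/mapP; exists (x, y).
  by rewrite mem_undup mem_cat; apply/orP; right; apply/mapP; exists (x, y).
rewrite big_allpairs; move: hv; set a := \sum_(_ <- _) _; set b := \sum_(_ <- _) _ => hv h2.
have -> : b - S = (a - S) - (a - b) by ring.
by rewrite (le_trans (cabsD _ _))// cabsN; lra.
Qed.

Lemma csum_fubini T U (f : T * U -> C) M : bsum (fun i => cabs (f i)) M ->
  has_sum (fun x => csum (fun y => f (x, y))) (csum f).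
Proof.
move=> b; apply: (has_sum_fubini (csumP b)) => x; apply: (@csumP _ _ M).
exact: (@bsum_slice _ _ (fun i => cabs (f i))).
Qed.

Lemma has_sum_mul T U (f : T -> C) (g : U -> C) S S' M M' :
  has_sum f S -> has_sum g S' ->
  bsum (fun i => cabs (f i)) M -> bsum (fun i => cabs (g i)) M' ->
  has_sum (fun p : T * U => f p.1 * g p.2) (S * S').
Proof.
move=> hf hg bf bg.
have b : bsum (fun p : T * U => cabs (f p.1 * g p.2)) (M' * M).
  apply: (@bsum_prod _ _ _ (fun x => M' * cabs (f x))) => [p|x|].
      exact: cabs_ge0.
    apply: (@bsum_weaken _ _ (cabs (f x) * M')); first by rewrite mulrC.
    by apply: bsum_le (bsumZ (cabs_ge0 (f x)) bg) => y /=; rewrite cabsM.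
  exact: bsumZ (bsum_ge0 bg) bf.
have [Q hQ] := has_sum_ex b.
suff <- : Q = S * S' by [].
apply: (@has_sum_unique _ (fun x => f x * S')).
  by apply: has_sum_fubini hQ _ => x /=; apply: has_sumZ.
by rewrite mulrC; apply: eq_has_sum (has_sumZ S' hf) => x; rewrite mulrC.
Qed.

Definition tends (u : nat -> C) (l : C) :=
  forall e : R, 0 < e -> exists n0, forall n, (n0 <= n)%N -> cabs (u n - l) <= e.

Lemma tendsD u v l l' : tends u l -> tends v l' -> tends (fun n => u n + v n) (l + l').
Proof.
move=> h h' e e0; have e2 : 0 < e / 2 by lra.
have [n hn] := h _ e2; have [m hm] := h' _ e2.
exists (maxn n m) => k; rewrite geq_max => /andP[/hn h1 /hm h2].
have -> : u k + v k - (l + l') = (u k - l) + (v k - l') by ring.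
by rewrite (le_trans (cabsD _ _))//; lra.
Qed.

Lemma tends_cst l : tends (fun=> l) l.
Proof. by move=> e e0; exists 0%N => n _; rewrite subrr cabs0 ltW. Qed.

Lemma tends_sum T (s : seq T) (u : nat -> T -> C) (l : T -> C) :
  (forall i, tends (u^~ i) (l i)) -> tends (fun n => \sum_(i <- s) u n i) (\sum_(i <- s) l i).
Proof.
move=> h; elim: s => [|i s ih].
  by rewrite big_nil => e e0; exists 0%N => n _; rewrite big_nil subrr cabs0 ltW.
rewrite big_cons => e e0; have [n hn] := tendsD (h i) ih e0.
by exists n => k /hn; rewrite big_cons.
Qed.

Lemma tends_unique u l l' : tends u l -> tends u l' -> l = l'.
Proof.
move=> h h'; apply/eqP; rewrite -subr_eq0 -cabs_eq0; apply/negPn/negP => n0.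
have d0 : 0 < cabs (l - l') / 3 by rewrite divr_gt0// lt_neqAle eq_sym n0 cabs_ge0.
have [n hn] := h _ d0; have [m hm] := h' _ d0.
have h1 := hn _ (leq_maxl n m); have h2 := hm _ (leq_maxr n m).
have : cabs (l - l') <= cabs (u (maxn n m) - l) + cabs (u (maxn n m) - l').
  have -> : l - l' = (u (maxn n m) - l') - (u (maxn n m) - l) by ring.
  by rewrite addrC (le_trans (cabsD _ _))// cabsN.
lra.
Qed.

(** Tannery's theorem: outside a finite list the majorant is small uniformly in [n], and on the list
    convergence is termwise. *)
Lemma has_sum_dominated T (u : nat -> T -> C) (l : T -> C) (S : nat -> C) L
    (m : T -> R) M :
  bsum m M -> (forall n i, cabs (u n i) <= m i) -> (forall i, tends (u^~ i) (l i)) ->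
  (forall n, has_sum (u n) (S n)) -> has_sum l L -> tends S L.
Proof.
move=> mM um ul hS hL e e0.
have m0 i : 0 <= m i by rewrite (le_trans _ (um 0%N i))// cabs_ge0.
have lm i : cabs (l i) <= m i.
  apply/ler_addgt0Pr => d d0; have [n hn] := ul i _ d0.
  have := hn n (leqnn n); have := um n i.
  have {2}-> : l i = u n i - (u n i - l i) by ring.
  by have := cabsD (u n i) (- (u n i - l i)); rewrite cabsN; lra.
have e3 : 0 < e / 3 by lra.
have [s us hs] := bsum_tail m0 mM e3.
have [n0 hn] := tends_sum s ul e3; exists n0 => n /hn.
set a := \sum_(_ <- _) _; set b := \sum_(_ <- _) _ => h3.
have h1 : cabs (S n - a) <= e / 3.
  apply: has_sum_bound (has_sum_off us (hS n)) _; apply: bsum_le hs => i.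
  by case: ifP; rewrite ?cabs0.
have h2 : cabs (L - b) <= e / 3.
  apply: has_sum_bound (has_sum_off us hL) _; apply: bsum_le hs => i.
  by case: ifP; rewrite ?cabs0.
have -> : S n - L = (S n - a) + (a - b) - (L - b) by ring.
rewrite (le_trans (cabsD _ _))// cabsN.
by have := cabsD (S n - a) (a - b); lra.
Qed.

(** Without a maximum there would be arbitrarily many terms of size at least [g x0], against the
    bound [M]. Applied to a Gaussian sum it provides nearest lattice points. *)
Lemma bsum_max T (g : T -> R) M (P : T -> Prop) x0 : (forall i, 0 < g i) -> bsum g M ->
  P x0 -> exists2 x, P x & forall y, P y -> g y <= g x.
Proof.
move=> g0 gM Px0; apply/not_exists2P => H.
have H' x : P x -> exists2 y, P y & g x < g y.
  move=> Px; have [//|nP] := H x; apply/not_exists2P => K; apply: nP => y Py.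
  by have [//|] := K y; move=> /negP; rewrite -leNgt.
have K n : exists2 s : seq T, uniq s /\ size s = n & exists x, [/\ P x, g x0 <= g x &
    forall y, y \in s -> g x0 <= g y < g x].
  elim: n => [|n [s [us ss] [x [Px x0x hx]]]].
    by exists [::] => //; exists x0.
  have [y Py xy] := H' _ Px; exists (x :: s); rewrite /= ?us ?ss; last first.
    exists y; split => //; first by rewrite (le_trans x0x)// ltW.
    move=> w; rewrite inE => /orP[/eqP ->|/hx/andP[-> /lt_trans ->//]].
    by rewrite x0x xy.
  by split=> //; rewrite andbT; apply/negP => /hx; rewrite ltxx andbF.
have [s [us ss] [x [_ _ hx]]] := K (Num.bound (M / g x0)).
have : \sum_(i <- s) g x0 <= M.
  rewrite (le_trans _ (gM s us))// big_seq [leRHS]big_seq; apply: ler_sum => i.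
  by move=> /hx/andP[].
rewrite big_const_seq count_predT ss iter_addr_0 -mulr_natr leNgt => /negP; apply.
rewrite mulrC -ltr_pdivrMr//; apply: archi_boundP.
by rewrite divr_ge0 ?(bsum_ge0 gM)// ltW.
Qed.

End UnconditionalSums.

(** * Gaussian sums over the integers *)

Section GaussianBounds.
Variable R : realType.
Local Notation C := R[i].

Lemma geometric_le (q : R) n : 0 <= q < 1 -> \sum_(i < n) q ^+ i <= (1 - q)^-1.
Proof.
move=> /andP[q0 q1]; rewrite -[leRHS]mul1r ler_pdivlMr ?subr_gt0//.
have -> : (\sum_(i < n) q ^+ i) * (1 - q) = 1 - q ^+ n.
  elim: n => [|n ih]; first by rewrite big_ord0 expr0 mul0r subrr.
  by rewrite big_ord_recr/= mulrDl ih exprS; ring.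
by rewrite lerBlDr lerDl exprn_ge0.
Qed.

Lemma bsum_geometric (q : R) : 0 <= q < 1 -> bsum (fun n : nat => q ^+ n) (1 - q)^-1.
Proof.
move=> q01 s us; have q0 : 0 <= q by case/andP: q01.
pose K := (\max_(i <- s) i).+1.
apply: (@le_trans _ _ (\sum_(i <- iota 0 K) q ^+ i)).
  apply: ler_sum_subset; rewrite ?iota_uniq// => i; first exact: exprn_ge0.
  by move=> si; rewrite mem_iota add0n ltnS leq_bigmax_seq.
rewrite (_ : iota 0 K = index_iota 0 K); last by rewrite /index_iota subn0.
by rewrite big_mkord geometric_le.
Qed.

Lemma bsum_int (g : int -> R) M M' : bsum (fun n : nat => g n%:Z) M ->
  bsum (fun n : nat => g (- (n.+1)%:Z)) M' -> bsum g (M + M').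
Proof.
move=> h h' s us; rewrite (bigID (fun m : int => 0 <= m))/=; apply: lerD.
  rewrite -big_filter; have := h (map absz [seq m <- s | 0 <= m]).
  rewrite big_map big_seq [X in _ -> X <= _]big_seq.
  have -> : \sum_(i <- [seq m <- s | 0 <= m] | i \in [seq m <- s | 0 <= m]) g `|i|%N%:Z =
     \sum_(i <- [seq m <- s | 0 <= m] | i \in [seq m <- s | 0 <= m]) g i.
    by apply: eq_bigr => i; rewrite mem_filter => /andP[i0 _]; rewrite gez0_abs.
  apply; rewrite map_inj_in_uniq ?filter_uniq// => i j.
  rewrite !mem_filter => /andP[i0 _] /andP[j0 _] e.
  by rewrite -(gez0_abs i0) e gez0_abs.
rewrite -big_filter; have := h' (map (fun m : int => (`|m|%N).-1) [seq m <- s | ~~ (0 <= m)]).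
rewrite big_map big_seq [X in _ -> X <= _]big_seq.
have e1 (i : int) : ~~ (0 <= i) -> - (`|i|.-1.+1)%N%:Z = i by lia.
have -> : \sum_(i <- [seq m <- s | ~~ (0 <= m)] | i \in [seq m <- s | ~~ (0 <= m)])
    g (- (`|i|.-1.+1)%N%:Z) =
   \sum_(i <- [seq m <- s | ~~ (0 <= m)] | i \in [seq m <- s | ~~ (0 <= m)]) g i.
  by apply: eq_bigr => i; rewrite mem_filter => /andP[i0 _]; rewrite e1.
apply; rewrite map_inj_in_uniq ?filter_uniq// => i j.
rewrite !mem_filter => /andP[i0 _] /andP[j0 _] e.
by rewrite -(e1 _ i0) e e1.
Qed.

Lemma bsum_gauss (c b : R) : 0 < c ->
  exists M, bsum (fun m : int => expR (- c * m%:~R ^+ 2 + b * `|m%:~R|)) M.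
Proof.
move=> c0; pose q := expR (- (c / 2)).
have q01 : 0 <= q < 1 by rewrite expR_ge0 expR_lt1; lra.
have h (n : nat) (x : R) : `|x| = n%:R -> expR (- c * x ^+ 2 + b * `|x|) <=
    expR (b ^+ 2 / (2 * c)) * q ^+ n.
  move=> xn; rewrite -expRM_natl -expRD ler_expR -[x ^+ 2]real_normK ?num_real// xn.
  have n1 : n%:R <= n%:R ^+ 2 :> R by rewrite -natrX ler_nat; case: n {xn} => // n; nia.
  (* Half of the quadratic term absorbs the linear term [b n]; since [n <= n^2], the other half is
     bounded by a geometric series. *)
  have : 0 <= c / 2 * (n%:R - b / c) ^+ 2 by rewrite mulr_ge0 ?sqr_ge0//; lra.
  have -> : c / 2 * (n%:R - b / c) ^+ 2 = c / 2 * n%:R ^+ 2 - b * n%:R + b ^+ 2 / (2 * c).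
    by field; rewrite gt_eqF.
  set B := b ^+ 2 / _; move: n1; set v : R := n%:R; set u := v ^+ 2.
  by clearbody u v B; nra.
eexists; apply: bsum_int.
  by apply: bsum_le (bsumZ (expR_ge0 (b ^+ 2 / (2 * c))) (bsum_geometric q01)) => n;
    apply: h; rewrite normr_nat.
apply: bsum_le (bsumZ (expR_ge0 (b ^+ 2 / (2 * c))) (bsum_geometric q01)) => n.
apply: le_trans (h n.+1 _ _) _; first by rewrite mulrNz normrN normr_nat.
rewrite ler_wpM2l ?expR_ge0// exprS ler_piMl ?exprn_ge0//; lra.
Qed.

Lemma has_sum_inj (T U : choiceType) (phi : U -> T) (psi : T -> U) (f : T -> C) S :
  cancel phi psi -> (forall x, phi (psi x) <> x -> f x = 0) ->
  has_sum f S -> has_sum (f \o phi) S.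
Proof.
move=> k1 k2 h e e0; have [s us hs] := h e e0.
exists (undup (map psi s)); first exact: undup_uniq.
move=> t ut st.
pose s' := map phi t ++ [seq x <- s | x \notin map phi t].
have := hs s'; rewrite big_cat/= big_map [X in _ + X - _]big1_seq ?addr0; last first.
  move=> x; rewrite mem_filter => /andP[_ /andP[xt xs]]; apply: k2 => e1.
  move/negP: xt; apply; apply/mapP; exists (psi x) => //.
  by apply: st; rewrite mem_undup map_f.
apply.
  rewrite cat_uniq map_inj_uniq ?ut/=; last exact: can_inj k1.
  rewrite filter_uniq// andbT; apply/hasPn => x.
  by rewrite mem_filter => /andP[].
by move=> x xs; rewrite mem_cat mem_filter xs andbT orbN.
Qed.

End GaussianBounds.

(** * Polya's finite form of the Poisson formula *)

Section Polya.
Variable R : realType.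
Local Notation C := R[i].

Definition ce (t : R) : C := cexp (iu R * (2 * pi * t)%:C).

Lemma ceD a b : ce (a + b) = ce a * ce b.
Proof. by rewrite /ce -cexpD -mulrDr -rmorphD/= -mulrDr. Qed.
Lemma ce_int (m : int) : ce m%:~R = 1. Proof. exact: cexp2piIn. Qed.
Lemma ce0 : ce 0 = 1. Proof. exact: (ce_int 0). Qed.
Lemma ceMn a n : ce (a *+ n) = ce a ^+ n.
Proof. by elim: n => [|n ih]; rewrite ?mulr0n ?ce0// mulrS ceD ih exprS. Qed.
Lemma cabs_ce t : cabs (ce t) = 1.
Proof. by rewrite cabs_cexp !ReIm !(mul0r, mulr0) subr0 expR0. Qed.
Lemma ce_neq0 t : ce t != 0. Proof. exact: cexp_neq0. Qed.
Lemma ceN t : ce (- t) = (ce t)^-1.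
Proof. by apply: (mulfI (ce_neq0 t)); rewrite mulfV ?ce_neq0// -ceD subrr ce0. Qed.
Lemma ceE t : ce t = Complex (cos (2 * pi * t)) (sin (2 * pi * t)).
Proof.
by apply: complexP; rewrite /ce /= !(mul0r, mul1r, add0r, addr0, subr0, oppr0, mulr0) expR0 mul1r.
Qed.

Lemma ce_half_cos t : ce (t / 2) + ce (- (t / 2)) = (2 * cos (pi * t))%:C.
Proof.
rewrite !ceE mulrN cosN sinN (_ : 2 * pi * (t / 2) = pi * t); last by field.
by apply: complexP; rewrite !ReIm/=; ring.
Qed.

Lemma ce_eq1 (t : R) : ce t = 1 -> exists m : int, t = m%:~R.
Proof.
set f := Num.floor t => h.
exists f; have := floor_itv t; rewrite -/f => /andP[f1 f2].
move: f2; rewrite intrD => f2.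
set d := t - f%:~R; have d0 : 0 <= d < 1 by rewrite /d; apply/andP; split; lra.
have hd : ce d = 1 by rewrite /d ceD h mul1r ceN ce_int invr1.
have hc : cos (2 * pi * d) = 1 by move: hd; rewrite ceE => -[].
have pi0 := pi_gt0 R.
suff : d = 0 by rewrite /d; lra.
apply/eqP; apply/negPn/negP => dn0.
have dp : 0 < d by rewrite lt_neqAle eq_sym dn0; case/andP: d0.
have : sin (pi * d) ^+ 2 = 0.
  move: hc; rewrite (_ : 2 * pi * d = (pi * d) *+ 2); last by rewrite mulr2n; ring.
  rewrite cos_mulr2n sin2cos2 mulr2n => hh.
  by move: hh; set c2 := cos _ ^+ 2; lra.
move/eqP; rewrite sqrf_eq0 gt_eqF// sin_gt0_pi//.
by apply/andP; split; [rewrite mulr_gt0|rewrite gtr_pMr//; case/andP: d0].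
Qed.

Lemma sum_ce (N : nat) (k : int) : (0 < N)%N ->
  \sum_(j < N) ce (k%:~R / N%:R) ^+ j = if (N%:Z %| k)%Z then N%:R else 0.
Proof.
move=> N0; have N1 : N%:R != 0 :> R by rewrite pnatr_eq0 -lt0n.
case: ifPn => [/dvdzP[q ->]|nd].
  rewrite (_ : _ / _ = q%:~R); last by rewrite intrM -pmulrn mulfK.
  by rewrite ce_int; under eq_bigr do rewrite expr1n; rewrite sumr_const card_ord.
apply/eqP; have : (ce (k%:~R / N%:R) - 1) * (\sum_(j < N) ce (k%:~R / N%:R) ^+ j) = 0.
  rewrite -subrX1 -ceMn (_ : _ *+ N = k%:~R); first by rewrite ce_int subrr.
  by rewrite -[LHS]mulr_natr divfK.
move/eqP; rewrite mulf_eq0 subr_eq0 => /orP[/eqP/ce_eq1[m hm]|//].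
move/negP: nd; case; apply/dvdzP; exists m.
have : k%:~R = (m * N)%:~R :> R by rewrite intrM -pmulrn -hm divfK.
by move/intr_inj.
Qed.

(** Normalised to 1 at [k = 0], and 0 for [|k| > n], where the binomial vanishes. For [k] of order
    [sqrt n] it approximates the Gaussian [exp(- k^2 / n)]. *)
Definition binr (n : nat) (k : int) : R :=
  'C(n.*2, n + `|k|)%:R / 'C(n.*2, n)%:R.

Lemma bin_central_gt0 n : 0 < 'C(n.*2, n)%:R :> R.
Proof. by rewrite ltr0n bin_gt0 -addnn leq_addr. Qed.

Lemma binr_nat (n i : nat) : (i <= n.*2)%N ->
  binr n (n%:Z - i%:Z) = 'C(n.*2, i)%:R / 'C(n.*2, n)%:R.
Proof.
move=> i2; rewrite /binr; congr (_%:R / _).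
have [in'|ni] := leqP i n.
  have -> : (n + `|n%:Z - i%:Z|)%N = (n.*2 - i)%N by lia.
  by rewrite bin_sub.
by congr ('C(_, _)); lia.
Qed.

Lemma polya_pow (n : nat) (t : R) :
  ((2 * cos (pi * t)) ^+ n.*2)%:C =
  \sum_(i < (n.*2).+1) 'C(n.*2, i)%:R * ce (t * (n%:Z - i%:Z)%:~R).
Proof.
rewrite rmorphXn/= -ce_half_cos exprDn; apply: eq_bigr => i _.
rewrite -mulr_natl; congr (_ * _); rewrite -!ceMn -ceD; congr ce.
have i2 : (i <= n.*2)%N by rewrite -ltnS.
have e : (n%:Z - i%:Z)%:~R = n%:R - i%:R :> R by rewrite rmorphB.
have e2 : n.*2%:R = 2 * n%:R :> R by rewrite -mul2n natrM.
rewrite e -[_ *+ (n.*2 - i)]mulr_natr -[_ *+ i]mulr_natr natrB// e2.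
by field.
Qed.

(** Summing the binomial expansion of a power of [2 cos] against [N]-th roots of unity selects the
    exponents congruent to [r] modulo [N]. *)
Lemma polya_sum (n N : nat) (r j0 : int) (y : R) : (0 < N)%N ->
  \sum_(j < N) ((2 * cos (pi * ((j%:Z + j0)%:~R + y) / N%:R)) ^+ n.*2)%:C *
      ce (- ((j%:Z + j0) * r)%:~R / N%:R) =
  \sum_(i < (n.*2).+1) 'C(n.*2, i)%:R * ce (y * (n%:Z - i%:Z)%:~R / N%:R) *
      (if (N%:Z %| n%:Z - i%:Z - r)%Z then N%:R else 0).
Proof.
move=> N0; have N1 : N%:R != 0 :> R by rewrite pnatr_eq0 -lt0n.
under eq_bigr => j _ do rewrite -mulrA polya_pow big_distrl/=.
rewrite exchange_big/=; apply: eq_bigr => i _.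
set k := n%:Z - i%:Z.
have -> : (if (N%:Z %| k - r)%Z then N%:R else 0) =
    \sum_(j < N) ce ((j%:Z + j0)%:~R * (k - r)%:~R / N%:R).
  rewrite -sum_ce//; have [d|nd] := boolP (N%:Z %| k - r)%Z; last first.
    transitivity (\sum_(j < N) ce (j0%:~R * (k - r)%:~R / N%:R) *
       ce ((k - r)%:~R / N%:R) ^+ j); last first.
      apply: eq_bigr => j _; rewrite -ceMn -ceD; congr ce.
      have -> : (j%:Z + j0)%:~R = j%:R + j0%:~R :> R by rewrite rmorphD.
      by rewrite -[_ *+ j]mulr_natr; field.
    by rewrite -mulr_sumr sum_ce// (negPf nd) mulr0.
  apply: eq_bigr => j _; case/dvdzP: d => q ->.
  have e1 : (q * N)%:~R / N%:R = q%:~R :> R by rewrite intrM -pmulrn mulfK.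
  by rewrite -mulrA e1 -intrM !ce_int expr1n.
rewrite mulr_sumr; apply: eq_bigr => j _.
rewrite -!mulrA -!ceD; congr (_ * ce _).
by rewrite !(intrD, intrM, mulrNz); field.
Qed.

(** The exact identity whose limit, for [n / N^2 -> 1 / s] and [r / N -> x], is the Poisson formula:
    the binomials tend to a Gaussian and the powers of the cosine to the dual Gaussian. *)
Lemma polya_has_sum (n N : nat) (r j0 : int) (y : R) : (0 < N)%N ->
  has_sum (fun m : int => (binr n (m * N + r))%:C * ce (y * (m * N + r)%:~R / N%:R))
   ((2 ^+ n.*2 / (N%:R * 'C(n.*2, n)%:R))%:C *
     \sum_(j < N) (cos (pi * ((j%:Z + j0)%:~R + y) / N%:R) ^+ n.*2)%:C *
      ce (- ((j%:Z + j0) * r)%:~R / N%:R)).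
Proof.
move=> N0; have N1 : N%:R != 0 :> C by rewrite pnatr_eq0 -lt0n.
pose f (k : int) : C := (binr n k)%:C * ce (y * k%:~R / N%:R) *
  (if (N%:Z %| k - r)%Z then 1 else 0).
have c0 : 'C(n.*2, n)%:R != 0 :> C by rewrite pnatr_eq0 -lt0n bin_gt0 -addnn leq_addr.
set S := (X in has_sum _ X).
have hf : has_sum f S.
  pose s := map (fun i : nat => n%:Z - i%:Z) (iota 0 (n.*2).+1).
  have us : uniq s by rewrite map_inj_uniq ?iota_uniq// => i j; lia.
  have := @has_sum_fin R _ f s us; rewrite big_map.
  have -> : \sum_(j <- iota 0 (n.*2).+1) f (n%:Z - j%:Z) = S.
    rewrite (_ : iota 0 _ = index_iota 0 (n.*2).+1) ?big_mkord; last by rewrite /index_iota subn0.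
    rewrite /S fmorph_div/= rmorphM/= !rmorph_nat.
    apply: (mulfI N1); apply: (mulfI c0); rewrite -mulrA mulr_sumr mulr_sumr.
    rewrite [RHS](_ : _ = (2 ^+ n.*2)%:C * \sum_(j < N)
      (cos (pi * ((j%:Z + j0)%:~R + y) / N%:R) ^+ n.*2)%:C *
      ce (- ((j%:Z + j0) * r)%:~R / N%:R)); last first.
      by field; rewrite N1 c0.
    transitivity (\sum_(j < N) ((2 * cos (pi * ((j%:Z + j0)%:~R + y) / N%:R)) ^+ n.*2)%:C *
      ce (- ((j%:Z + j0) * r)%:~R / N%:R)); last first.
      by rewrite mulr_sumr; apply: eq_bigr => j _; rewrite exprMn rmorphM/= -!mulrA.
    rewrite polya_sum//; apply: eq_bigr => i _; rewrite /f binr_nat; last by rewrite -ltnS.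
    rewrite fmorph_div/= !rmorph_nat; case: ifP => _; last by rewrite !mulr0.
    by field; rewrite c0.
  apply=> k ks; rewrite /f /binr bin_small ?mul0r ?rmorph0 ?mul0r//.
  rewrite ltnNge; apply/negP => h; move/negP: ks; apply.
  apply/mapP; exists (`|n%:Z - k|)%N; last by lia.
  by rewrite mem_iota; lia.
have := @has_sum_inj R _ _ (fun m : int => m * N + r) (fun k => ((k - r) %/ N)%Z) f S.
move=> /(_ _ _ hf) H; apply: eq_has_sum (H _ _).
  by move=> m /=; rewrite /f addrK dvdz_mull// mulr1.
  by move=> m; rewrite addrK mulzK//; lia.
move=> k hk; rewrite /f; case: ifP => // d; last by rewrite mulr0.
by case: hk; rewrite divzK// subrK.
Qed.

End Polya.

(** * Limits and majorants of both sides of Polya's identity *)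

Section PolyaLimits.
Variable R : realType.
Local Notation C := R[i].

Lemma expR_le_1B (t : R) : 1 - t <= expR (- t).
Proof. by have := expR_ge1Dx (- t). Qed.

Lemma expR_ge_1B (t : R) : t < 1 -> expR (- (t / (1 - t))) <= 1 - t.
Proof.
move=> t1; have d0 : 0 < 1 - t by lra.
rewrite expRN -[leRHS]invrK lef_pV2 ?posrE ?expR_gt0 ?invr_gt0//.
by apply: le_trans (expR_ge1Dx _); rewrite le_eqVlt; apply/orP; left; apply/eqP; field; rewrite gt_eqF.
Qed.

Lemma binrS n (k : nat) : (k < n)%N ->
  binr R n k.+1 = binr R n k * ((n - k)%:R / (n + k).+1%:R).
Proof.
move=> kn; rewrite /binr !absz_nat addnS.
have h := @mul_bin_left n.*2 (n + k).
have e1 : (n.*2 - (n + k) = n - k)%N by lia.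
have : ((n + k).+1 * 'C(n.*2, (n + k).+1))%:R = ((n - k) * 'C(n.*2, n + k))%:R :> R.
  by rewrite h e1.
rewrite !natrM => e.
have c0 := bin_central_gt0 R n.
have n0 : (n + k).+1%:R != 0 :> R by rewrite pnatr_eq0.
apply: (mulfI n0); rewrite mulrA e; field.
by rewrite -natrD nat1r n0 gt_eqF.
Qed.

Lemma binr0 n : binr R n 0 = 1.
Proof. by rewrite /binr addn0 divff// gt_eqF// bin_central_gt0. Qed.

Lemma binr_ge0 n (k : int) : 0 <= binr R n k.
Proof. by rewrite divr_ge0. Qed.

(** The successive quotients are [1 - (2 j + 1) / (n + j + 1)], and the odd numbers [2 j + 1] with
    [j < k] add up to [k^2]. *)
Lemma binr_le (n k : nat) : (0 < n)%N -> (k <= n)%N ->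
  binr R n k <= expR (- (k%:R ^+ 2 / (n + k)%:R)).
Proof.
move=> n0 kn.
suff H : forall j, (j <= k)%N -> binr R n j <= expR (- (j%:R ^+ 2 / (n + k)%:R)) by exact: H.
elim=> [_|j ih jk]; first by rewrite binr0 expr0n/= mul0r oppr0 expR0.
have jn : (j < n)%N by lia.
rewrite binrS//.
have e : - (j.+1%:R ^+ 2 / (n + k)%:R) =
   - (j%:R ^+ 2 / (n + k)%:R) + - (((j.*2).+1)%:R / (n + k)%:R) :> R.
  by rewrite -opprD -mulrDl; congr (- (_ / _)); rewrite -!natrX -natrD; congr (_%:R); lia.
rewrite e expRD ler_pM ?binr_ge0 ?divr_ge0 ?ih//; first lia.
have -> : (n - j)%:R / (n + j).+1%:R = 1 - (j.*2).+1%:R / (n + j).+1%:R :> R.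
  have h : (n + j).+1%:R != 0 :> R by rewrite pnatr_eq0.
  apply: (mulIf h); rewrite mulrBl !divfK// mul1r -natrB; last by lia.
  by congr (_%:R); lia.
apply: le_trans (expR_le_1B _) _; rewrite ler_expR lerN2 ler_pM2l ?ltr0n//.
by rewrite lef_pV2 ?posrE ?ltr0n ?ler_nat//; lia.
Qed.

Lemma binr_ge (n k : nat) : (k < n)%N ->
  expR (- (k%:R ^+ 2 / (n - k)%:R)) <= binr R n k.
Proof.
move=> kn.
suff H : forall j, (j <= k)%N -> expR (- (j%:R ^+ 2 / (n - k)%:R)) <= binr R n j by exact: H.
elim=> [_|j ih jk]; first by rewrite binr0 expr0n/= mul0r oppr0 expR0.
have jn : (j < n)%N by lia.
rewrite binrS//.
have e : - (j.+1%:R ^+ 2 / (n - k)%:R) =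
   - (j%:R ^+ 2 / (n - k)%:R) + - (((j.*2).+1)%:R / (n - k)%:R) :> R.
  by rewrite -opprD -mulrDl; congr (- (_ / _)); rewrite -!natrX -natrD; congr (_%:R); lia.
rewrite e expRD ler_pM ?expR_ge0 ?ih//; first lia.
have h : (n + j).+1%:R != 0 :> R by rewrite pnatr_eq0.
have e2 : (n - j)%:R / (n + j).+1%:R = 1 - (j.*2).+1%:R / (n + j).+1%:R :> R.
  apply: (mulIf h); rewrite mulrBl !divfK// mul1r -natrB; last by lia.
  by congr (_%:R); lia.
rewrite e2; apply: le_trans _ (expR_ge_1B _); last first.
  by rewrite ltr_pdivrMr ?ltr0n// mul1r ltr_nat; lia.
rewrite ler_expR lerN2 -e2.
have -> : (j.*2).+1%:R / (n + j).+1%:R / ((n - j)%:R / (n + j).+1%:R) =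
    (j.*2).+1%:R / (n - j)%:R :> R.
  have h' : (n - j)%:R != 0 :> R by rewrite pnatr_eq0; lia.
  by rewrite invf_div mulrA divfK.
by rewrite ler_pM2l ?ltr0n// lef_pV2 ?posrE ?ltr0n ?ler_nat//; lia.
Qed.

Lemma sin_bounds (x : R) : 0 <= x <= 1 -> x * (1 - x ^+ 2 / 2) <= sin x <= x.
Proof.
have mvt (t : R) : 0 < t -> exists2 c, 0 < c < t & sin t = cos c * t.
  move=> t0; have := @MVT R (@sin R) (@cos R) 0 t t0.
  move=> /(_ (fun c _ => is_derive_sin c)) [].
    by apply: continuous_subspaceT; exact: continuous_sin.
  by move=> c ct e; exists c; move: ct e; rewrite in_itv/= sin0 !subr0.
have up (t : R) : 0 <= t -> sin t <= t.
  rewrite le_eqVlt => /orP[/eqP <-|t0]; first by rewrite sin0.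
  by have [c _ ->] := mvt _ t0; rewrite ler_piMl ?cos_le1// ltW.
case/andP => x0 x1; rewrite up// andbT.
move: x0; rewrite le_eqVlt => /orP[/eqP <-|x0]; first by rewrite mul0r sin0.
have [c /andP[c0 cx] ->] := mvt _ x0; rewrite mulrC ler_pM2r//.
have -> : cos c = 1 - 2 * sin (c / 2) ^+ 2.
  have {1}-> : c = (c / 2) *+ 2 by rewrite mulr2n; lra.
  by rewrite cos_mulr2n cos2sin2 mulr2n; ring.
have h1 : sin (c / 2) <= c / 2 by apply: up; lra.
have h2 : 0 <= sin (c / 2).
  by rewrite ltW// sin2_gt0//; apply/andP; split; lra.
nra.
Qed.

Lemma sin_sqr_bounds (x : R) : `|x| <= 1 ->
  (x * (1 - x ^+ 2 / 2)) ^+ 2 <= sin x ^+ 2 <= x ^+ 2.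
Proof.
wlog x0 : x / 0 <= x => [H|].
  have [|x0] := leP 0 x; first exact: H.
  by move=> x1; have := H (- x); rewrite sinN normrN !(mulNr, sqrrN); apply=> //; lra.
rewrite ger0_norm// => x1; have /andP[h1 h2] : x * (1 - x ^+ 2 / 2) <= sin x <= x.
  by apply: sin_bounds; rewrite x0.
have h3 : 0 <= x * (1 - x ^+ 2 / 2) by rewrite mulr_ge0//; nra.
by apply/andP; split; rewrite ler_pXn2r ?nnegrE//; lra.
Qed.

Lemma cos_half (t : R) : cos t = 1 - 2 * sin (t / 2) ^+ 2.
Proof.
have {1}-> : t = (t / 2) *+ 2 by rewrite mulr2n; lra.
by rewrite cos_mulr2n cos2sin2 mulr2n; ring.
Qed.

Lemma cos_pow_le n (t : R) : `|t| <= pi / 2 ->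
  cos t ^+ n.*2 <= expR (- (n%:R * t ^+ 2 / 4)).
Proof.
move=> tp; have p2 := pihalf_lt2 R.
have c0 : 0 <= cos t by rewrite cos_ge0_pihalf// -ler_norml.
have /andP[h _] : (t / 2 * (1 - (t / 2) ^+ 2 / 2)) ^+ 2 <= sin (t / 2) ^+ 2 <= (t / 2) ^+ 2.
  by apply: sin_sqr_bounds; rewrite normrM [`|2^-1|]ger0_norm//; lra.
have h2 : cos t <= expR (- (t ^+ 2 / 8)).
  apply: le_trans (expR_le_1B _); rewrite cos_half.
  have : (t / 2) ^+ 2 <= 1.
    by rewrite -[_ ^+ 2]real_normK ?num_real// expr_le1// normrM [`|2^-1|]ger0_norm//; lra.
  move: h; rewrite exprMn; set u := (t / 2) ^+ 2 => h u1.
  have u0 : 0 <= u by exact: sqr_ge0.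
  have -> : t ^+ 2 / 8 = u / 2 by rewrite /u; field.
  have : u / 4 <= u * (1 - u / 2) ^+ 2 by rewrite ler_wpM2l//; nra.
  lra.
apply: (@le_trans _ _ (expR (- (t ^+ 2 / 8)) ^+ n.*2)).
  by apply: lerXn2r; rewrite ?nnegrE ?expR_ge0.
rewrite -expRM_natl ler_expR le_eqVlt; apply/orP; left; apply/eqP.
by rewrite -mul2n natrM; field.
Qed.

Local Open Scope classical_set_scope.

Lemma tends_cvg (u : nat -> C) (l : C) :
  (fun n => Re (u n)) @ \oo --> Re l -> (fun n => Im (u n)) @ \oo --> Im l -> tends u l.
Proof.
move=> /cvgrPdist_le h /cvgrPdist_le h' e e0; have e2 : 0 < e / 2 by lra.
have [n _ hn] := h _ e2; have [m _ hm] := h' _ e2.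
exists (maxn n m) => k; rewrite geq_max => /andP[nk mk].
apply: le_trans (cabs_leRI _) _; rewrite ReD ReN ImD ImN.
have := hn _ nk; have := hm _ mk; rewrite /= distrC => h1; rewrite distrC => h2.
lra.
Qed.

Variables (s : R) (s0 : 0 < s).

(** Odd, so that the residues modulo [NN L] form the symmetric range from [- L] to [L]. The exponent
    [nn L] is close to [NN^2 / s], and positive because of the successor. *)
Definition NN (L : nat) : nat := (L.*2).+1.
Definition nn (L : nat) : nat := (Num.truncn ((NN L)%:R ^+ 2 / s)).+1.

Lemma NN_gt0 L : 0 < (NN L)%:R :> R. Proof. by rewrite ltr0n. Qed.

Lemma cvg_invNN : (fun L => (NN L)%:R^-1 : R) @ \oo --> (0 : R).
Proof.
apply: (@squeeze_cvgr _ _ _ _ (fun=> 0) (@harmonic R)); last exact: cvg_harmonic; last exact: cvg_cst.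
near=> n; rewrite invr_ge0 ltW ?NN_gt0//= lef_pV2 ?posrE ?ltr0n// ler_nat /NN.
by lia.
Unshelve. all: by end_near. Qed.

Lemma nn_bounds L : s^-1 <= (nn L)%:R / (NN L)%:R ^+ 2 <= s^-1 + (NN L)%:R^-1.
Proof.
have N0 := NN_gt0 L.
have N2 : 0 < (NN L)%:R ^+ 2 :> R by rewrite exprn_gt0.
have x0 : 0 <= (NN L)%:R ^+ 2 / s by rewrite divr_ge0 ?ltW.
have /andP[h1 h2] := truncn_itv x0.
have e1 : (NN L)%:R ^+ 2 / s = s^-1 * (NN L)%:R ^+ 2 by rewrite mulrC.
rewrite ler_pdivlMr// ler_pdivrMr// -e1 /nn ltW//= mulrDl -e1 -natr1 lerD//.
by rewrite expr2 mulrA mulVf ?gt_eqF// mul1r /NN ler1n.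
Qed.

Lemma cvg_nn : (fun L => (nn L)%:R / (NN L)%:R ^+ 2 : R) @ \oo --> s^-1.
Proof.
apply: (@squeeze_cvgr _ _ _ _ (fun=> s^-1) (fun L => s^-1 + (NN L)%:R^-1)).
    by near=> n; exact: nn_bounds.
  exact: cvg_cst.
rewrite -[X in _ --> X]addr0; apply: cvgD; [exact: cvg_cst|exact: cvg_invNN].
Unshelve. all: by end_near. Qed.

Variables (x y : R).

Definition rrat (L : nat) : int := Num.floor (x * (NN L)%:R).
Definition kk (m : int) (L : nat) : int := m * (NN L) + rrat L.

Lemma rr_bounds L : x - (NN L)%:R^-1 <= (rrat L)%:~R / (NN L)%:R <= x.
Proof.
have N0 := NN_gt0 L; have := floor_itv (x * (NN L)%:R); rewrite -/(rrat L) intrD.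
move=> /andP[h1 h2]; rewrite ler_pdivlMr// ler_pdivrMr// mulrBl mulVf ?gt_eqF//.
by rewrite h1 andbT; move: h2; lra.
Qed.

Lemma cvg_rr : (fun L => (rrat L)%:~R / (NN L)%:R : R) @ \oo --> x.
Proof.
apply: (@squeeze_cvgr _ _ _ _ (fun L => x - (NN L)%:R^-1) (fun=> x)).
    by near=> n; exact: rr_bounds.
  rewrite -[X in _ --> X]subr0; apply: cvgB; [exact: cvg_cst|exact: cvg_invNN].
exact: cvg_cst.
Unshelve. all: by end_near. Qed.

Lemma kkE m L : (kk m L)%:~R / (NN L)%:R = m%:~R + (rrat L)%:~R / (NN L)%:R :> R.
Proof.
by rewrite /kk intrD intrM -pmulrn mulrDl mulfK// gt_eqF// NN_gt0.
Qed.

Lemma cvg_kk m : (fun L => (kk m L)%:~R / (NN L)%:R : R) @ \oo --> m%:~R + x.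
Proof.
under eq_fun do rewrite kkE.
by apply: cvgD; [exact: cvg_cst|exact: cvg_rr].
Qed.

Lemma cvg_expNratio (a b : nat -> R) (A B : R) : B != 0 -> a @ \oo --> A -> b @ \oo --> B ->
  (fun L => expR (- (a L / b L))) @ \oo --> expR (- (A / B)).
Proof.
move=> B0 ha hb; apply: continuous_cvg; first exact: continuous_expR.
by apply: cvgN; apply: cvgM => //; apply: cvgV.
Qed.

Lemma cvg_binr m : (fun L => binr R (nn L) (kk m L)) @ \oo --> expR (- (s * (m%:~R + x) ^+ 2)).
Proof.
have sV : s^-1 != 0 by rewrite invr_eq0 gt_eqF.
pose a L := `|(kk m L)%:~R / (NN L)%:R| : R.
pose b L := (nn L)%:R / (NN L)%:R ^+ 2 : R.
have ha : a @ \oo --> `|m%:~R + x| by apply: cvg_norm; exact: cvg_kk.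
have ha2 : (fun L => a L ^+ 2) @ \oo --> (m%:~R + x) ^+ 2.
  by rewrite -[X in _ --> X]real_normK ?num_real//; apply: cvgM.
have hb : b @ \oo --> s^-1 by exact: cvg_nn.
have hae : (fun L => a L * (NN L)%:R^-1) @ \oo --> (0 : R).
  by rewrite -[X in _ --> X](mulr0 `|m%:~R + x|); apply: cvgM => //; exact: cvg_invNN.
have -> : s * (m%:~R + x) ^+ 2 = (m%:~R + x) ^+ 2 / s^-1 by rewrite invrK mulrC.
have ak L : (`|kk m L|%N)%:R = a L * (NN L)%:R :> R.
  rewrite /a normrM [`|(NN L)%:R^-1|]ger0_norm ?invr_ge0 ?ltW ?NN_gt0// divfK ?gt_eqF ?NN_gt0//.
  by rewrite natr_absz intr_norm.
have bn L : (nn L)%:R = b L * (NN L)%:R ^+ 2 :> R by rewrite divfK// expf_neq0// gt_eqF// NN_gt0.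
have bk L : binr R (nn L) (kk m L) = binr R (nn L) `|kk m L|%N by rewrite /binr absz_nat.
apply: (@squeeze_cvgr _ _ _ _
  (fun L => expR (- (a L ^+ 2 / (b L - a L * (NN L)%:R^-1))))
  (fun L => expR (- (a L ^+ 2 / (b L + a L * (NN L)%:R^-1))))); last first.
    apply: cvg_expNratio => //.
    by rewrite -[X in _ --> X]addr0; apply: cvgD.
  apply: cvg_expNratio => //.
  by rewrite -[X in _ --> X]subr0; apply: cvgB.
near=> L.
have N0 := NN_gt0 L; have N1 : (NN L)%:R != 0 :> R by rewrite gt_eqF.
have hlt : (`|kk m L| < nn L)%N.
  rewrite -(ltr_nat R) ak bn expr2 mulrA ltr_pM2r// -ltr_pdivrMr//.
  rewrite -subr_gt0; near: L.
  apply: (cvgr_gt s^-1); last by rewrite invr_gt0.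
  by rewrite -[X in _ --> X]subr0; apply: cvgB.
rewrite bk; apply/andP; split.
  have -> : a L ^+ 2 / (b L - a L / (NN L)%:R) = (`|kk m L|%N)%:R ^+ 2 / (nn L - `|kk m L|)%:R.
    have -> : (nn L - `|kk m L|)%:R = (b L - a L / (NN L)%:R) * (NN L)%:R ^+ 2.
      by rewrite natrB 1?ltnW// bn ak; field.
    by rewrite ak exprMn -mulf_div divff ?mulr1// expf_neq0.
  exact: binr_ge.
have -> : a L ^+ 2 / (b L + a L / (NN L)%:R) = (`|kk m L|%N)%:R ^+ 2 / (nn L + `|kk m L|)%:R.
  have -> : (nn L + `|kk m L|)%:R = (b L + a L / (NN L)%:R) * (NN L)%:R ^+ 2.
    by rewrite natrD bn ak; field.
  by rewrite ak exprMn -mulf_div divff ?mulr1// expf_neq0.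
by apply: binr_le => //; rewrite ltnW.
Unshelve. all: by end_near. Qed.

(** With [cos = 1 - t], the power lies between [exp(- 2 n t / (1 - t))] and [exp(- 2 n t)], and
    [n t] converges. *)
Lemma cvg_cospow (c : R) : (fun L => cos (c / (NN L)%:R) ^+ (nn L).*2) @ \oo --> expR (- (c ^+ 2 / s)).
Proof.
pose t L := 2 * sin (c / (NN L)%:R / 2) ^+ 2.
pose b L := (nn L)%:R / (NN L)%:R ^+ 2 : R.
have hb : b @ \oo --> s^-1 by exact: cvg_nn.
have hc : (fun L => c / (NN L)%:R) @ \oo --> (0 : R).
  by rewrite -[X in _ --> X](mulr0 c); apply: cvgM; [exact: cvg_cst|exact: cvg_invNN].
pose w L := c / (NN L)%:R / 2.
have hw : w @ \oo --> (0 : R).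
  by rewrite -[X in _ --> X](mul0r 2^-1); apply: cvgM => //; exact: cvg_cst.
have hw2 : (fun L => w L ^+ 2 / 2) @ \oo --> (0 : R).
  rewrite -[X in _ --> X](mul0r 2^-1); apply: cvgM; last exact: cvg_cst.
  by rewrite -[X in _ --> X](mul0r 0); apply: cvgM.
have hNt : (fun L => (NN L)%:R ^+ 2 * t L) @ \oo --> c ^+ 2 / 2.
  apply: (@squeeze_cvgr _ _ _ _ (fun L => c ^+ 2 / 2 * (1 - w L ^+ 2 / 2) ^+ 2) (fun=> c ^+ 2 / 2)).
      near=> L; have N1 : (NN L)%:R != 0 :> R by rewrite gt_eqF// NN_gt0.
      have /sin_sqr_bounds/andP[h1 h2] : `|w L| <= 1.
        near: L; move/cvgrPdist_le : hw => /(_ 1 ltr01); apply: filterS => L.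
        by rewrite sub0r normrN.
      have N2 : 0 <= 2 * (NN L)%:R ^+ 2 :> R by rewrite mulr_ge0// sqr_ge0.
      have e : c ^+ 2 / 2 = 2 * (NN L)%:R ^+ 2 * w L ^+ 2.
        by rewrite /w; move: ((NN L)%:R : R) N1 => N N1; field.
      have e2 : 2 * (NN L)%:R ^+ 2 * w L ^+ 2 * (1 - w L ^+ 2 / 2) ^+ 2 =
         2 * (NN L)%:R ^+ 2 * (w L * (1 - w L ^+ 2 / 2)) ^+ 2 by ring.
      have e3 : (NN L)%:R ^+ 2 * t L = 2 * (NN L)%:R ^+ 2 * sin (w L) ^+ 2.
        by rewrite /t -/(w L); move: ((NN L)%:R : R) (sin (w L)) => N S; ring.
      by rewrite e e2 e3 !ler_wpM2l.
    have hl : (fun L => 1 - w L ^+ 2 / 2) @ \oo --> (1 : R).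
      by rewrite -[X in _ --> X]subr0; apply: cvgB => //; exact: cvg_cst.
    have -> : c ^+ 2 / 2 = c ^+ 2 / 2 * (1 * 1) by rewrite !mulr1.
    by apply: cvgM; [rewrite !mulr1; exact: cvg_cst|apply: cvgM].
  exact: cvg_cst.
have hnt : (fun L => (nn L)%:R * t L *+ 2) @ \oo --> c ^+ 2 / s.
  have -> : (fun L => (nn L)%:R * t L *+ 2) = (fun L => 2 * (b L * ((NN L)%:R ^+ 2 * t L))).
    apply/funext => L; have N1 : (NN L)%:R != 0 :> R by rewrite gt_eqF// NN_gt0.
    by rewrite /b -mulr_natl; field.
  have -> : c ^+ 2 / s = 2 * (s^-1 * (c ^+ 2 / 2)) by field; rewrite gt_eqF.
  by apply: cvgM; [exact: cvg_cst|apply: cvgM].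
have ht : t @ \oo --> (0 : R).
  have -> : t = (fun L => ((NN L)%:R ^+ 2 * t L) * ((NN L)%:R^-1 * (NN L)%:R^-1)).
    apply/funext => L; have N1 : (NN L)%:R != 0 :> R by rewrite gt_eqF// NN_gt0.
    by field.
  rewrite -[X in _ --> X](mulr0 (c ^+ 2 / 2)); apply: cvgM => //.
  by rewrite -[X in _ --> X](mulr0 0); apply: cvgM; exact: cvg_invNN.
have cE L : cos (c / (NN L)%:R) = 1 - t L by rewrite cos_half.
apply: (@squeeze_cvgr _ _ _ _ (fun L => expR (- (((nn L)%:R * t L *+ 2) / (1 - t L))))
   (fun L => expR (- (((nn L)%:R * t L *+ 2) / 1)))); last first.
    rewrite -[X in expR (- X)]divr1; apply: cvg_expNratio => //; exact: cvg_cst.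
  rewrite -[X in expR (- X)]divr1; apply: cvg_expNratio => //.
  by rewrite -[X in _ --> X]subr0; apply: cvgB => //; exact: cvg_cst.
near=> L; rewrite cE.
have t1 : t L < 1 by near: L; apply: (cvgr_lt 0).
have e1 (v : R) : expR (- ((nn L)%:R * t L *+ 2 / v)) = expR (- (t L / v)) ^+ (nn L).*2.
  by rewrite -expRM_natl -mul2n natrM -mulr_natl; congr expR; ring.
rewrite !e1; apply/andP; split.
  by apply: lerXn2r; rewrite ?nnegrE ?expR_ge0 ?expR_ge_1B//; lra.
by apply: lerXn2r; rewrite ?nnegrE ?expR_ge0 ?divr1 ?expR_le_1B//; lra.
Unshelve. all: by end_near. Qed.

(** [uu] and [vv] are the terms of the two sides of Polya's identity; [vv] is extended by zero, so
    that the index type does not change with [L]. *)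
Definition uu (L : nat) (m : int) : C :=
  (binr R (nn L) (kk m L))%:C * ce (y * (kk m L)%:~R / (NN L)%:R).

Definition vv (L : nat) (j : int) : C :=
  if (`|j| <= L)%N then (cos (pi * (j%:~R + y) / (NN L)%:R) ^+ (nn L).*2)%:C *
    ce (- (j * rrat L)%:~R / (NN L)%:R) else 0.

Definition AA (L : nat) : R := (NN L)%:R * 'C((nn L).*2, nn L)%:R / 2 ^+ (nn L).*2.

Lemma cvg_ce (a : nat -> R) (A : R) :
  a @ \oo --> A -> (fun L => Re (ce (a L))) @ \oo --> Re (ce A) /\
     (fun L => Im (ce (a L))) @ \oo --> Im (ce A).
Proof.
move=> ha; have h : (fun L => 2 * pi * a L) @ \oo --> 2 * pi * A.
  by apply: cvgM => //; exact: cvg_cst.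
split.
  rewrite ceE (_ : (fun L => Re _) = (fun L => cos (2 * pi * a L))).
    by apply: continuous_cvg h; exact: continuous_cos.
  by apply/funext => L; rewrite ceE.
rewrite ceE (_ : (fun L => Im _) = (fun L => sin (2 * pi * a L))).
  by apply: continuous_cvg h; exact: continuous_sin.
by apply/funext => L; rewrite ceE.
Qed.

Lemma tends_mulce (g a : nat -> R) (G A : R) : g @ \oo --> G -> a @ \oo --> A ->
  tends (fun L => (g L)%:C * ce (a L)) (G%:C * ce A).
Proof.
move=> hg /cvg_ce[h1 h2]; apply: tends_cvg.
  under eq_fun do rewrite ReM ReC ImC mul0r subr0.
  by rewrite ReM ReC ImC mul0r subr0; apply: cvgM.
under eq_fun do rewrite ImM ReC ImC mul0r addr0.
by rewrite ImM ReC ImC mul0r addr0; apply: cvgM.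
Qed.

Lemma uu_tends m : tends (uu^~ m)
  ((expR (- (s * (m%:~R + x) ^+ 2)))%:C * ce (y * (m%:~R + x))).
Proof.
apply: tends_mulce; first exact: cvg_binr.
under eq_fun do rewrite -mulrA.
by apply: cvgM; [exact: cvg_cst|exact: cvg_kk].
Qed.

Lemma vv_tends j : tends (vv^~ j)
  ((expR (- ((pi * (j%:~R + y)) ^+ 2 / s)))%:C * ce (- (j%:~R * x))).
Proof.
have h : tends (fun L => (cos (pi * (j%:~R + y) / (NN L)%:R) ^+ (nn L).*2)%:C *
    ce (- (j * rrat L)%:~R / (NN L)%:R))
  ((expR (- ((pi * (j%:~R + y)) ^+ 2 / s)))%:C * ce (- (j%:~R * x))).
  apply: tends_mulce; first exact: cvg_cospow.
  under eq_fun do rewrite intrM mulNr -mulrA.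
  by apply: cvgN; apply: cvgM; [exact: cvg_cst|exact: cvg_rr].
move=> e e0; have [n hn] := h e e0; exists (maxn n `|j|) => L.
by rewrite geq_max /vv => /andP[/hn + ->].
Qed.

Lemma bsum_shift_gauss (c d : R) : 0 < c -> exists M,
  bsum (fun m : int => expR (- (c * (m%:~R + d) ^+ 2))) M.
Proof.
move=> c0; have [M hM] := bsum_gauss (2 * c * `|d|) c0.
exists M; apply: bsum_le hM => m; rewrite ler_expR.
have h : - (2 * (m%:~R * d)) <= 2 * (`|m%:~R| * `|d|) :> R.
  by rewrite -normrM; have := ler_norm (- (m%:~R * d)); rewrite normrN; lra.
have := sqr_ge0 d; move: h; set P := `|m%:~R|; set Q := `|d|.
have -> : (m%:~R + d) ^+ 2 = m%:~R ^+ 2 + 2 * (m%:~R * d) + d ^+ 2 :> R by ring.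
set X := m%:~R ^+ 2; set Y := m%:~R * d; set Z := d ^+ 2 => h1 h2.
nra.
Qed.

Lemma uu_bound : exists2 m : int -> R, (exists M, bsum m M) & forall L i, cabs (uu L i) <= m i.
Proof.
(* For [k <= n] the denominator [n + k] is at most [2 n <= 2 (1 / s + 1) N^2], which yields this
   constant. *)
pose c := s / (2 * (s + 1)); have c0 : 0 < c by rewrite divr_gt0// mulr_gt0// addr_gt0.
have [M hM] := bsum_gauss (c * 2 * (`|x| + 1)) c0.
exists (fun m : int => expR (- c * m%:~R ^+ 2 + (c * 2 * (`|x| + 1)) * `|m%:~R|)); first by exists M.
move=> L m; rewrite cabsM cabs_ce mulr1 cabsC ger0_norm ?binr_ge0//.
have N0 := NN_gt0 L; have N1 : (NN L)%:R != 0 :> R by rewrite gt_eqF.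
have [kn|nk] := leqP `|kk m L| (nn L); last first.
  rewrite /binr bin_small ?mul0r ?expR_ge0//; lia.
have -> : binr R (nn L) (kk m L) = binr R (nn L) `|kk m L|%N by rewrite /binr absz_nat.
apply: le_trans (binr_le (isT : (0 < nn L)%N) kn) _; rewrite ler_expR.
set a := (kk m L)%:~R / (NN L)%:R : R.
have ha : a = m%:~R + (rrat L)%:~R / (NN L)%:R by rewrite /a kkE.
have ha2 : `|a - m%:~R| <= `|x| + 1.
  rewrite ha addrC addKr; have /andP[h1 h2] := rr_bounds L.
  have : (NN L)%:R^-1 <= 1 :> R by rewrite invf_le1// ler1n.
  by move=> h3; rewrite ler_norml; have := ler_norm x; have := ler_norm (- x);
     rewrite normrN => ? ?; apply/andP; split; lra.
have hk : (`|kk m L|%N)%:R ^+ 2 = a ^+ 2 * (NN L)%:R ^+ 2 :> R.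
  by rewrite -exprMn divfK// natr_absz intr_norm real_normK// num_real.
have hn : (nn L + `|kk m L|)%:R <= 2 * (s^-1 + 1) * (NN L)%:R ^+ 2 :> R.
  have : (nn L)%:R <= (s^-1 + 1) * (NN L)%:R ^+ 2 :> R.
    have /andP[_] := nn_bounds L; rewrite ler_pdivrMr ?exprn_gt0//.
    move=> /le_trans; apply; rewrite ler_wpM2r ?sqr_ge0// lerD2l.
    by rewrite invf_le1// ler1n.
  have : (`|kk m L|%N)%:R <= (nn L)%:R :> R by rewrite ler_nat.
  rewrite natrD; lra.
have h2 : c * a ^+ 2 <= (`|kk m L|%N)%:R ^+ 2 / (nn L + `|kk m L|)%:R.
  rewrite ler_pdivlMr ?ltr0n ?addn_gt0// hk.
  apply: le_trans (_ : c * a ^+ 2 * (2 * (s^-1 + 1) * (NN L)%:R ^+ 2) <= _).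
    by rewrite ler_wpM2l// mulr_ge0 ?sqr_ge0// ltW.
  have -> : c * a ^+ 2 * (2 * (s^-1 + 1) * (NN L)%:R ^+ 2) = a ^+ 2 * (NN L)%:R ^+ 2; last by [].
  by rewrite /c; field; rewrite !gt_eqF// addr_gt0.
apply: le_trans (_ : - (c * a ^+ 2) <= _); first by rewrite lerN2.
have : m%:~R ^+ 2 - 2 * (`|x| + 1) * `|m%:~R| <= a ^+ 2.
  have -> : a ^+ 2 = m%:~R ^+ 2 + 2 * ((a - m%:~R) * m%:~R) + (a - m%:~R) ^+ 2 by ring.
  have : - ((a - m%:~R) * m%:~R) <= (`|x| + 1) * `|m%:~R|.
    apply: le_trans (_ : `|(a - m%:~R) * m%:~R| <= _); first by rewrite -normrN ler_norm.
    by rewrite normrM ler_wpM2r.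
  have := sqr_ge0 (a - m%:~R); move: ((a - m%:~R) * m%:~R) => Y; lra.
move: (`|x| + 1) => D; move: `|m%:~R| (m%:~R ^+ 2) (a ^+ 2) => P Q A h; nra.
Qed.

Hypothesis y12 : `|y| <= 1 / 2.

(** Since [|y| <= 1/2], all angles stay within [pi / 2], where [cos_pow_le] bounds the powers of the
    cosine uniformly in [L]. *)
Lemma vv_bound : exists2 m : int -> R, (exists M, bsum m M) & forall L i, cabs (vv L i) <= m i.
Proof.
have p0 := pi_gt0 R.
have aux (l a b : R) : b <= 1 / 2 -> a <= l -> a + b <= 2^-1 * (2 * l + 1) by lra.
have {}aux l a := aux l a _ y12.
pose c := pi ^+ 2 / (4 * s); have c0 : 0 < c by rewrite divr_gt0 ?exprn_gt0// mulr_gt0.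
have [M hM] := bsum_shift_gauss y c0.
exists (fun j : int => expR (- (c * (j%:~R + y) ^+ 2))); first by exists M.
move=> L j; rewrite /vv; case: ifP => [jL|_]; last by rewrite cabs0 expR_ge0.
have N0 := NN_gt0 L; have N1 : (NN L)%:R != 0 :> R by rewrite gt_eqF.
rewrite cabsM cabs_ce mulr1 cabsC ger0_norm; last by rewrite -mul2n exprM exprn_ge0// sqr_ge0.
apply: le_trans (cos_pow_le _ _) _.
  rewrite normrM normrM normfV (gtr0_norm N0) (gtr0_norm p0) ler_pdivrMr//.
  rewrite -mulrA ler_pM2l//; apply: le_trans (ler_normD _ _) _.
  have : `|j%:~R| <= L%:R :> R by rewrite -intr_norm -[L%:R]/(L%:Z%:~R) ler_int; lia.
  have -> : (NN L)%:R = 2 * L%:R + 1 :> R by rewrite /NN -addn1 natrD -mul2n natrM.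
  exact: aux.
rewrite ler_expR lerN2.
have /andP[h _] := nn_bounds L.
have -> : (nn L)%:R * (pi * (j%:~R + y) / (NN L)%:R) ^+ 2 / 4 =
  ((nn L)%:R / (NN L)%:R ^+ 2) * (pi ^+ 2 * (j%:~R + y) ^+ 2 / 4) by field.
have -> : c * (j%:~R + y) ^+ 2 = s^-1 * (pi ^+ 2 * (j%:~R + y) ^+ 2 / 4).
  by rewrite /c; field; rewrite gt_eqF.
by rewrite ler_wpM2r// divr_ge0// mulr_ge0 ?sqr_ge0.
Qed.

Lemma polya_eq L S : has_sum (uu L) S -> has_sum (vv L) ((AA L)%:C * S).
Proof.
move=> hS; have N0 : (0 < NN L)%N by [].
have := @polya_has_sum R (nn L) (NN L) (rrat L) (- L%:Z) y N0.
have c0 := bin_central_gt0 R (nn L).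
have N1 : (NN L)%:R != 0 :> R by rewrite gt_eqF// NN_gt0.
move=> /(has_sum_unique hS) ->.
rewrite mulrA -rmorphM/= /AA [X in X%:C * _](_ : _ = 1) ?mul1r; last first.
  by field; rewrite N1 gt_eqF//= expf_neq0.
pose t := map (fun i : nat => i%:Z - L%:Z) (iota 0 (NN L)).
have ut : uniq t by rewrite map_inj_uniq ?iota_uniq// => i j; lia.
have := @has_sum_fin R _ (vv L) t ut; rewrite big_map.
rewrite (_ : iota 0 _ = index_iota 0 (NN L)) ?big_mkord; last by rewrite /index_iota subn0.
have -> : \sum_(i < NN L) vv L (i%:Z - L%:Z) = \sum_(j < NN L)
   (cos (pi * ((j%:Z - L%:Z)%:~R + y) / (NN L)%:R) ^+ (nn L).*2)%:C *
   ce (- ((j%:Z - L%:Z) * rrat L)%:~R / (NN L)%:R).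
  apply: eq_bigr => i _; rewrite /vv ifT//.
  by have := ltn_ord i; rewrite /NN; lia.
apply=> j jt; rewrite /vv ifF//; apply/negP => jL; move/negP: jt; apply.
apply/mapP; exists (absz (j + L%:Z)); last by lia.
by rewrite mem_iota /NN; lia.
Qed.

Lemma polya_limit U V :
  has_sum (fun m : int => (expR (- (s * (m%:~R + x) ^+ 2)))%:C * ce (y * (m%:~R + x))) U ->
  has_sum (fun j : int => (expR (- ((pi * (j%:~R + y)) ^+ 2 / s)))%:C * ce (- (j%:~R * x))) V ->
  exists S, tends S U /\ tends (fun L => (AA L)%:C * S L) V.
Proof.
move=> hU hV; have [m [M mM] hm] := uu_bound; have [m' [M' mM'] hm'] := vv_bound.
have hS L : has_sum (uu L) (csum (uu L)) by apply: (@csumP _ _ _ M); apply: bsum_le mM.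
exists (fun L => csum (uu L)); split.
  exact: (has_sum_dominated mM hm uu_tends hS hU).
apply: (has_sum_dominated mM' hm' vv_tends _ hV) => L.
exact: polya_eq.
Qed.

End PolyaLimits.

(** * Poisson summation for complex Gaussians *)

Section Poisson.
Variable R : realType.
Local Notation C := R[i].
Local Open Scope classical_set_scope.

(** The sequence of Wallis's product: increasing and bounded, so its limit [Wc] exists and is
    positive. It controls the normalising factor through [AA^2 = (N^2 / n) * wallis n]. *)
Definition wallis (n : nat) : R := n%:R * ('C(n.*2, n)%:R / 2 ^+ n.*2) ^+ 2.

Lemma bin_centralS n : 'C(n.+1.*2, n.+1)%:R / 2 ^+ n.+1.*2 =
  'C(n.*2, n)%:R / 2 ^+ n.*2 * ((n.*2).+1%:R / (n.*2).+2%:R) :> R.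
Proof.
have e : ('C(n.+1.*2, n.+1) * (n.+1) = 'C(n.*2, n) * (n.*2).+1 * 2)%N.
  have h1 := mul_bin_diag (n.*2).+1 n.
  have h2 := mul_bin_left (n.*2) n.
  have h3 := mul_bin_diag (n.*2) n.
  have h4 : 'C((n.*2).+1, n) = 'C((n.*2).+1, n.+1) by rewrite -bin_sub; [congr 'C(_, _)|]; lia.
  have h5 : (n.+1 * 'C((n.*2).+1, n.+1) = (n.*2).+1 * 'C(n.*2, n))%N by rewrite -mul_bin_diag.
  by rewrite doubleS binS h4 addnn -muln2 mulnAC [(_ * n.+1)%N]mulnC h5 [((n.*2).+1 * _)%N]mulnC.
have e' : 'C(n.+1.*2, n.+1)%:R * n.+1%:R = 'C(n.*2, n)%:R * (n.*2).+1%:R * 2 :> R.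
  by rewrite -!natrM e.
have n1 : n.+1%:R != 0 :> R by rewrite pnatr_eq0.
have n2 : (n.*2).+2%:R = 2 * n.+1%:R :> R by rewrite -natrM; congr (_%:R); lia.
rewrite n2 doubleS !exprS; apply: (mulIf n1).
have p0 : 2 ^+ n.*2 != 0 :> R by rewrite expf_neq0.
rewrite mulrAC e'; move: p0 n1; move: (2 ^+ n.*2) (n.+1%:R : R) ('C(n.*2, n)%:R : R) ((n.*2).+1%:R : R).
by move=> a b c d a0 b0; field; rewrite b0.
Qed.

Lemma wallis_mono n : wallis n <= wallis n.+1.
Proof.
case: n => [|n]; first by rewrite /wallis mul0r mulr_ge0 ?sqr_ge0.
pose b : R := ('C(n.+1.*2, n.+1)%:R / 2 ^+ n.+1.*2) ^+ 2.
have b0 : 0 <= b by exact: sqr_ge0.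
have -> : wallis n.+1 = b * n.+1%:R by rewrite mulrC.
have -> : wallis n.+2 = b * (n.+2%:R * ((n.+1.*2).+1%:R / (n.+1.*2).+2%:R) ^+ 2).
  by rewrite /wallis bin_centralS exprMn mulrCA.
rewrite ler_wpM2l// expr_div_n mulrA ler_pdivlMr ?exprn_gt0 ?ltr0n//.
rewrite -!natrX -!natrM ler_nat; nia.
Qed.

Lemma wallis_le n : wallis n <= 1 / 2.
Proof.
suff h : ('C(n.*2, n)%:R / 2 ^+ n.*2) ^+ 2 * (n.*2).+1%:R <= 1 :> R.
  rewrite /wallis mulrC; set b := _ ^+ 2 in h *.
  have b0 : 0 <= b by exact: sqr_ge0.
  have e : (n.*2).+1%:R = 2 * n%:R + 1 :> R by rewrite -addn1 natrD -mul2n natrM.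
  by move: h; rewrite e; clearbody b; nra.
elim: n => [|n ih]; first by rewrite bin0 expr0 divr1 expr1n mulr1.
rewrite bin_centralS exprMn; set b := (_ / _) ^+ 2 in ih *.
apply: le_trans ih; rewrite -mulrA ler_wpM2l ?sqr_ge0//.
rewrite expr_div_n mulrAC ler_pdivrMr ?exprn_gt0 ?ltr0n//.
rewrite -!natrX -!natrM ler_nat; nia.
Qed.

Lemma wallis_gt0 n : (0 < n)%N -> 0 < wallis n.
Proof.
by move=> n0; rewrite mulr_gt0 ?ltr0n// exprn_gt0// divr_gt0 ?bin_central_gt0// exprn_gt0.
Qed.

Definition Wc : R := lim (wallis @ \oo).

Lemma cvg_wallis : wallis @ \oo --> Wc.
Proof.
apply: (@nondecreasing_is_cvgn _ wallis).
  by apply/nondecreasing_seqP => n; exact: wallis_mono.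
by exists (1 / 2) => _ [n _ <-]; exact: wallis_le.
Qed.

Lemma Wc_gt0 : 0 < Wc.
Proof.
apply: lt_le_trans (wallis_gt0 (isT : (0 < 1)%N)) _.
apply: limr_ge; first exact: cvgP cvg_wallis.
have h n : wallis 1 <= wallis n.+1.
  by elim: n => // n ih; apply: le_trans ih (wallis_mono _).
near=> n; have n1 : (1 <= n)%N by near: n; exact: nbhs_infty_ge.
by rewrite -(prednK n1).
Unshelve. all: by end_near. Qed.

Lemma nn_infty (s : R) : 0 < s -> nn s @ \oo --> \oo.
Proof.
move=> s0; apply/cvgnyPge => A; near=> L.
have hL : (Num.bound (A%:R * s) <= L)%N by near: L; exact: nbhs_infty_ge.
rewrite -(ler_nat R).
have /andP[h _] := nn_bounds s0 L; have N0 := NN_gt0 R L.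
move: h; rewrite ler_pdivlMr ?exprn_gt0// => h.
apply: le_trans h; rewrite mulrC ler_pdivlMr//.
have h1 : A%:R * s <= L%:R.
  apply: le_trans (ltW (archi_boundP _)) _; last by rewrite ler_nat.
  by rewrite mulr_ge0// ltW.
apply: le_trans h1 _; rewrite -natrX ler_nat /NN; nia.
Unshelve. all: by end_near. Qed.

Lemma cvg_AA2 (s : R) : 0 < s -> (fun L => AA s L ^+ 2) @ \oo --> s * Wc.
Proof.
move=> s0.
have -> : (fun L => AA s L ^+ 2) =
   (fun L => ((nn s L)%:R / (NN L)%:R ^+ 2)^-1 * wallis (nn s L)).
  apply/funext => L; rewrite /AA /wallis.
  have N1 : (NN L)%:R != 0 :> R by rewrite gt_eqF// NN_gt0.
  have n1 : (nn s L)%:R != 0 :> R by rewrite pnatr_eq0.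
  by rewrite invf_div mulrA divfK// -exprMn mulrA.
apply: cvgM.
  rewrite -[X in _ --> X]invrK; apply: cvgV; first by rewrite invr_eq0 gt_eqF.
  exact: cvg_nn.
exact: (cvg_comp _ _ (nn_infty s0) cvg_wallis).
Qed.

Lemma tends_cvgR (u : nat -> R) (l : R) : u @ \oo --> l -> tends (fun n => (u n)%:C) l%:C.
Proof. by move=> h; apply: tends_cvg => //=; exact: cvg_cst. Qed.

Lemma tendsM (u v : nat -> C) l l' : tends u l -> tends v l' -> tends (fun n => u n * v n) (l * l').
Proof.
move=> h h' e e0.
pose K := cabs l + cabs l' + 1.
have K0 : 0 < K by rewrite ltr_wpDl// addr_ge0 ?cabs_ge0.
pose d := Num.min 1 (e / (2 * K)).
have d0 : 0 < d by rewrite lt_min ltr01 divr_gt0// mulr_gt0.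
have [n hn] := h _ d0; have [m hm] := h' _ d0.
exists (maxn n m) => k; rewrite geq_max => /andP[/hn h1 /hm h2].
have d1 : d <= 1 by rewrite ge_min lexx.
have d2 : d * (2 * K) <= e by rewrite -ler_pdivlMr ?mulr_gt0// ge_min lexx orbT.
have -> : u k * v k - l * l' = (u k - l) * (v k - l') + (u k - l) * l' + l * (v k - l') by ring.
apply: le_trans (cabsD _ _) _; apply: le_trans (lerD (cabsD _ _) (lexx _)) _.
rewrite !cabsM; move: h1 h2 d2; rewrite /K.
have := cabs_ge0 l; have := cabs_ge0 l'; have := cabs_ge0 (u k - l); have := cabs_ge0 (v k - l').
move: (cabs l) (cabs l') (cabs (u k - l)) (cabs (v k - l')) => a b x y; nra.
Qed.

Lemma bsum_cgauss (s : R) (xi : C) : 0 < s -> exists M,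
  bsum (fun m : int => cabs (cexp (- (s * m%:~R ^+ 2)%:C + m%:~R * xi))) M.
Proof.
move=> s0; have [M hM] := bsum_gauss `|Re xi| s0; exists M; apply: bsum_le hM => m.
rewrite cabs_cexp ler_expR ReD ReN ReC ReM Re_int Im_int mul0r subr0 mulNr lerD2l.
by apply: le_trans (ler_norm _) _; rewrite normrM mulrC.
Qed.

Lemma bsum_cgauss_dual (s : R) (xi : C) : 0 < s -> exists M,
  bsum (fun k : int => cabs (cexp ((xi + iu R * (2 * pi * k%:~R)%:C) ^+ 2 / (4 * s)%:C))) M.
Proof.
move=> s0; have p0 := pi_gt0 R.
have c0 : 0 < pi ^+ 2 / s by rewrite divr_gt0// exprn_gt0.
have [M hM] := bsum_shift_gauss (Im xi / (2 * pi)) c0.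
exists (expR (Re xi ^+ 2 / (4 * s)) * M).
apply: bsum_le (bsumZ (expR_ge0 _) hM) => k.
rewrite cabs_cexp -expRD ler_expR -fmorphV ReM ReC ImC mulr0 subr0 expr2 !ReIm.
rewrite le_eqVlt; apply/orP; left; apply/eqP.
have s1 : s != 0 by rewrite gt_eqF.
have p1 : pi != 0 :> R by rewrite gt_eqF.
by move: (pi : R) p1 => P p1; field; rewrite s1 p1.
Qed.

Lemma poisson_aux (s : R) (xi : C) U V : 0 < s ->
  has_sum (fun m : int => cexp (- (s * m%:~R ^+ 2)%:C + m%:~R * xi)) U ->
  has_sum (fun k : int => cexp ((xi + iu R * (2 * pi * k%:~R)%:C) ^+ 2 / (4 * s)%:C)) V ->
  `|Im xi| <= pi -> exists S, tends S U /\ tends (fun L => (AA s L)%:C * S L) V.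
Proof.
move=> s0 hU hV hI; have p0 := pi_gt0 R.
(* Completing the square: the real part of [xi] becomes the shift [x] of the Gaussian, the imaginary
   part the character [y], and [E] is the constant left over. *)
pose x := - Re xi / (2 * s); pose y := Im xi / (2 * pi).
have exi : xi = - (2 * s * x)%:C + iu R * (2 * pi * y)%:C.
  have s1 : s != 0 by rewrite gt_eqF.
  have p1 : pi != 0 :> R by rewrite gt_eqF.
  rewrite /x /y; apply: complexP; rewrite !ReIm; move: (pi : R) p1 => P p1.
    by field; rewrite ?s1 ?p1.
  by field; rewrite ?s1 ?p1.
have y12 : `|y| <= 1 / 2.
  rewrite /y normrM normfV [`|2 * pi|]gtr0_norm ?mulr_gt0// ler_pdivrMr ?mulr_gt0//; lra.
pose E := cexp (- (s * x ^+ 2)%:C + iu R * (2 * pi * (x * y))%:C).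
have E0 : E != 0 by exact: cexp_neq0.
have s1 : s != 0 by rewrite gt_eqF.
have [||S [h1 h2]] := @polya_limit R s s0 x y y12 (E * U) (E * V).
    apply: eq_has_sum (has_sumZ E hU) => m; rewrite -cexpR /ce -!cexpD; congr cexp.
    by rewrite exi; apply: complexP; rewrite !ReIm; move: (pi : R) => P; ring.
  apply: eq_has_sum (has_sumZ E hV) => m; rewrite -cexpR /ce -!cexpD; congr cexp.
  rewrite exi -[(4 * s)%:C^-1]fmorphV; apply: complexP; rewrite expr2 !ReIm; move: (pi : R) => P.
    by field; rewrite s1.
  by field; rewrite s1.
exists (fun L => E^-1 * S L); split.
  by rewrite -[U](mulKf E0); apply: tendsM => //; exact: tends_cst.
rewrite -[V](mulKf E0); have := tendsM (tends_cst E^-1) h2.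
by rewrite (_ : (fun n => _) = (fun L => (AA s L)%:C * (E^-1 * S L)))// funeqE => L; ring.
Qed.

Lemma has_sum_neq0_gauss (s : R) : 0 < s -> exists2 U : R, 0 < U &
  has_sum (fun m : int => cexp (- (s * m%:~R ^+ 2)%:C + m%:~R * 0)) U%:C.
Proof.
move=> s0; have [M hM] := bsum_cgauss 0 s0; have [S hS] := has_sum_ex hM.
have e m : cexp (- (s * m%:~R ^+ 2)%:C + m%:~R * 0) = (expR (- (s * m%:~R ^+ 2)))%:C.
  by rewrite mulr0 addr0 -rmorphN cexpR.
have hp (t : seq int) : uniq t -> {subset [:: 0%Z] <= t} ->
    1 <= Re (\sum_(m <- t) cexp (- (s * m%:~R ^+ 2)%:C + m%:~R * 0)).
  move=> ut st; rewrite Re_sum (bigD1_seq 0%Z); last exact: ut; last by apply: st; rewrite inE.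
  rewrite e expr0n mulr0 oppr0 expR0 ReC lerDl sumr_ge0// => m _.
  by rewrite e ReC expR_ge0.
have hi (t : seq int) : Im (\sum_(m <- t) cexp (- (s * m%:~R ^+ 2)%:C + m%:~R * 0)) = 0.
  by rewrite Im_sum big1// => m _; rewrite e.
have hI : Im S = 0.
  apply/eqP; rewrite -normr_eq0 eq_le normr_ge0 andbT; apply/ler_addgt0Pr => d d0.
  have [t ut ht] := hS d d0; have := ht t ut (fun _ h => h).
  move=> /(le_trans (Im_le_cabs _)); rewrite ImD hi ImN sub0r normrN add0r.
  by [].
have hR : 1 / 2 <= Re S.
  have [|t ut ht] := hS (1 / 2); first by lra.
  have uu : uniq (undup (0%Z :: t)) by exact: undup_uniq.
  have := ht _ uu; have := hp _ uu; set T := \sum_(_ <- _) _ => h1 h2.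
  have {}h1 : 1 <= Re T.
    by apply: h1 => z; rewrite inE => /eqP ->; rewrite mem_undup inE eqxx.
  have {}h2 : cabs (T - S) <= 1 / 2.
    by apply: h2 => z hz; rewrite mem_undup inE hz orbT.
  have := le_trans (Re_le_cabs _) h2; rewrite ReD ReN ler_norml => /andP[_].
  lra.
exists (Re S); first by lra.
by have -> : (Re S)%:C = S by apply: complexP; rewrite ?ReC ?ImC ?hI.
Qed.

Definition Kp : R := (Num.sqrt Wc)^-1.

Lemma Kp_gt0 : 0 < Kp. Proof. by rewrite invr_gt0 sqrtr_gt0 Wc_gt0. Qed.

(** Only the square of [AA] has a known limit. At [xi = 0], where [U0 > 0] and [V0 >= 0], this gives
    [s Wc U0^2 = V0^2] and determines the root; the relation [V0 U = U0 V] transfers it to [xi]. *)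
Lemma poisson_small (s : R) (xi : C) U V : 0 < s ->
  has_sum (fun m : int => cexp (- (s * m%:~R ^+ 2)%:C + m%:~R * xi)) U ->
  has_sum (fun k : int => cexp ((xi + iu R * (2 * pi * k%:~R)%:C) ^+ 2 / (4 * s)%:C)) V ->
  `|Im xi| <= pi -> U = (Kp / Num.sqrt s)%:C * V.
Proof.
move=> s0 hU hV hI; have p0 := pi_gt0 R.
have [U0 U0p hU0] := has_sum_neq0_gauss s0.
have [M0 hM0] := bsum_cgauss_dual 0 s0; have [V0 hV0] := has_sum_ex hM0.
have [|S0 [h1 h2]] := poisson_aux s0 hU0 hV0; first by rewrite normr0 ltW.
have [S [h3 h4]] := poisson_aux s0 hU hV hI.
have hA2 : tends (fun L => (AA s L)%:C * (AA s L)%:C) (s * Wc)%:C.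
  have := tends_cvgR (cvg_AA2 s0).
  by rewrite (_ : (fun n => _) = (fun L => (AA s L)%:C * (AA s L)%:C))// funeqE => L; rewrite rmorphM.
have eV : (s * Wc)%:C * (U0%:C * U0%:C) = V0 * V0.
  apply: tends_unique (tendsM hA2 (tendsM h1 h1)) _.
  have := tendsM h2 h2.
  by rewrite (_ : (fun n => _) = (fun L => (AA s L)%:C * (AA s L)%:C * (S0 L * S0 L)))// funeqE => L; ring.
have eUV : V0 * U = U0%:C * V.
  apply: tends_unique (tendsM h2 h3) _; have := tendsM h1 h4.
  by rewrite (_ : (fun n => _) = (fun L => (AA s L)%:C * S0 L * S L))// funeqE => L; ring.
have sW : 0 < s * Wc by rewrite mulr_gt0// Wc_gt0.
have V0p : exists2 v : R, 0 <= v & V0 = v%:C.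
  have e k : cexp ((0 + iu R * (2 * pi * k%:~R)%:C) ^+ 2 / (4 * s)%:C) =
      (expR (- ((2 * pi * k%:~R) ^+ 2 / (4 * s))))%:C.
    rewrite -cexpR; congr cexp; rewrite add0r -fmorphV.
    by apply: complexP; rewrite expr2 !ReIm; move: (pi : R) ((4 * s)^-1) => P s'; ring.
  have hI0 : Im V0 = 0.
    apply/eqP; rewrite -normr_eq0 eq_le normr_ge0 andbT; apply/ler_addgt0Pr => d d0.
    have [u uu hu] := hV0 d d0; have := hu u uu (fun _ h => h).
    move=> /(le_trans (Im_le_cabs _)); rewrite ImD ImN Im_sum big1 ?sub0r ?normrN ?add0r//.
    by move=> k _; rewrite e.
  exists (Re V0); last by apply: complexP; rewrite ?ReC ?ImC ?hI0.
  apply/ler_addgt0Pr => d d0.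
  have [u uu hu] := hV0 d d0; have := hu u uu (fun _ h => h).
  move=> /(le_trans (Re_le_cabs _)); rewrite ReD ReN Re_sum ler_norml => /andP[_].
  have : 0 <= \sum_(k <- u) Re (cexp ((0 + iu R * (2 * pi * k%:~R)%:C) ^+ 2 / (4 * s)%:C)).
    by apply: sumr_ge0 => k _; rewrite e ReC expR_ge0.
  set T := \sum_(_ <- _) _; lra.
have [v v0 ev] := V0p.
have hv : v = Num.sqrt (s * Wc) * U0.
  have : v ^+ 2 = s * Wc * U0 ^+ 2.
    have h : (v * v)%:C = (s * Wc * (U0 * U0))%:C :> C.
      by rewrite [LHS]rmorphM/= -ev -eV [RHS]rmorphM/= [X in _ = _ * X]rmorphM.
    by rewrite !expr2; exact: complexI h.
  move=> hv2; apply/eqP; rewrite -(@eqrXn2 _ 2)//; last first.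
    by rewrite mulr_ge0 ?sqrtr_ge0// ltW.
  by rewrite exprMn sqr_sqrtr ?ltW// hv2.
have U0n : U0%:C != 0 :> C by rewrite -cabs_eq0 cabsC normr_eq0 gt_eqF.
have : (Num.sqrt (s * Wc))%:C * U = V.
  by apply: (mulfI U0n); rewrite mulrA [_ * _%:C]mulrC -rmorphM/= -hv -ev.
move=> <-; rewrite mulrA -rmorphM/= sqrtrM ?ltW//.
rewrite [X in X%:C * _](_ : _ = 1) ?mul1r// /Kp.
have a0 : Num.sqrt s != 0 by rewrite gt_eqF// sqrtr_gt0.
have b0 : Num.sqrt Wc != 0 by rewrite gt_eqF// sqrtr_gt0 Wc_gt0.
by move: (Num.sqrt s) (Num.sqrt Wc) a0 b0 => a b a0 b0; field; rewrite a0 b0.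
Qed.

(** Subtracting a multiple of [2 pi i] from [xi] changes no term on the left and only shifts the
    index on the right. *)
Lemma poisson (s : R) (xi : C) U V : 0 < s ->
  has_sum (fun m : int => cexp (- (s * m%:~R ^+ 2)%:C + m%:~R * xi)) U ->
  has_sum (fun k : int => cexp ((xi + iu R * (2 * pi * k%:~R)%:C) ^+ 2 / (4 * s)%:C)) V ->
  U = (Kp / Num.sqrt s)%:C * V.
Proof.
move=> s0 hU hV; have p0 := pi_gt0 R.
pose j := Num.floor ((Im xi + pi) / (2 * pi)).
have := floor_itv ((Im xi + pi) / (2 * pi)); rewrite -/j intrD.
rewrite ler_pdivlMr ?mulr_gt0// ltr_pdivrMr ?mulr_gt0// => /andP[j1 j2].
pose xi' := xi - iu R * (2 * pi * j%:~R)%:C.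
apply: (@poisson_small s xi') => //.
    apply: eq_has_sum hU => m; rewrite /xi' mulrBr addrA [RHS]cexpD [X in _ = _ * X]cexpN.
    rewrite [X in _ = _ / X](_ : _ = 1) ?divr1//.
    rewrite intC mulrCA -rmorphM/= (_ : m%:~R * (2 * pi * j%:~R) = 2 * pi * (m * j)%:~R).
      exact: cexp2piIn.
    by rewrite intrM; move: (pi : R) => P; ring.
  have := has_sum_bij (phi := fun k => k - j) (psi := fun k => k + j) _ _ hV.
  move=> /(_ (fun k => subrK j k) (fun k => addrK j k)).
  apply: eq_has_sum => k.
  rewrite -[LHS]/(cexp ((xi + iu R * (2 * pi * (k - j)%:~R)%:C) ^+ 2 / (4 * s)%:C)).
  rewrite (_ : xi + iu R * (2 * pi * (k - j)%:~R)%:C = xi' + iu R * (2 * pi * k%:~R)%:C)//.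
  by rewrite /xi' intrB; apply: complexP; rewrite !ReIm; move: (pi : R) => P; ring.
rewrite /xi' ImD ImN ImM ReI ImI ReC ImC mul0r add0r mul1r ler_norml.
by move: j1 j2; move: (pi : R) => P; set J : R := j%:~R; lra.
Qed.

End Poisson.

(** * The Eisenstein lattice and its Poisson formula *)

Section EisensteinLattice.
Variable R : realType.
Local Notation C := R[i].

(** Locked, like [ss] and [w3], so that it stays an atom for the algebraic tactics and enters
    through [sq3_sqr] and [pi_ss] alone. *)
Definition sq3 : R := locked (Num.sqrt 3).
Definition ss : R := locked (pi / sq3).

Lemma sq3E : sq3 = Num.sqrt 3. Proof. by rewrite /sq3 -lock. Qed.
Lemma sq3_gt0 : 0 < sq3. Proof. by rewrite sq3E sqrtr_gt0. Qed.
Lemma sq3_sqr : sq3 ^+ 2 = 3. Proof. by rewrite sq3E sqr_sqrtr. Qed.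
Lemma sq3_neq0 : sq3 != 0. Proof. by rewrite gt_eqF// sq3_gt0. Qed.
Lemma pi_ss : pi = ss * sq3. Proof. by rewrite /ss -lock divfK// sq3_neq0. Qed.
Lemma ss_gt0 : 0 < ss. Proof. by rewrite /ss -lock divr_gt0 ?pi_gt0 ?sq3_gt0. Qed.
Lemma ss_neq0 : ss != 0. Proof. by rewrite gt_eqF// ss_gt0. Qed.

Definition eis := (int * int)%type.
Implicit Types (m b : eis).

Definition w3 : C := locked (Complex (- (1 / 2)) (sq3 / 2)).
Lemma w3E : w3 = zeta R. Proof. by rewrite /w3 -lock sq3E. Qed.
Lemma Re_w3 : Re w3 = - (1 / 2). Proof. by rewrite /w3 -lock. Qed.
Lemma Im_w3 : Im w3 = sq3 / 2. Proof. by rewrite /w3 -lock. Qed.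

Lemma iu_sqr : iu R ^+ 2 = -1.
Proof. by apply: complexP; rewrite expr2 !ReIm; ring. Qed.
Lemma sq3C_sqr : (sq3%:C : C) ^+ 2 = 3.
Proof. by rewrite -rmorphXn/= sq3_sqr rmorph_nat. Qed.
Lemma w3I : w3 = - (1 / 2) + iu R * sq3%:C / 2.
Proof.
have -> : - (1 / 2) + iu R * sq3%:C / 2 = (- (1 / 2))%:C + iu R * (sq3 / 2)%:C :> C.
  by rewrite !toC; ring.
by apply: complexP; rewrite !ReIm ?Re_w3 ?Im_w3; ring.
Qed.

Lemma w3J_iu : w3^* = - (1 / 2) - iu R * sq3%:C / 2.
Proof.
have -> : - (1 / 2) - iu R * sq3%:C / 2 = (- (1 / 2))%:C - iu R * (sq3 / 2)%:C :> C.
  by rewrite !toC; ring.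
by apply: complexP; rewrite !ReIm ?Re_w3 ?Im_w3; ring.
Qed.

(* the first component is the coefficient of the cube root of unity *)
Definition ei (m : eis) : C := m.2%:~R + m.1%:~R * w3.
Definition en (m : eis) : int := m.2 ^+ 2 - m.2 * m.1 + m.1 ^+ 2.

Lemma Re_ei m : Re (ei m) = m.2%:~R - m.1%:~R / 2.
Proof. by rewrite /ei !ReIm Re_w3 Im_w3; lra. Qed.
Lemma Im_ei m : Im (ei m) = m.1%:~R * sq3 / 2.
Proof. by rewrite /ei !ReIm Re_w3 Im_w3; field. Qed.

Lemma enR m : (en m)%:~R = m.2%:~R ^+ 2 - m.2%:~R * m.1%:~R + m.1%:~R ^+ 2 :> R.
Proof. by rewrite /en !expr2 !(intrD, intrM, mulrNz). Qed.

Lemma en_cabs m : (en m)%:~R = cabs (ei m) ^+ 2.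
Proof.
rewrite cabs_sqr Re_ei Im_ei enR.
have -> : (m.1%:~R * sq3 / 2) ^+ 2 = m.1%:~R ^+ 2 * sq3 ^+ 2 / 4 by field.
by rewrite sq3_sqr; field.
Qed.

Lemma en_ge_half m : m.1 ^+ 2 + m.2 ^+ 2 <= 2 * en m.
Proof. by rewrite /en; have := sqr_ge0 (m.1 - m.2); lia. Qed.

Lemma cabs_ei_le m : cabs (ei m) <= `|m.1%:~R| + `|m.2%:~R|.
Proof.
rewrite /ei addrC (le_trans (cabsD _ _))// lerD// ?cabsM intC cabsC//.
suff -> : cabs w3 = 1 by rewrite mulr1.
apply/eqP; rewrite -(@eqrXn2 _ 2)// ?cabs_ge0// cabs_sqr Re_w3 Im_w3 expr1n.
by rewrite [(sq3 / 2) ^+ 2]expr_div_n sq3_sqr; apply/eqP; field.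
Qed.

Lemma bsum_E_gauss (c B : R) : 0 < c -> 0 <= B -> exists M,
  bsum (fun m : eis => expR (- c * (en m)%:~R + B * cabs (ei m))) M.
Proof.
move=> c0 B0; have c2 : 0 < c / 2 by lra.
have [M hM] := bsum_gauss B c2.
exists (M * M).
apply: (@bsum_prod _ _ _ _ (fun x : int =>
   expR (- (c / 2) * x%:~R ^+ 2 + B * `|x%:~R|) * M)) => [i|x|].
    exact: expR_ge0.
  apply: bsum_le (bsumZ (expR_ge0 _) hM) => y.
  rewrite -expRD ler_expR.
  have h1 := cabs_ei_le (x, y); have h2 := en_ge_half (x, y).
  have {}h2 : x%:~R ^+ 2 + y%:~R ^+ 2 <= 2 * (en (x, y))%:~R :> R.
    by move: h2; rewrite -(ler_int R) intrD intrM !expr2 !intrM.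
  have h3 : B * cabs (ei (x, y)) <= B * (`|x%:~R| + `|y%:~R|) by rewrite ler_wpM2l.
  move: h2 h3; move: (en _)%:~R (cabs _) => e a; nra.
by under eq_fun do rewrite mulrC; apply: bsumZ => //; exact: bsum_ge0 hM.
Qed.

Lemma has_sum_swap (f : int * int -> C) S : has_sum f S -> has_sum (fun p => f (p.2, p.1)) S.
Proof.
move=> h; have := has_sum_bij (phi := fun p : int * int => (p.2, p.1)) (psi := fun p : int * int => (p.2, p.1)) _ _ h.
by apply=> -[].
Qed.

(** The one-variable formula is applied twice, after [m2^2 - m2 m1 + m1^2 = (m2 - m1 / 2)^2 + 3/4
    m1^2], with the parameters [eta] and [3 eta / 4]. *)
Lemma poisson_E (eta : R) (be ga : C) U V : 0 < eta ->
  has_sum (fun m : eis => cexp (- (eta * (en m)%:~R)%:C + ei m * be + (ei m)^* * ga)) U ->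
  has_sum (fun n : eis => cexp ((be + (2 * ss)%:C * (ei n)^*) * (ga - (2 * ss)%:C * ei n) / eta%:C)) V ->
  U = (2 * Kp R ^+ 2 / (sq3 * eta))%:C * V.
Proof.
move=> e0 hU hV; have e1 : eta != 0 by rewrite gt_eqF.
have s3 := sq3_neq0; have p0 := pi_gt0 R; have eC : (eta%:C : C) != 0 by rewrite fmorph_eq0.
have e34 : 0 < 3 * eta / 4 by lra.
(* The sum after transformation of the second coordinate only; both sides are compared with it. *)
pose G (p : int * int) : C := cexp (- (3 * eta / 4 * p.1%:~R ^+ 2)%:C +
   p.1%:~R * (iu R * (sq3 / 2)%:C * (be - ga) + iu R * (pi * p.2%:~R)%:C) +
   (be + ga + iu R * (2 * pi * p.2%:~R)%:C) ^+ 2 / (4 * eta)%:C).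
have [MG bG] : exists M, bsum (fun p => cabs (G p)) M.
  have [M1 h1] := bsum_cgauss (iu R * (sq3 / 2)%:C * (be - ga)) e34.
  have [M2 h2] := bsum_cgauss_dual (be + ga) e0.
  exists (M2 * M1).
  apply: (@bsum_prod _ _ _ _ (fun x : int => M2 *
     cabs (cexp (- (3 * eta / 4 * x%:~R ^+ 2)%:C + x%:~R * (iu R * (sq3 / 2)%:C * (be - ga)))))).
      by move=> i; exact: cabs_ge0.
    move=> x; rewrite mulrC; apply: bsum_le (bsumZ (cabs_ge0 _) h2) => k.
    rewrite /G !cabs_cexp -expRD ler_expR/= !ReD lerD2r lerD2l.
    by rewrite mulrDr ReD -[leRHS]addr0 lerD2l !ReIm !(mul0r, mulr0, subr0).
  exact: bsumZ (bsum_ge0 h2) h1.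
have [SG hG] := has_sum_ex bG.
have eU : U = (Kp R / Num.sqrt eta)%:C * SG.
  have inner (n : int) : exists2 S, has_sum (fun k : int => G (n, k)) S &
     has_sum (fun m : int => cexp (- (eta * (en (n, m))%:~R)%:C + ei (n, m) * be +
        (ei (n, m))^* * ga)) ((Kp R / Num.sqrt eta)%:C * S).
    pose xi := (eta * n%:~R)%:C + be + ga.
    pose Q := - (eta * n%:~R ^+ 2)%:C + n%:~R * (w3 * be + w3^* * ga).
    have [M1 h1] := bsum_cgauss xi e0; have [S1 k1] := has_sum_ex h1.
    have [M2 h2] := bsum_cgauss_dual xi e0; have [S2 k2] := has_sum_ex h2.
    exists (cexp Q * S2).
      apply: eq_has_sum (has_sumZ (cexp Q) k2) => k; rewrite -cexpD /G; congr cexp.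
      rewrite /Q /xi /= w3J_iu w3I !toC; move: (iu R) iu_sqr (eta%:C) eC => j hj e eC.
      by field: hj; rewrite eC.
    rewrite mulrCA -(poisson e0 k1 k2).
    apply: eq_has_sum (has_sumZ (cexp Q) k1) => m; rewrite -cexpD; congr cexp.
    by rewrite /Q /xi enR /ei /= !(conjD, conjM, conjz) w3J_iu w3I !toC; field.
  pose F (n : int) := csum (fun k : int => G (n, k)).
  apply: (@has_sum_unique _ _ (fun n => (Kp R / Num.sqrt eta)%:C * F n)).
    apply: has_sum_fubini hU _ => n; have [S h1 h2] := inner n.
    by rewrite /F (csumE h1).
  apply: has_sumZ; apply: has_sum_fubini hG _ => n; have [S h1 h2] := inner n.
  by rewrite /F (csumE h1).
have eG : SG = (Kp R / Num.sqrt (3 * eta / 4))%:C * V.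
  have inner (k : int) : exists2 S, has_sum (fun l : int =>
       cexp ((be + (2 * ss)%:C * (ei (- k, l))^*) * (ga - (2 * ss)%:C * ei (- k, l)) / eta%:C)) S &
     has_sum (fun n : int => G (n, k)) ((Kp R / Num.sqrt (3 * eta / 4))%:C * S).
    pose xi := iu R * (sq3 / 2)%:C * (be - ga) + iu R * (pi * k%:~R)%:C.
    pose Q := (be + ga + iu R * (2 * pi * k%:~R)%:C) ^+ 2 / (4 * eta)%:C.
    have [M1 h1] := bsum_cgauss xi e34; have [S1 k1] := has_sum_ex h1.
    have [M2 h2] := bsum_cgauss_dual xi e34; have [S2 k2] := has_sum_ex h2.
    exists (cexp Q * S2).
      apply: eq_has_sum (has_sumZ (cexp Q) k2) => l; rewrite -cexpD; congr cexp.
      rewrite /Q /xi /ei pi_ss intrN /= !(conjD, conjM, conjN, conjz) w3J_iu w3I !toC.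
      move: (iu R) iu_sqr (sq3%:C) sq3C_sqr (ss%:C) (eta%:C) eC => j hj t ht s e eC.
      by field: hj ht; rewrite eC.
    rewrite mulrCA -(poisson e34 k1 k2).
    by apply: eq_has_sum (has_sumZ (cexp Q) k1) => n; rewrite -cexpD /G addrC.
  pose F (k : int) := csum (fun n : int => G (n, k)).
  have hG' := has_sum_swap hG.
  have hV' := has_sum_bij (phi := fun p : int * int => (- p.1, p.2)) (psi := fun p : int * int => (- p.1, p.2)) _ _ hV.
  apply: (@has_sum_unique _ _ F).
    apply: has_sum_fubini hG' _ => k; have [S h1 h2] := inner k.
    by rewrite /F (csumE h2).
  pose F' (k : int) := csum (fun l : int => cexp ((be + (2 * ss)%:C * (ei (- k, l))^*) *
     (ga - (2 * ss)%:C * ei (- k, l)) / eta%:C)).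
  have eF k : F k = (Kp R / Num.sqrt (3 * eta / 4))%:C * F' k.
    by have [S h1 h2] := inner k; rewrite /F /F' (csumE h1) (csumE h2).
  apply: (@eq_has_sum _ _ (fun k => (Kp R / Num.sqrt (3 * eta / 4))%:C * F' k)) => //.
  apply: has_sumZ; apply: has_sum_fubini (hV' _ _) _; rewrite ?/F' => k; rewrite ?opprK -?surjective_pairing//.
  by have [S h1 h2] := inner k; rewrite (csumE h1).
rewrite eU eG mulrA -rmorphM/=; congr (_%:C * _).
have -> : Num.sqrt (3 * eta / 4) = sq3 * Num.sqrt eta / 2.
  have -> : 3 * eta / 4 = (sq3 / 2) ^+ 2 * eta.
    by rewrite expr_div_n sq3_sqr; field.
  by rewrite sqrtrM ?sqr_ge0// sqrtr_sqr ger0_norm ?divr_ge0 ?ltW ?sq3_gt0// mulrAC.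
have : Num.sqrt eta ^+ 2 = eta by rewrite sqr_sqrtr// ltW.
have : Num.sqrt eta != 0 by rewrite gt_eqF// sqrtr_gt0.
move: (Num.sqrt eta) (Kp R) sq3 s3 => q K t t0 q0 <-.
by field; rewrite q0 t0.
Qed.

End EisensteinLattice.

(** * The sigma function of the lattice and its periodic square [rho] *)

Section Sigma.
Variable R : realType.
Local Notation C := R[i].
Local Notation w := (w3 R).
Local Notation s_ := ((ss R)%:C : C).
Implicit Types (x y z e : C) (k : int) (b : eis).

Lemma w3J : w^* = - 1 - w.
Proof. by apply: complexP; rewrite !ReIm ?Re_w3 ?Im_w3; field. Qed.
Lemma w3_sqr : w ^+ 2 = - 1 - w.
Proof.
have h := sq3_sqr R.
by apply: complexP; rewrite expr2 !ReIm Re_w3 Im_w3; field: h.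
Qed.
Definition cJ := (conjD, conjM, conjN, conjR, conjn, conjz, conj0, conj1, conjKc,
  (conjX, conjV, w3J)).

Lemma piIE : iu R * pi%:C = s_ * (1 + 2 * w).
Proof. by rewrite pi_ss; apply: complexP; rewrite !ReIm Re_w3 Im_w3; field. Qed.

Lemma cexp_int2 k : cexp (2 * s_ * (1 + 2 * w) * k%:~R) = 1.
Proof.
suff -> : 2 * s_ * (1 + 2 * w) * k%:~R = iu R * (2 * pi * k%:~R)%:C by rewrite cexp2piIn.
rewrite !CM Cint Cnat -[2 * s_ * _]mulrA -piIE; move: (pi%:C : C) => P; ring.
Qed.

Lemma cexp_eq k x y : x = y + 2 * s_ * (1 + 2 * w) * k%:~R -> cexp x = cexp y.
Proof. by move=> ->; rewrite cexpD cexp_int2 mulr1. Qed.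

Lemma cexp_parity k (l : int) : (k = l %[mod 2])%Z ->
  cexp (s_ * (1 + 2 * w) * k%:~R) = cexp (s_ * (1 + 2 * w) * l%:~R).
Proof.
move/eqP; rewrite eqz_mod_dvd => /dvdzP[c /eqP]; rewrite subr_eq => /eqP ->.
rewrite intrD intrM mulrDr cexpD.
by rewrite [X in cexp X * _](_ : _ = 2 * s_ * (1 + 2 * w) * c%:~R); [rewrite cexp_int2 mul1r|ring].
Qed.

Lemma cabs_cexpI (a : R) : cabs (cexp (s_ * (1 + 2 * w) * a%:C)) = 1.
Proof.
rewrite cabs_cexp -[RHS]expR0; congr expR.
by rewrite !ReIm Re_w3 Im_w3; field.
Qed.

Lemma cabs_cexp_eq (a : R) x y : x = y + s_ * (1 + 2 * w) * a%:C ->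
  cabs (cexp x) = cabs (cexp y).
Proof. by move=> ->; rewrite cexpD cabsM cabs_cexpI mulr1. Qed.

(** A Jacobi theta series over the odd numbers [2 k + 1], times [exp(s x^2)]. This factor gives it
    the quasi-periods of the Weierstrass sigma function of the lattice, as [sg_add1] and [sg_addw]
    show. *)
Definition sgt x k : C := cexp (s_ * (x ^+ 2 - (1 + 2 * w) * (2 * k%:~R + 1) / 2
  - (2 + w) * (2 * k%:~R + 1) ^+ 2 / 4 + (1 + 2 * w) * (2 * k%:~R + 1) * x)).
Definition sg x : C := csum (sgt x).

Lemma cabs_sgt x k : cabs (sgt x k) = cabs (cexp (s_ * (x ^+ 2 - 3 / 8 + (1 + 2 * w) * x))) *
  cabs (cexp (- (3 * ss R / 2 * k%:~R ^+ 2)%:C + k%:~R * (s_ * (- 3 / 2 + 2 * (1 + 2 * w) * x)))).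
Proof.
rewrite -cabsM -cexpD /sgt.
pose P : R := 2 * k%:~R + 1.
apply: (cabs_cexp_eq (a := - (P / 2 + P ^+ 2 / 8))).
by rewrite /P !(CM, CD, CN, CV, CX, Cint, Cnat, CV); field.
Qed.

Lemma sgt_bsum x : exists M, bsum (fun k => cabs (sgt x k)) M.
Proof.
have c0 : 0 < 3 * ss R / 2 by have := ss_gt0 R; lra.
have [M hM] := bsum_cgauss (s_ * (- 3 / 2 + 2 * (1 + 2 * w) * x)) c0.
eexists; under eq_fun do rewrite cabs_sgt.
exact: bsumZ (cabs_ge0 _) hM.
Qed.

Lemma sgP x : has_sum (sgt x) (sg x).
Proof. by have [M h] := sgt_bsum x; exact: csumP h. Qed.

(** The substitution [k -> - 1 - k] changes the sign of [2 k + 1], and the linear phase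
    [- (1 + 2 w) (2 k + 1) / 2] then contributes the factor -1. *)
Lemma sgN x : sg (- x) = - sg x.
Proof.
have := has_sum_bij (phi := fun k : int => - 1 - k) (psi := fun k : int => - 1 - k) _ _ (sgP (- x)).
move=> h; have {}h := h _ _; rewrite -(csumE (h _ _)).
  apply: csumE; rewrite -[- sg x]mulN1r; apply: eq_has_sum (has_sumZ (-1) (sgP x)) => k.
  rewrite -(cexp_piI R) piIE /= /sgt -cexpD.
  by apply: (@cexp_eq (- k)); rewrite intrB intrN; field.
  by move=> k; lia.
by move=> k; lia.
Qed.

Lemma sg0 : sg 0 = 0.
Proof. by have := sgN 0; rewrite oppr0 => h; apply/eqP; have := mulrn_eq0 (sg 0) 2; rewrite mulr2n {1}h addNr eqxx/= => <-. Qed.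

Lemma triangular_int (m : int) : exists t, m ^+ 2 - m = t * 2.
Proof.
have [c [->|->]] : exists c : int, m = 2 * c \/ m = 2 * c + 1 by exists (m %/ 2)%Z; lia.
  by exists (2 * c ^+ 2 - c); ring.
by exists (2 * c ^+ 2 + c); ring.
Qed.

Definition sgn b : C := cexp (s_ * (1 + 2 * w) * (en b)%:~R).

Lemma cabs_sgn b : cabs (sgn b) = 1.
Proof. by rewrite /sgn intC cabs_cexpI. Qed.

Lemma sgn_mod b : sgn b = cexp (s_ * (1 + 2 * w) * (b.2 * (1 + b.1) + b.1)%:~R).
Proof.
apply: cexp_parity; case: b => n m; rewrite /en/=; apply/eqP; rewrite eqz_mod_dvd.
have [t ht] := triangular_int n; have [t' ht'] := triangular_int m.
apply/dvdzP; exists (t + t' - m * n); rewrite mulrBl mulrDl -ht -ht'; ring.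
Qed.

Definition S0t x y b : C := sgn b *
  cexp (2 * s_ * (x * y^* - (en b)%:~R / 2 + (ei R b)^* * x - ei R b * y^*)).

Lemma S0t_bsum x y : exists M, bsum (fun b => cabs (S0t x y b)) M.
Proof.
have B0 : 0 <= 2 * ss R * (cabs x + cabs y).
  by rewrite !mulr_ge0 ?addr_ge0 ?cabs_ge0 ?ltW ?ss_gt0.
have [M hM] := bsum_E_gauss (ss_gt0 R) B0.
exists (expR (2 * ss R * Re (x * y^*)) * M).
apply: bsum_le (bsumZ (expR_ge0 _) hM) => b.
rewrite cabsM cabs_sgn mul1r cabs_cexp -expRD ler_expR.
have h1 : Re ((ei R b)^* * x) <= cabs x * cabs (ei R b).
  by rewrite (le_trans (ler_norm _))// (le_trans (Re_le_cabs _))// cabsM cabsJ mulrC.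
have h2 : - Re (ei R b * y^*) <= cabs y * cabs (ei R b).
  rewrite (le_trans (ler_norm _))// normrN (le_trans (Re_le_cabs _))// cabsM cabsJ mulrC//.
have -> : 2 * s_ * (x * y^* - (en b)%:~R / 2 + (ei R b)^* * x - ei R b * y^*) =
  (2 * ss R)%:C * (x * y^* + (ei R b)^* * x - ei R b * y^* - ((en b)%:~R / 2)%:C).
  by rewrite !(CM, CD, CN, CV, CX, Cint, CV); ring.
rewrite [Re _]ReM ReC ImC mul0r subr0 !(ReD, ReN) ReC.
have := ss_gt0 R; move: (Re (_ * _)) h1 h2 => A; move: (Re (_ * _)) (Re _) => A1 A2 h1 h2 hs.
by nra.
Qed.

Definition Ks : R := locked (Kp R / Num.sqrt (ss R)).
Lemma KsE : Ks = Kp R / Num.sqrt (ss R). Proof. by rewrite /Ks -lock. Qed.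
Lemma Ks_gt0 : 0 < Ks.
Proof. by rewrite KsE divr_gt0 ?Kp_gt0 ?sqrtr_gt0 ?ss_gt0. Qed.

(** For a fixed difference [n] of the indices of the two theta series, Poisson summation over the
    remaining index produces the second coordinate [m] of a lattice point. So this lattice sum
    factors into a function of [x] and the conjugate of one of [y]. *)
Lemma S0E x y : has_sum (S0t x y) (Ks%:C * (sg x * (sg y)^*)).
Proof.
have [M1 h1] := S0t_bsum x y; have [U hU] := has_sum_ex h1.
suff -> : Ks%:C * (sg x * (sg y)^*) = U by [].
have [Mx hx] := sgt_bsum x; have [My hy] := sgt_bsum y.
have hP : has_sum (fun p : int * int => sgt x p.1 * (sgt y p.2)^*) (sg x * (sg y)^*).
  apply: (has_sum_mul (sgP x) (has_sumJ (sgP y)) hx).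
  by under eq_fun do rewrite cabsJ; exact: hy.
have {}hP := has_sum_bij (phi := fun p : int * int => (p.2, p.1 + p.2)) (psi := fun p : int * int => (p.2 - p.1, p.1)) _ _ hP.
have {}hP : has_sum (fun p : int * int => sgt x p.2 * (sgt y (p.1 + p.2))^*) (sg x * (sg y)^*).
  by apply: hP => -[a c] /=; congr pair; lia.
have inner (n : int) : exists2 S, has_sum (fun k : int => sgt x k * (sgt y (n + k))^*) S &
    has_sum (fun m : int => S0t x y (n, m)) (Ks%:C * S).
  pose xi := s_ * (n%:~R + 2 * (x - y^*) + (1 + 2 * w) * (1 + n%:~R)).
  pose Q := s_ * (2 * x * y^* - n%:~R ^+ 2 + 2 * n%:~R * (w^* * x - w * y^*) + (1 + 2 * w) * n%:~R).
  have s0 := ss_gt0 R.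
  have [M3 h3] := bsum_cgauss xi s0; have [S1 k1] := has_sum_ex h3.
  have [M4 h4] := bsum_cgauss_dual xi s0; have [S2 k2] := has_sum_ex h4.
  exists (cexp Q * S2).
    apply: eq_has_sum (has_sumZ (cexp Q) k2) => k; rewrite /sgt cexpJ -!cexpD.
    have -> : iu R * (2 * pi * k%:~R)%:C = 2 * s_ * (1 + 2 * w) * k%:~R.
      by rewrite !CM Cint Cnat mulrA [iu R * _]mulrCA piIE; ring.
    congr cexp; rewrite /Q /xi !cJ [(4 * _)%:C]CM Cnat intrD.
    have hw := w3_sqr; have hs : s_ != 0 by rewrite -cabs_gt0 cabsC normr_gt0 ss_neq0.
    by field: hw.
  rewrite KsE mulrCA -(poisson s0 k1 k2).
  apply: eq_has_sum (has_sumZ (cexp Q) k1) => m.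
  rewrite /S0t sgn_mod/= -!cexpD; congr cexp; rewrite /Q /xi /ei/= !cJ /en !CM ?CX ?Cint.
  rewrite !expr2 !(intrD, intrM, intrN); have hw := w3_sqr.
  by field: hw.

apply: (@has_sum_unique _ _ (fun n => Ks%:C * csum (fun k : int => sgt x k * (sgt y (n + k))^*))).
  apply: has_sumZ; apply: has_sum_fubini hP _ => n; have [S a c] := inner n.
  by rewrite (csumE a).
apply: has_sum_fubini hU _ => n; have [S a c] := inner n.
by rewrite (csumE a).
Qed.

Lemma sg_add1 x : sg (x + 1) = - cexp (2 * s_ * (x + 1 / 2)) * sg x.
Proof.
apply: csumE; apply: eq_has_sum (has_sumZ _ (sgP x)) => k.
rewrite -[- cexp _]mulN1r -(cexp_piI R) piIE /sgt -!cexpD.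
apply: (@cexp_eq (- k)); rewrite intrN; by field.
Qed.

Lemma sg_addw x : sg (x + w) = - cexp (2 * s_ * (w^* * x + 1 / 2)) * sg x.
Proof.
have h := has_sum_bij (phi := fun k : int => k + 1) (psi := fun k : int => k - 1) _ _ (sgP x).
apply: csumE; apply: eq_has_sum (has_sumZ _ (h _ _)) => k.
rewrite -[- cexp _]mulN1r -(cexp_piI R) piIE /sgt/= -!cexpD; congr cexp.
rewrite intrD cJ; have hw := w3_sqr; by field: hw.
by rewrite addrK.
by rewrite subrK.
Qed.

Definition rt x b : C := sgn b *
  cexp (2 * s_ * (- ((en b)%:~R / 2) + ((ei R b)^* * x - ei R b * x^*))).
(** The exponential compensates the quasi-periods, so that the squared modulus of [sg] becomes
    periodic; [rho_sum] is its Fourier series. *)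
Definition rho x : R := Ks * cabs (sg x) ^+ 2 * expR (- (2 * ss R * cabs x ^+ 2)).

Lemma rho_ge0 x : 0 <= rho x.
Proof.
by apply: mulr_ge0 (expR_ge0 _); apply: mulr_ge0 (ltW Ks_gt0) _; exact: sqr_ge0.
Qed.

Lemma cabs_sg x : Ks * cabs (sg x) ^+ 2 = rho x * expR (2 * ss R * cabs x ^+ 2).
Proof. by rewrite /rho -!mulrA -expRD addNr expR0 mulr1. Qed.

Lemma rho_eq0 x : (rho x == 0) = (sg x == 0).
Proof.
rewrite /rho mulf_eq0 (gt_eqF (expR_gt0 _)) orbF mulf_eq0 (gt_eqF Ks_gt0)/=.
by rewrite sqrf_eq0 cabs_eq0.
Qed.

Lemma rho_sum x : has_sum (rt x) (rho x)%:C.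
Proof.
have h := has_sumZ (cexp (- (2 * ss R * cabs x ^+ 2))%:C) (S0E x x).
have -> : (rho x)%:C = cexp (- (2 * ss R * cabs x ^+ 2))%:C * (Ks%:C * (sg x * (sg x)^*)).
  by rewrite cexpR mulcJ -!CM; congr (_%:C); rewrite /rho; ring.
move: h; apply: eq_has_sum => b; rewrite /rt /S0t mulrCA -cexpD; congr (_ * cexp _).
rewrite CN CM CM Cnat -mulcJ; ring.
Qed.

Lemma rho_add x e : is_eis e -> rho (x + e) = rho x.
Proof.
move=> [m [n ->]]; apply: complexI; apply: has_sum_unique (rho_sum x).
apply: eq_has_sum (rho_sum _) => b; rewrite /rt; congr (_ * _).
apply: (@cexp_eq (b.2 * n - b.1 * m)); rewrite /ei !cJ -w3E intrB !intrM !cJ.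
have hw := w3_sqr; ring: hw.
Qed.

Lemma rhoN x : rho (- x) = rho x.
Proof. by rewrite /rho sgN !cabsN. Qed.

Definition mulw b : eis := (b.2 - b.1, - b.1).
Definition divw b : eis := (- b.2, b.1 - b.2).

Lemma ei_mulw b : ei R (mulw b) = w * ei R b.
Proof. rewrite /ei /mulw/= !(intrB, intrN); have hw := w3_sqr; ring: hw. Qed.
Lemma en_mulw b : en (mulw b) = en b.
Proof. by rewrite /en /mulw/=; ring. Qed.
Lemma mulwK : cancel mulw divw.
Proof. by move=> [x y]; rewrite /mulw /divw/=; congr pair; ring. Qed.
Lemma divwK : cancel divw mulw.
Proof. by move=> [x y]; rewrite /mulw /divw/=; congr pair; ring. Qed.

(** Multiplication by [w] permutes the terms of the kernel. This fixes [sg (w * x)] up to a constant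
    of modulus one, which is determined in [sg_w]. *)
Lemma sg_w_prod x y : sg (w * x) * (sg (w * y))^* = sg x * (sg y)^*.
Proof.
apply: (mulfI (x := Ks%:C)); first by rewrite -cabs_gt0 cabsC normr_gt0 gt_eqF// Ks_gt0.
apply: has_sum_unique (S0E x y).
have h := has_sum_bij mulwK divwK (S0E (w * x) (w * y)).
apply: eq_has_sum h => b /=; rewrite /S0t /sgn en_mulw ei_mulw !cJ; congr (_ * cexp _).
have hw := w3_sqr; ring: hw.
Qed.

End Sigma.

(** * Gaussian sums bounded uniformly in the shift *)

Section ShiftedGauss.
Variable R : realType.
Local Notation C := R[i].

(** One [M] serves all shifts [t]: in the multiple sums below the shift of an inner sum depends on
    the outer indices. *)
Lemma bsum_int_shift (c : R) : 0 < c -> exists M, forall t : R,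
  bsum (fun m : int => expR (- c * (m%:~R - t) ^+ 2)) M.
Proof.
move=> c0; have c2 : 0 < c / 2 by lra.
have [M hM] := bsum_gauss 0 c2; exists (expR c * M) => t.
pose f := Num.floor t.
have hf : f%:~R <= t < f%:~R + 1.
  by have := floor_itv t; rewrite intrD.
have h : bsum (fun m : int => expR (- c * (m%:~R - (t - f%:~R)) ^+ 2)) (expR c * M).
  apply: bsum_le (bsumZ (expR_ge0 c) hM) => m; rewrite -expRD ler_expR mul0r addr0.
  have [u0 u1] : 0 <= t - f%:~R /\ t - f%:~R <= 1 by split; lra.
  move: (t - f%:~R) u0 u1 => u u0 u1; have := sqr_ge0 (m%:~R - 2 * u).
  have : u ^+ 2 <= 1 by rewrite expr_le1.
  move: (m%:~R : R) => x hu hx.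
  have k : x ^+ 2 / 2 - 1 <= (x - u) ^+ 2 by lra.
  have := ler_wpM2l (ltW c0) k; lra.
have := bsum_inj (phi := fun m : int => m - f) _ h => /(_ (can_inj (subrK f))).
by apply: bsum_le => m; rewrite /= intrB; rewrite (_ : _ - _ - _ = m%:~R - t)//; ring.
Qed.

Lemma bsum_E_shift (c : R) : 0 < c -> exists M, forall x : C,
  bsum (fun b : eis => expR (- c * cabs (ei R b - x) ^+ 2)) M.
Proof.
move=> c0; have c2 : 0 < c / 2 by lra.
have [M hM] := bsum_int_shift c2; exists (M * M) => x.
have t0 := sq3_neq0 R; have t2 := sq3_sqr R.
pose x1 := 2 * Im x / sq3 R; pose x2 := Re x + x1 / 2.
apply: (@bsum_prod _ _ _ _ (fun n : int => expR (- (c / 2) * (n%:~R - x1) ^+ 2) * M)) => [i|n|].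
    exact: expR_ge0.
  apply: bsum_le (bsumZ (expR_ge0 _) (hM x2)) => m; rewrite -expRD ler_expR.
  rewrite cabs_sqr [Re _]ReD [Im _]ImD ReN ImN Re_ei Im_ei/=.
  have -> : Re x = x2 - x1 / 2 by rewrite /x2; lra.
  have -> : Im x = x1 * sq3 R / 2 by rewrite /x1; field.
  have -> : (m%:~R - n%:~R / 2 - (x2 - x1 / 2)) ^+ 2 + (n%:~R * sq3 R / 2 - x1 * sq3 R / 2) ^+ 2 =
    (m%:~R - x2) ^+ 2 - (m%:~R - x2) * (n%:~R - x1) + (n%:~R - x1) ^+ 2 by field: t2.
  move: (m%:~R - x2) (n%:~R - x1) => p q.
  by have := sqr_ge0 (p - q); nra.
by under eq_fun do rewrite mulrC; apply: bsumZ => //; exact: bsum_ge0 (hM 0).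
Qed.

Lemma bsum_prodM (T U : choiceType) (g : T -> R) (g' : U -> R) M M' : (forall i, 0 <= g i) ->
  (forall i, 0 <= g' i) -> bsum g M -> bsum g' M' ->
  bsum (fun p : T * U => g p.1 * g' p.2) (M * M').
Proof.
move=> g0 g'0 h h'.
apply: (@bsum_prod _ _ _ _ (fun x => g x * M')) => [i|x|]; first exact: mulr_ge0.
  exact: (bsumZ (g0 x) h').
by under eq_fun do rewrite mulrC; rewrite mulrC; apply: bsumZ => //; exact: bsum_ge0 h'.
Qed.

End ShiftedGauss.

(** * Vectors, the Hermitian form and cusp coordinates *)

Section Vectors.
Variable R : realType.
Local Notation C := R[i].
Local Notation w := (w3 R).
Local Notation s_ := ((ss R)%:C : C).

Definition o1 : 'I_4 := @Ordinal 4 1 isT.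
Definition o2 : 'I_4 := @Ordinal 4 2 isT.
Definition o3 : 'I_4 := @Ordinal 4 3 isT.

Definition V4 (a b c d : C) : 'cV[C]_4 :=
  \col_k (if k == ord0 then a else if k == o1 then b else if k == o2 then c else d).

Lemma V4_0 a b c d : V4 a b c d ord0 ord0 = a. Proof. by rewrite mxE. Qed.
Lemma V4_1 a b c d : V4 a b c d o1 ord0 = b. Proof. by rewrite mxE. Qed.
Lemma V4_2 a b c d : V4 a b c d o2 ord0 = c. Proof. by rewrite mxE. Qed.
Lemma V4_3 a b c d : V4 a b c d o3 ord0 = d. Proof. by rewrite mxE. Qed.
Definition V4E := (V4_0, V4_1, V4_2, V4_3).

Lemma ord4P (P : 'I_4 -> Prop) : P ord0 -> P o1 -> P o2 -> P o3 -> forall k, P k.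
Proof.
move=> p0 p1 p2 p3 [[|[|[|[|//]]]] h].
      by rewrite (_ : Ordinal h = ord0)//; exact: val_inj.
    by rewrite (_ : Ordinal h = o1)//; exact: val_inj.
  by rewrite (_ : Ordinal h = o2)//; exact: val_inj.
by rewrite (_ : Ordinal h = o3)//; exact: val_inj.
Qed.

Lemma vec4P (x y : 'cV[C]_4) : x ord0 ord0 = y ord0 ord0 -> x o1 ord0 = y o1 ord0 ->
  x o2 ord0 = y o2 ord0 -> x o3 ord0 = y o3 ord0 -> x = y.
Proof. by move=> h0 h1 h2 h3; apply/colP; apply: ord4P. Qed.

Lemma sum4 (f : 'I_4 -> C) : \sum_k f k = f ord0 + f o1 + f o2 + f o3.
Proof.
rewrite !big_ord_recl big_ord0 addr0 !addrA.
by congr (_ + f _ + f _ + f _); apply: val_inj.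
Qed.

Lemma hformE (z x : 'cV[C]_4) : hform z x = (z ord0 ord0)^* * x ord0 ord0 -
  (z o1 ord0)^* * x o1 ord0 - (z o2 ord0)^* * x o2 ord0 - (z o3 ord0)^* * x o3 ord0.
Proof.
have := sum4 (fun k => (z k ord0)^* * x k ord0); rewrite (bigD1 ord0)//= /hform.
rewrite cjNum; under [X in _ -> _ - X = _]eq_bigr => k _ do rewrite cjNum.
by rewrite -!addrA => /addrI ->; rewrite !opprD !addrA.
Qed.

Implicit Types z x y p l : 'cV[C]_4.

Lemma hformJ z x : (hform z x)^* = hform x z.
Proof. by rewrite !hformE !(conjD, conjN, conjM, conjKc); ring. Qed.
Lemma hformDr z x y : hform z (x + y) = hform z x + hform z y.
Proof. by rewrite !hformE !mxE; ring. Qed.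
Lemma hformDl z x y : hform (x + y) z = hform x z + hform y z.
Proof. by rewrite !hformE !mxE !conjD; ring. Qed.
Lemma hformZr z x a : hform z (a *: x) = a * hform z x.
Proof. by rewrite !hformE !mxE; ring. Qed.
Lemma hformZl z x a : hform (a *: x) z = a^* * hform x z.
Proof. by rewrite !hformE !mxE !conjM; ring. Qed.
Lemma hformNr z x : hform z (- x) = - hform z x.
Proof. by rewrite !hformE !mxE; ring. Qed.
Lemma hformNl z x : hform (- x) z = - hform x z.
Proof. by rewrite !hformE !mxE !conjN; ring. Qed.
Definition hformL := (hformDl, hformDr, hformZl, hformZr, hformNl, hformNr).

Lemma hform_real z : (hform z z)^* = hform z z. Proof. exact: hformJ. Qed.
Lemma Im_hform z : Im (hform z z) = 0.
Proof. by have /(congr1 (@complex.Im R)) := hform_real z; rewrite ImJ; lra. Qed.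
Definition hn z : R := Re (hform z z).
Lemma hnE z : hform z z = (hn z)%:C.
Proof. by apply: complexP; rewrite ?ReC ?ImC ?Im_hform. Qed.
Lemma ballconeE z : ballcone z <-> 0 < hn z.
Proof. by rewrite /ballcone /= hnE ltcR. Qed.

Definition lat (z : 'cV[C]_4) := forall k, is_eis (z k ord0).

(** The index type is all of ['cV[C]_4], cut down to the lattice by the test, so that elements of
    [G3] reindex the sum by plain multiplication. *)
Definition Nt (p z l : 'cV[C]_4) : C := if `[< lat l >] then
  cexp (2 * s_ * ((1 + w) * hform l l + hform l p - hform p l
     - hform l z * hform z l / hform z z)) else 0.
Definition NN0 p z : C := csum (Nt p z).

(* the point [t e + a e' + c e_2 + d e_3], for the isotropic vectors
   e = (1, 1, 0, 0) and e' = (1 + w, w, 0, 0) with h(e, e') = 1 *)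
Definition cusp4 (t a c d : C) := V4 (t + a * (1 + w)) (t + a * w) c d.

Lemma cusp_coordK (z : 'cV[C]_4) :
  z = cusp4 (- w * z ord0 ord0 + (1 + w) * z o1 ord0) (z ord0 ord0 - z o1 ord0) (z o2 ord0) (z o3 ord0).
Proof. have hw := w3_sqr R; apply: vec4P; rewrite V4E//; ring: hw. Qed.

Lemma hform_cusp t a c d t' a' c' d' :
  hform (cusp4 t a c d) (cusp4 t' a' c' d') = t^* * a' + a^* * t' - c^* * c' - d^* * d'.
Proof.
rewrite hformE !V4E !cJ; have hw := w3_sqr R; ring: hw.
Qed.

End Vectors.

(** * Factorisation of the invariant sum along the cusp *)

Section Key.
Variable R : realType.
Local Notation C := R[i].
Local Notation w := (w3 R).
Local Notation s_ := ((ss R)%:C : C).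
Local Notation ei := (ei R).
Implicit Types (p q a b m n : eis).

Definition addE a b : eis := (a.1 + b.1, a.2 + b.2).
Definition oppE a : eis := (- a.1, - a.2).
Lemma ei_add a b : ei (addE a b) = ei a + ei b.
Proof. by rewrite /ei /addE/= !intrD; ring. Qed.
Lemma ei_opp a : ei (oppE a) = - ei a.
Proof. by rewrite /ei /oppE/= !intrN; ring. Qed.
Lemma addEK a b : addE (addE a b) (oppE b) = a.
Proof. by case: a b => [? ?] [? ?]; rewrite /addE /oppE/=; congr pair; ring. Qed.
Lemma addENK a b : addE (addE a (oppE b)) b = a.
Proof. by case: a b => [? ?] [? ?]; rewrite /addE /oppE/=; congr pair; ring. Qed.

Lemma ei_inj : injective ei.
Proof.
have t0 := sq3_neq0 R.
move=> [a1 a2] [b1 b2] h; have hi : Im (ei (a1, a2)) = Im (ei (b1, b2)) by rewrite h.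
have hr : Re (ei (a1, a2)) = Re (ei (b1, b2)) by rewrite h.
move: hi hr; rewrite !Im_ei !Re_ei/= => hi.
have e1 : a1%:~R = b1%:~R :> R by apply: (mulIf t0); lra.
rewrite e1 => hr; have e2 : a2%:~R = b2%:~R :> R by lra.
by congr pair; apply: (@intr_inj R).
Qed.

Lemma enC a : (en a)%:~R = ei a * (ei a)^*.
Proof. by rewrite mulcJ -en_cabs Cint. Qed.

Lemma is_eisP x : is_eis x <-> exists a, x = ei a.
Proof.
split=> [[m [n ->]]|[a ->]]; first by exists (n, m); rewrite /ei w3E.
by exists a.2, a.1; rewrite /ei w3E.
Qed.

Variables (tau u2 u3 pm pa p2 p3 : C) (y : R).
Hypothesis y_gt0 : 0 < y.
Hypothesis yE : y%:C = tau + tau^* - u2 * u2^* - u3 * u3^*.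

(** Together with two values of [sg] this is a term of the Fourier-Jacobi expansion at the cusp [e],
    of frequency [|mu|^2] in [tau]. *)
Definition Ph1 p : C := let mu := ei p + pa in
  cexp (2 * s_ * (mu^* * pm - mu * pm^* - mu * mu^* * tau + p2^* * mu * u2 + p3^* * mu * u3)).
Definition Pht p : C := let mu := ei p + pa in
  Ph1 p * (sg (mu * u2 - p2) * sg (mu * u3 - p3)).
Definition Phi : C := csum Pht.

(** A lattice vector is split into its coordinates [a, b2, b3] and the coordinate [M] along [e];
    Poisson summation takes place in [M]. *)
Definition T3 := (eis * (eis * eis))%type.
Definition Gt (t : T3 * eis) : C := let: (a, (b2, b3), M) := t in
  Nt (cusp4 pm pa p2 p3) (cusp4 tau 1 u2 u3) (cusp4 (ei M) (ei a) (ei b2) (ei b3)).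

Lemma lat_cusp M a b2 b3 : lat (cusp4 (ei M) (ei a) (ei b2) (ei b3)).
Proof.
have h1 : ei (addE M (addE a (mulw a))) = ei M + ei a * (1 + w).
  by rewrite !ei_add ei_mulw; ring.
have h2 : ei (addE M (mulw a)) = ei M + ei a * w.
  by rewrite !ei_add ei_mulw; ring.
by apply: ord4P; rewrite V4E; apply/is_eisP; rewrite -?h1 -?h2; eexists.
Qed.

Lemma GtE a b2 b3 M : Gt (a, (b2, b3), M) =
  let H := (ei M)^* * ei a + (ei a)^* * ei M - ei b2 * (ei b2)^* - ei b3 * (ei b3)^* in
  let X := (ei a)^* * tau - (ei b2)^* * u2 - (ei b3)^* * u3 in
  cexp (2 * s_ * ((1 + w) * H + ((ei M)^* * pa - ei M * pa^*) + ((ei a)^* * pm - ei a * pm^*)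
    - ((ei b2)^* * p2 - ei b2 * p2^*) - ((ei b3)^* * p3 - ei b3 * p3^*)
    - ((ei M)^* + X) * (ei M + X^*) / y%:C)).
Proof.
rewrite /Gt /Nt asboolT; last exact: lat_cusp.
move: (ei M) (ei a) (ei b2) (ei b3) => M' a' b2' b3' /=.
rewrite !hform_cusp !cJ yE; congr cexp; congr (_ * _).
rewrite ?C1 !mulr1 !mul1r; set Y := tau^* + _ - _ - _.
have -> : tau + tau^* - u2 * u2^* - u3 * u3^* = Y by rewrite /Y; ring.
by move: (Y^-1) => Z; ring.
Qed.

Lemma Re_2s (D : C) : Re (2 * s_ * D) = 2 * ss R * Re D.
Proof. by rewrite !ReIm; ring. Qed.
Lemma Re_skew (x z : C) : Re (x^* * z - x * z^*) = 0.
Proof. by rewrite !ReIm; ring. Qed.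
Lemma Re_bound_aux (q K1 K2 K3 K4 : C) (v A B2 B3 c : R) : v != 0 ->
  Re K1 = 0 -> Re K2 = 0 -> Re K3 = 0 -> Re K4 = 0 ->
  Re ((1 + w) * (q + q^* - v%:C * A%:C - B2%:C - B3%:C) + K1 + K2 - K3 - K4 - c%:C / v%:C) =
  (2 * Re q - v * A - B2 - B3) / 2 - c / v.
Proof.
by move=> v0 h1 h2 h3 h4; rewrite -fmorphV !ReIm Re_w3 Im_w3 h1 h2 h3 h4; field; rewrite v0.
Qed.

(** Completing squares writes [h(l,l)] through [m = M + X^*] and the [b - a u]. The shift of each
    square depends on the outer indices only, which is what [bsum_E_shift] requires. *)
Lemma cabs_Gt a b2 b3 M : cabs (Gt (a, (b2, b3), M)) <=
  expR (- (ss R * y / 3) * (en a)%:~R) *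
  (expR (- ss R * cabs (ei b2 - ei a * u2) ^+ 2) *
  (expR (- ss R * cabs (ei b3 - ei a * u3) ^+ 2) *
   expR (- (ss R / (3 * y)) * cabs (ei M - (- ((ei a)^* * tau - (ei b2)^* * u2 - (ei b3)^* * u3)^*)) ^+ 2))).
Proof.
rewrite -!expRD GtE/=; set X := _ - (ei b3)^* * u3; set H := _ - ei b3 * (ei b3)^*.
rewrite cabs_cexp ler_expR.
pose m := ei M + X^*.
have e1 : H = m * (ei a)^* + m^* * ei a - y%:C * (ei a * (ei a)^*)
   - (ei b2 - ei a * u2) * (ei b2 - ei a * u2)^* - (ei b3 - ei a * u3) * (ei b3 - ei a * u3)^*.
  rewrite yE /H /m /X; move: (ei M) (ei a) (ei b2) (ei b3) => M' a' b2' b3'.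
  by rewrite !cJ; ring.
have eX : (ei M)^* + X = m^* by rewrite /m !cJ.
have e2 : ei M - - X^* = m by rewrite /m opprK.
rewrite eX e2 e1 en_cabs.
have -> : m^* * m = (cabs m ^+ 2)%:C by rewrite mulrC mulcJ.
rewrite !mulcJ; set A := cabs (ei a); set B2 := cabs (_ - _); set B3 := cabs (_ - _).
have hA : Re (m * (ei a)^*) <= cabs m * A.
  by rewrite (le_trans (ler_norm _))// (le_trans (Re_le_cabs _))// cabsM cabsJ.
have -> : m^* * ei a = (m * (ei a)^*)^* by rewrite !cJ.
have hs := ss_gt0 R; have hm := cabs_ge0 m; have hA0 : 0 <= A := cabs_ge0 _.
rewrite Re_2s Re_bound_aux ?Re_skew// ?gt_eqF//.
move: (Re _) hA => r hr.
have k : (2 * r - y * A ^+ 2) / 2 - cabs m ^+ 2 / y <= - (y * A ^+ 2 / 6) - cabs m ^+ 2 / (6 * y).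
  have -> : cabs m ^+ 2 / y = y * (cabs m / y) ^+ 2 by field; rewrite gt_eqF.
  have -> : cabs m ^+ 2 / (6 * y) = y * (cabs m / y) ^+ 2 / 6 by field; rewrite gt_eqF.
  have em : cabs m = y * (cabs m / y) by field; rewrite gt_eqF.
  rewrite {}em in hr; move: (cabs m / y) hr => g hr.
  have := mulr_ge0 (ltW y_gt0) (sqr_ge0 (A - 3 / 2 * g)); have := mulr_ge0 (ltW y_gt0) (sqr_ge0 g); lra.
have := ler_wpM2l (ltW hs) k.
have -> : ss R * (- (y * A ^+ 2 / 6) - cabs m ^+ 2 / (6 * y)) =
  - (ss R * y / 3) * A ^+ 2 / 2 - (ss R / (3 * y)) * cabs m ^+ 2 / 2 by field; rewrite gt_eqF.
by lra.
Qed.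

Lemma bsumZr (T : choiceType) (g : T -> R) M c : 0 <= c -> bsum g M ->
  bsum (fun i => g i * c) (M * c).
Proof. by move=> c0 h; rewrite mulrC; under eq_fun do rewrite mulrC; exact: bsumZ. Qed.

Lemma bsum_cut (c : R) (x : C) : 0 < c -> exists M, bsum (fun b : eis => expR (- c * cabs (ei b + x) ^+ 2)) M.
Proof.
move=> c0; have [M hM] := bsum_E_shift c0; exists M; apply: bsum_le (hM (- x)) => b.
by rewrite opprK.
Qed.

Lemma Gt_bsum : exists M, bsum (fun t => cabs (Gt t)) M.
Proof.
have s0 := ss_gt0 R.
have c1 : 0 < ss R * y / 3 by rewrite divr_gt0 ?mulr_gt0.
have c4 : 0 < ss R / (3 * y) by rewrite divr_gt0 ?mulr_gt0.
have [K1 h1] := bsum_E_shift c1; have [K2 h2] := bsum_E_shift s0; have [K4 h4] := bsum_E_shift c4.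
have k2 : 0 <= K2 := bsum_ge0 (h2 0); have k4 : 0 <= K4 := bsum_ge0 (h4 0).
exists (K1 * (K2 * (K2 * K4))).
apply: (@bsum_prod _ _ _ _ (fun t : T3 => expR (- (ss R * y / 3) * (en t.1)%:~R) *
  (expR (- ss R * cabs (ei t.2.1 - ei t.1 * u2) ^+ 2) *
  (expR (- ss R * cabs (ei t.2.2 - ei t.1 * u3) ^+ 2) * K4)))).
    by move=> t; exact: cabs_ge0.
  move=> [a [b2 b3]]; apply: bsum_le; first by move=> M; exact: cabs_Gt.
  by do 3![apply: bsumZ; first exact: expR_ge0]; exact: h4.
apply: (@bsum_prod _ _ _ _ (fun a => expR (- (ss R * y / 3) * (en a)%:~R) * (K2 * (K2 * K4)))).
    by move=> t; rewrite !mulr_ge0 ?expR_ge0.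
  move=> a /=; apply: (bsumZ (expR_ge0 _)).
  apply: (@bsum_prodM _ _ _ (fun b => expR (- ss R * cabs (ei b - ei a * u2) ^+ 2))
     (fun b => expR (- ss R * cabs (ei b - ei a * u3) ^+ 2) * K4)) => [i|i||].
        exact: expR_ge0.
      by rewrite mulr_ge0 ?expR_ge0.
    exact: h2.
  exact: (bsumZr k4 (h2 _)).
apply: bsumZr; first by rewrite !mulr_ge0.
by apply: bsum_le (h1 0) => a; rewrite subr0 en_cabs.
Qed.

(** Up to a constant, the term of [Pht p * (Pht q)^*] when the products of values of [sg] are
    expanded by [S0E]. *)
Definition Et p q b2 b3 : C := let mu := ei p + pa in let nu := ei q + pa in
  (Ph1 p * (Ph1 q)^* * (expR (- (2 * ss R * (cabs p2 ^+ 2 + cabs p3 ^+ 2))))%:C) *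
  (S0t (mu * u2 - p2) (nu * u2 - p2) b2 * S0t (mu * u3 - p3) (nu * u3 - p3) b3).

Lemma cabs_S0t x z b : cabs (S0t x z b) =
  expR (ss R * (cabs x ^+ 2 + cabs z ^+ 2 - cabs (ei b - (x - z)) ^+ 2)).
Proof.
rewrite cabsM cabs_sgn mul1r cabs_cexp Re_2s; congr expR.
rewrite enC; move: (ei b) => e; rewrite mulcJ.
have -> : (cabs e ^+ 2)%:C / 2 = (cabs e ^+ 2 / 2)%:C :> C.
  by rewrite CM CV Cnat.
by rewrite !cabs_sqr !ReIm; field.
Qed.

Lemma cabs_Ph1 p : cabs (Ph1 p) = expR (2 * ss R * (- (cabs (ei p + pa) ^+ 2 * Re tau) +
  Re (p2^* * (ei p + pa) * u2) + Re (p3^* * (ei p + pa) * u3))).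
Proof.
rewrite cabs_cexp Re_2s; congr (expR (_ * _)).
rewrite mulcJ [Re _]ReD [Re (_ + p2^* * _ * _)]ReD; congr (_ + _ + _).
have -> : Re ((ei p + pa)^* * pm - (ei p + pa) * pm^* - (cabs (ei p + pa) ^+ 2)%:C * tau) =
  - (cabs (ei p + pa) ^+ 2 * Re tau) by rewrite [LHS]ReD Re_skew !ReIm; ring.
by [].
Qed.

Lemma cabs_Et p q b2 b3 : let mu := ei p + pa in let nu := ei q + pa in
  cabs (Et p q b2 b3) = expR (- (ss R * y) * cabs mu ^+ 2) * expR (- (ss R * y) * cabs nu ^+ 2) *
   (expR (- ss R * cabs (ei b2 - (mu - nu) * u2) ^+ 2) *
    expR (- ss R * cabs (ei b3 - (mu - nu) * u3) ^+ 2)).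
Proof.
move=> mu nu; rewrite /Et -/mu -/nu 2!cabsM cabsM cabsM cabsJ !cabs_S0t !cabs_Ph1 -/mu -/nu.
rewrite cabsC ger0_norm ?expR_ge0// -!expRD; congr expR.
have yR : y = 2 * Re tau - cabs u2 ^+ 2 - cabs u3 ^+ 2.
  by rewrite -[LHS](ReC y) yE !cabs_sqr !ReIm; ring.
have E (x u p' : C) : cabs (x * u - p') ^+ 2 = cabs x ^+ 2 * cabs u ^+ 2 + cabs p' ^+ 2 - 2 * Re (p'^* * x * u).
  by rewrite !cabs_sqr !ReIm; ring.
have D b (u p' : C) : ei b - (mu * u - p' - (nu * u - p')) = ei b - (mu - nu) * u by ring.
by rewrite (D b2 u2 p2) (D b3 u3 p3) (E mu u2 p2) (E nu u2 p2) (E mu u3 p3) (E nu u3 p3) yR; ring.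
Qed.

Lemma Et_bsum : exists M, bsum (fun t : (eis * eis) * (eis * eis) =>
  cabs (Et t.1.1 t.1.2 t.2.1 t.2.2)) M.
Proof.
have s0 := ss_gt0 R.
have c1 : 0 < ss R * y by rewrite mulr_gt0.
have [K1 h1] := bsum_cut pa c1; have [K2 h2] := bsum_E_shift s0.
have k2 : 0 <= K2 := bsum_ge0 (h2 0).
exists (K1 * K1 * (K2 * K2)).
apply: (@bsum_prod _ _ _ _ (fun t : eis * eis => expR (- (ss R * y) * cabs (ei t.1 + pa) ^+ 2) *
   expR (- (ss R * y) * cabs (ei t.2 + pa) ^+ 2) * (K2 * K2))).
    by move=> t; exact: cabs_ge0.
  move=> [p q]; under eq_fun do rewrite cabs_Et.
  rewrite /=; apply: (bsumZ (mulr_ge0 (expR_ge0 _) (expR_ge0 _))).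
  set f := fun b => expR (- ss R * cabs (ei b - (ei p + pa - (ei q + pa)) * u2) ^+ 2).
  set f' := fun b => expR (- ss R * cabs (ei b - (ei p + pa - (ei q + pa)) * u3) ^+ 2).
  by apply: (@bsum_prodM _ _ _ f f') => *; rewrite ?expR_ge0//; exact: h2.
apply: (bsumZr (mulr_ge0 k2 k2)).
set f := fun b => expR (- (ss R * y) * cabs (ei b + pa) ^+ 2).
by apply: (@bsum_prodM _ _ _ f f) => *; rewrite ?expR_ge0.
Qed.

Definition Et' (t : T3 * eis) : C := Et (addE t.1.1 t.2) t.2 t.1.2.1 t.1.2.2.

Lemma Et'_bsum : exists M, bsum (fun t => cabs (Et' t)) M.
Proof.
have [M h] := Et_bsum; exists M.
apply: (bsum_inj (phi := fun t : T3 * eis => ((addE t.1.1 t.2, t.2), (t.1.2.1, t.1.2.2))) _ h).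
move=> [[a [b c]] d] [[a' [b' c']] d'] e.
have hd : d = d' := congr1 (fun x => x.1.2) e.
have hb : b = b' := congr1 (fun x => x.2.1) e.
have hc : c = c' := congr1 (fun x => x.2.2) e.
have ha : addE a d = addE a' d' := congr1 (fun x => x.1.1) e.
by rewrite -[a](addEK a d) ha hd addEK hb hc.
Qed.

Definition Kq : R := 2 * Kp R ^+ 2 / (sq3 R * (2 * ss R / y)).

(** The dual index of [M] takes the part of [q], and the coordinate [a] that of the difference
    [p - q]: the invariant sum becomes a double sum over [p] and [q]. *)
Lemma Gt_dual t S V : has_sum (fun M => Gt (t, M)) S -> has_sum (fun q => Et' (t, q)) V ->
  S = Kq%:C * V.
Proof.
case: t => [a [b2 b3]] hS hV.
pose X := (ei a)^* * tau - (ei b2)^* * u2 - (ei b3)^* * u3.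
pose base := 2 * s_ * ((1 + w) * (- (ei b2 * (ei b2)^*) - ei b3 * (ei b3)^*) +
  ((ei a)^* * pm - ei a * pm^*) - ((ei b2)^* * p2 - ei b2 * p2^*) - ((ei b3)^* * p3 - ei b3 * p3^*)
  - X * X^* / y%:C).
pose be := 2 * s_ * ((1 + w) * (ei a)^* - pa^* - X / y%:C).
pose ga := 2 * s_ * ((1 + w) * ei a + pa - X^* / y%:C).
have y0 : y%:C != 0 :> C by rewrite -cabs_gt0 cabsC normr_gt0 gt_eqF.
have s0 : s_ != 0 by rewrite -cabs_gt0 cabsC normr_gt0 ss_neq0.
have eta0 : 0 < 2 * ss R / y by rewrite divr_gt0 ?mulr_gt0 ?ss_gt0.
have nb := cexp_neq0 base.
rewrite -[S](mulVKf nb) -[V](mulVKf nb) [RHS]mulrCA; congr (_ * _).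
apply: (@poisson_E _ (2 * ss R / y) be ga) => //.
  apply: eq_has_sum (has_sumZ _ hS) => M; apply: (mulfI nb); rewrite mulVKf// GtE/= -cexpD; congr cexp.
  rewrite -/X /base /be /ga !CM Cint enC CV Cnat.
  move: (ei M) (X^*) (ei M)^* => M' XJ MJ; clearbody X.
  by field; rewrite y0.
(* With [n = w a - q] the two factors of the dual exponent become, up to [2 s], [- (nu^* + X / y)]
   and [mu - X^* / y], since [1 + w + w^* = 0]. *)
have hV' := has_sum_bij (phi := fun n => addE (mulw a) (oppE n)) (psi := fun n => addE (mulw a) (oppE n)) _ _ hV.
apply: eq_has_sum (has_sumZ _ (hV' _ _)) => n; last 2 first.
  by case: n => n1 n2; rewrite /addE /oppE/=; congr pair; ring.
  by case: n => n1 n2; rewrite /addE /oppE/=; congr pair; ring.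
apply: (mulfI nb); rewrite mulVKf// /= /Et' /Et /Ph1/= /S0t /sgn -cexpR cexpJ -!cexpD.
apply: (@cexp_eq _ (en b2 + en b3)).
have ec : (- (2 * ss R * (cabs p2 ^+ 2 + cabs p3 ^+ 2)))%:C = - (2 * s_ * (p2 * p2^* + p3 * p3^*)).
  by rewrite !mulcJ -CD -(Cnat R 2) -CM -CM -CN.
rewrite !ei_add !ei_opp ei_mulw intrD !enC /base /be /ga ec !CM CV !Cnat /X.
move: (ei n) (ei a) (ei b2) (ei b3) => n' a' b2' b3'; rewrite !cJ ?C1.
have hw := w3_sqr R.
rewrite yE in y0 *.
by field: hw; rewrite y0 s0.
Qed.

Lemma rho_bounded : exists B : R, 0 <= B /\ forall x : C, rho x <= B.
Proof.
have [M hM] := bsum_E_shift (ss_gt0 R); exists M; split; first exact: bsum_ge0 (hM 0).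
move=> x; rewrite -[leLHS]ger0_norm ?rho_ge0// -cabsC.
apply: has_sum_bound (rho_sum x) _; apply: bsum_le (hM 0) => b.
rewrite /rt cabsM cabs_sgn mul1r cabs_cexp Re_2s ler_expR subr0 -en_cabs.
rewrite [Re _]ReD Re_skew addr0 ReN intC -(Cnat R 2) -CV -CM ReC.
lra.
Qed.

(** The size of a term is a Gaussian in [mu], of rate given by the height [y], times values of the
    bounded periodic function [rho]. All dominations of the series rest on this identity. *)
Lemma cabs_Pht2 p : Ks R ^+ 2 * cabs (Pht p) ^+ 2 =
  expR (2 * ss R * (cabs p2 ^+ 2 + cabs p3 ^+ 2)) * expR (- (2 * ss R * y * cabs (ei p + pa) ^+ 2)) *
  (rho ((ei p + pa) * u2 - p2) * rho ((ei p + pa) * u3 - p3)).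
Proof.
rewrite /Pht !cabsM cabs_Ph1 !exprMn -expRM_natl.
have cp (a b c e : R) : a ^+ 2 * (b * (c * e)) = b * ((a * c) * (a * e)) by ring.
rewrite cp !cabs_sg.
have yR : y = 2 * Re tau - cabs u2 ^+ 2 - cabs u3 ^+ 2.
  by rewrite -[LHS](ReC y) yE !cabs_sqr !ReIm; ring.
have E (x u p' : C) : cabs (x * u - p') ^+ 2 = cabs x ^+ 2 * cabs u ^+ 2 + cabs p' ^+ 2 - 2 * Re (p'^* * x * u).
  by rewrite !cabs_sqr !ReIm; ring.
have cp2 (a b c d e : R) : a * (b * c * (d * e)) = a * c * e * (b * d) by ring.
rewrite cp2 -!expRD; congr (expR _ * _).
by rewrite (E (ei p + pa) u2 p2) (E (ei p + pa) u3 p3) yR; ring.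
Qed.

Lemma Pht_bound (B : R) : 0 <= B -> (forall x : C, rho x <= B) -> forall p, cabs (Pht p) <=
  B / Ks R * expR (ss R * (cabs p2 ^+ 2 + cabs p3 ^+ 2)) * expR (- (ss R * y) * cabs (ei p + pa) ^+ 2).
Proof.
move=> B0 hB p; have K0 := Ks_gt0 R; have BK : 0 <= B / Ks R by rewrite divr_ge0// ltW.
rewrite -(@ler_pXn2r _ 2) ?nnegrE ?cabs_ge0//; last first.
  by rewrite !(mulr_ge0 BK, mulr_ge0) ?expR_ge0.
rewrite -(@ler_pM2l _ (Ks R ^+ 2)) ?exprn_gt0// cabs_Pht2.
have cp (a b c d : R) : c != 0 -> c ^+ 2 * (b / c * a * d) ^+ 2 = a ^+ 2 * d ^+ 2 * (b * b).
  by move=> c0; field.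
rewrite cp ?gt_eqF// -!expRM_natl.
have -> : 2%:R * (ss R * (cabs p2 ^+ 2 + cabs p3 ^+ 2)) = 2 * ss R * (cabs p2 ^+ 2 + cabs p3 ^+ 2) by ring.
have -> : 2%:R * (- (ss R * y) * cabs (ei p + pa) ^+ 2) = - (2 * ss R * y * cabs (ei p + pa) ^+ 2) by ring.
apply: ler_wpM2l; first by rewrite mulr_ge0 ?expR_ge0.
by apply: ler_pM; rewrite ?rho_ge0.
Qed.

Lemma Pht_bsum : exists M, bsum (fun p => cabs (Pht p)) M.
Proof.
have [B [B0 hB]] := rho_bounded; have c1 : 0 < ss R * y by rewrite mulr_gt0 ?ss_gt0.
have [K1 h1] := bsum_cut pa c1.
have BE : 0 <= B / Ks R * expR (ss R * (cabs p2 ^+ 2 + cabs p3 ^+ 2)).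
  by apply: mulr_ge0 (expR_ge0 _); rewrite divr_ge0 ?(ltW (Ks_gt0 R)).
by exists (B / Ks R * expR (ss R * (cabs p2 ^+ 2 + cabs p3 ^+ 2)) * K1); apply: bsum_le (bsumZ BE h1) => p; exact: Pht_bound.
Qed.

Lemma PhiP : has_sum Pht Phi.
Proof. by have [M h] := Pht_bsum; exact: csumP h. Qed.

Definition Kz : R := Kq * Ks R ^+ 2 * expR (- (2 * ss R * (cabs p2 ^+ 2 + cabs p3 ^+ 2))).

Lemma Gt_sum : has_sum Gt (Kz * cabs Phi ^+ 2)%:C.
Proof.
have [MG bG] := Gt_bsum; have [ME bE] := Et_bsum; have [ME' bE'] := Et'_bsum.
have hG := csumP bG; have hE := csumP bE; have hE' := csumP bE'.
have eE : csum Et' = csum (fun t : (eis * eis) * (eis * eis) => Et t.1.1 t.1.2 t.2.1 t.2.2).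
  apply: has_sum_unique hE' _.
  apply: (has_sum_bij (phi := fun t : T3 * eis => ((addE t.1.1 t.2, t.2), (t.1.2.1, t.1.2.2)))
     (psi := fun t : (eis * eis) * (eis * eis) => ((addE t.1.1 (oppE t.1.2), (t.2.1, t.2.2)), t.1.2)) _ _ hE).
    by move=> [[a [b c]] d] /=; rewrite addEK.
  by move=> [[a d] [b c]] /=; rewrite addENK.
have -> : (Kz * cabs Phi ^+ 2)%:C = csum Gt; last exact: hG.
transitivity (Kq%:C * csum Et').
  rewrite eE; pose cst := expR (- (2 * ss R * (cabs p2 ^+ 2 + cabs p3 ^+ 2))).
  have h (t : eis * eis) : has_sum (fun b : eis * eis => Et t.1 t.2 b.1 b.2)
     ((Ks R ^+ 2 * cst)%:C * (Pht t.1 * (Pht t.2)^*)).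
    case: t => p q /=; set mu := ei p + pa; set nu := ei q + pa.
    have [m2 k2] := S0t_bsum (mu * u2 - p2) (nu * u2 - p2).
    have [m3 k3] := S0t_bsum (mu * u3 - p3) (nu * u3 - p3).
    have := has_sumZ (Ph1 p * (Ph1 q)^* * cst%:C)
       (has_sum_mul (S0E (mu * u2 - p2) (nu * u2 - p2)) (S0E (mu * u3 - p3) (nu * u3 - p3)) k2 k3).
    congr has_sum; rewrite /Pht -/mu -/nu !conjM !CM; ring.
  have [MP bP] := Pht_bsum.
  have h2 := has_sum_mul PhiP (has_sumJ PhiP) bP _.
  have {}h2 := has_sumZ (Ks R ^+ 2 * cst)%:C (h2 MP _).
  have h3 := has_sum_fubini hE (fun t => h t).
  rewrite (has_sum_unique h3 (h2 _)); last first.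
    by under eq_fun do rewrite cabsJ.
  by rewrite mulcJ -!CM /Kz -/cst; congr (_%:C); ring.
pose D t := csum (fun q => Et' (t, q)).
pose D' t := csum (fun M => Gt (t, M)).
have hD : has_sum D (csum Et') := csum_fubini bE'.
have hD' : has_sum D' (csum Gt) := csum_fubini bG.
apply: (has_sum_unique (has_sumZ Kq%:C hD)).
apply: eq_has_sum hD' => t; apply: Gt_dual.
  by apply: (@csumP _ _ _ MG); exact: (@bsum_slice _ _ _ (fun i => cabs (Gt i))).
by apply: (@csumP _ _ _ ME'); exact: (@bsum_slice _ _ _ (fun i => cabs (Et' i))).
Qed.

End Key.

(** * Closure properties of the Eisenstein integers *)

Section EisensteinRing.
Variable R : realType.
Local Notation C := R[i].
Local Notation w := (w3 R).
Implicit Types x y : C.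

Definition mulE (a b : eis) : eis :=
  (a.1 * b.2 + a.2 * b.1 - a.1 * b.1, a.2 * b.2 - a.1 * b.1).
Lemma ei_mul a b : ei R (mulE a b) = ei R a * ei R b.
Proof.
rewrite /ei /mulE/= !(intrB, intrD, intrM); have hw := w3_sqr R; ring: hw.
Qed.

Lemma is_eisD x y : is_eis x -> is_eis y -> is_eis (x + y).
Proof. by move=> /is_eisP[a ->] /is_eisP[b ->]; apply/is_eisP; exists (addE a b); rewrite ei_add. Qed.
Lemma is_eisN x : is_eis x -> is_eis (- x).
Proof. by move=> /is_eisP[a ->]; apply/is_eisP; exists (oppE a); rewrite ei_opp. Qed.
Lemma is_eisM x y : is_eis x -> is_eis y -> is_eis (x * y).
Proof. by move=> /is_eisP[a ->] /is_eisP[b ->]; apply/is_eisP; exists (mulE a b); rewrite ei_mul. Qed.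
Lemma is_eis_int (n : int) : is_eis (n%:~R : C).
Proof. by exists n, 0; rewrite mul0r addr0. Qed.
Lemma is_eis0 : is_eis (0 : C). Proof. exact: (is_eis_int 0). Qed.
Lemma is_eis1 : is_eis (1 : C). Proof. exact: (is_eis_int 1). Qed.
Lemma is_eis_nat (n : nat) : is_eis (n%:R : C). Proof. exact: (is_eis_int n%:Z). Qed.
Lemma is_eisw : is_eis w. Proof. by exists 0, 1; rewrite add0r mul1r w3E. Qed.
Lemma is_eisJ x : is_eis x -> is_eis x^*.
Proof.
move=> /is_eisP[a ->]; rewrite /ei !(conjD, conjM, conjz, w3J).
by do ?[apply: is_eisD|apply: is_eisN|apply: is_eisM]; rewrite ?is_eis1//; do ?[exact: is_eis_int|exact: is_eisw|exact: is_eis1].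
Qed.
Lemma is_eis_sum (I : Type) (s : seq I) (f : I -> C) : (forall i, is_eis (f i)) ->
  is_eis (\sum_(i <- s) f i).
Proof. by move=> h; elim/big_rec: _ => [|i x _ hx]; [exact: is_eis0|exact: is_eisD]. Qed.
End EisensteinRing.

Ltac is_eis_tac := do ?[assumption | exact: is_eis0 | exact: is_eis1 | exact: is_eisw
  | exact: is_eis_int | exact: is_eis_nat | apply: is_eisD | apply: is_eisN | apply: is_eisM | apply: is_eisJ].

(** * The invariant sum as a function of [p] and of the point *)

Section NForm.
Variable R : realType.
Local Notation C := R[i].
Local Notation w := (w3 R).
Implicit Types (z p l : 'cV[C]_4) (g : 'M[C]_4).

Lemma has_sum_extend (T U : choiceType) (phi : U -> T) (psi : T -> U) (f : T -> C) S :
  cancel phi psi -> (forall x, phi (psi x) <> x -> f x = 0) ->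
  has_sum (f \o phi) S -> has_sum f S.
Proof.
move=> k1 k2 h e e0; have [s us hs] := h e e0.
exists (map phi s); first by rewrite map_inj_uniq//; exact: can_inj k1.
move=> t ut st; pose t' := [seq x <- t | phi (psi x) == x].
have e1 : \sum_(i <- t) f i = \sum_(i <- t') f i.
  rewrite big_filter [LHS](bigID (fun x => phi (psi x) == x))/= [X in _ + X]big1 ?addr0// => x /eqP.
  exact: k2.
have e2 : map phi (map psi t') = t'.
  by rewrite -map_comp -[RHS]map_id; apply/eq_in_map => x; rewrite mem_filter => /andP[/eqP].
rewrite e1 -e2 big_map; apply: hs.
  by rewrite -(map_inj_uniq (can_inj k1)) e2 filter_uniq.
move=> x xs; apply/mapP; exists (phi x); last by rewrite k1.
by rewrite mem_filter k1 eqxx/= st// map_f.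
Qed.

Definition eisof (x : C) : eis := xget (0, 0) [set a | ei R a = x]%classic.
Lemma eisofK a : eisof (ei R a) = a.
Proof. by rewrite /eisof; case: xgetP => [b _ /ei_inj//|/(_ a) /= []]. Qed.
Lemma ei_of x : is_eis x -> ei R (eisof x) = x.
Proof. by move=> /is_eisP[a ->]; rewrite eisofK. Qed.

Definition cA z : C := z ord0 ord0 - z o1 ord0.
Definition cB z : C := - w * z ord0 ord0 + (1 + w) * z o1 ord0.

Lemma cA_cusp t a c d : cA (cusp4 t a c d) = a.
Proof. by rewrite /cA !V4E; ring. Qed.
Lemma cB_cusp t a c d : cB (cusp4 t a c d) = t.
Proof. rewrite /cB !V4E; have hw := w3_sqr R; ring: hw. Qed.
Lemma cuspK z : cusp4 (cB z) (cA z) (z o2 ord0) (z o3 ord0) = z.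
Proof. by rewrite [RHS]cusp_coordK. Qed.
Lemma cuspZ (k : C) t a c d : k *: cusp4 t a c d = cusp4 (k * t) (k * a) (k * c) (k * d).
Proof. by apply: vec4P; rewrite mxE !V4E//; ring. Qed.
Lemma cuspD (t a c d t' a' c' d' : C) :
  cusp4 t a c d + cusp4 t' a' c' d' = cusp4 (t + t') (a + a') (c + c') (d + d').
Proof. by apply: vec4P; rewrite mxE !V4E//; ring. Qed.

Lemma lat_coord l : lat l -> is_eis (cB l) /\ is_eis (cA l).
Proof. by move=> h; split; rewrite /cA /cB; is_eis_tac; exact: h. Qed.

Definition tau_ z := cB z / cA z.
(** The height of [z] above the cusp [e]: [cA z] is [h(e, z)], so this is [h(z,z) / |h(e,z)|^2]. *)
Definition hy z : R := hn z / cabs (cA z) ^+ 2.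

Lemma hn_coord z : hn z = cabs (z ord0 ord0) ^+ 2 - cabs (z o1 ord0) ^+ 2
  - cabs (z o2 ord0) ^+ 2 - cabs (z o3 ord0) ^+ 2.
Proof. by rewrite /hn hformE !cabs_sqr !ReIm; ring. Qed.

Lemma cA_neq0 z : 0 < hn z -> cA z != 0.
Proof.
move=> h; apply/eqP => /eqP; rewrite /cA subr_eq0 => /eqP e; move: h; rewrite hn_coord e.
have := sqr_ge0 (cabs (z o2 ord0)); have := sqr_ge0 (cabs (z o3 ord0)); lra.
Qed.

Lemma hy_gt0 z : 0 < hn z -> 0 < hy z.
Proof. by move=> h; rewrite divr_gt0// exprn_gt0// cabs_gt0 cA_neq0. Qed.

Definition norm4 z := cusp4 (tau_ z) 1 (z o2 ord0 / cA z) (z o3 ord0 / cA z).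
Lemma norm4E z : cA z != 0 -> z = cA z *: norm4 z.
Proof. by move=> h; rewrite cuspZ /tau_ !mulr1 ![cA z * _]mulrC !divfK// cuspK. Qed.

Lemma hnZ (k : C) z : hn (k *: z) = cabs k ^+ 2 * hn z.
Proof. by rewrite /hn hformZl hformZr mulrA [_^* * _]mulrC mulcJ ReM ReC ImC mul0r subr0. Qed.

Lemma hyE z : 0 < hn z -> (hy z)%:C = tau_ z + (tau_ z)^* -
  (z o2 ord0 / cA z) * (z o2 ord0 / cA z)^* - (z o3 ord0 / cA z) * (z o3 ord0 / cA z)^*.
Proof.
move=> h; have A0 := cA_neq0 h.
have -> : hy z = hn (norm4 z).
  by rewrite /hy {1}(norm4E A0) hnZ mulrAC divff ?mul1r// sqrf_eq0 cabs_eq0.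
by rewrite -hnE hform_cusp conj1; ring.
Qed.

Lemma NtZ (k : C) p z l : k != 0 -> Nt p (k *: z) l = Nt p z l.
Proof.
move=> k0; rewrite /Nt; case: asboolP => // _; congr cexp; congr (_ * (_ - _)).
rewrite !hformL; have k1 : k^* != 0 by rewrite -cabs_gt0 cabsJ cabs_gt0.
have [->|h0] := eqVneq (hform z z) 0; first by rewrite !mulr0 invr0 !mulr0.
by field; rewrite h0 k0 k1.
Qed.

Lemma NtP p z : 0 < hn z -> has_sum (Nt p z) (Kz (p o2 ord0) (p o3 ord0) (hy z) *
  cabs (Phi (tau_ z) (z o2 ord0 / cA z) (z o3 ord0 / cA z) (cB p) (cA p) (p o2 ord0) (p o3 ord0)) ^+ 2)%:C.
Proof.
move=> h; have A0 := cA_neq0 h.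
have H := Gt_sum (cB p) (cA p) (p o2 ord0) (p o3 ord0) (hy_gt0 h) (hyE h).
pose phi (t : T3 * eis) := cusp4 (ei R t.2) (ei R t.1.1) (ei R t.1.2.1) (ei R t.1.2.2).
pose psi (l : 'cV[C]_4) : T3 * eis := ((eisof (cA l), (eisof (l o2 ord0), eisof (l o3 ord0))), eisof (cB l)).
apply: (@has_sum_extend _ _ phi psi).
    move=> [[a [b2 b3]] M]; rewrite /phi /psi cA_cusp cB_cusp !V4E !eisofK//.
  move=> l hl; rewrite /Nt asboolF// => ll; apply: hl.
  have [h1 h2] := lat_coord ll.
  by rewrite /phi /psi/= !ei_of// cuspK.
apply: eq_has_sum H => -[[a [b2 b3]] M]; rewrite /Gt cuspK.
by rewrite /= [in RHS](norm4E A0) NtZ.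
Qed.

Lemma NN0E p z : 0 < hn z -> NN0 p z = (Kz (p o2 ord0) (p o3 ord0) (hy z) *
  cabs (Phi (tau_ z) (z o2 ord0 / cA z) (z o3 ord0 / cA z) (cB p) (cA p) (p o2 ord0) (p o3 ord0)) ^+ 2)%:C.
Proof. by move=> h; exact: csumE (NtP p h). Qed.

Lemma Kz_gt0 c d (y : R) : 0 < y -> 0 < Kz c d y :> R.
Proof.
move=> y0; have h1 := Kp_gt0 R; have h2 := sq3_gt0 R; have h3 := ss_gt0 R.
have h4 := Ks_gt0 R; have h5 := expR_gt0 (- (2 * ss R * (cabs c ^+ 2 + cabs d ^+ 2))).
have h6 : 0 < Kq y.
  rewrite /Kq; apply: divr_gt0; first by rewrite mulr_gt0// exprn_gt0.
  by apply: mulr_gt0 => //; apply: divr_gt0 => //; exact: mulr_gt0.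
by rewrite /Kz mulr_gt0// mulr_gt0// exprn_gt0.
Qed.

Lemma NN0_eq0 p z : 0 < hn z -> NN0 p z = 0 <->
  Phi (tau_ z) (z o2 ord0 / cA z) (z o3 ord0 / cA z) (cB p) (cA p) (p o2 ord0) (p o3 ord0) = 0.
Proof.
move=> h; rewrite NN0E//; split=> [|->]; last by rewrite cabs0 expr0n/= mulr0.
move=> /(congr1 (@complex.Re R)); rewrite ReC Re0 => /eqP.
by rewrite mulf_eq0 gt_eqF ?Kz_gt0 ?hy_gt0//= sqrf_eq0 cabs_eq0 => /eqP.
Qed.

Lemma lat_mul g l : (forall k j, is_eis (g k j)) -> lat l -> lat (g *m l).
Proof. by move=> hg hl k; rewrite mxE; apply: is_eis_sum => j; exact: is_eisM. Qed.
Lemma latD l p : lat l -> lat p -> lat (l + p).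
Proof. by move=> h h' k; rewrite mxE; exact: is_eisD. Qed.
Lemma latN l : lat l -> lat (- l).
Proof. by move=> h k; rewrite mxE; exact: is_eisN. Qed.

(** [g] permutes the lattice, so both families have the same values in [has_sum], and [csum] chooses
    the same one. *)
Lemma NN0_G3 g p z : G3 g -> NN0 (g *m p) (g *m z) = NN0 p z.
Proof.
move=> [g1 g2 g3 g4].
have e l : Nt (g *m p) (g *m z) (g *m l) = Nt p z l.
  rewrite /Nt !g4; congr (if _ then _ else _); apply: asbool_equiv_eq; split; last exact: lat_mul.
  by move=> /(lat_mul g3); rewrite mulKmx.
rewrite /NN0 /csum; congr xget; apply/seteqP; split => S /= h.
  have := has_sum_bij (mulKmx g2) (mulKVmx g2) h; apply: eq_has_sum => l; exact: e.
have := has_sum_bij (mulKVmx g2) (mulKmx g2) h; apply: eq_has_sum => l /=.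
by rewrite -e mulKVmx.
Qed.

Lemma hform_lat l p : lat l -> lat p -> is_eis (hform l p).
Proof. by move=> h h'; rewrite hformE; is_eis_tac; solve [exact: h | exact: h']. Qed.

(** For [a] in the lattice [a - a^*] is an integral multiple of [1 + 2 w], and
    [2 s (1 + 2 w) = 2 pi i]. *)
Lemma NN0D p q z : lat q -> NN0 (p + q) z = NN0 p z.
Proof.
move=> hq; rewrite /NN0; congr csum; apply/funext => l; rewrite /Nt; case: asboolP => // hl.
have /is_eisP[a ha] := hform_lat hl hq.
apply: (@cexp_eq _ a.1); rewrite !hformL -[hform q l]hformJ ha /ei !(conjD, conjM, conjz, w3J).
by ring.
Qed.

Lemma hn_G3 g z : G3 g -> hn (g *m z) = hn z.
Proof. by move=> [_ _ _ h]; rewrite /hn h. Qed.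

End NForm.

(** * Real inequalities for the fundamental domain *)

Section CuspGeometry.
Variable F : realFieldType.

(** Bounds the distance [a] of [tau] from the middle line of its strip: [|tau| >= 1] gives the last
    hypothesis once [Re tau <= 11/20 + m]. *)
Lemma L0 (s a m : F) : s ^+ 2 = 3 -> 173/100 <= s -> s <= 1733/1000 ->  1/64 <= m -> m <= 1/3 ->
  0 <= a -> a <= s/2 -> s * a - a^+2 <= 21/400 + 11/10 * m + m ^+2 -> a <= (2/100 + 5/10/100)+(1 + 12/100 + 1/10/100) * m.
Proof.
move=> s2 s1 s1' m0 m1 a0 a1 h; case: lerP => // h1.
have [A e] : exists A, A = (2/100 + 5/10/100)+(1 + 12/100 + 1/10/100) * m by eexists.
rewrite -e in h1.
have : s * A - A ^+2 < s * a - a ^+ 2 by nra.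
have : 21/400 + 11/10 * m + m ^+2 <= 173/100 * A - A^+2 by rewrite e; nra.
nra.
Qed.
Lemma sq2_lt1 (X Y X' Y' : F) : 0 <= X <= X' -> 0 <= Y <= Y' -> X' ^+ 2 + Y' ^+ 2 < 1 -> X ^+ 2 + Y ^+ 2 < 1.
Proof.
move=> /andP[x0 x1] /andP[y0 y1]; apply: le_lt_trans.
by apply: lerD; rewrite ler_pXn2r// nnegrE (le_trans _ x1, le_trans _ y1).
Qed.
(** [L1] to [L2] bound the circle conditions of [L_real] by functions of [x] alone, one for each
    case. On [[0.108, 1/2]] the parabola [x^2] lies below its chord [0.608 x - 0.054], which leaves
    quadratic inequalities. *)
Lemma L1 (x : F) : (10/100 + 8/10/100) <= x -> x <= 1/2 ->
 ((2/100 + 5/10/100)+(1 + 28/100 + 1/10/100) * x ^+ 2 + (37/100 + 6/10/100) * x) ^+ 2 + (105/100+(1 + 14/100 + 2/10/100) * x ^+ 2 -x) ^+ 2 < 1.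
Proof.
move=> h1 h2; have q : x ^+2 <= (60/100 + 8/10/100) * x - (5/100 + 4/10/100) by nra.
have q0 := sqr_ge0 x.
apply: (@sq2_lt1 _ _ ((2/100 + 5/10/100)+(1 + 28/100 + 1/10/100) * ((60/100 + 8/10/100) * x - (5/100 + 4/10/100)) + (37/100 + 6/10/100) * x) (105/100+(1 + 14/100 + 2/10/100) * ((60/100 + 8/10/100) * x - (5/100 + 4/10/100)) -x)).
  apply/andP; split; lra.
  apply/andP; split; lra.
nra.
Qed.
Lemma L1b (x : F) : (10/100 + 8/10/100) <= x -> x <= 1/2 ->
 ((2/100 + 5/10/100)+(1 + 49/100 + 6/10/100) * x ^+ 2 ) ^+ 2 + (105/100+(1 + 33/100 + 4/10/100) * x ^+ 2 -x) ^+ 2 < 1.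
Proof.
move=> h1 h2; have q : x ^+2 <= (60/100 + 8/10/100) * x - (5/100 + 4/10/100) by nra.
have q0 := sqr_ge0 x.
apply: (@sq2_lt1 _ _ ((2/100 + 5/10/100)+(1 + 49/100 + 6/10/100) * ((60/100 + 8/10/100) * x - (5/100 + 4/10/100))) (105/100+(1 + 33/100 + 4/10/100) * ((60/100 + 8/10/100) * x - (5/100 + 4/10/100)) -x)).
  apply/andP; split; lra.
  apply/andP; split; lra.
nra.
Qed.
Lemma L1c (x : F) : (10/100 + 8/10/100) <= x -> x <= 1/2 ->
 ((57/100 + 9/10/100) * x) ^+ 2 + (105/100+(1 + 33/100 + 4/10/100) * x ^+ 2 -x) ^+ 2 < 1.
Proof.
move=> h1 h2; have q : x ^+2 <= (60/100 + 8/10/100) * x - (5/100 + 4/10/100) by nra.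
have q0 := sqr_ge0 x.
apply: (@sq2_lt1 _ _ ((57/100 + 9/10/100) * x) (105/100+(1 + 33/100 + 4/10/100) * ((60/100 + 8/10/100) * x - (5/100 + 4/10/100)) -x)).
  apply/andP; split; lra.
  apply/andP; split; lra.
nra.
Qed.
Lemma L2 (x : F) : (10/100 + 8/10/100) <= x -> x <= 1/2 ->
 ((67/100 + 9/10/100) * x) ^+ 2  + (105/100+(1 + 14/100 + 2/10/100) * x ^+ 2 -(82/100 + 5/10/100) * x) ^+ 2 < 1.
Proof.
move=> h1 h2; have q : x ^+2 <= (60/100 + 8/10/100) * x - (5/100 + 4/10/100) by nra.
have q0 := sqr_ge0 x.
apply: (@sq2_lt1 _ _ ((67/100 + 9/10/100) * x) (105/100+(1 + 14/100 + 2/10/100) * ((60/100 + 8/10/100) * x - (5/100 + 4/10/100)) -(82/100 + 5/10/100) * x)).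
  apply/andP; split; lra.
  apply/andP; split; lra.
nra.
Qed.
Lemma sq_between (a lo hi : F) : lo <= a -> a <= hi -> 0 <= hi -> - hi <= lo -> a ^+ 2 <= hi ^+ 2.
Proof. by move=> *; nra. Qed.

Lemma sq3_mul_le (s J : F) : 173/100 <= s -> J <= 0 \/ 173/100 * J <= s * J.
Proof. by move=> h; have [?|?] := lerP J 0; [left|right; rewrite ler_wpM2r// ltW]. Qed.

Lemma L_gap (s x J : F) : s ^+ 2 = 3 -> 0 <= x -> x <= 1/2 -> 65/100 * x <= s * J -> s * J <= x ->
  x ^+ 2 + J ^+ 2 - (x + s * J) / 2 <= (1 + 14/100 + 2/10/100) * x ^+ 2 - (82/100 + 5/10/100) * x.
Proof.
move=> s2 x0 x1 h1 h2; have -> : J ^+ 2 = (s * J) ^+ 2 / 3 by rewrite exprMn s2; field.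
move: (s * J) h1 h2 => v h1 h2; have := sqr_ge0 x.
have : 0 <= (v - 65/100 * x) * (1/2 - (v + 65/100 * x) / 3) by rewrite mulr_ge0//; lra.
by lra.
Qed.

Lemma L_real (s x J a T m n : F) : s ^+ 2 = 3 -> 173/100 <= s -> s <= 1733/1000 -> m = x^+2 + J^+2 ->
  1/64 <= m -> 0 <= a -> a <= s/2 -> x <= 1/2 -> - x <= s * J -> s * J <= x ->
  1/2 <= T -> n <= 2 * m -> 2 * T - n < 11/10 ->
  1 <= T^+2 + (s/2 - a)^+2 -> 1 <= (T + 1/2 - x)^+2 + (a + J)^+2 ->
  1 <= (T + 1/2 - (x + s * J)/2)^+2 + (a + (J - s * x)/2)^+2 -> False.
Proof.
move=> s2 s1 s1' e m0 a0 a1 x1 J0 J1 T0 nm yT c0 c1 c2.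
have T1 : T <= 11/20 + m by clear - nm yT; lra.
have x0 : 0 <= x by clear - J0 J1; lra.
have J2 : J ^+ 2 <= x ^+ 2 / 3.
  have : (s * J) ^+ 2 <= x ^+ 2 by clear - J0 J1; nra.
  by rewrite exprMn s2; clear; lra.
(* As [m <= 4/3 x^2], the bound [m >= 1/64] forces [x^2 >= 3/256]. *)
have x2 : (10/100 + 8/10/100) <= x by clear - x0 e J2 m0; nra.
have m1 : m <= 1/3 by clear - x0 x1 e J2; nra.
have aA : a <= (2/100 + 5/10/100)+(1 + 12/100 + 1/10/100) * m.
  apply: (L0 s2 s1 s1' m0 m1 a0 a1).
  have : T ^+ 2 <= (11/20 + m) ^+ 2 by clear - T0 T1; nra.
  have : (s / 2 - a) ^+ 2 = 3/4 - s * a + a^+2 by rewrite -s2; field.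
  nra.
have Jlo : - ((57/100 + 9/10/100) * x) <= J.
  by clear - J0 s1 x0; have [h|] := sq3_mul_le (- J) s1; rewrite ?mulrN; lra.
have ax := sqr_ge0 x; clear c0 nm yT a1 m0 m1.
(* Up to this slope the circle [c1] of the nearest unit gives the contradiction, beyond it the
   circle [c2] of the neighbouring unit. *)
have [hJ|hJ] := lerP (s * J) (65/100 * x).
  have Jx : J <= (37/100 + 6/10/100) * x by clear - hJ s1 x0; have [h|h] := sq3_mul_le J s1; lra.
  have [J00|J00] := lerP 0 J.
    have JJ : J ^+ 2 <= ((37/100 + 6/10/100) * x) ^+ 2 by clear - Jx x0 J00; rewrite ler_pXn2r// nnegrE; lra.
    have mx : m <= (1 + 14/100 + 2/10/100) * x ^+ 2 by clear - JJ e ax; move: JJ; rewrite exprMn; lra.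
    have := L1 x2 x1; apply/negP; rewrite -leNgt; apply: le_trans c1 _; rewrite addrC lerD//.
      by clear - aA mx Jx a0 x0 ax J00; rewrite ler_pXn2r// ?nnegrE; lra.
    by clear - mx T0 T1 x1 x0 ax; rewrite ler_pXn2r// ?nnegrE; lra.
  have mx : m <= (1 + 33/100 + 4/10/100) * x ^+ 2 by clear - e J2 ax; lra.
  have [aJ|aJ] := lerP (a + J) 0.
    have := L1c x2 x1; apply/negP; rewrite -leNgt; apply: le_trans c1 _; rewrite addrC lerD//.
      by clear - Jlo a0 x0 aJ; apply: (@sq_between _ (- ((57/100 + 9/10/100) * x))); lra.
    by clear - mx T0 T1 x1 x0 ax; rewrite ler_pXn2r// ?nnegrE; lra.
  have := L1b x2 x1; apply/negP; rewrite -leNgt; apply: le_trans c1 _; rewrite addrC lerD//.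
    by clear - aA mx J00 aJ x0 ax; rewrite ler_pXn2r// ?nnegrE; lra.
  by clear - mx T0 T1 x1 x0 ax; rewrite ler_pXn2r// ?nnegrE; lra.
have sx : s * x <= 1733/1000 * x by rewrite ler_wpM2r.
have sx' : 173/100 * x <= s * x by rewrite ler_wpM2r.
have Jx' : (37/100 + 5/10/100) * x <= J.
  have J0' : 0 <= J by rewrite -(@pmulr_rge0 _ s); clear - s1 hJ x0; lra.
  by have := ler_wpM2r J0' s1'; clear - hJ x0; lra.
have gb := L_gap s2 x0 x1 (ltW hJ) J1.
have := L2 x2 x1; apply/negP; rewrite -leNgt; apply: le_trans c2 _; rewrite addrC lerD//.
  have q : x ^+2 <= (60/100 + 8/10/100) * x - (5/100 + 4/10/100) by clear - x1 x2; nra.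
  have Ju : J <= (57/100 + 9/10/100) * x by clear -J1 s1 x0; have [h|h] := sq3_mul_le J s1; lra.
  by apply: (@sq_between _ (- ((67/100 + 9/10/100) * x))); [clear - a0 Jx' sx|clear - aA e J2 q Ju sx' x0|clear - x0|clear - x0]; lra.
by clear - gb T0 T1 e J1 x1 x0; rewrite ler_pXn2r// ?nnegrE; lra.
Qed.

End CuspGeometry.

(** * Sums of real families *)

Section RealSums.
Variable R : realType.
Local Notation C := R[i].

Definition rsum (T : choiceType) (g : T -> R) (S : R) := has_sum (fun i => (g i)%:C) (S%:C : C).

Section Gen.
Variable T : choiceType.
Implicit Types (g h : T -> R) (S M : R).

Lemma rsum_approx g S : rsum g S -> forall e, 0 < e -> exists2 s0 : seq T, uniq s0 &
  forall s, uniq s -> {subset s0 <= s} -> `|\sum_(i <- s) g i - S| <= e.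
Proof.
move=> h e e0; have [s us hs] := h e e0; exists s => // t ut st.
by have := hs t ut st; rewrite -rmorph_sum -rmorphB cabsC.
Qed.

Lemma rsum_le_bsum g S M : rsum g S -> bsum g M -> S <= M.
Proof.
move=> /rsum_approx h b; apply/ler_addgt0Pr => e /h[s us hs].
by have := hs s us (fun x xs => xs); have := b s us; rewrite ler_norml => ? /andP[? ?]; lra.
Qed.

Lemma rsum_ge g S (s : seq T) : (forall i, 0 <= g i) -> rsum g S -> uniq s -> \sum_(i <- s) g i <= S.
Proof.
move=> g0 /rsum_approx h us; apply/ler_addgt0Pr => e /h[s0 us0 hs].
have := hs (undup (s0 ++ s)) (undup_uniq _); rewrite ler_norml => H.
have /andP[? ?] := H (fun x xs => ltac:(by rewrite mem_undup mem_cat xs)).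
have : \sum_(i <- s) g i <= \sum_(i <- undup (s0 ++ s)) g i.
  by apply: ler_sum_subset; rewrite ?undup_uniq// => x xs; rewrite mem_undup mem_cat xs orbT.
lra.
Qed.

Lemma rsum_ge0 g S : (forall i, 0 <= g i) -> rsum g S -> 0 <= S.
Proof. by move=> g0 h; have := rsum_ge g0 h (isT : uniq [::]); rewrite big_nil. Qed.

Lemma rsumD g h S S' : rsum g S -> rsum h S' -> rsum (fun i => g i + h i) (S + S').
Proof. by move=> a b; have := has_sumD a b; rewrite -CD; apply: eq_has_sum => i; rewrite CD. Qed.
Lemma rsumZ g S c : rsum g S -> rsum (fun i => c * g i) (c * S).
Proof. by move=> a; have := has_sumZ c%:C a; rewrite -CM; apply: eq_has_sum => i; rewrite CM. Qed.
Lemma rsumB g h S S' : rsum g S -> rsum h S' -> rsum (fun i => g i - h i) (S - S').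
Proof.
move=> a b; have := rsumD a (rsumZ (-1) b); rewrite mulN1r.
by apply: eq_has_sum => i; rewrite mulN1r.
Qed.
Lemma eq_rsum g h S : g =1 h -> rsum g S -> rsum h S.
Proof. by move=> /funext ->. Qed.
Lemma rsum_le g h S S' : (forall i, g i <= h i) -> rsum g S -> rsum h S' -> S <= S'.
Proof.
move=> le a b; rewrite -subr_ge0; apply: rsum_ge0 (rsumB b a) => i.
by rewrite subr_ge0.
Qed.
Lemma rsum_ex g M : (forall i, 0 <= g i) -> bsum g M -> exists S, rsum g S.
Proof.
move=> g0 b; have [S h] := has_sum_real g0 b; exists (Re S).
rewrite /rsum (_ : (Re S)%:C = S)//; apply: complexP; rewrite ?ReC ?ImC//; have := has_sumJ h.
rewrite (_ : (fun i => ((g i)%:C)^*) = (fun i => (g i)%:C)); last by apply/funext => i; rewrite conjR.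
by move=> /(has_sum_unique h)/(congr1 (@complex.Im R)); rewrite ImJ; lra.
Qed.
Lemma rsum_off g S (s : seq T) : uniq s -> rsum g S ->
  rsum (fun i => if i \in s then 0 else g i) (S - \sum_(i <- s) g i).
Proof.
move=> us h; have := has_sum_off us h; rewrite -rmorph_sum -rmorphB.
by apply: eq_has_sum => i; case: ifP.
Qed.
Lemma rsum_abs g S M : rsum g S -> bsum (fun i => `|g i|) M -> `|S| <= M.
Proof.
move=> h b; rewrite -cabsC; apply: has_sum_bound h _.
by under eq_fun do rewrite cabsC.
Qed.
Lemma bsum_off g M (s : seq T) : (forall i, 0 <= g i) -> uniq s -> bsum g M ->
  bsum (fun i => if i \in s then 0 else g i) (M - \sum_(i <- s) g i).
Proof.
move=> g0 us b t ut.
have -> : \sum_(i <- t) (if i \in s then 0 else g i) = \sum_(i <- [seq x <- t | x \notin s]) g i.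
  by rewrite big_filter [RHS]big_mkcond; apply: eq_bigr => i _; case: (i \in s).
rewrite lerBrDl -big_cat; apply: b; rewrite cat_uniq us filter_uniq// andbT.
by apply/hasPn => x; rewrite mem_filter => /andP[].
Qed.
End Gen.

Lemma rsum_inj (T U : choiceType) (phi : U -> T) (psi : T -> U) (g : T -> R) S :
  cancel phi psi -> (forall x, phi (psi x) <> x -> g x = 0) -> rsum g S -> rsum (g \o phi) S.
Proof.
move=> k h r; have := has_sum_inj (psi := psi) k _ r.
by apply=> x /h ->.
Qed.

End RealSums.

(** * Sums over Eisenstein integers by their norm *)

Section NormSums.
Variable R : realType.
Implicit Types (b : eis).

Definition nb b : nat := absz (en b).
Lemma nbE b : (nb b)%:Z = en b. Proof. by rewrite /nb gez0_abs// /en; nia. Qed.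
Lemma nbR b : (nb b)%:R = (en b)%:~R :> R. Proof. by rewrite -nbE. Qed.

(** Multiplication by the primitive sixth root of unity [1 + w]. *)
Definition rot b : eis := (b.2, b.2 - b.1).
Lemma en_rot b : en (rot b) = en b. Proof. by rewrite /en /rot/=; ring. Qed.
Definition rotV b : eis := (b.1 - b.2, b.1).
Lemma rotK : cancel rot rotV. Proof. by case=> x y; rewrite /rot /rotV/=; congr pair; ring. Qed.
Lemma rotVK : cancel rotV rot. Proof. by case=> x y; rewrite /rot /rotV/=; congr pair; ring. Qed.

(** Coordinates [(p.1 + 1) * 1 + p.2 * (1 + w)] on a sector of 60 degrees that contains only one of
    its two sides; its rotations cover the nonzero integers. *)
Definition sec (p : nat * nat) : eis := (p.2%:Z, p.1%:Z + 1 + p.2%:Z).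
Definition secN (p : nat * nat) : nat := ((p.1).+1 ^ 2 + (p.1).+1 * p.2 + p.2 ^ 2)%N.
Lemma nb_sec p : nb (sec p) = secN p.
Proof. by apply/eqP; rewrite -eqz_nat nbE /en /sec /secN/=; apply/eqP; lia. Qed.

Lemma sector_cover b : b != (0, 0) -> exists k : 'I_6, exists p, b = iter k rot (sec p).
Proof.
have P k : (k < 6)%N -> 0 <= (iter k rotV b).1 < (iter k rotV b).2 ->
    exists k : 'I_6, exists p, b = iter k rot (sec p).
  move=> k6 /andP[h1 h2]; exists (Ordinal k6); set c := iter k rotV b in h1 h2.
  exists (absz (c.2 - c.1 - 1)%R, absz c.1).
  have -> : sec (absz (c.2 - c.1 - 1)%R, absz c.1) = c.
    by rewrite /sec/= [RHS]surjective_pairing; congr pair; lia.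
  by rewrite /c /=; elim: (k) => // n ih; rewrite iterSr iterS rotVK.
case: b P => x y P; rewrite xpair_eqE negb_and => h.
have := P 0%N isT; have := P 1%N isT; have := P 2%N isT; have := P 3%N isT; have := P 4%N isT;
  have := P 5%N isT; rewrite /= /rotV/=; move=> P5 P4 P3 P2 P1 P0.
have [h0|h0] := boolP (0 <= x < y); first exact: P0.
have [h1|h1] := boolP (0 <= x - y < x); first exact: P1.
have [h2|h2] := boolP (0 <= x - y - x < x - y); first exact: P2.
have [h3|h3] := boolP (0 <= x - y - x - (x - y) < x - y - x); first exact: P3.
have [h4|h4] := boolP (0 <= x - y - x - (x - y) - (x - y - x) < x - y - x - (x - y)); first exact: P4.
apply: P5; lia.
Qed.

Lemma bsum_sector (G : nat -> R) M : (forall n, 0 <= G n) -> G 0%N = 0 ->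
  bsum (fun p => G (secN p)) M -> bsum (fun b => G (nb b)) (6 * M).
Proof.
move=> G0 G00 h s us.
pose A (k : 'I_6) b := (0 <= (iter k rotV b).1) && ((iter k rotV b).1 < (iter k rotV b).2).
have rotVi k p : iter k rotV (iter k rot (sec p)) = sec p.
  by elim: k => // k ih; rewrite iterSr iterS rotK ih.
have nbi k b : nb (iter k rot b) = nb b by elim: k => //= k ih; rewrite /nb en_rot -/(nb _) ih.
have rotVKi k b : iter k rot (iter k rotV b) = b.
  by elim: k => // k ih; rewrite iterSr iterS rotVK.
apply: (@le_trans _ _ (\sum_(b <- s) \sum_(k < 6 | A k b) G (nb b))).
  apply: ler_sum => b _; have [->|b0] := eqVneq b (0, 0); first by rewrite G00 sumr_ge0// => ? _; rewrite G00.
  have [k [p e]] := sector_cover b0.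
  have Ak : A k b by rewrite /A e rotVi /sec/=; lia.
  by rewrite (bigD1 k)//= lerDl sumr_ge0// => ? _; exact: G0.
rewrite (exchange_big_dep xpredT)//=.
have -> : 6 * M = \sum_(k < 6) M by rewrite sumr_const card_ord mulr_natl.
apply: ler_sum => k _.
pose f b : nat * nat := (absz ((iter k rotV b).2 - (iter k rotV b).1 - 1)%R, absz (iter k rotV b).1).
have fK b : A k b -> sec (f b) = iter k rotV b.
  by move=> /andP[h1 h2]; rewrite /sec /f/= [RHS]surjective_pairing; congr pair; lia.
rewrite -big_filter; apply: (@le_trans _ _ (\sum_(p <- map f [seq b <- s | A k b]) G (secN p))).
  rewrite big_map big_seq [leRHS]big_seq; apply: ler_sum => b; rewrite mem_filter => /andP[Ab _].
  rewrite -nb_sec fK// -[X in G (nb X)](rotVKi k b) nbi//.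
apply: h; rewrite map_inj_in_uniq ?filter_uniq// => b b'; rewrite !mem_filter => /andP[h1 _] /andP[h2 _].
by move=> /(congr1 sec); rewrite !fK// => /(congr1 (iter k rot)); rewrite !rotVKi.
Qed.

(** This linear bound replaces sums over norms by the double geometric series of [bsum_pow2]. *)
Lemma secN_ge p : (1 + 3 * p.1 + 2 * p.2 <= secN p)%N.
Proof. by case: p => j i; rewrite /secN/=; nia. Qed.

Lemma bsum_pow2 (r : R) : 0 <= r -> r < 1 -> bsum (fun p : nat * nat => r ^+ (3 * p.1 + 2 * p.2))
  (((1 - r ^+ 3) * (1 - r ^+ 2))^-1).
Proof.
move=> r0 r1; rewrite invfM.
have h3 : 0 <= r ^+ 3 < 1 by rewrite exprn_ge0//= exprn_ilt1.
have h2 : 0 <= r ^+ 2 < 1 by rewrite exprn_ge0//= exprn_ilt1.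
have := @bsum_prodM _ _ _ (fun n => (r ^+ 3) ^+ n) (fun n => (r ^+ 2) ^+ n) _ _ _ _ (bsum_geometric h3) (bsum_geometric h2).
move=> H; apply: bsum_le (H _ _) => [p|n|n]; rewrite ?exprn_ge0//.
by rewrite -!exprM exprD.
Qed.

End NormSums.

(** * The Fourier series of [rho] and the value of [q0] *)

Section RhoBounds.
Variable R : realType.
Local Notation C := R[i].
Local Notation s_ := ((ss R)%:C : C).
Implicit Types (x y : C) (b a : eis).

Definition q0 : R := locked (expR (- ss R)).
Lemma q0E : q0 = expR (- ss R). Proof. by rewrite /q0 -lock. Qed.
Lemma q0_gt0 : 0 < q0. Proof. by rewrite q0E expR_gt0. Qed.
Lemma q0_ge0 : 0 <= q0. Proof. exact: ltW q0_gt0. Qed.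
Lemma q0X n : q0 ^+ n = expR (- ss R * n%:R).
Proof. by rewrite q0E -expRM_natl mulrC. Qed.
Lemma q0_lt1 : q0 < 1. Proof. by rewrite q0E expR_lt1 oppr_lt0 ss_gt0. Qed.

Definition ph x b : R := 4 * ss R * Im ((ei R b)^* * x).
Definition rr x b : R := (-1) ^+ nb b * q0 ^+ nb b * cos (ph x b).

Lemma sgnE b : sgn R b = ((-1) ^+ nb b)%:C.
Proof.
rewrite /sgn -nbE -pmulrn mulr_natr cexpMn -piIE cexp_piI.
by rewrite CX CN C1.
Qed.

Lemma Re_cexpI (a : R) : Re (cexp (iu R * a%:C)) = cos a.
Proof.
have [h1 h2] : Re (iu R * a%:C) = 0 /\ Im (iu R * a%:C) = a by rewrite !ReIm; split; ring.
by rewrite /cexp h1 h2 /= expR0 mul1r.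
Qed.

Lemma rt_Re x b : Re (rt x b) = rr x b.
Proof.
rewrite /rt sgnE ReM ReC ImC mul0r subr0 /rr -[RHS]mulrA; congr (_ * _).
have -> : 2 * s_ * (- ((en b)%:~R / 2) + ((ei R b)^* * x - ei R b * x^*)) =
   (- ss R * (nb b)%:R)%:C + iu R * (ph x b)%:C.
  rewrite (nbR R) /ph; move: (ei R b) => e.
  have -> : (en b)%:~R / 2 = ((en b)%:~R / 2)%:C :> C by rewrite CM CV Cint Cnat.
  by apply: complexP; rewrite !ReIm; field.
by rewrite cexpD cexpR ReM ReC ImC mul0r subr0 -q0X Re_cexpI.
Qed.

Lemma rho_rsum x : rsum (rr x) (rho x).
Proof.
have h := has_sumZ (2^-1) (has_sumD (rho_sum x) (has_sumJ (rho_sum x))).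
have e (z : C) : 2^-1 * (z + z^*) = (Re z)%:C.
  have -> : z + z^* = 2 * (Re z)%:C by apply: complexP; rewrite !ReIm; ring.
  by rewrite mulKf// pnatr_eq0.
by move: h; rewrite e ReC; apply: eq_has_sum => b; rewrite e rt_Re.
Qed.

Lemma rr_le x b : `|rr x b| <= q0 ^+ nb b.
Proof.
rewrite /rr !normrM normrX normrN1 expr1n mul1r (ger0_norm (exprn_ge0 _ q0_ge0)).
by rewrite ler_piMr ?exprn_ge0 ?q0_ge0// ler_norml cos_geN1 cos_le1.
Qed.

(** The elements of norm 1, and in [W6] those of norm 3; the norm 2 does not occur. *)
Definition U6 : seq eis := [:: (0, 1); (0, -1); (1, 0); (-1, 0); (1, 1); (-1, -1)].
Definition W6 : seq eis := [:: (-1, 1); (1, -1); (1, 2); (-1, -2); (2, 1); (-2, -1)].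

Lemma small_range (n : int) : n ^+ 2 <= 5 -> n \in [:: -2; -1; 0; 1; 2].
Proof.
move=> h; have : - 2 <= n <= 2 by nia.
by rewrite !inE; lia.
Qed.

Lemma nb_small b : (nb b < 4)%N -> b \in (0, 0) :: U6 ++ W6.
Proof.
rewrite -ltz_nat nbE => h; have [x2 y2] : b.1 ^+ 2 <= 5 /\ b.2 ^+ 2 <= 5.
  have e1 : 4 * en b = (2 * b.2 - b.1) ^+ 2 + 3 * b.1 ^+ 2 by rewrite /en; ring.
  have e2 : 4 * en b = (2 * b.1 - b.2) ^+ 2 + 3 * b.2 ^+ 2 by rewrite /en; ring.
  have := sqr_ge0 (2 * b.1 - b.2); have := sqr_ge0 (2 * b.2 - b.1).
  by clear - e1 e2 h; split; lia.
pose rg : seq int := [:: -2; -1; 0; 1; 2].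
have H : all (fun x : int => all (fun y : int => (en (x, y) < 4%Z) ==> ((x, y) \in (0, 0) :: U6 ++ W6)) rg) rg.
  by vm_compute.
case: b h x2 y2 => x y h /small_range x2 /small_range y2.
by have /allP/(_ y y2)/implyP/(_ h) := allP H x x2.
Qed.

(** [tl] bounds the terms of norm at least 4 and [tl1] those of norm at least 3. The subtracted [1]
    and [r^2] belong to the sector points of norm 1 and 3 in the geometric majorant. *)
Definition tl (r : R) : R := 6 * r * (((1 - r ^+ 3) * (1 - r ^+ 2))^-1 - 1 - r ^+ 2).
Definition tl1 (r : R) : R := 6 * r * (((1 - r ^+ 3) * (1 - r ^+ 2))^-1 - 1).

Implicit Types (r : R).

Lemma bsum_norm_tail r n0 (s : seq (nat * nat)) : (0 < n0)%N -> 0 <= r -> r < 1 -> uniq s ->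
  (forall p, p \in s -> (secN p < n0)%N) ->
  bsum (fun b => if (nb b < n0)%N then 0 else r ^+ nb b)
    (6 * (r * (((1 - r ^+ 3) * (1 - r ^+ 2))^-1 - \sum_(p <- s) r ^+ (3 * p.1 + 2 * p.2)))).
Proof.
move=> n00 r0 r1 us hs.
apply: (@bsum_sector _ (fun n => if (n < n0)%N then 0 else r ^+ n)) => [n|/=|].
    by case: ifP => // _; rewrite exprn_ge0.
  by rewrite n00.
have e0 : forall p : nat * nat, 0 <= r ^+ (3 * p.1 + 2 * p.2) by move=> p; rewrite exprn_ge0.
apply: bsum_le (bsumZ r0 (bsum_off e0 us (bsum_pow2 r0 r1))) => p.
case: (boolP (p \in s)) => [/hs->|_]; first by rewrite mulr0.
case: ifP => _; first by rewrite mulr_ge0.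
by rewrite -exprS ler_wiXn2l// ?(ltW r1)//; have := secN_ge p; lia.
Qed.

Lemma bsum_tl r : 0 <= r -> r < 1 -> bsum (fun b => if (nb b < 4)%N then 0 else r ^+ nb b) (tl r).
Proof.
move=> r0 r1; have := @bsum_norm_tail r 4 [:: (0, 0); (0, 1)]%N isT r0 r1 isT.
rewrite !big_cons big_nil /= expr0 addr0 => H; have {}H := H _.
rewrite (_ : tl r = 6 * (r * (((1 - r ^+ 3) * (1 - r ^+ 2))^-1 - (1 + r ^+ 2)))); first apply: H.
  by move=> p; rewrite !inE => /orP[]/eqP->.
by rewrite /tl; move: (_^-1) => v; ring.
Qed.

Lemma bsum_tl1 r : 0 <= r -> r < 1 -> bsum (fun b => if (nb b < 3)%N then 0 else r ^+ nb b) (tl1 r).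
Proof.
move=> r0 r1; have := @bsum_norm_tail r 3 [:: (0, 0)]%N isT r0 r1 isT.
rewrite !big_cons big_nil /= expr0 addr0 => H; have {}H := H _.
rewrite (_ : tl1 r = 6 * (r * (((1 - r ^+ 3) * (1 - r ^+ 2))^-1 - 1))); first apply: H.
  by move=> p; rewrite !inE => /eqP->.
by rewrite /tl1; move: (_^-1) => v; ring.
Qed.

Lemma rho0 : rho (0 : C) = 0.
Proof. by apply/eqP; rewrite rho_eq0 sg0. Qed.

Lemma ph0 b : ph 0 b = 0. Proof. by rewrite /ph mulr0 Im0 mulr0. Qed.

(** At 0 all cosines are 1 and [rho 0 = 0], as [sg] is odd. The remaining equation is what gives
    access to the numerical value of [exp(- pi / sqrt 3)]. *)
Lemma q0_eq : `|1 - 6 * q0 - 6 * q0 ^+ 3| <= tl q0.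
Proof.
have h := rsum_off (s := (0, 0) :: U6 ++ W6) isT (rho_rsum 0).
have e : 1 - 6 * q0 - 6 * q0 ^+ 3 = \sum_(b <- (0, 0) :: U6 ++ W6) rr 0 b.
  rewrite /U6 /W6 /= !big_cons big_nil /rr !ph0 cos0 /nb /en/=; ring.
rewrite rho0 sub0r -e in h; rewrite -normrN; apply: rsum_abs h _.
apply: bsum_le (bsum_tl q0_ge0 q0_lt1) => b; case: ifP => [_|/negP hb].
  by rewrite normr0; case: ifP => // _; rewrite exprn_ge0 ?q0_ge0.
case: ifP => [/nb_small//|_]; exact: rr_le.
Qed.

Lemma sq3_bounds : 173/100 <= sq3 R /\ sq3 R <= 1733/1000.
Proof.
have h := sq3_sqr R; have h0 := sq3_gt0 R.
by move: (sq3 R) h h0 => t h h0; split; nra.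
Qed.

Lemma q0_lt : q0 < 2/5.
Proof.
have [h1 h2] := sq3_bounds; have h0 := sq3_gt0 R.
have hs : 115/100 <= ss R.
  rewrite -(@ler_pM2r _ (sq3 R))// -pi_ss; have := pi_ge2 R; nra.
have e1 : q0 = (expR (ss R / 4) ^+ 4)^-1.
  by rewrite -expRM_natl q0E expRN; congr (expR _)^-1; field.
have e2 : 1287 / 1000 <= expR (ss R / 4) by have := expR_ge1Dx (ss R / 4); lra.
rewrite e1; move: (expR _) e2 => E e2; have e3 : 165/100 <= E ^+ 2 by nra.
have e4 : 25/10 < E ^+ 4 by rewrite (exprM E 2 2); nra.
rewrite -[ltRHS]invrK ltf_pV2 ?posrE//; lra.
Qed.

Lemma tl_le r (u c3 c2 v : R) : 0 <= r -> r <= u -> u ^+ 3 <= c3 -> u ^+ 2 <= c2 -> c3 < 1 -> c2 < 1 ->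
  1 <= v * ((1 - c3) * (1 - c2)) -> tl1 r <= 6 * u * (v - 1) /\ tl r <= 6 * u * (v - 1) - 6 * r ^+ 3.
Proof.
move=> r0 ru h3 h2 k3 k2 hv.
have r3 : r ^+ 3 <= c3 by apply: le_trans h3; rewrite ler_pXn2r// nnegrE (le_trans r0).
have r2 : r ^+ 2 <= c2 by apply: le_trans h2; rewrite ler_pXn2r// nnegrE (le_trans r0).
have p3 : 0 <= r ^+ 3 := exprn_ge0 _ r0; have p2 : 0 <= r ^+ 2 := exprn_ge0 _ r0.
have V : ((1 - r ^+ 3) * (1 - r ^+ 2))^-1 <= v.
  have g3 : 0 < 1 - c3 by lra.
  have g2 : 0 < 1 - c2 by lra.
  have v0 : 0 < v by rewrite -(pmulr_lgt0 v (mulr_gt0 g3 g2)); lra.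
  rewrite -[leLHS]mul1r ler_pdivrMr; last by apply: mulr_gt0; lra.
  apply: le_trans hv _; rewrite ler_wpM2l ?(ltW v0)//; apply: ler_pM; lra.
have u0 : 0 <= u by lra.
have V1 : 1 <= ((1 - r ^+ 3) * (1 - r ^+ 2))^-1.
  rewrite -[leLHS]invr1 lef_pV2 ?posrE//; last by apply: mulr_gt0; lra.
  by rewrite -[leRHS]mulr1; apply: ler_pM; lra.
have T1 : tl1 r <= 6 * u * (v - 1).
  rewrite /tl1; move: (_^-1) V V1 => V hV V1; apply: ler_pM; try lra.
split=> //; rewrite /tl; move: T1; rewrite /tl1; move: (_^-1) => W; lra.
Qed.

(** Each upper bound of [q0] shrinks the tail in [q0_eq], and the smaller tail improves the bound:
    0.4, 0.25, 0.18, 0.166, 0.164. *)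
Lemma q0_small : q0 < 164/1000 /\ 161/1000 < q0.
Proof.
have := q0_eq; rewrite ler_norml => /andP[hl hu].
have q := q0_ge0; have q4 := q0_lt.
have [] := @tl_le q0 (2/5) (8/125) (4/25) (159/125) q (ltW q4); try lra.
move=> _ t1; have q1 : q0 < 1/4 by move: t1 hl q; clear; move: (tl q0) q0 => T x *; nra.
have [] := @tl_le q0 (1/4) (2/125) (6/100 + 3/10/100) (217/200) q (ltW q1); try lra.
move=> _ t2; have q2 : q0 < 9/50 by move: t2 hl q1 q; clear; move: (tl q0) q0 => T x *; nra.
have [] := @tl_le q0 (9/50) (3/5/100) (3/100 + 3/10/100) (1 + 4/100 + 1/10/100) q (ltW q2); try lra.
move=> _ t3; have q3 : q0 < 16/100 + 6/10/100 by move: t3 hl q2 q; clear; move: (tl q0) q0 => T x *; nra.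
have [] := @tl_le q0 (16/100 + 6/10/100) (1/200) (2/100 + 8/10/100) (1 + 3/100 + 4/10/100) q (ltW q3); try lra.
move=> _ t4; split.
  by move: t4 hl q3 q; clear; move: (tl q0) q0 => T x *; nra.
by move: t4 hu; clear; move: (tl q0) q0 => T x *; lra.
Qed.

End RhoBounds.

(** * Comparison between values of [rho] *)

Section RhoRatio.
Variable R : realType.
Local Notation C := R[i].
Local Notation w := (w3 R).
Local Notation s_ := ((ss R)%:C : C).
Local Notation q0 := (q0 R).
Implicit Types (x y z : C) (b a : eis).

(** [1 - cos A] is half the squared distance of [exp(i A)] from 1, so this is the triangle
    inequality in a weighted squared form. *)
Lemma one_sub_cos_add (A B t : R) : 0 < t ->
  1 - cos (A + B) <= (1 + t) * (1 - cos A) + (1 + t^-1) * (1 - cos B).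
Proof.
move=> t0; rewrite cosD.
have hA := cos2Dsin2 A; have hB := cos2Dsin2 B.
have := cos_le1 A; have := cos_geN1 A; have := cos_le1 B; have := cos_geN1 B.
move: (cos A) (sin A) (cos B) (sin B) hA hB => c1 s1 c2 s2 hA hB b1 b2 b3 b4.
have [p ep] : exists p, p = 1 - c1 by eexists.
have [q eq] : exists q, q = 1 - c2 by eexists.
have p0 : 0 <= p by lra.
have q1 : 0 <= q by lra.
have tp : 0 <= t * p by rewrite mulr_ge0// ltW.
have tq : 0 <= t^-1 * q by rewrite mulr_ge0// invr_ge0 ltW.
have h1 : s1 ^+ 2 <= 2 * p by rewrite ep; nra.
have h2 : s2 ^+ 2 <= 2 * q by rewrite eq; nra.
have h3 : s1 * s2 <= t * p + t^-1 * q.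
  have e : (t * p) * (t^-1 * q) = p * q by field; rewrite gt_eqF.
  have k : (s1 * s2) ^+ 2 <= 4 * (p * q).
    by rewrite exprMn; apply: le_trans (ler_pM (sqr_ge0 _) (sqr_ge0 _) h1 h2) _; lra.
  rewrite -e in k; move: (t * p) (t^-1 * q) tp tq k => a b a0 b0 k.
  move: (s1 * s2) k => v k; rewrite leNgt; apply/negP => hn.
  have : (a + b) ^+ 2 < v ^+ 2 by rewrite ltr_pXn2r ?nnegrE ?addr_ge0// (le_trans _ (ltW hn))// addr_ge0.
  by have := sqr_ge0 (a - b); lra.
rewrite !mulrDl !mul1r -ep -eq; have -> : c1 = 1 - p by lra.
have -> : c2 = 1 - q by lra.
have : 0 <= p * q by rewrite mulr_ge0.
lra.
Qed.

Lemma one_sub_cos_double (A : R) : 1 - cos (2 * A) <= 4 * (1 - cos A).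
Proof.
have -> : 2 * A = A + A by ring.
rewrite cosD -!expr2 sin2cos2; have := cos_le1 A; have := cos_geN1 A; move: (cos A) => c; nra.
Qed.

Lemma phD x y b : ph (x + y) b = ph x b + ph y b.
Proof. by rewrite /ph mulrDr ImD mulrDr. Qed.
Lemma phN x b : ph (- x) b = - ph x b.
Proof. by rewrite /ph mulrN ImN mulrN. Qed.
Lemma ei_divw b : ei R (divw b) = w^* * ei R b.
Proof. by rewrite /ei /divw w3J /= !(intrB, intrN); have hw := w3_sqr R; ring: hw. Qed.
Lemma phw x b : ph (w * x) b = ph x (divw b).
Proof. by rewrite /ph ei_divw conjM conjKc; congr (_ * Im _); ring. Qed.

Definition dbl b : eis := (2 * b.1, 2 * b.2).
Lemma ei_dbl b : ei R (dbl b) = 2 * ei R b.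
Proof. by rewrite /ei /dbl/= !intrM; ring. Qed.
Lemma nb_dbl b : nb (dbl b) = (4 * nb b)%N.
Proof. by apply/eqP; rewrite -eqz_nat PoszM !nbE /en /dbl/=; apply/eqP; ring. Qed.
Lemma ph_dbl x b : ph x (dbl b) = 2 * ph x b.
Proof.
by rewrite /ph ei_dbl; move: (ei R b) => e; rewrite !ReIm; ring.
Qed.

Lemma ph_00 x : ph x (0, 0) = 0.
Proof. by rewrite /ph /ei/= !mulr0z mul0r addr0 conj0 mul0r Im0 mulr0. Qed.

Lemma bsum_q0 : exists M, bsum (fun b => q0 ^+ nb b) M.
Proof.
have [M h] := bsum_E_shift (ss_gt0 R); exists M; apply: bsum_le (h 0) => b.
by rewrite subr0 -en_cabs q0X (nbR R).
Qed.

Definition vt x b : R := q0 ^+ nb b * (1 - cos (ph x b)).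
Lemma vt_ge0 x b : 0 <= vt x b.
Proof. by rewrite mulr_ge0 ?exprn_ge0 ?q0_ge0// subr_ge0 cos_le1. Qed.

Lemma vt_bsum x : exists M, bsum (vt x) M.
Proof.
have [M h] := bsum_q0; exists (2 * M); apply: bsum_le (bsumZ _ h) => // b.
rewrite /vt mulrC ler_wpM2r ?exprn_ge0 ?q0_ge0//; have := cos_geN1 (ph x b); lra.
Qed.

Definition vp (e : bool) x b : R := if odd (nb b) == e then vt x b else 0.
Lemma vp_ge0 e x b : 0 <= vp e x b.
Proof. by rewrite /vp; case: ifP => // _; exact: vt_ge0. Qed.

(** Subtracting the series of [rho 0 = 0] turns every cosine into [1 - cos >= 0]. Then [rho] is the
    part of odd norms ([true]) minus that of even norms ([false]). *)
Definition VV e x : R := Re (csum (fun b => (vp e x b)%:C)).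
Lemma VVP e x : rsum (vp e x) (VV e x).
Proof.
have [M h] := vt_bsum x.
have {}h : bsum (vp e x) M by apply: bsum_le h => b; rewrite /vp; case: ifP => // _; exact: vt_ge0.
have [S hS] := rsum_ex (vp_ge0 e x) h.
by rewrite /VV (csumE hS) ReC.
Qed.
Lemma VV_ge0 e x : 0 <= VV e x. Proof. exact: rsum_ge0 (vp_ge0 e x) (VVP e x). Qed.

Lemma rhoV x : rho x = VV true x - VV false x.
Proof.
have h : rsum (fun b => rr x b - rr 0 b) (rho x).
  by rewrite -[rho x]subr0 -(rho0 R); apply: rsumB (rho_rsum _) (rho_rsum _).
have h2 := rsumB (VVP true x) (VVP false x).
apply: complexI; apply: has_sum_unique h2; apply: eq_rsum h => b.
rewrite /rr /vp /vt ph0 cos0 -signr_odd; case: (odd _) => /=; rewrite ?expr0 ?expr1; ring.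
Qed.

(** As 2 is inert, the points of even norm are the doubles of lattice points; doubling multiplies
    the norm by 4 and [1 - cos] by at most 4. *)
Lemma VV_even_le x : VV false x <= 4 * q0 ^+ 3 * (VV true x + VV false x).
Proof.
pose hf b : eis := ((b.1 %/ 2)%Z, (b.2 %/ 2)%Z).
have h := rsum_inj (phi := dbl) (psi := hf) (g := vp false x) _ _ (VVP false x).
have k1 : cancel dbl hf by move=> [a1 a2]; rewrite /dbl /hf/=; congr pair; lia.
have k2 b : dbl (hf b) <> b -> vp false x b = 0.
  move=> hb; rewrite /vp; case: ifP => // /eqP ho; exfalso; apply: hb.
  have : (2 %| en b)%Z by rewrite -nbE; move: (nb b) ho => n ho; lia.
  case: b {ho} => m n; rewrite /en /dbl /hf/= => hd.
  have [c [hc|hc]] : exists c : int, m = 2 * c \/ m = 2 * c + 1 by exists (m %/ 2)%Z; lia.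
    have [d [hd'|hd']] : exists c : int, n = 2 * c \/ n = 2 * c + 1 by exists (n %/ 2)%Z; lia.
      by congr pair; lia.
    exfalso; move: hd; rewrite hc hd' => /dvdzP[t ht]; lia.
  have [d [hd'|hd']] : exists c : int, n = 2 * c \/ n = 2 * c + 1 by exists (n %/ 2)%Z; lia.
    exfalso; move: hd; rewrite hc hd' => /dvdzP[t ht]; lia.
  exfalso; move: hd; rewrite hc hd' => /dvdzP[t ht]; lia.
have {}h := h k1 k2.
have h2 := rsumZ (4 * q0 ^+ 3) (rsumD (VVP true x) (VVP false x)).
apply: rsum_le h h2 => b /=.
have -> : vp true x b + vp false x b = vt x b.
  by rewrite /vp; case: (odd _) => /=; rewrite ?addr0 ?add0r.
rewrite {1}/vp; case: ifP => _; last by rewrite !mulr_ge0 ?exprn_ge0 ?q0_ge0 ?vt_ge0.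
rewrite /vt nb_dbl ph_dbl.
have [n0|n0] := posnP (nb b).
  have -> : b = (0, 0).
    have := @nb_small b; rewrite n0 => /(_ isT); rewrite !inE.
    by move: n0 => /[swap]; do ?[case/orP]; move=> /eqP-> //.
  by rewrite ph_00 !mulr0 cos0 subrr !mulr0.
have hc := one_sub_cos_double (ph x b).
(* For a norm [n >= 1] one has [4 n >= 3 + n]. *)
have hq : q0 ^+ (4 * nb b) <= q0 ^+ 3 * q0 ^+ nb b.
  by rewrite -exprD ler_wiXn2l ?q0_ge0 ?(ltW (q0_lt1 R))//; lia.
apply: le_trans (ler_pM (exprn_ge0 _ (q0_ge0 R)) _ hq hc) _.
  by rewrite subr_ge0 cos_le1.
by rewrite le_eqVlt; apply/orP; left; apply/eqP; ring.
Qed.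

Lemma VV_odd_le x : VV true x <= 1019/1000 * rho x.
Proof.
have h := VV_even_le x; have [h1 _] := q0_small R; have g := q0_ge0 R.
have q3 : 4 * q0 ^+ 3 <= 18/1000.
  move: q0 h1 g => q h1 g; have : q ^+ 2 <= 27/1000 by nra.
  have := sqr_ge0 q; nra.
have v1 := VV_ge0 true x; have v2 := VV_ge0 false x; rewrite rhoV.
move: (VV true x) (VV false x) (4 * q0 ^+ 3) h q3 v1 v2 => a b c h q3 v1 v2.
have : b <= 18/1000 * (a + b) by apply: le_trans h _; rewrite ler_wpM2r// addr_ge0.
lra.
Qed.

Lemma rho_le_VV x : rho x <= VV true x.
Proof. by rewrite rhoV; have := VV_ge0 false x; lra. Qed.

Lemma VV_add (t : R) x y : 0 < t ->
  VV true (x + y) <= (1 + t) * VV true x + (1 + t^-1) * VV true y.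
Proof.
move=> t0; apply: rsum_le (VVP _ _) (rsumD (rsumZ _ (VVP true x)) (rsumZ _ (VVP true y))) => b.
rewrite /vp; case: ifP => _; last by rewrite !mulr0 addr0.
rewrite /vt phD; have c0 := exprn_ge0 (nb b) (q0_ge0 R).
apply: le_trans (ler_wpM2l c0 (one_sub_cos_add (ph x b) (ph y b) t0)) _.
by rewrite le_eqVlt; apply/orP; left; apply/eqP; ring.
Qed.

Lemma VVN x : VV true (- x) = VV true x.
Proof.
apply: complexI; apply: has_sum_unique (VVP true x); apply: eq_rsum (VVP true (- x)) => b.
by rewrite /vp /vt phN cosN.
Qed.

Lemma VVw x : VV true (w * x) = VV true x.
Proof.
apply: complexI; apply: (has_sum_unique (VVP true (w * x))).
have h := has_sum_bij divwK mulwK (VVP true x).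
apply: eq_has_sum h => b /=; rewrite /vp /vt phw.
have -> : nb (divw b) = nb b by rewrite -{2}[b]divwK /nb en_mulw.
by [].
Qed.

Lemma VV0 : VV true 0 = 0.
Proof.
apply: complexI; apply: (has_sum_unique (VVP true 0)).
have := @has_sum_fin _ _ (fun b => (vp true (0 : C) b)%:C) [::] isT; rewrite big_nil; apply=> b _.
by rewrite /vp /vt ph0 cos0 subrr mulr0; case: ifP.
Qed.

(** The square root of [VV true] behaves like a seminorm invariant under units, so a sum of [l]
    units enlarges it at most [l] times. *)
Definition word (l : nat) (c : C) := forall x, VV true (c * x) <= l%:R ^+ 2 * VV true x.

Lemma word0 : word 0 0.
Proof. by move=> x; rewrite mul0r VV0 mulr_ge0 ?sqr_ge0 ?VV_ge0. Qed.
Lemma word1 : word 1 1. Proof. by move=> x; rewrite mul1r expr1n mul1r. Qed.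
Lemma word_add m n c d : (m = 0%N -> c = 0) -> (n = 0%N -> d = 0) -> word m c -> word n d ->
  word (m + n) (c + d).
Proof.
move=> hm hn hc hd; have [m0|m0] := posnP m; first by rewrite m0 hm// !add0r.
have [n0|n0] := posnP n; first by rewrite n0 hn// addn0 addr0.
move=> x; have p : 0 < n%:R / m%:R :> R by rewrite divr_gt0 ?ltr0n.
have m1 : m%:R != 0 :> R by rewrite pnatr_eq0 -lt0n.
have n1 : n%:R != 0 :> R by rewrite pnatr_eq0 -lt0n.
rewrite mulrDl; apply: le_trans (VV_add _ _ p) _.
apply: le_trans (lerD (ler_wpM2l _ (hc x)) (ler_wpM2l _ (hd x))) _.
    by have := ltW p; lra.
  by rewrite addr_ge0// invr_ge0 ltW.
rewrite natrD !mulrA -mulrDl ler_wpM2r ?VV_ge0// le_eqVlt; apply/orP; left; apply/eqP.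
by field; rewrite m1 n1.
Qed.
Lemma wordN l c : word l c -> word l (- c).
Proof. by move=> h x; rewrite mulNr VVN. Qed.
Lemma wordw l c : word l c -> word l (w * c).
Proof. by move=> h x; rewrite -mulrA VVw. Qed.
Lemma word_nat n c : word 1 c -> word n (n%:R * c).
Proof.
move=> h; elim: n => [|n ih]; first by rewrite mul0r; exact: word0.
rewrite -addn1 natrD mulrDl mul1r; apply: word_add => // ->; by rewrite mul0r.
Qed.
Lemma word_int (n : int) c : word 1 c -> word (absz n) (n%:~R * c).
Proof.
move=> h; case: n => n; first exact: word_nat.
by rewrite NegzE mulrNz mulNr abszN; apply: wordN; exact: word_nat.
Qed.

Lemma word_pair (m n : int) c d : word 1 c -> word 1 d -> word (absz m + absz n) (m%:~R * c + n%:~R * d).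
Proof.
by move=> hc hd; apply: word_add; try exact: word_int; move/eqP; rewrite absz_eq0 => /eqP->; rewrite mul0r.
Qed.

(** [a] is a combination of two neighbouring sixth roots of unity with nonnegative coefficients of
    sum [l]. The bound says that the hexagon of radius [l] contains the circle of radius
    [l sqrt 3 / 2]. *)
Lemma word_ei a : exists2 l, word l (ei R a) & (3 * l ^ 2 <= 4 * nb a)%N.
Proof.
have w1 := word1; have ww : word 1 w by have := wordw word1; rewrite mulr1.
have w1w : word 1 (1 + w).
  have := wordN (wordw ww); rewrite -expr2 w3_sqr; congr word; ring.
case: a => n m.
have nE : 4 * (nb (n, m))%:Z = (2 * m - n) ^+ 2 + 3 * n ^+ 2 by rewrite nbE /en/=; ring.
have E : (nb (n, m))%:Z = m ^+ 2 - m * n + n ^+ 2 by rewrite nbE.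
have S (x : int) : (absz x)%:Z ^+ 2 = x ^+ 2 by rewrite abszE; case: x => x; rewrite ?normrN /= ?sqrrN.
have K (x y : int) (c d : C) : word 1 c -> word 1 d -> ei R (n, m) = x%:~R * c + y%:~R * d ->
    3 * ((absz x)%:Z + (absz y)%:Z) ^+ 2 <= 4 * (nb (n, m))%:Z ->
    exists2 l, word l (ei R (n, m)) & (3 * l ^ 2 <= 4 * nb (n, m))%N.
  move=> hc hd e le; exists (absz x + absz y)%N; first by rewrite e; exact: word_pair.
  by rewrite -lez_nat !PoszM; move: le; rewrite -PoszD !expr2 -PoszM.
have [h|h] := boolP ((0 <= m) && (n <= 0) || (m <= 0) && (0 <= n)).
  apply: (K m n 1 w) => //; first by rewrite /ei/=; ring.
  rewrite E; have := sqr_ge0 (m + n); nia.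
have [h'|h'] := boolP ((0 <= m - n) && (0 <= n) || (m - n <= 0) && (n <= 0)).
  apply: (K (m - n) n 1 (1 + w)) => //; first by rewrite /ei/= intrB; ring.
  have -> : (absz (m - n))%:Z + (absz n)%:Z = (absz m)%:Z by lia.
  rewrite S E; have := sqr_ge0 (m - 2 * n); nia.
apply: (K m (n - m) (1 + w) w) => //; first by rewrite /ei/= intrB; ring.
have -> : (absz m)%:Z + (absz (n - m))%:Z = (absz n)%:Z by lia.
rewrite S E; have := sqr_ge0 (2 * m - n); nia.
Qed.

Lemma rho_word a : exists2 l, (3 * l ^ 2 <= 4 * nb a)%N &
  forall x, rho (ei R a * x) <= 1019/1000 * l%:R ^+ 2 * rho x.
Proof.
have [l h1 h2] := word_ei a; exists l => // x.
apply: le_trans (rho_le_VV _) _; apply: le_trans (h1 x) _.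
apply: le_trans (ler_wpM2l (sqr_ge0 _) (VV_odd_le x)) _.
by rewrite le_eqVlt; apply/orP; left; apply/eqP; ring.
Qed.
Lemma VV_term (s : seq eis) x : uniq s -> \sum_(b <- s) vp true x b <= VV true x.
Proof. by move=> us; exact: rsum_ge (vp_ge0 _ _) (VVP _ _) us. Qed.

Lemma cos_eq1 (t : R) : cos t = 1 -> exists k : int, t = 2 * pi * k%:~R.
Proof.
move=> h; have p0 := pi_gt0 R.
have : ce (t / (2 * pi)) = 1.
  have e : 2 * pi * (t / (2 * pi)) = t by rewrite mulrC divfK// mulf_neq0 ?pnatr_eq0 ?gt_eqF.
  have s0 : sin t = 0.
    by apply/eqP; rewrite -sqrf_eq0 sin2cos2 h expr1n subrr.
  rewrite /ce e; apply: complexP; first by rewrite Re_cexpI h.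
  have [h1 h2] : Re (iu R * t%:C) = 0 /\ Im (iu R * t%:C) = t by rewrite !ReIm; split; ring.
  by rewrite /cexp h1 h2 /= s0 mulr0.
by move=> /ce_eq1[m hm]; exists m; rewrite -hm mulrC divfK// mulf_neq0 ?pnatr_eq0 ?gt_eqF.
Qed.

(** [VV_odd_le] makes all terms of odd norm vanish; the phases of the units 1 and [w] then give both
    coordinates of [x]. *)
Lemma rho_eq0P x : rho x = 0 -> is_eis x.
Proof.
move=> h0; have v0 : VV true x = 0.
  by apply/eqP; rewrite eq_le VV_ge0 andbT; have := VV_odd_le x; rewrite h0 mulr0.
have key b : nb b = 1%N -> cos (ph x b) = 1.
  move=> hb; have := VV_term (s := [:: b]) x isT; rewrite big_seq1 v0 /vp hb /= /vt hb expr1.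
  by have := cos_le1 (ph x b); have := q0_gt0 R; move: (q0) (cos _) => q c *; nra.
have [k hk] := cos_eq1 (key (0, 1) erefl).
have [l hl] := cos_eq1 (key (1, 0) erefl).
have s0 := ss_neq0 R; have t0 := sq3_neq0 R; have t2 := sq3_sqr R.
have e1 : Im x = k%:~R * sq3 R / 2.
  move: hk; rewrite /ph /ei/= mul0r addr0 conjz !ReIm mul0r addr0 mul1r pi_ss => hk.
  by apply: (mulfI (x := 4 * ss R)); [rewrite mulf_neq0// pnatr_eq0|rewrite hk; field].
have e2 : Re x = - (l%:~R + k%:~R / 2).
  move: hl; rewrite /ph /ei/= add0r mul1r w3J !ReIm Re_w3 Im_w3 pi_ss e1 => hl.
  apply: (mulfI (x := 2 * ss R * sq3 R)); first by rewrite !mulf_neq0// pnatr_eq0.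
  by move: hl; move: (Re x) => r; clear -t2; nra.
by exists (- l), k; apply: complexP; rewrite -w3E !ReIm Re_w3 Im_w3 ?e1 ?e2 ?intrN; field.
Qed.

(** [1 / sqrt(-3)], a deep hole of the lattice, where [rho] is nearly maximal. *)
Definition hh : C := (1 + 2 * w)^-1.

Lemma theta_neq0 : 1 + 2 * w != 0.
Proof.
rewrite -cabs_gt0 lt_neqAle cabs_ge0 andbT eq_sym -sqrf_eq0 cabs_sqr !ReIm Re_w3 Im_w3.
by have := sq3_sqr R; move: (sq3 R) => t h; rewrite gt_eqF//; nra.
Qed.

Lemma theta_sqr : (1 + 2 * w) ^+ 2 = -3.
Proof. have hw := w3_sqr R; ring: hw. Qed.

Lemma hhE : hh = - (1 + 2 * w) / 3.
Proof. have hw := w3_sqr R; rewrite /hh; field: hw; exact: theta_neq0. Qed.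

Lemma cos_2pi3 : cos (2 * pi / 3 : R) = - (1 / 2) /\ 0 < sin (2 * pi / 3 : R).
Proof.
have p0 := pi_gt0 R.
have s0 : 0 < sin (2 * pi / 3 : R) by apply: sin_gt0_pi; lra.
split=> //; set t := 2 * pi / 3.
have e3 : cos (t + t + t) = 1.
  have -> : t + t + t = pi *+ 2 by rewrite /t; field.
  by rewrite cos2pi.
have := cos2Dsin2 t; move: e3; rewrite !cosD !sinD.
move: s0; rewrite -/t; move: (cos t) (sin t) => c s s0 e3 e2.
have e4 : (c ^+ 2 + s ^+ 2) * c = c by rewrite e2 mul1r.
have : (c - 1) * (2 * c + 1) ^+ 2 = 0 by lra.
move/eqP; rewrite mulf_eq0 => /orP[|]; first by rewrite subr_eq0 => /eqP hc; exfalso; nra.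
by rewrite sqrf_eq0 => /eqP; lra.
Qed.

Lemma cos_4pi3 : cos (4 * pi / 3 : R) = - (1 / 2).
Proof.
have [h _] := cos_2pi3; have -> : 4 * pi / 3 = 2 * pi / 3 + 2 * pi / 3 :> R by field.
by rewrite cosD -!expr2 sin2cos2 h; field.
Qed.

Lemma cos_ph_hh b : nb b = 1%N -> cos (ph hh b) = - (1 / 2).
Proof.
move=> hb; have [c2 _] := cos_2pi3; have c4 := cos_4pi3.
have e : ph hh b = - (2 * pi / 3 * (2 * b.2 - b.1)%:~R).
  rewrite /ph hhE pi_ss; have t2 := sq3_sqr R.
  have -> : - (1 + 2 * w) / 3 = ((3:R)^-1)%:C * - (1 + 2 * w) by rewrite CV Cnat mulrC.
  by rewrite /ei !ReIm Re_w3 Im_w3 intrB intrM; field: t2.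
have hk : 2 * b.2 - b.1 \in [:: 1; -1; 2; -2].
  have := @nb_small b; rewrite hb => /(_ isT) hin.
  have H : all (fun b => (nb b == 1%N) ==> (2 * b.2 - b.1 \in [:: 1; -1; 2; -2])) ((0, 0) :: U6 ++ W6).
    by vm_compute.
  by have /implyP := allP H b hin; rewrite hb; apply.
have d2 : 2 * pi / 3 * (2 : int)%:~R = 4 * pi / 3 :> R by field.
have d3 (k : int) : cos (2 * pi / 3 * (- k)%:~R) = cos (2 * pi / 3 * k%:~R :> R) by rewrite intrN mulrN cosN.
by move: hk; rewrite e cosN !inE => /or4P[]/eqP->; rewrite ?d3 ?d2 ?mulr1.
Qed.

Lemma nb_small3 b : (nb b < 3)%N -> b \in (0, 0) :: U6.
Proof.
move=> h; have /nb_small : (nb b < 4)%N by apply: leq_trans h _.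
rewrite -cat_cons mem_cat => /orP[//|]; rewrite !inE => hb; exfalso; move: h.
by move: hb; do ?[case/orP]; move=> /eqP->.
Qed.

Definition cs x : R := cos (ph x (0, 1)) + cos (ph x (1, 0)) + cos (ph x (0, 1) + ph x (1, 0)).

(** [3 + 2 cs x] is the squared modulus of [1 + exp(i alpha) + exp(- i beta)] for the two phases. *)
Lemma cs_ge x : - (3 / 2) <= cs x.
Proof.
rewrite /cs cosD; have := cos2Dsin2 (ph x (0, 1)); have := cos2Dsin2 (ph x (1, 0)).
move: (cos _) (sin _) (cos _) (sin _) => c1 s1 c2 s2 h1 h2.
have := sqr_ge0 (1 + c1 + c2); have := sqr_ge0 (s1 - s2); nra.
Qed.

Lemma rho_approx x : `|rho x - (1 - 2 * q0 * cs x)| <= tl1 q0.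
Proof.
have h := rsum_off (s := (0, 0) :: U6) isT (rho_rsum x).
have e : 1 - 2 * q0 * cs x = \sum_(b <- (0, 0) :: U6) rr x b.
  have p11 : ph x (1, 1) = ph x (0, 1) + ph x (1, 0).
    by rewrite /ph /ei/= !mul0r !addr0 !mul1r !add0r -mulrDr -ImD -mulrDl conjD.
  have pN (m n : int) : ph x (- m, - n) = - ph x (m, n).
    by rewrite /ph (_ : ei R (- m, - n) = - ei R (m, n)) ?conjN ?mulNr ?ImN ?mulrN// /ei/= !intrN; ring.
  have p01 : ph x (0, -1) = - ph x (0, 1) by rewrite -pN.
  have p10 : ph x (-1, 0) = - ph x (1, 0) by rewrite -pN.
  have p1m : ph x (-1, -1) = - ph x (1, 1) by rewrite -pN.
  rewrite /U6 !big_cons big_nil /rr ph_00 p01 p10 p1m !cosN p11 cos0.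
  have -> : nb (0, 0) = 0%N by [].
  have -> : nb (0, 1) = 1%N by [].
  have -> : nb (0, -1) = 1%N by [].
  have -> : nb (1, 0) = 1%N by [].
  have -> : nb (-1, 0) = 1%N by [].
  have -> : nb (1, 1) = 1%N by [].
  have -> : nb (-1, -1) = 1%N by [].
  by rewrite /cs; ring.
rewrite -e in h; apply: rsum_abs h _.
apply: bsum_le (bsum_tl1 (q0_ge0 R) (q0_lt1 R)) => b; case: ifP => [_|/negP hb].
  by rewrite normr0; case: ifP => // _; rewrite exprn_ge0 ?q0_ge0.
case: ifP => [/nb_small3//|_]; exact: rr_le.
Qed.

Lemma tl1_le (r u c3 c2 v : R) : 0 <= r -> r <= u -> u ^+ 3 <= c3 -> u ^+ 2 <= c2 -> c3 < 1 -> c2 < 1 ->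
  1 <= v * ((1 - c3) * (1 - c2)) -> tl1 r <= 6 * u * (v - 1).
Proof. by move=> h1 h2 h3 h4 h5 h6 h7; have [] := tl_le h1 h2 h3 h4 h5 h6 h7. Qed.

Lemma tl1_q0 : tl1 q0 <= 34/1000.
Proof.
have [h1 _] := q0_small R.
apply: le_trans (@tl1_le q0 (164/1000) (5/1000) (27/1000) (1034/1000) (q0_ge0 R) (ltW h1) _ _ _ _ _) _; lra.
Qed.

Lemma rho_upper x : rho x <= 1 + 3 * q0 + 34/1000.
Proof.
have := rho_approx x; rewrite ler_norml => /andP[_ h]; have t := tl1_q0; have c := cs_ge x.
have := ler_wpM2l (q0_ge0 R) c; lra.
Qed.

Lemma cs_hh : cs hh = - (3 / 2).
Proof.
have p11 : ph hh (1, 1) = ph hh (0, 1) + ph hh (1, 0).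
  by rewrite /ph /ei/= !mul0r !addr0 !mul1r !add0r -mulrDr -ImD -mulrDl conjD.
by rewrite /cs -p11 !cos_ph_hh//; lra.
Qed.

Lemma rho_hh_lower : 1 + 3 * q0 - 34/1000 <= rho hh.
Proof.
have := rho_approx hh; rewrite ler_norml cs_hh => /andP[h _]; have t := tl1_q0; lra.
Qed.

Lemma rho_le_hh x : rho x <= 1047/1000 * rho hh.
Proof. have := rho_upper x; have := rho_hh_lower; have [_ h] := q0_small R; lra. Qed.

Lemma rho_hh_gt0 : 0 < rho hh.
Proof. by have := rho_hh_lower; have [_ h] := q0_small R; lra. Qed.

Lemma sg_hh_neq0 : sg hh != 0.
Proof. by rewrite -rho_eq0 gt_eqF// rho_hh_gt0. Qed.
Lemma sin_sqr_le (u : R) : sin u ^+ 2 <= u ^+ 2.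
Proof.
wlog u0 : u / 0 <= u.
  move=> H; have [/H//|/ltW h] := lerP 0 u.
  by have := H (- u); rewrite sinN !sqrrN; apply; rewrite oppr_ge0.
have [u1|u1] := lerP u 1.
  have /andP[h1 h2] := @sin_bounds R u (introT andP (conj u0 u1)).
  rewrite ler_pXn2r// ?nnegrE// (le_trans _ h1)// mulr_ge0//; nra.
have := sin2cos2 u; have := sqr_ge0 (cos u); nra.
Qed.

Lemma one_sub_cos_le (t : R) : 1 - cos t <= t ^+ 2 / 2.
Proof.
have e : t = t / 2 + t / 2 by lra.
rewrite {1}e cosD -!expr2 cos2sin2; have := sin_sqr_le (t / 2); lra.
Qed.

Lemma ss_lt : ss R < 195/100.
Proof.
rewrite ltNge; apply/negP => h; have [_ hq] := q0_small R.
have e1 : q0 = (expR (ss R / 32) ^+ 32)^-1.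
  by rewrite -expRM_natl q0E expRN; congr (expR _)^-1; field.
have e2 : 1060 / 1000 <= expR (ss R / 32) by have := expR_ge1Dx (ss R / 32); lra.
move: (expR _) e1 e2 => E e1 e2; clear h.
have f1 : 1123 / 1000 <= E ^+ 2 by clear -e2; nra.
have f2 : 1261 / 1000 <= E ^+ 4 by rewrite (exprM E 2 2); move: (E ^+ 2) f1; clear => F f1; nra.
have f3 : 1590 / 1000 <= E ^+ 8 by rewrite (exprM E 4 2); move: (E ^+ 4) f2; clear => F f2; nra.
have f4 : 2528 / 1000 <= E ^+ 16 by rewrite (exprM E 8 2); move: (E ^+ 8) f3; clear => F f3; nra.
have f5 : 639 / 100 <= E ^+ 32 by rewrite (exprM E 16 2); move: (E ^+ 16) f4; clear => F f4; nra.
move: hq; rewrite e1; move: (E ^+ 32) f5; clear => F f5 hq.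
have F0 : 0 < F by lra.
have : 161 / 1000 * F < F^-1 * F by rewrite ltr_pM2r.
rewrite mulVf ?gt_eqF//; lra.
Qed.

Lemma bsum_nq : bsum (fun b => (nb b)%:R * q0 ^+ nb b) (1152/1000).
Proof.
have [h1 _] := q0_small R; have g := q0_ge0 R.
have r0 : 0 <= 2 * q0 by lra.
have r1 : 2 * q0 < 1 by lra.
have K := bsumZ g (bsum_pow2 r0 r1).
have H : bsum (fun p => (secN p)%:R * q0 ^+ secN p) (q0 * ((1 - (2 * q0) ^+ 3) * (1 - (2 * q0) ^+ 2))^-1).
  apply: bsum_le K => p; have := secN_ge p.
  have -> : secN p = (secN p).-1.+1 by have := secN_ge p; lia.
  move: (secN p).-1 => n hn.
  have n2 : n.+1%:R <= 2 ^+ n :> R.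
    elim: n {hn} => [|n ih]; first by rewrite expr0.
    rewrite exprS -addn1 natrD; have : 1 <= 2 ^+ n :> R by rewrite exprn_ege1// ler1n.
    lra.
  rewrite exprS mulrCA ler_wpM2l//.
  apply: le_trans (ler_wpM2r (exprn_ge0 n g) n2) _; rewrite -exprMn.
  by rewrite ler_wiXn2l ?(ltW r1)//; lia.
have := @bsum_sector R (fun n => n%:R * q0 ^+ n) _ _ _ H.
move=> B; apply: bsum_weaken (B _ _) => [|n|]; last 2 first.
  by rewrite mulr_ge0// exprn_ge0.
  by rewrite mul0r.
have [c3 c2] : (2 * q0) ^+ 3 <= 36/1000 /\ (2 * q0) ^+ 2 <= 108/1000.
  move: h1 g; move: q0 => q h1 g; have : (2 * q) ^+ 2 <= 108/1000 by nra.
  split=> //; rewrite exprS; nra.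
have v : ((1 - (2 * q0) ^+ 3) * (1 - (2 * q0) ^+ 2))^-1 <= 117/100.
  rewrite -[leLHS]mul1r ler_pdivrMr; last by apply: mulr_gt0; lra.
  apply: (@le_trans _ _ (117/100 * ((1 - 36/1000) * (1 - 108/1000)))); first by lra.
  by clear - c3 c2; apply: ler_wpM2l; [|apply: ler_pM]; lra.
move: (_^-1) v => V v; have : 0 <= 117/100 - V by lra.
nra.
Qed.

(** Averaging over the three rotations by [w] makes the sum of the squared phases isotropic: it
    equals [24 s^2 N(b) |x|^2]. *)
Lemma VV_small x : VV true x <= 1763/100 * cabs x ^+ 2.
Proof.
have hs := ss_lt; have s0 := ss_gt0 R.
have h3 : rsum (fun b => (vp true x b + vp true (w * x) b + vp true (w * (w * x)) b) / 3) (VV true x).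
  have := rsumZ (3^-1) (rsumD (rsumD (VVP true x) (VVP true (w * x))) (VVP true (w * (w * x)))).
  rewrite !VVw (_ : 3^-1 * _ = VV true x); last by field.
  by apply: eq_rsum => b; rewrite mulrC.
apply: rsum_le_bsum h3 _.
have K : 0 <= 153/10 * cabs x ^+ 2 by rewrite mulr_ge0 ?sqr_ge0// divr_ge0.
have cx := sqr_ge0 (cabs x).
apply: (@bsum_weaken _ _ _ (153/10 * cabs x ^+ 2 * (1152/1000))); first by lra.
apply: bsum_le (bsumZ K bsum_nq) => b.
have pos : 0 <= 153/10 * cabs x ^+ 2 * ((nb b)%:R * q0 ^+ nb b).
  by apply: mulr_ge0 K _; rewrite mulr_ge0 ?exprn_ge0 ?q0_ge0.
rewrite /vp; case: ifP => _; last by rewrite !addr0 mul0r.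
rewrite /vt -!mulrDr -mulrA [leRHS]mulrC -[leRHS]mulrA [leRHS]mulrCA ler_wpM2l ?exprn_ge0 ?q0_ge0//.
have := one_sub_cos_le (ph x b); have := one_sub_cos_le (ph (w * x) b); have := one_sub_cos_le (ph (w * (w * x)) b).
have E : ph x b ^+ 2 + ph (w * x) b ^+ 2 + ph (w * (w * x)) b ^+ 2 = 24 * ss R ^+ 2 * ((nb b)%:R * cabs x ^+ 2).
  rewrite /ph (nbR R) en_cabs !cabs_sqr; move: (ei R b) => e; have t2 := sq3_sqr R.
  by rewrite !ReIm Re_w3 Im_w3; field: t2.
move=> k1 k2 k3.
apply: (@le_trans _ _ (4 * ss R ^+ 2 * ((nb b)%:R * cabs x ^+ 2))); first by lra.
have hA : ss R ^+ 2 <= 3803/1000 by clear - hs s0; nra.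
have hB : 0 <= (nb b)%:R * cabs x ^+ 2 by rewrite mulr_ge0 ?sqr_ge0.
by have := ler_wpM2r hB hA; clear - hB; lra.
Qed.

(** The six units alone give [VV true hh >= 9 q0], and [VV_add] with [t = 1] transfers this to
    [hh + d]. The radius is the [1/32] of [near] times [|hh|^2 = 1/3]. *)
Lemma rho_near_hh x d : cabs d ^+ 2 <= 1/96 -> rho x <= 287/100 * rho (hh + d).
Proof.
move=> hd; have h1 := VV_odd_le (hh + d); have h2 := VV_small d; have u := rho_upper x.
have [q1 q2] := q0_small R.
have h3 : 9 * q0 <= VV true hh.
  apply: le_trans (VV_term (s := U6) hh isT).
  have V b : nb b = 1%N -> vp true hh b = q0 * (3 / 2).
    by move=> hb; rewrite /vp hb/= /vt hb expr1 cos_ph_hh//; congr (_ * _); lra.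
  by rewrite /U6 !big_cons big_nil !V//; lra.
have := @VV_add 1 (hh + d) (- d) ltr01; rewrite addrK VVN invr1 => h4.
lra.
Qed.

Lemma cexp_2pi3 : cexp (s_ * (1 + 2 * w) * (2 / 3)) = w.
Proof.
have [c s] := cos_2pi3; have t2 := sq3_sqr R; have t0 := sq3_gt0 R.
have -> : s_ * (1 + 2 * w) * (2 / 3) = iu R * (2 * pi / 3)%:C.
  by rewrite -piIE !CM CV !Cnat; move: (pi%:C : C) => P; ring.
apply: complexP; first by rewrite Re_cexpI c Re_w3.
have [h1 h2] : Re (iu R * (2 * pi / 3)%:C) = 0 /\ Im (iu R * (2 * pi / 3)%:C) = 2 * pi / 3.
  by move: (2 * pi / 3) => P; rewrite !ReIm; split; ring.
rewrite /cexp h1 h2 Im_w3 [Im _]/= expR0 mul1r.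
apply/eqP; rewrite -(@eqrXn2 _ 2)// ?(ltW s)//; last by rewrite divr_ge0// ltW.
by rewrite sin2cos2 c expr_div_n t2; apply/eqP; field.
Qed.

(** The constant left open by [sg_w_prod] is read off at [hh], where [w * hh = hh + w + 1] and the
    quasi-periods apply. *)
Lemma sg_w x : sg (w * x) = w * sg x.
Proof.
have hw := w3_sqr R.
have e : sg (w * hh) = w * sg hh.
  have -> : w * hh = hh + w + 1 by rewrite hhE; field: hw.
  rewrite sg_add1 sg_addw mulrA mulrNN -cexpD; congr (_ * _).
  rewrite -[RHS]cexp_2pi3; congr cexp; rewrite hhE w3J; by field: hw.
have := sg_w_prod x hh; rewrite e conjM mulrA => h.
have n0 : (sg hh)^* != 0 by rewrite -cabs_gt0 cabsJ cabs_gt0 sg_hh_neq0.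
have := mulIf n0 h; rewrite w3J => k; rewrite -k; ring: hw.
Qed.

End RhoRatio.

(** * Criteria for zeros and the numerical sums they need *)

Section ZeroFree.
Variable R : realType.
Local Notation C := R[i].
Local Notation q0 := (q0 R).
Implicit Types (p b a : eis).

Lemma has_sum_neq0 (T : choiceType) (f : T -> C) S (s : seq T) B : uniq s -> has_sum f S ->
  bsum (fun i => if i \in s then 0 else cabs (f i)) B -> B < cabs (\sum_(i <- s) f i) -> S != 0.
Proof.
move=> us h b lt; have h2 := has_sum_off us h; apply/eqP => S0; rewrite S0 sub0r in h2.
have : cabs (- \sum_(i <- s) f i) <= B.
  apply: has_sum_bound h2 _; apply: bsum_le b => i; case: ifP => _ //; by rewrite cabs0.
by rewrite cabsN leNgt lt.
Qed.

Lemma pow_diff_le (X Y : C) (r : R) n : cabs X <= r -> cabs Y <= r ->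
  cabs (Y * X ^+ n.+1 - X * Y ^+ n.+1) <= n%:R * cabs (Y - X) * r ^+ n.+1.
Proof.
move=> hX hY; have r0 : 0 <= r := le_trans (cabs_ge0 _) hX.
have D : cabs (X ^+ n - Y ^+ n) <= n%:R * cabs (Y - X) * r ^+ n.-1.
  elim: n => [|n ih]; first by rewrite !expr0 subrr cabs0 !mul0r.
  have -> : X ^+ n.+1 - Y ^+ n.+1 = X * (X ^+ n - Y ^+ n) + (X - Y) * Y ^+ n by rewrite !exprS; ring.
  apply: le_trans (cabsD _ _) _; rewrite !cabsM [cabs (X - Y)]cabsB.
  have h1 : cabs X * cabs (X ^+ n - Y ^+ n) <= n%:R * cabs (Y - X) * r ^+ n.
    case: n ih => [|n] ih; first by rewrite !expr0 subrr cabs0 mulr0 !mul0r.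
    apply: le_trans (ler_pM (cabs_ge0 _) (cabs_ge0 _) hX ih) _.
    by rewrite le_eqVlt; apply/orP; left; apply/eqP; rewrite /= exprS; ring.
  have h2 : cabs (Y - X) * cabs (Y ^+ n) <= cabs (Y - X) * r ^+ n.
    by rewrite ler_wpM2l ?cabs_ge0// cabsX lerXn2r ?nnegrE ?cabs_ge0.
  rewrite [n.+1.-1]/= -[n.+1]addn1 natrD; lra.
case: n D => [|n] D; first by rewrite !expr1 mulrC subrr cabs0 !mul0r.
have -> : Y * X ^+ n.+2 - X * Y ^+ n.+2 = X * Y * (X ^+ n.+1 - Y ^+ n.+1) by rewrite !exprS; ring.
rewrite !cabsM; apply: le_trans (ler_pM _ (cabs_ge0 _) (ler_pM (cabs_ge0 _) (cabs_ge0 _) hX hY) D) _.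
  by rewrite mulr_ge0 ?cabs_ge0.
by rewrite le_eqVlt; apply/orP; left; apply/eqP; rewrite /= !exprS; ring.
Qed.

(* Two zeros of the same power series: the combination Y F(X) - X F(Y) kills the
   linear coefficient, so the constant coefficient has to beat only the rest. *)
Lemma near_critical (T : choiceType) (t : T -> C) (d : T -> nat) (s : seq T) (X Y : C) (r B : R) :
  uniq s -> (forall i, (i \in s) = (d i == 0%N)) -> cabs X <= r -> cabs Y <= r ->
  has_sum (fun i => t i * X ^+ d i) 0 -> has_sum (fun i => t i * Y ^+ d i) 0 ->
  bsum (fun i => (d i).-1%:R * (cabs (t i) * r ^+ d i)) B -> B < cabs (\sum_(i <- s) t i) -> X = Y.
Proof.
move=> us ds hX hY sX sY b lt; apply/eqP; apply: contraLR lt => XY; rewrite -leNgt.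
have h := has_sumD (has_sumZ Y sX) (has_sumN (has_sumZ X sY)); rewrite !mulr0 subr0 in h.
have {}h : has_sum (fun i => t i * (Y * X ^+ d i - X * Y ^+ d i)) 0.
  by apply: eq_has_sum h => i; ring.
have h2 := has_sum_off us h; rewrite sub0r in h2.
have p : 0 < cabs (Y - X) by rewrite cabs_gt0 subr_eq0 eq_sym.
rewrite -(ler_pM2l p).
have -> : cabs (Y - X) * cabs (\sum_(i <- s) t i) = cabs (- \sum_(i <- s) t i * (Y * X ^+ d i - X * Y ^+ d i)).
  rewrite cabsN -cabsM; congr cabs; rewrite mulr_sumr !big_seq; apply: eq_bigr => i.
  by rewrite ds => /eqP->; rewrite !expr0; ring.
apply: has_sum_bound h2 _; apply: bsum_le (bsumZ (ltW p) b) => i; case: ifP => [|/negbT].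
  rewrite cabs0 => _; rewrite !mulr_ge0 ?cabs_ge0// exprn_ge0// (le_trans (cabs_ge0 _) hX)//.
rewrite ds -lt0n; case: (d i) => // n _; rewrite cabsM /=.
apply: le_trans (ler_wpM2l (cabs_ge0 _) (pow_diff_le n hX hY)) _.
by rewrite le_eqVlt; apply/orP; left; apply/eqP; ring.
Qed.

Lemma expR_root (n : nat) : (0 < n)%N -> expR (- (ss R / n%:R)) ^+ n = q0.
Proof.
move=> n0; rewrite -expRM_natl q0E; congr expR; rewrite mulrN mulrCA divff ?mulr1//.
by rewrite pnatr_eq0 -lt0n.
Qed.

Lemma Q_far (y : R) : 11/10 <= y -> expR (- (ss R * y)) <= 11/80.
Proof.
move=> hy; have s0 := ss_gt0 R; have [h1 _] := q0_small R.
have E0 := expR_gt0 (- (ss R / 10)); have e := @expR_root 10 isT.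
apply: (@le_trans _ _ (q0 * expR (- (ss R / 10)))).
  rewrite q0E -expRD ler_expR; have := ler_wpM2l (ltW s0) hy; lra.
move: (expR _) E0 e => E E0 e.
have : E <= 836/1000.
  rewrite leNgt; apply/negP => hE; move: h1; rewrite -e.
  have f1 : 698/1000 <= E ^+ 2 by clear -hE; nra.
  have f2 : 487/1000 <= E ^+ 4 by rewrite (exprM E 2 2); move: (E ^+ 2) f1; clear => F f1; nra.
  have f3 : 237/1000 <= E ^+ 8 by rewrite (exprM E 4 2); move: (E ^+ 4) f2; clear => F f2; nra.
  rewrite (exprD E 8 2); move: (E ^+ 8) (E ^+ 2) f1 f3; clear => F G; nra.
have g := q0_ge0 R; move: h1 E0 g; move: q0; clear => q *; nra.
Qed.

(** The 32nd root of [q0]: near the critical segment the height is at least [31/32], and the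
    relevant quantity is [En^31]. *)
Definition En : R := expR (- (ss R / 32)).
Lemma En_gt0 : 0 < En. Proof. exact: expR_gt0. Qed.

Lemma pow31_lt (E : R) : 0 < E -> E < 943/1000 -> E ^+ 31 < 174/1000.
Proof.
move=> E0 hE.
have p2 : 0 <= E ^+ 2 <= 890/1000 by apply/andP; split; [exact: sqr_ge0|clear -hE E0; nra].
have p4 : 0 <= E ^+ 4 <= 793/1000.
  rewrite (exprM E 2 2) sqr_ge0/=; move: (E ^+ 2) p2; clear => F /andP[? ?]; nra.
have p8 : 0 <= E ^+ 8 <= 629/1000.
  rewrite (exprM E 4 2) sqr_ge0/=; move: (E ^+ 4) p4; clear => F /andP[? ?]; nra.
have p16 : 0 <= E ^+ 16 <= 396/1000.
  rewrite (exprM E 8 2) sqr_ge0/=; move: (E ^+ 8) p8; clear => F /andP[? ?]; nra.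
have p24 : 0 <= E ^+ 24 <= 250/1000.
  rewrite (exprD E 16 8); move: (E ^+ 16) (E ^+ 8) p16 p8; clear => F G /andP[? ?] /andP[? ?].
  by apply/andP; split; nra.
have p6 : 0 <= E ^+ 6 <= 706/1000.
  rewrite (exprD E 4 2); move: (E ^+ 4) (E ^+ 2) p4 p2; clear => F G /andP[? ?] /andP[? ?].
  by apply/andP; split; nra.
have p30 : 0 <= E ^+ 30 <= 1766/10000.
  rewrite (exprD E 24 6); move: (E ^+ 24) (E ^+ 6) p24 p6; clear => F G /andP[? ?] /andP[? ?].
  by apply/andP; split; nra.
rewrite (exprS E 30); move: (E ^+ 30) p30 => F /andP[f0 f1]; clear -E0 hE f0 f1; nra.
Qed.

Lemma En_bounds : En ^+ 31 <= 174/1000 /\ 943/1000 <= En.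
Proof.
have e := @expR_root 32 isT; have E0 := En_gt0; rewrite -/En in e; have [h1 h2] := q0_small R.
split.
  rewrite leNgt; apply/negP => h.
  have hE : En < 943/1000.
    rewrite -(@ltr_pM2r _ (En ^+ 31)) ?exprn_gt0// -exprS e.
    by apply: lt_le_trans h1 _; move: (En ^+ 31) h; clear => F h; lra.
  by have := pow31_lt E0 hE; lra.
rewrite leNgt; apply/negP => h; move: h2; rewrite -e; move: En E0 h; clear => E E0 hE.
have p2 : 0 <= E ^+ 2 <= 890/1000 by apply/andP; split; [exact: sqr_ge0|clear -hE E0; nra].
have p4 : 0 <= E ^+ 4 <= 793/1000.
  rewrite (exprM E 2 2) sqr_ge0/=; move: (E ^+ 2) p2; clear => F /andP[? ?]; nra.
have p8 : 0 <= E ^+ 8 <= 629/1000.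
  rewrite (exprM E 4 2) sqr_ge0/=; move: (E ^+ 4) p4; clear => F /andP[? ?]; nra.
have p16 : 0 <= E ^+ 16 <= 396/1000.
  rewrite (exprM E 8 2) sqr_ge0/=; move: (E ^+ 8) p8; clear => F /andP[? ?]; nra.
rewrite (exprM E 16 2); move: (E ^+ 16) p16; clear => F /andP[? ?]; nra.
Qed.
Lemma bsum_supp (T : choiceType) (v : T -> R) (s : seq T) : uniq s -> (forall i, 0 <= v i) ->
  bsum (fun i => if i \in s then v i else 0) (\sum_(i <- s) v i).
Proof.
move=> us v0 t ut.
have -> : \sum_(i <- t) (if i \in s then v i else 0) = \sum_(i <- [seq i <- t | i \in s]) v i.
  by rewrite big_filter [RHS]big_mkcond.
by apply: ler_sum_subset; rewrite ?filter_uniq// => i; rewrite mem_filter => /andP[].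
Qed.

(** The series of type II run over integers [1 + th p], of norm [N = 1 + 3 k], with terms of size
    [c N * Q^k]. The norm 1 is left out, as it belongs to the leading terms. *)
Definition GII (c : nat -> R) (Q : R) (N : nat) : R :=
  if (3 < N)%N && (N %% 3 == 1)%N then c N * Q ^+ (N.-1 %/ 3) else 0.

Lemma GII_ge0 c Q N : (forall n, 0 <= c n) -> 0 <= Q -> 0 <= GII c Q N.
Proof. by move=> c0 q; rewrite /GII; case: ifP => // _; rewrite mulr_ge0 ?exprn_ge0. Qed.

(** Among the six sector points with [i + j <= 2] only the norm 4, once, and the norm 7, twice,
    contribute. The constant [5/1000] bounds the sum of [(1/10)^(i + j)] over [i + j >= 3]. *)
Lemma bsum_GII (c : nat -> R) (Q c4 c7 D : R) : (forall n, 0 <= c n) -> 0 <= Q -> 0 <= D ->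
  c 4 * Q <= c4 -> c 7 * Q ^+ 2 <= c7 ->
  (forall p : nat * nat, (2 < p.1 + p.2)%N -> GII c Q (secN p) <= D * (1 / 10) ^+ (p.1 + p.2)) ->
  bsum (fun p : nat * nat => GII c Q (secN p)) (c4 + 2 * c7 + D * (5 / 1000)).
Proof.
move=> c0 Q0 D0 h4 h7 hD.
have c40 : 0 <= c4 by apply: le_trans h4; rewrite mulr_ge0.
have c70 : 0 <= c7 by apply: le_trans h7; rewrite mulr_ge0 ?sqr_ge0.
pose s6 : seq (nat * nat) := [:: (0, 0); (1, 0); (0, 1); (2, 0); (1, 1); (0, 2)]%N.
pose v (p : nat * nat) : R := if p == (1, 0)%N then c4 else if (p == (1, 1)%N) || (p == (0, 2)%N) then c7 else 0.
have v0 (p : nat * nat) : 0 <= v p by rewrite /v; case: ifP => // _; case: ifP.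
have r01 : 0 <= (1 / 10 : R) < 1 by apply/andP; split; lra.
have G : bsum (fun p : nat * nat => (1 / 10 : R) ^+ (p.1 + p.2)) ((1 - 1 / 10)^-1 * (1 - 1 / 10)^-1).
  have := @bsum_prodM R _ _ (fun n => (1 / 10) ^+ n) (fun n => (1 / 10) ^+ n) _ _ _ _ (bsum_geometric r01) (bsum_geometric r01).
  move=> H; apply: bsum_le (H _ _) => [p|n|n]; first by rewrite exprD.
    by rewrite exprn_ge0//; lra.
  by rewrite exprn_ge0//; lra.
have e0 (p : nat * nat) : 0 <= (1 / 10 : R) ^+ (p.1 + p.2) by rewrite exprn_ge0//; lra.
have K := bsumD (bsum_supp (s := s6) isT v0) (bsumZ D0 (bsum_off e0 (isT : uniq s6) G)).
apply: bsum_weaken (bsum_le _ K) => [|p].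
  rewrite !big_cons !big_nil /v /= !(expr0, expr1).
  have -> : (1 - 1 / 10 : R)^-1 = 10 / 9 by field.
  rewrite !add0r !addr0 (_ : c4 + (c7 + c7) = c4 + 2 * c7); last by ring.
  by rewrite lerD2l; apply: ler_wpM2l => //; clear; lra.
case: ifP => hp; last first.
  rewrite add0r; apply: hD; move: hp; case: p => j i; rewrite !inE !xpair_eqE /= => /negbT; lia.
rewrite mulr0 addr0; move: hp; rewrite !inE; do ?[case/orP]; move/eqP->; rewrite /v /GII /=.
all: rewrite ?expr1; by [].
Qed.

Lemma secN_tri (p : nat * nat) : (3 * (p.1 + p.2).+1 ^ 2 <= 4 * secN p)%N /\ (secN p <= (p.1 + p.2).+1 ^ 2)%N.
Proof.
case: p => j i; rewrite /secN/= -addSn; move: j.+1 => a.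
case: (leqP a i) => h; [rewrite -(subnKC h); move: (i - a)%N => d|rewrite -(subnKC (ltnW h)); move: (a - i)%N => d].
  by rewrite !expnS !expn0 !muln1; split; lia.
by rewrite !expnS !expn0 !muln1; split; lia.
Qed.
(** For [i + j = 3] the norms are 12, 13, 13, 16, and 12 is not congruent to 1. For [t = i + j >= 4]
    the exponent is at least [2 t - 2], which beats the growth [(t + 1)^4] of the coefficients. *)
Lemma GII_tail (c : nat -> R) (Q A D : R) : (forall n, 0 <= c n) -> 0 <= Q -> Q <= 174/1000 -> 0 <= A ->
  (forall p : nat * nat, (3 < p.1 + p.2)%N -> c (secN p) <= A * (p.1 + p.2).+1%:R ^+ 4) ->
  c 13 * Q ^+ 4 <= D / 1000 -> c 16 * Q ^+ 5 <= D / 1000 -> A * 625 * Q ^+ 6 <= D / 1000 * (1 / 10) ->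
  forall p : nat * nat, (2 < p.1 + p.2)%N -> GII c Q (secN p) <= D * (1 / 10) ^+ (p.1 + p.2).
Proof.
move=> c0 Q0 Q1 A0 hc h13 h16 h4 p.
have D0 : 0 <= D by have := mulr_ge0 (c0 13%N) (exprn_ge0 4 Q0); lra.
have d10 n : 0 <= D * (1 / 10) ^+ n by rewrite mulr_ge0// exprn_ge0//; lra.
rewrite leq_eqVlt => /orP[/eqP e|ht].
  have H : p \in [:: (0, 3); (1, 2); (2, 1); (3, 0)]%N.
    by case: p e => j i /= e; clear -e; rewrite !inE !xpair_eqE; lia.
  rewrite -e (_ : D * (1 / 10) ^+ 3 = D / 1000); last by field.
  have D1 : 0 <= D / 1000 := divr_ge0 D0 (ler0n _ _).
  move: (D / 1000) D1 h13 h16 => E D1 h13 h16.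
  by move: H {e}; rewrite !inE => /or4P[]/eqP->; rewrite /GII //=.
rewrite /GII; case: ifP => // /andP[N3 N1].
have [s1 s2] := secN_tri p; have hcp := hc p ht; move: (secN p) s1 s2 hcp N3 N1 => N s1 s2 hcp N3 N1.
move: (p.1 + p.2)%N ht s1 s2 hcp => t ht s1 s2 hcp.
have k : (2 * t - 2 <= N.-1 %/ 3)%N.
  clear -s1 N1; move/eqP: N1 => N1; set m := (N.-1 %/ 3)%N.
  have e : N = (3 * m).+1 by rewrite /m; lia.
  clearbody m; subst N; clear N1; rewrite leqNgt; apply/negP => hm.
  have [h3|h3] := leqP 3 t.
    rewrite -(subnKC h3) in s1 hm; move: (t - 3)%N s1 hm; clear => e.
    by rewrite !expnS !expn0 !muln1; lia.
  by case: t h3 s1 hm => [|[|[|//]]] _; rewrite !expnS !expn0 !muln1; lia.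
have q1 : Q <= 1 by lra.
apply: (@le_trans _ _ (A * t.+1%:R ^+ 4 * Q ^+ (2 * t - 2))).
  by apply: ler_pM => //; rewrite ?exprn_ge0// ler_wiXn2l.
clear -ht A0 Q0 Q1 h4; elim: t ht => // t ih ht.
move: ht; rewrite leq_eqVlt => /orP[/eqP[<-]|ht].
  rewrite (_ : D * (1 / 10) ^+ 4 = D / 1000 * (1 / 10)); last by field.
  by rewrite (_ : A * 5%:R ^+ 4 = A * 625)//; ring.
have {}ih := ih ht.
have -> : (2 * t.+1 - 2 = (2 * t - 2) + 2)%N by lia.
have r : t.+2%:R ^+ 4 * Q ^+ 2 <= t.+1%:R ^+ 4 * (1 / 10).
  have a : t.+2%:R * 5 <= t.+1%:R * 6 :> R by rewrite -!natrM ler_nat; lia.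
  have b : t.+2%:R ^+ 4 <= t.+1%:R ^+ 4 * (6 / 5) ^+ 4 :> R.
    by rewrite -exprMn lerXn2r// ?nnegrE// ?mulr_ge0//; lra.
  have c : Q ^+ 2 <= 31/1000 by nra.
  apply: le_trans (ler_pM _ _ b c) _; rewrite ?exprn_ge0//.
  rewrite -mulrA ler_wpM2l ?exprn_ge0//; lra.
rewrite exprD [(1 / 10) ^+ t.+1]exprS; have p1 : 0 <= Q ^+ (2 * t - 2) by rewrite exprn_ge0.
apply: (@le_trans _ _ (A * t.+1%:R ^+ 4 * Q ^+ (2 * t - 2) * (1 / 10))).
  have := ler_wpM2l A0 (ler_wpM2r p1 r).
  move: (Q ^+ (2 * t - 2)) (Q ^+ 2) (t.+2%:R ^+ 4) (t.+1%:R ^+ 4); clear => a b c d.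
  by congr (_ <= _); ring.
by rewrite [leRHS]mulrCA [leRHS]mulrC ler_wpM2r//; clear; lra.
Qed.

(** [cl] and [ch] bound [l^2] and [l] when [3 l^2 <= 4 N]; at the norms 4 and 7, which carry most of
    the sum, the integrality of [l] is exploited. *)
Definition cl (N : nat) : R := if N == 4%N then 4 else if N == 7%N then 9 else 4 / 3 * N%:R.
Definition ch (N : nat) : R := if N == 4%N then 2 else if N == 7%N then 3 else N%:R / 3.

Lemma cl_ge0 N : 0 <= cl N.
Proof. by rewrite /cl; case: ifP => // _; case: ifP => // _; rewrite mulr_ge0// divr_ge0. Qed.
Lemma ch_ge0 N : 0 <= ch N.
Proof. by rewrite /ch; case: ifP => // _; case: ifP => // _; rewrite divr_ge0. Qed.

Lemma word_cl (l N : nat) : (3 * l ^ 2 <= 4 * N)%N -> l%:R ^+ 2 <= cl N.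
Proof.
move=> h; rewrite /cl; case: ifP => [/eqP e|_]; last case: ifP => [/eqP e|_].
  have : (l <= 2)%N by move: h; rewrite e; nia.
  by case: l {h} => [|[|[|//]]] _; lra.
  have : (l <= 3)%N by move: h; rewrite e; nia.
  by case: l {h} => [|[|[|[|//]]]] _; lra.
have : (3 * l ^ 2)%:R <= (4 * N)%:R :> R by rewrite ler_nat.
by rewrite !natrM; lra.
Qed.

Lemma word_ch (l N : nat) : (3 * l ^ 2 <= 4 * N)%N -> (3 < N)%N -> (N %% 3 == 1)%N -> l%:R <= ch N.
Proof.
move=> h N3 N1; rewrite /ch; case: ifP => [/eqP e|/eqP n4]; last case: ifP => [/eqP e|/eqP n7].
  have : (l <= 2)%N by move: h; rewrite e; nia.
  by case: l {h} => [|[|[|//]]] _; lra.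
  have : (l <= 3)%N by move: h; rewrite e; nia.
  by case: l {h} => [|[|[|[|//]]]] _; lra.
have : (3 * l <= N)%N.
  have [N10|N13] : N = 10%N \/ (13 <= N)%N by clear h; lia.
    by rewrite N10 in h *; clear -h; nia.
  by clear -h N13; nia.
by rewrite -(ler_nat R) natrM; lra.
Qed.

Lemma sq_nat_bound (p : nat * nat) : (3 < p.1 + p.2)%N ->
  (secN p)%:R <= (p.1 + p.2).+1%:R ^+ 4 / 25 :> R /\ (secN p)%:R <= (p.1 + p.2).+1%:R ^+ 2 :> R.
Proof.
move=> ht; have [_ s2] := secN_tri p; have s3 : (secN p)%:R <= (p.1 + p.2).+1%:R ^+ 2 :> R.
  by rewrite -natrX ler_nat.
split=> //; apply: le_trans s3 _.
have h5 : 5 <= (p.1 + p.2).+1%:R :> R by rewrite ler_nat; lia.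
move: ((p.1 + p.2).+1%:R : R) h5 => T h5; rewrite (exprM T 2 2).
have : 25 <= T ^+ 2 by nra.
move: (T ^+ 2) => U hU; nra.
Qed.

Lemma big_secN (p : nat * nat) : (3 < p.1 + p.2)%N -> (secN p == 4%N) = false /\ (secN p == 7%N) = false.
Proof. by move=> ht; have [s1 _] := secN_tri p; split; apply/eqP; nia. Qed.

Lemma sum_far (Q : R) : 0 <= Q -> Q <= 11/80 -> bsum (fun p : nat * nat => GII cl Q (secN p)) (942/1000).
Proof.
move=> Q0 Q1; have q2 : Q ^+ 2 <= 19/1000 by nra.
have q4 : Q ^+ 4 <= 37/1000 * (1/100).
  by rewrite (exprM Q 2 2); have := sqr_ge0 Q; move: (Q ^+ 2) q2; clear => F *; nra.
have q5 : Q ^+ 5 <= 6/1000 * (1/100).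
  by rewrite (exprS Q 4); have := exprn_ge0 4 Q0; move: (Q ^+ 4) q4 => F f1 f2; clear -Q0 Q1 f1 f2; nra.
have q6 : Q ^+ 6 <= 1/1000 * (1/100).
  by rewrite (exprS Q 5); have := exprn_ge0 5 Q0; move: (Q ^+ 5) q5 => F f1 f2; clear -Q0 Q1 f1 f2; nra.
apply: (@bsum_weaken _ _ _ (55/100 + 2 * (171/1000) + 10 * (5/1000))); first by lra.
apply: bsum_GII => //.
  exact: cl_ge0.
  by rewrite /cl /=; lra.
  by rewrite /cl /=; lra.
apply: (@GII_tail _ _ (4/75)) => //.
  exact: cl_ge0.
  by lra.
  move=> p ht; rewrite /cl; have [-> ->] := big_secN ht.
  by have [h _] := sq_nat_bound ht; lra.
  by rewrite /cl /=; lra.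
  by rewrite /cl /=; lra.
by lra.
Qed.
Lemma near_pow (Q : R) : 0 <= Q -> Q <= 174/1000 ->
  [/\ Q ^+ 2 <= 303/1000 * (1/10), Q ^+ 4 <= 92/1000 * (1/100), Q ^+ 5 <= 17/1000 * (1/100) &
      Q ^+ 6 <= 28/1000 * (1/1000)].
Proof.
move=> Q0 Q1; have q2 : Q ^+ 2 <= 3028/1000 * (1/100) by nra.
have q4 : Q ^+ 4 <= 917/1000 * (1/1000).
  by rewrite (exprM Q 2 2); have := sqr_ge0 Q; move: (Q ^+ 2) q2; clear => F *; nra.
have q5 : Q ^+ 5 <= 17/1000 * (1/100).
  by rewrite (exprS Q 4); have := exprn_ge0 4 Q0; move: (Q ^+ 4) q4 => F f1 f2; clear -Q0 Q1 f1 f2; nra.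
split=> //; [lra|lra|].
rewrite (exprD Q 4 2); have := exprn_ge0 4 Q0; have := sqr_ge0 Q.
by move: (Q ^+ 4) (Q ^+ 2) q4 q2; clear => F G *; nra.
Qed.

Lemma sum_hole (Q : R) : 0 <= Q -> Q <= 174/1000 ->
  bsum (fun p : nat * nat => GII ch Q (secN p)) (556/1000).
Proof.
move=> Q0 Q1; have [q2 q4 q5 q6] := near_pow Q0 Q1.
apply: (@bsum_weaken _ _ _ (348/1000 + 2 * (909/1000 * (1/10)) + 5 * (5/1000))); first by lra.
apply: bsum_GII => //.
  exact: ch_ge0.
  by rewrite /ch /=; lra.
  by rewrite /ch /=; lra.
apply: (@GII_tail _ _ (1/75)) => //.
  exact: ch_ge0.
  by move=> p ht; rewrite /ch; have [-> ->] := big_secN ht; have [h _] := sq_nat_bound ht; lra.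
  by rewrite /ch /=; lra.
  by rewrite /ch /=; lra.
by lra.
Qed.

(** The weights [k - 1], with [k = (N - 1) / 3], come from [near_critical]. *)
Definition ck (N : nat) : R := (N.-1 %/ 3).-1%:R * cl N.

Lemma sum_crit (Q : R) : 0 <= Q -> Q <= 174/1000 ->
  bsum (fun p : nat * nat => GII ck Q (secN p)) (947/1000).
Proof.
move=> Q0 Q1; have [q2 q4 q5 q6] := near_pow Q0 Q1.
have ck0 n : 0 <= ck n by rewrite mulr_ge0 ?cl_ge0.
apply: (@bsum_weaken _ _ _ (0 + 2 * (273/1000) + 80 * (5/1000))); first by lra.
apply: bsum_GII => //.
  by rewrite /ck /= mul0r mul0r.
  by rewrite /ck /cl /= mul1r; lra.
apply: (@GII_tail _ _ (4/9)) => //.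
  move=> p ht; rewrite /ck /cl; have [-> ->] := big_secN ht; have [_ h] := sq_nat_bound ht.
  set T := _.+1%:R in h *; rewrite (exprM T 2 2).
  have k3 : ((secN p).-1 %/ 3)%N.-1%:R <= (secN p)%:R / 3 :> R.
    have : (3 * ((secN p).-1 %/ 3).-1 <= secN p)%N by move: (secN p) => j; clear; lia.
    by rewrite -(ler_nat R) natrM; lra.
  have := ler0n R ((secN p).-1 %/ 3)%N.-1; have := ler0n R (secN p).
  move: (((secN p).-1 %/ 3)%N.-1%:R : R) ((secN p)%:R : R) (T ^+ 2) k3 h; clear => a b c h1 h2 h3 h4.
  have h5 : a * b <= b / 3 * b by rewrite ler_wpM2r.
  have h6 : b * b <= c * c by apply: ler_pM.
  by rewrite mulrCA [c ^+ 2]expr2; lra.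
  by rewrite /ck /cl /=; lra.
  by rewrite /ck /cl /=; lra.
by lra.
Qed.

End ZeroFree.

(** * Zeros of the series of type I *)

Section PhiZeros.
Variable R : realType.
Local Notation C := R[i].
Local Notation w := (w3 R).
Local Notation s_ := ((ss R)%:C : C).
Local Notation q0 := (q0 R).
Local Notation hh := (hh R).
Local Notation ei := (ei R).
Implicit Types (p b a : eis) (x z tau : C).

Lemma ler_sq (a b : R) : 0 <= a -> 0 <= b -> a ^+ 2 <= b ^+ 2 -> a <= b.
Proof. by move=> a0 b0; rewrite ler_pXn2r ?nnegrE. Qed.

Lemma ei00 : ei (0, 0) = 0. Proof. by rewrite /ei/= !mulr0z mul0r addr0. Qed.

Lemma cabs_hh : cabs hh ^+ 2 = 1 / 3.
Proof.
have -> : hh = ((3 : R)^-1)%:C * - (1 + 2 * w) by rewrite hhE CV Cnat mulrC.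
by have t2 := sq3_sqr R; rewrite cabs_sqr !ReIm Re_w3 Im_w3; field: t2.
Qed.
Lemma hhJ : hh^* = - hh.
Proof. by rewrite hhE !cJ; field. Qed.

Lemma Pht_split (tau u2 u3 pm pa p2 p3 : C) p :
  Pht tau u2 u3 pm pa p2 p3 p = Pht 0 u2 u3 pm pa p2 p3 p *
   cexp (- (2 * s_ * (cabs (ei p + pa) ^+ 2)%:C * tau)).
Proof.
rewrite /Pht mulrAC /Ph1 -cexpD; congr (cexp _ * _).
by rewrite -mulcJ; move: (ei p + pa) => mu; ring.
Qed.

Lemma cexp_tau_nat (c : R) n tau : cexp (- (2 * s_ * (c + n%:R)%:C * tau)) =
  cexp (- (2 * s_ * c%:C * tau)) * cexp (- (2 * s_ * tau)) ^+ n.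
Proof. by rewrite -cexpMn -cexpD; congr cexp; rewrite CD Cnat -mulr_natr; ring. Qed.

Lemma cabs_X tau : cabs (cexp (- (2 * s_ * tau))) = expR (- (2 * ss R * Re tau)).
Proof. by rewrite cabs_cexp ReN Re_2s. Qed.

Lemma X0E : cexp (- (2 * s_ * (1 + w))) = - q0%:C.
Proof.
have -> : - (2 * s_ * (1 + w)) = - (s_ * (1 + 2 * w)) + (- ss R)%:C by rewrite CN; ring.
by rewrite cexpD cexpN -piIE cexp_piI cexpR -q0E invrN1 mulN1r.
Qed.

(** The constant of [rho_le_hh], kept as an atom until [cIE] is applied. *)
Definition cI : R := locked (1047/1000).
Lemma cIE : cI = 1047/1000. Proof. by rewrite /cI -lock. Qed.
Lemma cI_ge0 : 0 <= cI. Proof. by rewrite cIE; lra. Qed.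

Definition yeq tau u2 u3 (y : R) := 0 < y /\ y%:C = tau + tau^* - u2 * u2^* - u3 * u3^*.

Lemma PhtI0 tau u2 u3 pm : Pht tau u2 u3 pm 0 hh hh (0, 0) = sg hh * sg hh.
Proof.
rewrite /Pht /Ph1 ei00 addr0 !(mul0r, mulr0, conj0, subr0, add0r, addr0, oppr0) cexp0 mul1r.
by rewrite sgN mulrNN.
Qed.

(** The leading term contains [rho hh] twice, nearly the largest possible value, so every other term
    is smaller by its Gaussian factor. *)
Lemma PhtI_bound tau u2 u3 pm y p : yeq tau u2 u3 y -> cabs (Pht tau u2 u3 pm 0 hh hh p) <=
  cI * cabs (Pht tau u2 u3 pm 0 hh hh (0, 0)) * expR (- (ss R * y)) ^+ nb p.
Proof.
move=> [y0 yE].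
have e1 := cabs_Pht2 pm 0 hh hh yE p; have e0 := cabs_Pht2 pm 0 hh hh yE (0, 0).
rewrite ei00 !addr0 in e1 e0; rewrite cabs0 expr0n /= mulr0 oppr0 expR0 mulr1 !mul0r sub0r rhoN in e0.
have K := Ks_gt0 R; apply: ler_sq; first exact: cabs_ge0.
  by rewrite !mulr_ge0 ?cI_ge0 ?cabs_ge0 ?exprn_ge0 ?expR_ge0.
rewrite -(@ler_pM2l _ (Ks R ^+ 2)) ?exprn_gt0// e1.
set P0 := Pht _ _ _ _ _ _ _ _ in e0 *.
have -> : Ks R ^+ 2 * (cI * cabs P0 * expR (- (ss R * y)) ^+ nb p) ^+ 2 =
  cI ^+ 2 * (Ks R ^+ 2 * cabs P0 ^+ 2) * (expR (- (ss R * y)) ^+ nb p) ^+ 2 by ring.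
rewrite e0.
have -> : (expR (- (ss R * y)) ^+ nb p) ^+ 2 = expR (- (2 * ss R * y * cabs (ei p) ^+ 2)).
  by rewrite -exprM -expRM_natl -en_cabs -(nbR R) natrM; congr expR; ring.
have r1 := rho_le_hh (ei p * u2 - hh); have r2 := rho_le_hh (ei p * u3 - hh).
rewrite -cIE in r1 r2; have := ler_pM (rho_ge0 _) (rho_ge0 _) r1 r2.
move: (expR_ge0 (2 * ss R * (cabs hh ^+ 2 + cabs hh ^+ 2))) (expR_ge0 (- (2 * ss R * y * cabs (ei p) ^+ 2))).
move: (expR _) (expR _) (rho _ * rho _) (rho hh) => A B E r A0 B0 h.
have := ler_wpM2l (mulr_ge0 A0 B0) h; congr (_ <= _); ring.
Qed.

Lemma sg_hh2_gt0 : 0 < cabs (sg hh * sg hh).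
Proof. by rewrite cabsM mulr_gt0 ?cabs_gt0 ?sg_hh_neq0. Qed.

Lemma nb_eq0 b : (nb b == 0%N) = (b == (0, 0)).
Proof.
apply/eqP/eqP => [h|->//]; have : (nb b < 3)%N by rewrite h.
move/nb_small3; rewrite inE => /orP[/eqP//|hb]; exfalso; move: h.
have H : all (fun b => nb b != 0%N) U6 by vm_compute.
by move/eqP; apply/negP; exact: (allP H b hb).
Qed.

Lemma typeI_far tau u2 u3 pm y : yeq tau u2 u3 y -> 11/10 <= y -> Phi tau u2 u3 pm 0 hh hh <> 0.
Proof.
move=> hyE hy; apply/eqP; have n0 := sg_hh2_gt0; have hb p := PhtI_bound pm p hyE; have [y0 yE] := hyE.
have Q1 := Q_far hy; have Q0 := expR_ge0 (- (ss R * y)); move: (expR _) Q0 Q1 hb => Q Q0 Q1 hb.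
set N0 := cabs _ in n0.
have {}hb p : cabs (Pht tau u2 u3 pm 0 hh hh p) <= cI * N0 * Q ^+ nb p.
  by have := hb p; rewrite PhtI0.
have Qlt : Q < 1 by lra.
apply: (@has_sum_neq0 _ _ _ _ [:: (0, 0)] (cI * N0 * (844/1000)) isT (PhiP pm 0 hh hh y0 yE)).
  have K : 0 <= cI * N0 by rewrite mulr_ge0 ?cI_ge0 ?cabs_ge0.
  have S := @bsum_norm_tail R Q 1 [::] isT Q0 Qlt isT; rewrite big_nil subr0 in S.
  have {}S := S (fun v (h : v \in [::]) => ltac:(by [])).
  have q2 : Q ^+ 2 <= 19/1000 by clear -Q0 Q1; nra.
  have q3 : Q ^+ 3 <= 27/1000 * (1/10).
    by rewrite exprS; have := sqr_ge0 Q; move: (Q ^+ 2) q2 => F f1 f2; clear -Q0 Q1 f1 f2; nra.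
  have M : 6 * (Q * ((1 - Q ^+ 3) * (1 - Q ^+ 2))^-1) <= 844/1000.
    have v : ((1 - Q ^+ 3) * (1 - Q ^+ 2))^-1 <= 1023/1000.
      move: (Q ^+ 3) (Q ^+ 2) q3 q2; clear => a b ha hb.
      rewrite -[leLHS]mul1r ler_pdivrMr; last by apply: mulr_gt0; lra.
      apply: (@le_trans _ _ (1023/1000 * ((1 - 27/1000 * (1/10)) * (1 - 19/1000)))); first by lra.
      have f : (1 - 27/1000 * (1/10)) * (1 - 19/1000) <= (1 - a) * (1 - b) by apply: ler_pM; lra.
      by move: (_ * _) ((1 - a) * (1 - b)) f => F G f; lra.
    by move: (_^-1) v => V v; clear -v Q0 Q1; nra.
  apply: bsum_le (bsumZ K (bsum_weaken M S)) => p.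
  rewrite inE -nb_eq0 ltnS leqn0; case: ifP => _; [by rewrite mulr0|exact: hb].
by rewrite big_seq1 PhtI0 -/N0 cIE; clear -n0; lra.
Qed.

(** Outside this region the larger of the two squares exceeds [1/64], the threshold of [L_real]. *)
Definition near u2 u3 : Prop := cabs u2 ^+ 2 + cabs u3 ^+ 2 <= 1/32 :> R.

Lemma yeq0 u2 u3 : near u2 u3 -> yeq (1 + w) u2 u3 (1 - cabs u2 ^+ 2 - cabs u3 ^+ 2).
Proof.
rewrite /near => uu; split; first by lra.
by rewrite !mulcJ !cJ !CD !CN C1 ?C1; ring.
Qed.

Definition Qn : R := expR (- (ss R * (31/32))).
Lemma Qn_ge0 : 0 <= Qn. Proof. exact: expR_ge0. Qed.
Lemma Qn_le : Qn <= 174/1000.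
Proof.
have [h _] := En_bounds R; apply: le_trans h; rewrite /Qn /En -expRM_natl ler_expR; lra.
Qed.

Lemma Q_near u2 u3 : near u2 u3 -> expR (- (ss R * (1 - cabs u2 ^+ 2 - cabs u3 ^+ 2))) <= Qn.
Proof. by rewrite /near => uu; rewrite ler_expR lerN2 ler_wpM2l ?(ltW (ss_gt0 R))//; lra. Qed.

Lemma X_le tau : 1/2 <= Re tau -> cabs (cexp (- (2 * s_ * tau))) <= q0.
Proof.
move=> h; rewrite cabs_X q0E ler_expR; have := ler_wpM2l (ltW (ss_gt0 R)) h; lra.
Qed.

Lemma X0_cabs : cabs (cexp (- (2 * s_ * (1 + w)))) = q0.
Proof. by rewrite X0E cabsN cabsC ger0_norm ?q0_ge0. Qed.

(** Coefficients of the series as a power series in [X = exp(- 2 s tau)], with exponent [nb p]. *)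
Definition ti u2 u3 pm p : C := Pht 0 u2 u3 pm 0 hh hh p.
Lemma ti_split u2 u3 pm tau p : Pht tau u2 u3 pm 0 hh hh p = ti u2 u3 pm p * cexp (- (2 * s_ * tau)) ^+ nb p.
Proof.
rewrite Pht_split addr0 -en_cabs -(nbR R) -[(nb p)%:R]add0r cexp_tau_nat.
by rewrite !(mulr0, mul0r) oppr0 cexp0 mul1r.
Qed.

Definition N0 : R := cabs (sg hh * sg hh).

Lemma ti_bound u2 u3 pm p : near u2 u3 -> cabs (ti u2 u3 pm p) * q0 ^+ nb p <= cI * N0 * Qn ^+ nb p.
Proof.
move=> uu; have := PhtI_bound pm p (yeq0 uu).
rewrite PhtI0 ti_split cabsM cabsX X0_cabs => /le_trans; apply.
rewrite ler_wpM2l ?mulr_ge0 ?cI_ge0 ?cabs_ge0// lerXn2r ?nnegrE ?expR_ge0 ?Qn_ge0//.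
exact: Q_near.
Qed.

Lemma ti0 u2 u3 pm : ti u2 u3 pm (0, 0) = sg hh * sg hh. Proof. exact: PhtI0. Qed.

Lemma has_sum_ti u2 u3 pm tau y : yeq tau u2 u3 y ->
  has_sum (fun p => ti u2 u3 pm p * cexp (- (2 * s_ * tau)) ^+ nb p) (Phi tau u2 u3 pm 0 hh hh).
Proof. by move=> [h1 h2]; apply: eq_has_sum (PhiP pm 0 hh hh h1 h2) => p; rewrite ti_split. Qed.

Lemma tl1_Qn : tl1 Qn <= 387/1000 * (1/10).
Proof.
apply: le_trans (@tl1_le _ Qn (174/1000) (53/1000 * (1/10)) (303/1000 * (1/10)) (1037/1000) Qn_ge0 Qn_le _ _ _ _ _) _.
all: clear; lra.
Qed.

Lemma nb_lt3 p : (nb p < 3)%N -> (nb p < 2)%N.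
Proof.
move/nb_small3 => hp; have H : all (fun b => (nb b < 2)%N) ((0, 0) :: U6) by vm_compute.
exact: (allP H p hp).
Qed.

Lemma pred_pow2 n : (2 < n)%N -> n.-1%:R <= 4^-1 * 2 ^+ n :> R.
Proof.
case: n => [|[|[|n]]] // _; rewrite [_.-1]/= !exprS.
have h : (n.+1)%:R <= 2 ^+ n :> R by rewrite -natrX ler_nat ltn_expl.
have g : 1 <= n.+1%:R :> R by rewrite ler1n.
rewrite -[n.+2%:R]natr1; move: (2 ^+ n) (n.+1%:R) h g => F G; clear; lra.
Qed.

(** At [tau = 1 + w] the variable is [X = - q0], and the series vanishes there on account of a
    mirror. A second zero with [|X| <= q0] must coincide with it by [near_critical]. *)
Lemma typeI_crit u2 u3 tau y : near u2 u3 -> yeq tau u2 u3 y -> 1/2 <= Re tau ->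
  Phi (1 + w) u2 u3 0 0 hh hh = 0 -> Phi tau u2 u3 0 0 hh hh = 0 ->
  cexp (- (2 * s_ * tau)) = - q0%:C.
Proof.
move=> uu hy ht c0 c1; rewrite -X0E; have n0 : 0 < N0 := sg_hh2_gt0.
have s1 := has_sum_ti 0 hy; have s2 := has_sum_ti 0 (yeq0 uu); rewrite c1 in s1; rewrite c0 in s2.
have K : 0 <= cI * N0 by rewrite mulr_ge0 ?cI_ge0 ?cabs_ge0.
have r0 : 0 <= 2 * Qn by have := Qn_ge0; lra.
have r1 : 2 * Qn < 1 by have := Qn_le; lra.
(* The weights [n - 1] of [near_critical] are absorbed by [2^n / 4], hence the argument [2 * Qn]. *)
have T : 4^-1 * tl1 (2 * Qn) <= 1/10.
  have Q1 : 2 * Qn <= 348/1000 by have := Qn_le; lra.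
  have := @tl1_le _ (2 * Qn) (348/1000) (43/1000) (122/1000) (1191/1000) r0 Q1.
  clear; move: (tl1 _) => F H; have : F <= 6 * (348/1000) * (1191/1000 - 1) by apply: H; lra.
  lra.
have Z4 : 0 <= 4^-1 :> R by rewrite invr_ge0.
have B := bsumZ K (bsum_weaken T (bsumZ Z4 (bsum_tl1 r0 r1))).
apply: (@near_critical _ _ (ti u2 u3 0) nb [:: (0, 0)] _ _ q0 _ isT _ _ _ s1 s2 (bsum_le _ B)).
  by move=> i; rewrite inE nb_eq0.
  exact: X_le.
  by rewrite X0_cabs.
  move=> p; apply: le_trans (ler_wpM2l (ler0n _ _) (ti_bound 0 p uu)) _.
  rewrite mulrCA ler_wpM2l//; case: ifP => [|/negbT].
    by move/nb_lt3; case: (nb p) => [|[|//]] _; rewrite ?mul0r ?mulr0.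
  rewrite -leqNgt => h3; rewrite exprMn mulrA ler_wpM2r ?exprn_ge0 ?Qn_ge0//.
  exact: pred_pow2.
by rewrite big_seq1 ti0 -/N0 cIE; clear -n0; lra.
Qed.

Lemma sqr_lt (x y : R) : 0 <= x -> x < y -> x ^+ 2 < y ^+ 2.
Proof. by move=> x0 xy; rewrite ltr_pXn2r ?nnegrE// ltW// (le_lt_trans x0). Qed.

Lemma unit_ineq (N A B : R) : 0 < N -> 959/1000 * N <= A -> A <= 1041/1000 * N -> 0 <= B ->
  A ^+ 2 + B ^+ 2 <= 12/10 * N ^+ 2 -> A + 1733/1000 * B <= 189/100 * N.
Proof.
move=> n0 h1 h2 b0 h; rewrite leNgt; apply/negP => hc.
have hd : 0 <= 189/100 * N - A by lra.
have : (189/100 * N - A) ^+ 2 < (1733/1000 * B) ^+ 2 by apply: sqr_lt => //; lra.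
have : 0 <= (A - 959/1000 * N) * (1041/1000 * N - A) by clear - h1 h2; apply: mulr_ge0; lra.
have := mulr_ge0 (ltW n0) hd; have : 0 <= N * (A - 959/1000 * N) by clear - n0 h1; apply: mulr_ge0; lra.
nra.
Qed.

Lemma ti_char u2 u3 (k : R) p :
  ti u2 u3 (k%:C * hh) p = cexp (2 * s_ * (k * (2 * Re (ei p)))%:C * hh) * ti u2 u3 0 p.
Proof.
rewrite /ti /Pht [RHS]mulrA; congr (_ * _); rewrite /Ph1 -[RHS]cexpD; congr cexp.
have -> : (k * (2 * Re (ei p)))%:C = k%:C * (ei p + (ei p)^*).
  by rewrite CM; congr (_ * _); apply: complexP; rewrite !ReIm; ring.
by rewrite addr0 conjM conjR hhJ conj0; ring.
Qed.

Lemma char_val (k : R) (c : C) : k ^+ 2 = 1 -> c = (if k == 1 then w else w^*) ->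
  cexp (2 * s_ * (k * 2)%:C * hh) = c /\ cexp (2 * s_ * (k * (-1))%:C * hh) = c.
Proof.
move=> k2 ->; have hw := w3_sqr R; have e := cexp_2pi3 R.
have eV : cexp (- (s_ * (1 + 2 * w) * (2 / 3))) = w^*.
  have wn : w != 0 by rewrite -e cexp_neq0.
  by rewrite cexpN e; apply: (mulfI wn); rewrite mulfV// w3J; ring: hw.
have kk : k = 1 \/ k = -1.
  have : (k - 1) * (k + 1) = 0 by rewrite -subr_sqr k2 expr1n subrr.
  by move/eqP; rewrite mulf_eq0 subr_eq0 addr_eq0 => /orP[]/eqP; [left|right].
have n1 : (-1 == 1 :> R) = false by apply/eqP; lra.
case: kk => ->; rewrite ?eqxx ?n1.
  rewrite !mul1r CN C1 Cnat hhE; split; rewrite -[RHS]e; last by congr cexp; field.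
  by apply: (@cexp_eq _ (-1)); rewrite intrN; field.
rewrite mulN1r mulrNN mul1r !CN C1 Cnat hhE; split; rewrite -[RHS]eV; last by congr cexp; field.
by apply: (@cexp_eq _ 1); field.
Qed.

Lemma cabs3_le (a b c : C) (q M : R) : 0 <= q -> cabs a * q <= M -> cabs b * q <= M -> cabs c * q <= M ->
  q * cabs (a + b + c) <= 3 * M.
Proof.
move=> q_ge0 h1 h2 h3; have := ler_wpM2l q_ge0 (cabsD (a + b) c); have := ler_wpM2l q_ge0 (cabsD a b); lra.
Qed.

Lemma sq_le3 (x N : R) : 0 <= x -> x <= 547/1000 * N -> x ^+ 2 <= 3/10 * N ^+ 2.
Proof.
move=> x_ge0 h; have N_ge0 : 0 <= N by lra.
have := ler_pM x_ge0 x_ge0 h h; have := mulr_ge0 N_ge0 N_ge0; rewrite !expr2; move: (x * x) => X.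
have -> : 547/1000 * N * (547/1000 * N) = (547/1000 * (547/1000)) * (N * N) by clear; ring.
by move: (N * N) => M; clear; lra.
Qed.

Lemma char_contra (x x' S0 X : C) (k : R) : 0 < N0 -> cabs X <= q0 ->
  q0 * cabs x <= 3 * (cI * N0 * Qn) -> q0 * cabs x' <= 3 * (cI * N0 * Qn) -> N0 = cabs S0 ->
  cabs (S0 - q0%:C * (x + x')) <= cI * N0 * (387/1000 * (1/10)) ->
  ~ cabs (S0 + X * ((if k == 1 then w else w^*) * x + (if k == 1 then w else w^*)^* * x')) <= cI * N0 * (387/1000 * (1/10)).
Proof.
set c := if k == 1 then w else w^*.
move=> n0 XL xb xb' NE h2 h1.
have par : cabs (x + x') ^+ 2 + cabs (x - x') ^+ 2 = 2 * cabs x ^+ 2 + 2 * cabs x' ^+ 2.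
  by rewrite !cabs_sqr !ReIm; ring.
have [t1 t2] := sq3_bounds R.
have cx : cabs (c * x + c^* * x') <= (cabs (x + x') + 1733/1000 * cabs (x - x')) / 2.
  have -> : c * x + c^* * x' = - (1 / 2) * (x + x') + (c - c^*) / 2 * (x - x').
    have -> : c^* = - 1 - c by rewrite /c; case: ifP => _; rewrite ?cJ; ring.
    by field.
  have e2 : cabs ((c - c^*) / 2) = sq3 R / 2.
    rewrite cabsM cabsV -[2]/(2%:R) -(Cnat R 2) cabsC normr_nat; congr (_ / _).
    have -> : cabs (c - c^*) = cabs (w - w^*) by rewrite /c; case: ifP => _ //; rewrite conjKc cabsB.
    by apply/eqP; rewrite -(@eqrXn2 _ 2)// ?cabs_ge0 ?ltW ?sq3_gt0// cabs_sqr !ReIm Re_w3 Im_w3; apply/eqP; field.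
  apply: le_trans (cabsD _ _) _; rewrite (cabsM (- _)) (cabsM (_ / _)) e2 cabsN.
  have -> : cabs (1 / 2 : C) = 1 / 2 by rewrite -(Cnat R 2) -(C1 R) -CV -CM cabsC ger0_norm//; lra.
  have := ler_wpM2r (cabs_ge0 (x - x')) t2; lra.
have qp := q0_ge0 R; have QL := Qn_le; have Q0 := Qn_ge0.
have M : cI * N0 * Qn <= 1822/1000 * (1/10) * N0.
  by rewrite cIE mulrAC ler_wpM2r ?(ltW n0)//; clear -QL; lra.
have eps : cI * N0 * (387/1000 * (1/10)) <= 41/1000 * N0 by rewrite cIE; clear -n0; lra.
have A1 : 959/1000 * N0 <= q0 * cabs (x + x') /\ q0 * cabs (x + x') <= 1041/1000 * N0.
  have e : q0 * cabs (x + x') = cabs (q0%:C * (x + x')) by rewrite cabsM cabsC ger0_norm.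
  rewrite e; have := cabs_leB S0 (q0%:C * (x + x')); have := cabs_leB (q0%:C * (x + x')) S0.
  rewrite cabsB -NE; move: h2 eps; clear; move: (cabs _) (cabs _) (cI * N0 * _) => u v e; split; lra.
have [A1a A1b] := A1.
have AB : (q0 * cabs (x + x')) ^+ 2 + (q0 * cabs (x - x')) ^+ 2 <= 12/10 * N0 ^+ 2.
  have -> : (q0 * cabs (x + x')) ^+ 2 + (q0 * cabs (x - x')) ^+ 2 = 2 * (q0 * cabs x) ^+ 2 + 2 * (q0 * cabs x') ^+ 2.
    by rewrite !exprMn -mulrDr par; ring.
  have z1 : 0 <= q0 * cabs x by rewrite mulr_ge0 ?cabs_ge0.
  have z2 : 0 <= q0 * cabs x' by rewrite mulr_ge0 ?cabs_ge0.
  have K : 3 * (cI * N0 * Qn) <= 547/1000 * N0 by move: M n0; move: (cI * N0 * Qn) N0; clear => a b; lra.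
  have b1 := sq_le3 z1 (le_trans xb K); have b2 := sq_le3 z2 (le_trans xb' K).
  by move: (_ ^+ 2) (_ ^+ 2) (N0 ^+ 2) b1 b2 => a b n; clear; lra.
have B0 : 0 <= q0 * cabs (x - x') by rewrite mulr_ge0 ?cabs_ge0.
have F := unit_ineq n0 A1a A1b B0 AB.
have G : cabs (X * (c * x + c^* * x')) <= 945/1000 * N0.
  rewrite cabsM; apply: le_trans (ler_wpM2r (cabs_ge0 _) XL) _.
  apply: le_trans (ler_wpM2l qp cx) _; move: F; clear; move: (cabs _) (cabs _) => u v; lra.
have := cabs_leD S0 (X * (c * x + c^* * x')); rewrite -NE.
move: h1 eps G n0; clear; move: (cabs _) (cabs _) (cI * N0 * _) => u v e; lra.
Qed.

Lemma six_a (S a b c d e f q : C) : S + (a * - q + (b * - q + (c * - q + (d * - q + (e * - q + f * - q))))) =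
  S - q * (a + c + f + (b + d + e)).
Proof. by ring. Qed.

Lemma six_b (S a b c d e f q g g' : C) :
  S + (g * a * q + (g' * b * q + (g * c * q + (g' * d * q + (g' * e * q + g * f * q))))) =
  S + q * (g * (a + c + f) + g' * (b + d + e)).
Proof. by ring. Qed.

(** For [pm = hh] or [- hh] the six units are twisted by a cubic character: the cube roots of unity
    receive [c], their negatives [c^*]. The zero at the critical point of the untwisted series
    excludes a zero of the twisted one. *)
Lemma typeI_char u2 u3 tau y (k : R) : k ^+ 2 = 1 -> near u2 u3 -> yeq tau u2 u3 y -> 1/2 <= Re tau ->
  Phi (1 + w) u2 u3 0 0 hh hh = 0 -> Phi tau u2 u3 (k%:C * hh) 0 hh hh <> 0.
Proof.
move=> k2 uu hy ht c0 c1.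
have n0 : 0 < N0 := sg_hh2_gt0; have hw := w3_sqr R.
have s1 := has_sum_ti (k%:C * hh) hy; have s2 := has_sum_ti 0 (yeq0 uu); rewrite c1 in s1; rewrite c0 in s2.
have K : 0 <= cI * N0 by rewrite mulr_ge0 ?cI_ge0 ?cabs_ge0.
pose L : seq eis := (0, 0) :: U6.
have T : tl1 Qn <= 387/1000 * (1/10) := tl1_Qn.
have Q1 : Qn < 1 by have := Qn_le; lra.
have B := bsumZ K (bsum_weaken T (bsum_tl1 Qn_ge0 Q1)).
pose T_ p := ti u2 u3 0 p.
pose x := T_ (0, 1) + T_ (1, 0) + T_ (-1, -1); pose x' := T_ (0, -1) + T_ (-1, 0) + T_ (1, 1).
pose X := cexp (- (2 * s_ * tau)).
have XL : cabs X <= q0 := X_le ht.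
pose c := if k == 1 then w else w^*.
have rest pm Y S : cabs Y <= q0 -> has_sum (fun p => ti u2 u3 pm p * Y ^+ nb p) S ->
    cabs (S - \sum_(p <- L) ti u2 u3 pm p * Y ^+ nb p) <= cI * N0 * (387/1000 * (1/10)).
  move=> hY hS; apply: has_sum_bound (has_sum_off (isT : uniq L) hS) _.
  apply: bsum_le B => p; case: ifP => [_|/negP hp].
    by rewrite cabs0; case: ifP => _; rewrite ?mulr0 ?mulr_ge0 ?exprn_ge0 ?Qn_ge0 ?cabs_ge0 ?cI_ge0.
  case: ifP => [/nb_small3//|_]; apply: le_trans (ti_bound pm p uu).
  by rewrite cabsM ler_wpM2l ?cabs_ge0// cabsX lerXn2r ?nnegrE ?cabs_ge0 ?q0_ge0.
have nU (b : eis) : b \in U6 -> nb b = 1%N.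
  have H : all (fun b => nb b == 1%N) U6 by vm_compute.
  by move=> hb; apply/eqP; exact: (allP H b hb).
have h2 := rest 0 _ _ (eq_ind_r (fun v => v <= q0) (lexx q0) X0_cabs) s2; have h1 := rest _ _ _ XL s1.
have tb b : b \in U6 -> cabs (T_ b) * q0 <= cI * N0 * Qn.
  by move=> hb; have := ti_bound 0 b uu; rewrite nU// !expr1.
have sumL (f : eis -> C) : \sum_(p <- L) f p = f (0, 0) + (f (0, 1) + (f (0, -1) + (f (1, 0) + (f (-1, 0) + (f (1, 1) + f (-1, -1)))))).
  by rewrite /L /U6 !big_cons big_nil addr0.
rewrite (sub0r (\sum_(p <- L) _)) cabsN (sumL (fun p => _)) (ti0 u2 u3 0) in h2.
rewrite (sub0r (\sum_(p <- L) _)) cabsN (sumL (fun p => _)) (ti0 u2 u3 (k%:C * hh)) in h1.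
move: h2 h1.
have -> : nb (0, 0) = 0%N by [].
rewrite !nU// !expr1 expr0 !mulr1 X0E -/X.
have [ca cb] := char_val k2 (erefl c).
have reU b v : Re (ei b) = v -> ti u2 u3 (k%:C * hh) b = cexp (2 * s_ * (k * (2 * v))%:C * hh) * T_ b.
  by move=> <-; rewrite ti_char.
have cN v : cexp (2 * s_ * (k * (2 * - v))%:C * hh) = (cexp (2 * s_ * (k * (2 * v))%:C * hh))^-1.
  by rewrite -cexpN; congr cexp; rewrite !mulrN CN mulrN mulNr.
have v1 : cexp (2 * s_ * (k * (2 * 1))%:C * hh) = c by rewrite mulr1.
have v2 : cexp (2 * s_ * (k * (2 * - (1 / 2)))%:C * hh) = c.
  by have -> : k * (2 * - (1 / 2)) = k * -1 by clear; field.
have cV : c^-1 = c^*.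
  have c1' : c * c^* = 1 by rewrite /c; case: ifP => _; rewrite ?cJ; ring: hw.
  have cn : c != 0 by apply/eqP => cz; move: c1'; rewrite cz mul0r => /eqP; rewrite eq_sym oner_eq0.
  by apply: (mulfI cn); rewrite mulfV// c1'.
have v1' : cexp (2 * s_ * (k * (2 * -1))%:C * hh) = c^* by rewrite cN v1.
have v2' : cexp (2 * s_ * (k * (2 * (1 / 2)))%:C * hh) = c^*.
  by rewrite -cV -v2 -cN opprK.
have [r1 r2 r3 r4] : [/\ Re (ei (0, 1)) = 1, Re (ei (0, -1)) = -1, Re (ei (1, 0)) = - (1 / 2) & Re (ei (-1, 0)) = 1 / 2].
  by clear; split; rewrite Re_ei; cbn [fst snd]; rewrite ?intrN ?mulr0z ?mulr1z; lra.
have [r5 r6] : Re (ei (1, 1)) = 1 / 2 /\ Re (ei (-1, -1)) = - (1 / 2).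
  by clear; split; rewrite Re_ei; cbn [fst snd]; rewrite ?intrN ?mulr0z ?mulr1z; lra.
rewrite (reU _ _ r1) (reU _ _ r2) (reU _ _ r3) (reU _ _ r4) (reU _ _ r5) (reU _ _ r6).
rewrite v1 v1' v2 v2'; set S0 := sg hh * sg hh; rewrite -!/(T_ _).
rewrite six_a six_b; fold x x'.
have xb := cabs3_le (q0_ge0 R) (tb (0, 1) isT) (tb (1, 0) isT) (tb (-1, -1) isT).
have xb' := cabs3_le (q0_ge0 R) (tb (0, -1) isT) (tb (-1, 0) isT) (tb (1, 1) isT).
move=> h2 h1; apply: (@char_contra x x' S0 X k n0 XL xb xb' _ h2 h1); by [].
Qed.
End PhiZeros.

(** * Zeros of the series of type II *)

Section PhiZerosII.
Variable R : realType.
Local Notation C := R[i].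
Local Notation w := (w3 R).
Local Notation s_ := ((ss R)%:C : C).
Local Notation q0 := (q0 R).
Local Notation hh := (hh R).
Local Notation ei := (ei R).
Local Notation Qn := (Qn R).
Implicit Types (p b a : eis) (x z tau : C).

(** The integers [1 + th p], congruent to 1 modulo [th]: the frequency [p + hh] is [hh] times such
    an integer, and [kE p] is its norm minus one, divided by three. *)
Definition aE p : eis := addE (0, 1) (mulE (2, 1) p).
Definition kE p : nat := (nb (aE p)).-1 %/ 3.

Lemma aE_num p : (aE p).1 = 2 * p.2 - p.1 /\ (aE p).2 = 1 + p.2 - 2 * p.1.
Proof. by case: p => x y; rewrite /aE /addE /mulE /=; split; ring. Qed.

Lemma aE_en p : en (aE p) = 1 + 3 * (en p - p.1).
Proof. by have [h1 h2] := aE_num p; rewrite /en h1 h2; ring. Qed.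

Lemma nb_aE p : nb (aE p) = (1 + 3 * kE p)%N.
Proof.
have h := aE_en p; have h2 := nbE (aE p); have h3 := nbE p; rewrite h in h2.
have h4 : 0 <= en p - p.1.
  rewrite /en; case: (p) => x y /=; have s : 0 <= (2 * y - x) * (2 * y - x) by rewrite -expr2 sqr_ge0.
  have t : -1 <= x * (3 * x - 4).
    have [h'|[->//|h']] : x <= 0 \/ x = 1 \/ 2 <= x by lia.
      by nia.
    by nia.
  by move: s t; rewrite !expr2; nia.
rewrite /kE; move: (en p - p.1) h4 h2 => k; case: k => // k _ h2.
have -> : nb (aE p) = (1 + 3 * k)%N by lia.
by rewrite add1n /= mulKn.
Qed.

Lemma ei_aE p : ei (aE p) = 1 + (1 + 2 * w) * ei p.
Proof.
rewrite ei_add ei_mul.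
have -> : ei (0, 1) = 1 by rewrite /ei /= mulr0z mul0r addr0.
by have -> : ei (2, 1) = 1 + 2 * w by [].
Qed.

Lemma muE p : ei p + hh = hh * ei (aE p).
Proof. by rewrite ei_aE mulrDr mulrA mulVf ?theta_neq0// mulr1 mul1r addrC. Qed.

Lemma cabs_mu p : cabs (ei p + hh) ^+ 2 = 1 / 3 + (kE p)%:R.
Proof. by rewrite muE cabsM exprMn cabs_hh -en_cabs -(nbR R) nb_aE natrD natrM; field. Qed.

Lemma third_hh : 3^-1 = - (hh * hh).
Proof. by rewrite /hh -invfM -expr2 theta_sqr invrN opprK. Qed.

(** The points where [aE p] is one of the cube roots of unity [1, w, w^2]. *)
Definition P3 : seq eis := [:: (0, 0); (1, 1); (1, 0)].

Lemma kE_eq0 p : (p \in P3) = (kE p == 0%N).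
Proof.
apply/idP/eqP => [|h].
  have H : all (fun b => kE b == 0%N) P3 by vm_compute.
  by move=> hp; apply/eqP; exact: (allP H p hp).
have := nb_aE p; rewrite h muln0 addn0 => h1.
have := nbE (aE p); rewrite h1 aE_en => h2.
have : en p = p.1 by lia.
case: p {h h1 h2} => x y; rewrite /en /= => e.
have hx : x = 0 \/ x = 1.
  have s : 0 <= (2 * y - x) * (2 * y - x) by rewrite -expr2 sqr_ge0.
  have t : x * (3 * x - 4) <= 0 by move: s e; rewrite !expr2; nia.
  have [h'|[h'|h']] : x < 0 \/ 0 <= x <= 1 \/ 2 <= x by lia.
      by nia.
    by lia.
  by nia.
case: hx => hx; subst x.
  have -> : y = 0 by nia.
  by [].
have hy : y = 0 \/ y = 1 by nia.
by case: hy => ->.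
Qed.

(** No two values of [aE] are opposite, since they are congruent to 1 modulo [th]; so the values and
    their negatives together form a part of the full sum over norms. *)
Lemma bsum_half (G : nat -> R) M : (forall n, 0 <= G n) -> G 0%N = 0 ->
  bsum (fun p : nat * nat => G (secN p)) M -> bsum (fun p => G (nb (aE p))) (3 * M).
Proof.
move=> G0 G00 /(bsum_sector G0 G00) h s us.
have ia : injective aE.
  move=> p p' e; have [e1 e2] := aE_num p; have [e3 e4] := aE_num p'.
  by rewrite e in e1 e2; case: p p' e e1 e2 e3 e4 => [x y] [x' y'] /= _ *; congr pair; lia.
have io : injective oppE by move=> [x y] [x' y']; rewrite /oppE /= => -[] /oppr_inj -> /oppr_inj ->.
have := h (map aE s ++ map (oppE \o aE) s); rewrite big_cat !big_map /=.
have -> : \sum_(j <- s) G (nb (oppE (aE j))) = \sum_(j <- s) G (nb (aE j)).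
  apply: eq_bigr => j _; congr (G _); apply/eqP; rewrite -eqz_nat !nbE; apply/eqP.
  by rewrite /en /oppE /=; ring.
suff U : uniq ([seq aE i | i <- s] ++ [seq (oppE \o aE) i | i <- s]) by move=> /(_ U); lra.
have ic : injective (oppE \o aE) by move=> ? ? /io /ia.
rewrite cat_uniq (map_inj_uniq ia) (map_inj_uniq ic) us.
rewrite andbT; apply/hasPn => x /mapP[p _ ->]; apply/mapP => -[p' _].
have [e1 e2] := aE_num p; have [e3 e4] := aE_num p'.
rewrite /= /oppE e1 e2 => e; move: e3 e4; rewrite -e /=; lia.
Qed.

Section Param.
Variables (tau u2 u3 : C).
Local Notation P := (Pht tau u2 u3 (- hh) hh 0 0).

Lemma PhtII0 : P (0, 0) = cexp (- (2 * s_ / 3 * tau)) * (sg (hh * u2) * sg (hh * u3)).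
Proof.
rewrite /Pht /Ph1 ei00 add0r !subr0 hhJ; congr (cexp _ * _).
rewrite !conj0 conjN hhJ !mul0r !addr0.
by rewrite third_hh; ring.
Qed.

(** Each factor [sg] contributes a power of [w] by [sg_w], and their product cancels against the
    character coming from [pm = - hh]. *)
Lemma PhtII_P3 p : p \in P3 -> P p = P (0, 0).
Proof.
have hw := w3_sqr R; have hw3 : w ^+ 3 = 1 by ring: hw.
have K p' : P p' = cexp (2 * s_ * ((ei (aE p') - (ei (aE p'))^*) / 3 - ei (aE p') * (ei (aE p'))^* / 3 * tau)) *
    (sg (ei (aE p') * (hh * u2)) * sg (ei (aE p') * (hh * u3))).
  rewrite /Pht /Ph1 muE !subr0; move: (ei (aE p')) => a; congr (cexp _ * (sg _ * sg _)); [|ring|ring].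
  by rewrite conjM conjN hhJ !conj0 third_hh; ring.
rewrite PhtII0 !inE => /or3P[] /eqP ->; rewrite ?PhtII0// K ei_aE /ei /= !mulr1z ?mulr0z.
  have -> : 1 + (1 + 2 * w) * (1 + 1 * w) = w by ring: hw.
  rewrite !sg_w.
  have -> : forall c a b : C, c * (w * a * (w * b)) = c * w ^+ 2 * (a * b) by move=> *; ring.
  congr (_ * _).
  have -> : 2 * s_ * ((w - w^*) / 3 - w * w^* / 3 * tau) = s_ * (1 + 2 * w) * (2 / 3) - (2 * s_ / 3 * tau).
    by rewrite w3J; field: hw.
  by rewrite cexpD cexp_2pi3 mulrAC -exprS hw3 mul1r.
have -> : 1 + (1 + 2 * w) * (0 + 1 * w) = w * w by ring: hw.
rewrite -!(mulrA w w (hh * _)) !sg_w.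
have -> : forall c a b : C, c * (w * (w * a) * (w * (w * b))) = c * w * (w ^+ 3 * (a * b)) by move=> *; ring.
rewrite hw3 mul1r; congr (_ * _).
have -> : 2 * s_ * ((w * w - (w * w)^*) / 3 - w * w * (w * w)^* / 3 * tau) =
    - (s_ * (1 + 2 * w) * (2 / 3)) - (2 * s_ / 3 * tau).
  by rewrite conjM w3J; field: hw.
rewrite cexpD cexpN cexp_2pi3 mulrAC mulVf ?mul1r//.
by rewrite -(cexp_2pi3 R) cexp_neq0.
Qed.

Lemma PhtII_sum : \sum_(p <- P3) P p = 3 * P (0, 0).
Proof.
rewrite !big_cons big_nil (PhtII_P3 (isT : (1, 1) \in P3)) (PhtII_P3 (isT : (1, 0) \in P3)).
by move: (P (0, 0)) => c; ring.
Qed.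

Lemma PhtII_bound (y c : R) p : yeq tau u2 u3 y -> 0 <= c ->
  rho (ei (aE p) * (hh * u2)) * rho (ei (aE p) * (hh * u3)) <= c ^+ 2 * (rho (hh * u2) * rho (hh * u3)) ->
  cabs (P p) <= c * expR (- (ss R * y)) ^+ kE p * cabs (P (0, 0)).
Proof.
move=> [y0 yE] c0 hr; have K := Ks_gt0 R.
have e1 := cabs_Pht2 (- hh) hh 0 0 yE p; have e0 := cabs_Pht2 (- hh) hh 0 0 yE (0, 0).
rewrite ei00 add0r cabs_hh !subr0 in e0; rewrite cabs_mu muE !subr0 in e1.
have a v : hh * ei (aE p) * v = ei (aE p) * (hh * v) by rewrite mulrA (mulrC hh).
rewrite !a in e1.
rewrite !cabs0 !expr0n /= !addr0 !mulr0 !expR0 !mul1r in e0 e1.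
apply: ler_sq; first exact: cabs_ge0.
  by rewrite !mulr_ge0 ?cabs_ge0 ?exprn_ge0 ?expR_ge0.
rewrite -(@ler_pM2l _ (Ks R ^+ 2)) ?exprn_gt0// e1.
move: (P (0, 0)) e0 => P0 e0.
have -> : Ks R ^+ 2 * (c * expR (- (ss R * y)) ^+ kE p * cabs P0) ^+ 2 =
  c ^+ 2 * (expR (- (ss R * y)) ^+ kE p) ^+ 2 * (Ks R ^+ 2 * cabs P0 ^+ 2) by ring.
rewrite e0 -[(expR (- (ss R * y)) ^+ kE p) ^+ 2]exprM -expRM_natl natrM.
have -> : expR (- (2 * ss R * y * (3^-1 + (kE p)%:R))) =
    expR ((kE p)%:R * 2 * - (ss R * y)) * expR (- (2 * ss R * y / 3)).
  by rewrite -expRD; congr expR; ring.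
move: (expR_ge0 ((kE p)%:R * 2 * - (ss R * y))) (expR_ge0 (- (2 * ss R * y / 3))) hr.
move: (expR _) (expR _) (rho _ * rho _) (rho _ * rho _) => A B E r A0 B0 h.
by have := ler_wpM2l (mulr_ge0 A0 B0) h; congr (_ <= _); ring.
Qed.

Lemma PhtII0_eq0 : P (0, 0) = 0 -> is_eis (hh * u2) \/ is_eis (hh * u3).
Proof.
rewrite PhtII0 => /eqP; rewrite !mulf_eq0 (negbTE (cexp_neq0 _)) /=.
by rewrite -!rho_eq0; case/orP => /eqP h; [left|right]; apply: rho_eq0P.
Qed.

(** The sum of the three equal leading terms competes with the factor 3 of [bsum_half]. When the
    rest is dominated, a zero of the series forces the leading term, hence one of its factors [sg],
    to vanish. *)
Lemma typeII_gen (y K M : R) (c : nat -> R) : yeq tau u2 u3 y -> (forall n, 0 <= c n) -> 0 <= K ->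
  (forall p, p \notin P3 -> cabs (P p) <= K * c (nb (aE p)) * expR (- (ss R * y)) ^+ kE p * cabs (P (0, 0))) ->
  bsum (fun p : nat * nat => GII c (expR (- (ss R * y))) (secN p)) M -> K * M < 1 ->
  Phi tau u2 u3 (- hh) hh 0 0 = 0 -> is_eis (hh * u2) \/ is_eis (hh * u3).
Proof.
move=> yE c0 K0 hb hM KM h; apply: PhtII0_eq0; apply/eqP/negP => /negP P0.
have Q0 := expR_ge0 (- (ss R * y)); have [y0 yE'] := yE.
have P0' : 0 < cabs (P (0, 0)) by rewrite cabs_gt0.
have KP : 0 <= K * cabs (P (0, 0)) by rewrite mulr_ge0 ?cabs_ge0.
have H := bsumZ KP (bsum_half (fun n => GII_ge0 n c0 Q0) (erefl _) hM).
have := @has_sum_neq0 _ _ _ _ P3 _ isT (PhiP (- hh) hh 0 0 y0 yE') (bsum_le _ H).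
rewrite PhtII_sum h eqxx => F; have : false; last by [].
apply: F => [p|].
  case: ifP => [_|/negbT p3]; first by rewrite mulr_ge0 ?GII_ge0.
  have k0 := p3; rewrite kE_eq0 in k0.
  rewrite /GII nb_aE; have -> : (3 < 1 + 3 * kE p)%N by move: k0; case: (kE p) => // k _; lia.
  have -> : ((1 + 3 * kE p) %% 3 == 1)%N by lia.
  have -> : ((1 + 3 * kE p).-1 %/ 3 = kE p)%N by rewrite add1n /= mulKn.
  rewrite /=; apply: le_trans (hb p p3) _; rewrite nb_aE le_eqVlt; apply/orP; left; apply/eqP; ring.
rewrite cabsM -(Cnat R 3) cabsC normr_nat.
have -> : K * cabs (P (0, 0)) * (3 * M) = 3 * cabs (P (0, 0)) * (K * M) by ring.
by rewrite gtr_pMr// mulr_gt0.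
Qed.

Definition kW : R := locked (1019/1000).
Lemma kWE : kW = 1019/1000. Proof. by rewrite /kW -lock. Qed.
Lemma kW_ge0 : 0 <= kW. Proof. by rewrite kWE; lra. Qed.
Definition kH : R := locked (172/100).
Lemma kHE : kH = 172/100. Proof. by rewrite /kH -lock. Qed.
Lemma kH_ge0 : 0 <= kH. Proof. by rewrite kHE; lra. Qed.
Lemma kH_sqr : kW * (287/100) <= kH ^+ 2.
Proof. by rewrite kWE kHE; lra. Qed.

Lemma PhtII_cl y p : yeq tau u2 u3 y ->
  cabs (P p) <= kW * cl R (nb (aE p)) * expR (- (ss R * y)) ^+ kE p * cabs (P (0, 0)).
Proof.
move=> yE; have [l hl hr] := rho_word R (aE p); have hc := @word_cl R _ _ hl.
have K := kW_ge0; have c0 := cl_ge0 R (nb (aE p)).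
apply: (PhtII_bound yE); first exact: mulr_ge0.
rewrite -kWE in hr; have h2 := hr (hh * u2); have h3 := hr (hh * u3).
apply: le_trans (ler_pM (rho_ge0 _) (rho_ge0 _) h2 h3) _.
rewrite [leLHS](_ : _ = kW * l%:R ^+ 2 * (kW * l%:R ^+ 2) * (rho (hh * u2) * rho (hh * u3))); last by ring.
apply: ler_wpM2r; first by rewrite mulr_ge0 ?rho_ge0.
rewrite expr2.
have g : kW * l%:R ^+ 2 <= kW * cl R (nb (aE p)) by exact: ler_wpM2l.
have g0 : 0 <= kW * l%:R ^+ 2 by rewrite mulr_ge0// exprn_ge0.
exact: ler_pM.
Qed.

Lemma typeII_far y : yeq tau u2 u3 y -> 11/10 <= y ->
  Phi tau u2 u3 (- hh) hh 0 0 = 0 -> is_eis (hh * u2) \/ is_eis (hh * u3).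
Proof.
move=> yE hy; have Q1 := Q_far hy; have Q0 := expR_ge0 (- (ss R * y)).
apply: (typeII_gen yE (@cl_ge0 R) kW_ge0 (fun p _ => PhtII_cl p yE) (sum_far Q0 Q1)).
by rewrite kWE; lra.
Qed.

(** If one factor [rho] is within 2.87 of its maximum, its growth under multiplication by [aE p] is
    bounded by a constant. After the square root the coefficient is [kH * l] instead of [kW * l^2],
    small enough for heights down to [31/32]. *)
Lemma typeII_hole y : yeq tau u2 u3 y -> 31/32 <= y ->
  (forall x, rho x <= 287/100 * rho (hh * u2)) \/ (forall x, rho x <= 287/100 * rho (hh * u3)) ->
  Phi tau u2 u3 (- hh) hh 0 0 = 0 -> is_eis (hh * u2) \/ is_eis (hh * u3).
Proof.
move=> yE hy hole; have Q0 := expR_ge0 (- (ss R * y)).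
have Q1 : expR (- (ss R * y)) <= 174/1000.
  by apply: le_trans (Qn_le R); rewrite ler_expR lerN2 ler_wpM2l ?(ltW (ss_gt0 R)).
have hb p : p \notin P3 -> cabs (P p) <= kH * ch R (nb (aE p)) * expR (- (ss R * y)) ^+ kE p * cabs (P (0, 0)).
  rewrite kE_eq0 => k0; have [l hl hr] := rho_word R (aE p).
  have hc : l%:R <= ch R (nb (aE p)).
    by apply: word_ch => //; rewrite nb_aE; [move: k0; case: (kE p) => // k _; lia|lia].
  have K := kH_ge0; have c0 := ch_ge0 R (nb (aE p)).
  apply: (PhtII_bound yE); first exact: mulr_ge0.
  rewrite -kWE in hr; have h2 := hr (hh * u2); have h3 := hr (hh * u3).
  have H : rho (ei (aE p) * (hh * u2)) * rho (ei (aE p) * (hh * u3)) <=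
      kW * (287/100) * l%:R ^+ 2 * (rho (hh * u2) * rho (hh * u3)).
    case: hole => hx.
      apply: le_trans (ler_pM (rho_ge0 _) (rho_ge0 _) (hx _) h3) _.
      by rewrite le_eqVlt; apply/orP; left; apply/eqP; ring.
    apply: le_trans (ler_pM (rho_ge0 _) (rho_ge0 _) h2 (hx _)) _.
    by rewrite le_eqVlt; apply/orP; left; apply/eqP; ring.
  apply: le_trans H _; apply: ler_wpM2r; first by rewrite mulr_ge0 ?rho_ge0.
  rewrite exprMn.
  have kk := kH_sqr; have z : 0 <= kW * (287/100) by apply: mulr_ge0; [exact: kW_ge0|lra].
  apply: ler_pM => //.
  by rewrite lerXn2r ?nnegrE.
apply: (typeII_gen yE (@ch_ge0 R) kH_ge0 hb (sum_hole Q0 Q1)).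
by rewrite kHE; lra.
Qed.

End Param.

(** An integer [b] not divisible by [th] is 1 or -1 modulo [th], so [hh * b] is congruent to [hh] or
    [- hh] and [hh * u] lies near a hole. *)
Lemma rho_hole (b u : C) : is_eis b -> ~ is_eis (hh * b) -> cabs (u - b) ^+ 2 <= 1/32 ->
  forall x, rho x <= 287/100 * rho (hh * u).
Proof.
move=> hb nb' hd x; have hw := w3_sqr R; have tn := theta_neq0 R.
have [c [hc [eb|eb]]] : exists c, is_eis c /\ (hh * b = hh + c \/ hh * b = - hh + c).
  case: hb nb' => m [n ->]; rewrite -w3E => nb'.
  have e : hh * (m%:~R + n%:~R * w) = (m%:~R + n%:~R) * hh + n%:~R * (1 + w).
    rewrite /hh; apply: (mulfI tn); rewrite mulrA mulfV// mul1r mulrDr mulrCA mulfV// mulr1; ring: hw.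
  have z3 : 3 * hh = - (1 + 2 * w) by rewrite hhE; field.
  have d := divz_eq (m + n) 3; have r := modz_ge0 (m + n) (isT : (3 : int) != 0); have r3 := ltz_pmod (m + n) (isT : 0 < (3 : int)).
  have e2 : (m%:~R + n%:~R : C) = (((m + n) %/ 3)%Z)%:~R * 3 + (((m + n) %% 3)%Z)%:~R by rewrite -intrD {1}d intrD intrM.
  have [r0|[r1|r2]] : ((m + n) %% 3)%Z = 0 \/ ((m + n) %% 3)%Z = 1 \/ ((m + n) %% 3)%Z = 2 by lia.
    by case: nb'; rewrite e e2 r0 addr0 -mulrA z3; is_eis_tac.
  exists ((((m + n) %/ 3)%Z)%:~R * - (1 + 2 * w) + n%:~R * (1 + w)); split; first by is_eis_tac.
    by left; rewrite e e2 r1 -z3 mulr1z; ring.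
  exists ((((m + n) %/ 3)%Z)%:~R * - (1 + 2 * w) - (1 + 2 * w) + n%:~R * (1 + w)); split; first by is_eis_tac.
  by right; rewrite e e2 r2 -z3 -[2%:~R]/(2 : C); ring.
  have -> : rho (hh * u) = rho (hh + hh * (u - b)).
    by rewrite -(rho_add (hh + _) hc); congr rho; rewrite mulrBr eb; ring.
  by apply: rho_near_hh; rewrite cabsM exprMn cabs_hh; lra.
have -> : rho (hh * u) = rho (hh + - (hh * (u - b))).
  have -> : hh + - (hh * (u - b)) = - (- hh + hh * (u - b)) by ring.
  by rewrite rhoN -(rho_add (- hh + _) hc); congr rho; rewrite mulrBr eb; ring.
by apply: rho_near_hh; rewrite cabsN cabsM exprMn cabs_hh; lra.
Qed.

(** The scheme of [typeI_crit] once the common factor, of exponent [1/3] in place of an integer, is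
    removed. The case of a vanishing leading term is split off first. *)
Lemma typeII_crit u2 u3 tau y : near u2 u3 -> yeq tau u2 u3 y -> 1/2 <= Re tau ->
  Phi (1 + w) u2 u3 (- hh) hh 0 0 = 0 -> Phi tau u2 u3 (- hh) hh 0 0 = 0 ->
  [\/ is_eis (hh * u2), is_eis (hh * u3) | cexp (- (2 * s_ * tau)) = - q0%:C].
Proof.
move=> uu hy ht c0 c1; pose t p := Pht 0 u2 u3 (- hh) hh 0 0 p.
have [t0|t0] := eqVneq (t (0, 0)) 0.
  by case: (PhtII0_eq0 t0); [constructor 1|constructor 2].
constructor 3; rewrite -X0E.
have spl v p : Pht v u2 u3 (- hh) hh 0 0 p = cexp (- (2 * s_ * (1 / 3)%:C * v)) * (t p * cexp (- (2 * s_ * v)) ^+ kE p).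
  by rewrite Pht_split cabs_mu cexp_tau_nat -/(t p) mulrCA.
have hs v y' : yeq v u2 u3 y' -> Phi v u2 u3 (- hh) hh 0 0 = 0 ->
    has_sum (fun p => t p * cexp (- (2 * s_ * v)) ^+ kE p) 0.
  move=> [h1 h2] h3; have := PhiP (- hh) hh 0 0 h1 h2; rewrite h3 => /(has_sumZ (cexp (- (2 * s_ * (1 / 3)%:C * v)))^-1).
  rewrite mulr0; apply: eq_has_sum => p; rewrite spl mulrA mulVf ?mul1r ?cexp_neq0//.
have n0 : 0 < cabs (t (0, 0)) by rewrite cabs_gt0.
have tb p : cabs (t p) * q0 ^+ kE p <= kW * cl R (nb (aE p)) * Qn ^+ kE p * cabs (t (0, 0)).
  have := PhtII_cl p (yeq0 uu); rewrite !spl.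
  have -> : kE (0, 0) = 0%N by [].
  rewrite expr0 mulr1; move: (t p) (t (0, 0)) => tp tq; rewrite !cabsM cabsX X0_cabs.
  have z : 0 < cabs (cexp (- (2 * s_ * (1 / 3)%:C * (1 + w)))) by rewrite cabs_gt0 cexp_neq0.
  have -> : forall a b c d e : R, a * b * c * (d * e) = d * (a * b * c * e) by move=> *; ring.
  rewrite ler_pM2l// => /le_trans; apply; apply: ler_wpM2r; first exact: cabs_ge0.
  apply: ler_wpM2l; first by rewrite mulr_ge0 ?kW_ge0 ?cl_ge0.
  by rewrite lerXn2r ?nnegrE ?expR_ge0 ?Qn_ge0// Q_near.
have KP : 0 <= kW * cabs (t (0, 0)) by rewrite mulr_ge0 ?cabs_ge0 ?kW_ge0.
have ck0 n : 0 <= ck R n by rewrite mulr_ge0 ?cl_ge0.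
have H := bsumZ KP (bsum_half (fun n => GII_ge0 n ck0 (Qn_ge0 R)) (erefl _) (sum_crit (Qn_ge0 R) (Qn_le R))).
apply: (@near_critical _ _ t kE P3 _ _ q0 _ isT kE_eq0 (X_le ht) _ (hs _ _ hy c1) (hs _ _ (yeq0 uu) c0) (bsum_le _ H)).
  by rewrite X0_cabs.
  move=> p; apply: le_trans (ler_wpM2l (ler0n _ _) (tb p)) _.
  rewrite /GII /ck nb_aE.
  have -> : ((1 + 3 * kE p) %% 3 == 1)%N by lia.
  have -> : ((1 + 3 * kE p).-1 %/ 3 = kE p)%N by rewrite add1n /= mulKn.
  rewrite andbT; case: ifP => h.
    by rewrite le_eqVlt; apply/orP; left; apply/eqP; ring.
  have -> : kE p = 0%N by lia.
  by rewrite mul0r mulr0.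
have -> : \sum_(p <- P3) t p = 3 * t (0, 0) by exact: PhtII_sum.
rewrite cabsM -(Cnat R 3) cabsC normr_nat.
have -> : kW * cabs (t (0, 0)) * (3 * (947/1000)) = 3 * cabs (t (0, 0)) * (kW * (947/1000)) by ring.
have kb : kW * (947/1000) < 1 by rewrite kWE; lra.
by rewrite gtr_pMr// mulr_gt0.
Qed.
End PhiZerosII.

(** * Isometries of the lattice and vanishing on mirrors *)

Section Group.
Variable R : realType.
Local Notation C := R[i].
Local Notation hh := (hh R).
Local Notation th := (1 + 2 * w3 R).
Implicit Types (z x r : 'cV[C]_4) (A B g : 'M[C]_4).

Definition sg4 (k : 'I_4) : C := if k == ord0 then 1 else -1.
Definition bv (k : 'I_4) : 'cV[C]_4 := delta_mx k ord0.

Lemma bvE k l : bv k l ord0 = (l == k)%:R.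
Proof. by rewrite mxE eqxx andbT. Qed.

Lemma bvkk k : bv k k ord0 = 1. Proof. by rewrite bvE eqxx. Qed.

Lemma hform_sg z x : hform z x = \sum_k sg4 k * (z k ord0)^* * x k ord0.
Proof. by rewrite hformE sum4 /sg4 /=; ring. Qed.

Lemma hform_bvl k x : hform (bv k) x = sg4 k * x k ord0.
Proof.
rewrite hform_sg (bigD1 k)//= big1 => [|l lk]; first by rewrite bvE eqxx conj1 mulr1 addr0.
by rewrite bvE (negbTE lk) conj0 mulr0 mul0r.
Qed.

Lemma sg4_sqr k : sg4 k * sg4 k = 1.
Proof. by rewrite /sg4; case: ifP => _; rewrite ?mulrNN mulr1. Qed.

Lemma sg4_eis k : is_eis (sg4 k).
Proof. by rewrite /sg4; case: ifP => _; is_eis_tac. Qed.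

Lemma mulmx_bv A k l : (A *m bv k) l ord0 = A l k.
Proof. by rewrite -colE mxE. Qed.

Lemma lat_bv k : lat (bv k).
Proof. by move=> l; rewrite bvE; is_eis_tac. Qed.

(** The inverse of an isometry is its adjoint for [h], whose entries are conjugates of entries of
    [A] up to sign, hence integral. *)
Lemma mkG3 A : (forall k l, is_eis (A k l)) ->
  (forall z x, hform (A *m z) (A *m x) = hform z x) -> G3 A.
Proof.
move=> hA iA; pose B : 'M[C]_4 := \matrix_(k, l) (sg4 k * sg4 l * (A l k)^*).
have BA : B *m A = 1%:M.
  apply/matrixP => k l; rewrite !mxE.
  have -> : \sum_j B k j * A j l = sg4 k * hform (A *m bv k) (A *m bv l).
    by rewrite hform_sg mulr_sumr; apply: eq_bigr => j _; rewrite !mulmx_bv mxE; ring.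
  by rewrite iA hform_bvl mulrA sg4_sqr mul1r bvE.
have [_ uA] := mulmx1_unit BA.
have eB : invmx A = B by rewrite -[B]mulmx1 -(mulmxV uA) mulmxA BA mul1mx.
split=> // k l; rewrite eB mxE; apply: is_eisM; last exact: is_eisJ.
by apply: is_eisM; exact: sg4_eis.
Qed.

Lemma G3_lat g x : G3 g -> lat x -> lat (g *m x).
Proof. by move=> [h _ _ _]; exact: lat_mul. Qed.

Lemma G3M g g' : G3 g -> G3 g' -> G3 (g *m g').
Proof.
move=> [h1 h2 h3 h4] [k1 k2 k3 k4]; apply: mkG3 => [k l|z x]; last by rewrite -!mulmxA h4 k4.
by rewrite mxE; apply: is_eis_sum => j; exact: is_eisM.
Qed.

Lemma G3V g : G3 g -> G3 (invmx g).
Proof.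
move=> [h1 h2 h3 h4]; apply: mkG3 => // z x.
by rewrite -h4 !mulKVmx.
Qed.

Lemma G3_1 : G3 (1%:M : 'M[C]_4).
Proof. by apply: mkG3 => [k l|z x]; [rewrite mxE; is_eis_tac|rewrite !mul1mx]. Qed.

Lemma G3K g x : G3 g -> invmx g *m (g *m x) = x.
Proof. by move=> [_ h _ _]; rewrite mulKmx. Qed.
Lemma G3VK g x : G3 g -> g *m (invmx g *m x) = x.
Proof. by move=> [_ h _ _]; rewrite mulKVmx. Qed.

Lemma hform_adj g x z : G3 g -> hform (g *m x) z = hform x (invmx g *m z).
Proof. by move=> hg; have [_ _ _ h] := hg; rewrite -{1}(G3VK z hg) h. Qed.
Lemma hform_adjV g x z : G3 g -> hform (invmx g *m x) z = hform x (g *m z).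
Proof. by move=> hg; have [_ _ _ h] := hg; rewrite -h G3VK. Qed.

Definition hdl x : 'rV[C]_4 := \row_k (sg4 k * (x k ord0)^*).
Definition outer r x : 'M[C]_4 := r *m hdl x.

Lemma outerE r x z : outer r x *m z = hform x z *: r.
Proof.
rewrite /outer -mulmxA; have -> : hdl x *m z = (hform x z)%:M.
  apply/matrixP => k l; rewrite !ord1 !mxE eqxx mulr1n hform_sg.
  by apply: eq_bigr => j _; rewrite mxE.
by rewrite mul_mx_scalar.
Qed.

Lemma outer_eis r x k l : lat r -> lat x -> is_eis (outer r x k l).
Proof.
move=> hr hx; rewrite mxE; apply: is_eis_sum => j; rewrite mxE ord1.
by apply: is_eisM => //; apply: is_eisM; [exact: sg4_eis|exact: is_eisJ].
Qed.

Definition refl r (c : C) : 'M[C]_4 := 1%:M + c *: outer r r.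

Lemma reflE r c x : refl r c *m x = x + (c * hform r x) *: r.
Proof. by rewrite mulmxDl mul1mx -scalemxAl outerE scalerA. Qed.

Lemma G3_refl r (c : C) : lat r -> is_eis c -> c + c^* + c * c^* * hform r r = 0 -> G3 (refl r c).
Proof.
move=> hr hc e; apply: mkG3 => [k l|z x].
  by rewrite !mxE; apply: is_eisD; [is_eis_tac|apply: is_eisM => //; have := outer_eis k l hr hr; rewrite mxE].
rewrite !reflE !hformL -[hform z r]hformJ !conjM.
move: (hform r z) (hform z x) (hform r x) (hform r r) e => a b c' N e.
transitivity (b + a^* * c' * (c + c^* + c * c^* * N)); first by ring.
by rewrite e mulr0 addr0.
Qed.

Definition ec : 'cV[C]_4 := cusp4 1 0 0 0.
(** Eichler transformation: an element of the Heisenberg group fixing the isotropic vector [e],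
    which translates the transverse coordinates by [(b2, b3)]. *)
Definition eich (b2 b3 m : C) : 'M[C]_4 := 1%:M + outer (cusp4 0 0 b2 b3) ec + m *: outer ec ec - outer ec (cusp4 0 0 b2 b3).

Lemma lat_cusp4 (t a c d : C) : is_eis t -> is_eis a -> is_eis c -> is_eis d -> lat (cusp4 t a c d).
Proof. by move=> *; apply: ord4P; rewrite !V4E; is_eis_tac. Qed.

Lemma cuspN (t a c d : C) : - cusp4 t a c d = cusp4 (- t) (- a) (- c) (- d).
Proof. by rewrite -scaleN1r cuspZ !mulN1r. Qed.

Lemma eichE (b2 b3 m t a c d : C) : eich b2 b3 m *m cusp4 t a c d =
  cusp4 (t + m * a + b2^* * c + b3^* * d) a (c + a * b2) (d + a * b3).
Proof.
rewrite mulmxDl mulNmx !mulmxDl mul1mx -scalemxAl !outerE !hform_cusp !cuspZ cuspN !cuspD !cJ.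
by congr cusp4; ring.
Qed.

Lemma G3_eich (b2 b3 m : C) : is_eis b2 -> is_eis b3 -> is_eis m ->
  m + m^* = b2 * b2^* + b3 * b3^* -> G3 (eich b2 b3 m).
Proof.
move=> h2 h3 hm e; apply: mkG3 => [k l|z x].
  have le : lat ec by apply: lat_cusp4; is_eis_tac.
  have lb : lat (cusp4 0 0 b2 b3) by apply: lat_cusp4; is_eis_tac.
  have o r x' : lat r -> lat x' -> is_eis (outer r x' k l) by exact: outer_eis.
  have -> : eich b2 b3 m k l = (k == l)%:R + outer (cusp4 0 0 b2 b3) ec k l + m * outer ec ec k l - outer ec (cusp4 0 0 b2 b3) k l.
    by rewrite [LHS]mxE [X in X + _ = _]mxE [X in X + _ + _ = _]mxE [X in X + _ + _ + _ = _]mxE [X in _ + X + _ = _]mxE [X in _ + _ + X = _]mxE.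
  by apply: is_eisD; [apply: is_eisD; [apply: is_eisD; [is_eis_tac|exact: o]|apply: is_eisM => //; exact: o]|apply: is_eisN; exact: o].
rewrite -(cuspK z) -(cuspK x) !eichE !hform_cusp !cJ.
move: (cB z) (cA z) (z o2 ord0) (z o3 ord0) (cB x) (cA x) (x o2 ord0) (x o3 ord0) => t a c d t' a' c' d'.
have -> : m^* = b2 * b2^* + b3 * b3^* - m by rewrite -e addrAC subrr add0r.
by ring.
Qed.

Lemma bv_cusp2 : bv o2 = cusp4 0 0 1 0.
Proof. by apply: vec4P; rewrite V4E bvE//= ?mul0r ?addr0. Qed.
Lemma bv_cusp3 : bv o3 = cusp4 0 0 0 1.
Proof. by apply: vec4P; rewrite V4E bvE//= ?mul0r ?addr0. Qed.
Lemma hform_bv2 x : hform (bv o2) x = - x o2 ord0.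
Proof. by rewrite hform_bvl /sg4 /= mulN1r. Qed.
Lemma hform_bv3 x : hform (bv o3) x = - x o3 ord0.
Proof. by rewrite hform_bvl /sg4 /= mulN1r. Qed.
Lemma hform_ec x : hform ec x = cA x.
Proof. by rewrite -[x in LHS]cuspK hform_cusp !cJ; ring. Qed.

Definition Jm : 'M[C]_4 := refl (cusp4 1 (-1) 0 0) 1.
Lemma JmE (t a c d : C) : Jm *m cusp4 t a c d = cusp4 a t c d.
Proof. by rewrite reflE cuspZ cuspD hform_cusp !cJ; congr cusp4; ring. Qed.
Lemma G3_Jm : G3 Jm.
Proof.
apply: G3_refl; [apply: lat_cusp4; is_eis_tac|is_eis_tac|].
by rewrite hform_cusp !cJ; ring.
Qed.

Definition F2 : 'M[C]_4 := refl (bv o2) 2.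
Definition F3 : 'M[C]_4 := refl (bv o3) 2.
Lemma F2E (t a c d : C) : F2 *m cusp4 t a c d = cusp4 t a (- c) d.
Proof. by rewrite reflE bv_cusp2 cuspZ cuspD hform_cusp !cJ; congr cusp4; ring. Qed.
Lemma F3E (t a c d : C) : F3 *m cusp4 t a c d = cusp4 t a c (- d).
Proof. by rewrite reflE bv_cusp3 cuspZ cuspD hform_cusp !cJ; congr cusp4; ring. Qed.
Lemma G3_F2 : G3 F2.
Proof. by apply: G3_refl; [exact: lat_bv|is_eis_tac|rewrite hform_bv2 bvkk !cJ; ring]. Qed.
Lemma G3_F3 : G3 F3.
Proof. by apply: G3_refl; [exact: lat_bv|is_eis_tac|rewrite hform_bv3 bvkk !cJ; ring]. Qed.

Lemma mN1E x : (- 1%:M : 'M[C]_4) *m x = - x. Proof. by rewrite mulNmx mul1mx. Qed.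
Lemma G3_N1 : G3 (- 1%:M : 'M[C]_4).
Proof.
apply: mkG3 => [k l|z x]; first by rewrite !mxE; is_eis_tac.
by rewrite !mN1E !hformL opprK.
Qed.

(* swaps [r] and [bv o2] when these are orthogonal of norm -1 *)
Definition swp r : 'M[C]_4 := refl (bv o2 - r) 1.
Lemma swp_G3 r : lat r -> hform r r = -1 -> hform (bv o2) r = 0 -> G3 (swp r).
Proof.
move=> lr n1 o; apply: G3_refl; [apply: latD; [exact: lat_bv|exact: latN]|is_eis_tac|].
by rewrite !hformL n1 o -[hform r (bv _)]hformJ o hform_bv2 bvkk !cJ; ring.
Qed.
Lemma swp_bv r : hform (bv o2) r = 0 -> swp r *m bv o2 = r.
Proof.
move=> o; rewrite reflE hformDl hformNl -[hform r _]hformJ o hform_bv2 bvkk conj0 oppr0 addr0 mul1r.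
by rewrite scaleN1r opprB addrC subrK.
Qed.

Lemma swp_invol r : hform (bv o2) r = 0 -> hform r r = -1 -> swp r *m r = bv o2.
Proof.
by move=> o n1; rewrite reflE hformDl hformNl o n1 sub0r opprK mulr1 scale1r addrC subrK.
Qed.

Lemma third_theta : hh * th = 1. Proof. by rewrite mulVf ?theta_neq0. Qed.

Lemma NN0_mirror2 (p z : 'cV[C]_4) : 0 < hn z -> is_eis (p o2 ord0) -> z o2 ord0 = 0 -> NN0 p z = 0.
Proof.
move=> hz hp h0; apply/(NN0_eq0 _ hz); rewrite h0 mul0r.
apply: csumE; have -> : Pht (tau_ z) 0 (z o3 ord0 / cA z) (cB p) (cA p) (p o2 ord0) (p o3 ord0) = fun=> 0.
  apply/funext => m; rewrite /Pht mulr0 sub0r; have -> : sg (- p o2 ord0) = 0.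
    by apply/eqP; rewrite -rho_eq0 rhoN -[p o2 ord0]add0r rho_add// rho0.
  by rewrite mul0r mulr0.
move=> e e0; exists [::] => // s _ _; rewrite big1 // subrr cabs0 ltW//.
Qed.

(** The swap carries the mirror of [r] to that of [bv o2], where every term of the theta series
    contains the zero of [sg] at a lattice point. *)
Lemma NN0_mirror (p r z : 'cV[C]_4) : 0 < hn z -> lat r -> hform r r = -1 -> hform (bv o2) r = 0 ->
  is_eis (hform r p) -> hform r z = 0 -> NN0 p z = 0.
Proof.
move=> hz lr n1 o hp h0; have hg := swp_G3 lr n1 o; rewrite -(NN0_G3 p z hg).
have c2 x : (swp r *m x) o2 ord0 = - hform r x.
  rewrite -[LHS]opprK -hform_bv2 -{1}(swp_invol o n1).
  by have [_ _ _ ->] := hg.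
apply: NN0_mirror2; first by rewrite hn_G3.
  by rewrite c2; exact: is_eisN.
by rewrite c2 h0 oppr0.
Qed.
End Group.

(** * Reduction modulo [th] and highest points of orbits *)

Section Reduction.
Variable R : realType.
Local Notation C := R[i].
Local Notation w := (w3 R).
Local Notation hh := (hh R).
Local Notation th := (1 + 2 * w3 R).
Local Notation s_ := ((ss R)%:C : C).
Implicit Types (z x r p : 'cV[C]_4) (A B g : 'M[C]_4).

Lemma cexp_eq1 (x : C) : cexp x = 1 -> exists k : int, x = 2 * s_ * th * k%:~R.
Proof.
move=> h; have r0 : Re x = 0.
  by have := congr1 (@cabs R) h; rewrite cabs_cexp cabs1 => /(congr1 (@ln R)); rewrite expRK ln1.
have xE : x = iu R * (Im x)%:C.
  by apply: complexP; rewrite ?r0 !ReIm; ring.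
have c1 : cos (Im x) = 1.
  by have := congr1 (@complex.Re R) h; rewrite {1}xE Re_cexpI => ->.
have [k ke] := cos_eq1 c1; exists k.
rewrite xE ke !CM Cint Cnat.
transitivity (2 * (iu R * pi%:C) * k%:~R); first by ring.
by rewrite piIE; ring.
Qed.

Lemma X_eq (tau : C) : cexp (- (2 * s_ * tau)) = - (q0 R)%:C -> exists k : int, tau = 1 + w + th * k%:~R.
Proof.
rewrite -X0E => h; have : cexp (2 * s_ * (1 + w) - 2 * s_ * tau) = 1.
  by rewrite cexpD h -cexpD subrr cexp0.
move=> /cexp_eq1[k hk]; exists (- k).
have s0 : 2 * s_ != 0 by rewrite mulf_neq0 ?pnatr_eq0// fmorph_eq0 gt_eqF ?ss_gt0.
apply: (mulfI s0); rewrite intrN; move: hk; move: (2 * s_) => u hk.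
have -> : u * tau = u * (1 + w) - (u * (1 + w) - u * tau) by ring.
by rewrite hk; ring.
Qed.

(** The residue field of [th] has three elements. *)
Lemma eis_cases (x : C) : is_eis x -> exists (s : int) (c : C),
  [/\ is_eis c, x = s%:~R + th * c & s \in [:: 0; 1; -1]].
Proof.
move=> /is_eisP[[n m] ->]; have hw := w3_sqr R.
have e : ei R (n, m) = (m + n)%:~R + th * (n%:~R * (1 + w)).
  by rewrite /ei /= intrD; ring: hw.
have d := divz_eq (m + n) 3; have r := modz_ge0 (m + n) (isT : (3 : int) != 0); have r3 := ltz_pmod (m + n) (isT : 0 < (3 : int)).
move: ((m + n) %/ 3)%Z ((m + n) %% 3)%Z d r r3 => q t d r r3.
have t3 : th * th = -3 by rewrite -expr2 theta_sqr.
have [t0|[t1|t2]] : t = 0 \/ t = 1 \/ t = 2 by lia.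
  exists 0, (n%:~R * (1 + w) - th * q%:~R); split=> //; first by is_eis_tac.
  by rewrite e d t0 addr0 intrM mulr0z; move: th t3 => t' t3; ring: t3.
  exists 1, (n%:~R * (1 + w) - th * q%:~R); split=> //; first by is_eis_tac.
  by rewrite e d t1 intrD intrM; move: th t3 => t' t3; ring: t3.
exists (-1), (n%:~R * (1 + w) - th * (q%:~R + 1)); split=> //; first by is_eis_tac.
by rewrite e d t2 intrD intrM intrN; move: th t3 => t' t3; ring: t3.
Qed.

Lemma trace_theta (c : C) : is_eis c -> exists k : int, th * c + (th * c)^* = (3 * k)%:~R.
Proof.
move=> /is_eisP[[n m] ->]; exists (- n); rewrite /ei /= intrM intrN !cJ.
by have hw := w3_sqr R; ring: hw.
Qed.

Lemma theta_dvd (k : int) : is_eis (hh * k%:~R) -> exists m : int, k = 3 * m.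
Proof.
move=> /is_eisP[a e]; have := congr1 (@complex.Im R) e; have := congr1 (@complex.Re R) e.
rewrite Re_ei Im_ei; have -> : hh * k%:~R = ((k%:~R / 3 : R))%:C * - th.
  by rewrite hhE !CM CV Cint Cnat; field.
rewrite !ReIm Re_w3 Im_w3 => h1 h2; exists (- a.2); have t0 := sq3_neq0 R.
have h3 : a.1%:~R = - (2 * k%:~R / 3) :> R by apply: (mulIf t0); lra.
apply: (@intr_inj R); rewrite intrM intrN; lra.
Qed.

Lemma hform_int p : lat p -> exists k : int, hform p p = k%:~R.
Proof.
move=> hp; have h k : exists n : int, (p k ord0)^* * p k ord0 = n%:~R.
  by have /is_eisP[a ->] := hp k; exists (en a); rewrite enC mulrC.
have [a ha] := h ord0; have [b hb] := h o1; have [c hc] := h o2; have [d hd] := h o3.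
by exists (a - b - c - d); rewrite hformE ha hb hc hd !intrB.
Qed.

Lemma thJ : th^* = - th. Proof. by rewrite !cJ; ring. Qed.

Lemma hform_mod p q : lat p -> lat q -> exists k : int,
  hform (p + th *: q) (p + th *: q) = hform p p + (3 * k)%:~R.
Proof.
move=> hp hq; have [k hk] := hform_int hq; have [m hm] := trace_theta (hform_lat hp hq).
have -> : (fun k => hform (p + th *: q) (p + th *: q) = hform p p + (3 * k)%:~R) =
    (fun k : int => hform (p + th *: q) (p + th *: q) = hform p p + 3 * k%:~R) by apply/funext => k'; rewrite intrM.
exists (m + k); rewrite !hformL -[hform q p]hformJ hk intrD; have hm' : 3 * m%:~R = th * hform p q + (th * hform p q)^* by rewrite hm intrM.
have -> : 3 * (m%:~R + k%:~R) = 3 * m%:~R + 3 * k%:~R :> C by ring.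
rewrite hm'.
have t3 : th * th = -3 by rewrite -expr2 theta_sqr.
by rewrite conjM thJ; move: (hform p p) (hform p q) th t3 => a b t t3; ring: t3.
Qed.

(** Here [p] is the integral numerator, the sum being taken at [hh *: p]; [is_eis (hh * _)]
    expresses divisibility by [th]. *)
Definition root p z := exists2 G : 'M[C]_4, G3 G &
  is_eis (hh * hform p (G *m bv R o2)) /\ hform (G *m bv R o2) z = 0.

Definition ZS p z := NN0 (hh *: p) z = 0 -> root p z.

Lemma ZS_G3 g p z : G3 g -> ZS (g *m p) (g *m z) -> ZS p z.
Proof.
move=> hg h n0; have [|G hG [h1 h2]] := h; first by rewrite scalemxAr NN0_G3.
exists (invmx g *m G); first by apply: G3M => //; exact: G3V.
by rewrite -mulmxA hform_adjV// -hform_adj.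
Qed.

Lemma ZS_mod p q z : lat q -> ZS (p + th *: q) z -> ZS p z.
Proof.
move=> hq h n0; have [|G hG [h1 h2]] := h.
  by rewrite scalerDr scalerA third_theta scale1r NN0D.
exists G => //; split=> //.
have -> : hh * hform p (G *m bv R o2) = hh * hform (p + th *: q) (G *m bv R o2) + hform q (G *m bv R o2).
  have h1' := third_theta R; rewrite hformDl hformZl thJ; move: (hform p _) (hform q _) hh th h1' => a b c d e.
  by ring: e.
apply: is_eisD => //; apply: hform_lat => //; apply: G3_lat => //; exact: lat_bv.
Qed.

Lemma ZS_modE p p' q z : lat q -> p = p' + th *: q -> ZS p' z -> ZS p z.
Proof.
move=> hq -> h; apply: (@ZS_mod _ (- q)); first exact: latN.
by rewrite scalerN addrK.
Qed.

Lemma has_sum_max (T : choiceType) (f : T -> C) S (P : T -> Prop) (x0 : T) : has_sum f S -> P x0 -> f x0 != 0 ->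
  exists2 x : T, P x & forall y, P y -> cabs (f y) <= cabs (f x).
Proof.
move=> h P0 f0; have e0 : 0 < cabs (f x0) / 2 by rewrite divr_gt0// cabs_gt0.
have [s us hs] := h _ e0.
have out y : y \notin s -> cabs (f y) <= cabs (f x0).
  move=> ys; have h1 := hs s us (fun _ h => h).
  have sub : {subset s <= y :: s} by move=> x xs; rewrite inE xs orbT.
  have h2 := hs (y :: s); rewrite /= ys us big_cons in h2; have {}h2 := h2 isT sub.
  have -> : f y = (f y + \sum_(i <- s) f i - S) - (\sum_(i <- s) f i - S) by ring.
  by apply: le_trans (cabsD _ _) _; rewrite cabsN; lra.
have K (t : seq T) : exists2 x : T, P x & cabs (f x0) <= cabs (f x) /\ forall y, y \in t -> P y -> cabs (f y) <= cabs (f x).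
  elim: t => [|a t [x Px [x1 x2]]]; first by exists x0.
  have [[Pa le]|na] := pselect (P a /\ cabs (f x) <= cabs (f a)).
    exists a => //; split; first exact: le_trans le.
    by move=> y; rewrite inE => /orP[/eqP->//|yt Py]; apply: le_trans le; exact: x2.
  exists x => //; split=> // y; rewrite inE => /orP[/eqP-> Pa|]; last exact: x2.
  by rewrite leNgt; apply/negP => lt; apply: na; split=> //; exact: ltW.
have [x Px [x1 x2]] := K s; exists x => // y Py.
by have [ys|ys] := boolP (y \in s); [exact: x2|apply: le_trans x1; exact: out].
Qed.

(** Since [cA z = h(e, z)] and [h(z,z)] is invariant, [z] is highest above [e] within its orbit. *)
Definition hmin z := forall g, G3 g -> cabs (cA z) <= cabs (cA (g *m z)).

Lemma cabs_Nt0 z l : 0 < hn z -> lat l -> hform l l = 0 ->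
  cabs (Nt 0 z l) = expR (- (2 * ss R * (cabs (hform l z) ^+ 2 / hn z))).
Proof.
move=> hz hl l0; rewrite /Nt asboolT// l0 -[hform z l]hformJ mulcJ hnE.
have -> : hform l 0 = 0 by rewrite -(scale0r 0) hformZr mul0r.
have -> : hform 0 l = 0 by rewrite -(scale0r 0) hformZl conj0 mul0r.
rewrite mulr0 subr0 addr0 add0r cabs_cexp; congr expR.
by rewrite -CV -CM mulrN ReN Re_2s ReC.
Qed.

(** For isotropic [l] the term of [N_0] has modulus [exp(- 2 s |h(l,z)|^2 / h(z,z))]. A convergent
    sum has a largest term among the translates of [e], and this translate minimises [|h(l,z)|]. *)
Lemma exists_hmin z : 0 < hn z -> exists2 g, G3 g & hmin (g *m z).
Proof.
move=> hz; pose P l := exists2 g, G3 g & l = invmx g *m ec R.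
have lec : lat (ec R) by apply: lat_cusp4; is_eis_tac.
have ec0 : hform (ec R) (ec R) = 0 by rewrite hform_cusp !cJ; ring.
have PE l : P l -> lat l /\ hform l l = 0.
  move=> [g hg ->]; have hV := G3V hg; split; first exact: G3_lat.
  by have [_ _ _ ->] := hV.
have P0 : P (ec R) by exists 1%:M; [exact: G3_1|rewrite invmx1 mul1mx].
have [|l [g hg lE] hmax] := has_sum_max (NtP 0 hz) P0.
  by rewrite -cabs_gt0 cabs_Nt0// expR_gt0.
exists g => // g' hg'; have Pl' : P (invmx (g' *m g) *m ec R) by exists (g' *m g) => //; exact: G3M.
have Pl : P l by exists g.
have [l1 l2] := PE _ Pl; have [l3 l4] := PE _ Pl'.
have := hmax _ Pl'; rewrite !cabs_Nt0// ler_expR lerN2 ler_pM2l; last by rewrite mulr_gt0 ?ss_gt0.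
rewrite ler_pM2r ?invr_gt0// => /(ler_sq (cabs_ge0 _) (cabs_ge0 _)).
by rewrite lE !hform_adjV//; [rewrite !hform_ec mulmxA|exact: G3M].
Qed.

Lemma hmin_G3 g z : G3 g -> cabs (cA (g *m z)) = cabs (cA z) -> hmin z -> hmin (g *m z).
Proof. by move=> hg e h g' hg'; rewrite e mulmxA; apply: h; exact: G3M. Qed.

(** Minimality is tested on a translation along the cusp followed by [Jm], which exchanges [e] and
    [e']; the result is the isometric circle condition. *)
Lemma hmin_ge1 z (b2 b3 m : C) : 0 < hn z -> hmin z -> is_eis b2 -> is_eis b3 -> is_eis m ->
  m + m^* = b2 * b2^* + b3 * b3^* ->
  1 <= cabs (tau_ z + m - b2^* * (z o2 ord0 / cA z) - b3^* * (z o3 ord0 / cA z)).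
Proof.
move=> hz hm h2 h3 h4 e; have A0 := cA_neq0 hz.
have hg : G3 (Jm R *m eich (- b2) (- b3) m).
  by apply: G3M; [exact: G3_Jm|apply: G3_eich; rewrite ?cJ ?mulrNN//; is_eis_tac].
have := hm _ hg; rewrite -mulmxA -{2}(cuspK z) eichE JmE cA_cusp => h.
rewrite -(@ler_pM2l _ (cabs (cA z))) ?cabs_gt0// mulr1; apply: le_trans h _; rewrite -cabsM le_eqVlt.
apply/orP; left; apply/eqP; congr cabs; rewrite /tau_ !cJ.
by field.
Qed.
End Reduction.

(** * Every orbit has a point near the critical segment or high in the cusp *)

Section Zeros.
Variable R : realType.
Local Notation C := R[i].
Local Notation w := (w3 R).
Local Notation th := (1 + 2 * w3 R).
Implicit Types (z x r p : 'cV[C]_4) (A B g : 'M[C]_4).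

Definition units6 : seq C := [:: 1; 1 + w; w; -1; - (1 + w); - w].

Lemma units6_eis (e : C) : e \in units6 -> is_eis e /\ e * e^* = 1.
Proof.
have hw := w3_sqr R.
by rewrite !inE => /orP[|/orP[|/orP[|/orP[|/orP[]]]]] /eqP ->; split; solve [is_eis_tac | rewrite !cJ; ring: hw].
Qed.

Lemma units6_rot (e : C) : e \in units6 -> (1 + w) * e \in units6 /\ - w * e \in units6.
Proof.
have hw := w3_sqr R.
have m k (x : C) : (k < 6)%N -> x = units6`_k -> x \in units6 by move=> h ->; exact: mem_nth.
move=> /(nthP 0)[[|[|[|[|[|[|//]]]]]] /= _ <-]; split.
by apply: (@m 1%N) => //=; ring: hw.
by apply: (@m 5%N) => //=; ring: hw.
by apply: (@m 2%N) => //=; ring: hw.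
by apply: (@m 0%N) => //=; ring: hw.
by apply: (@m 3%N) => //=; ring: hw.
by apply: (@m 1%N) => //=; ring: hw.
by apply: (@m 4%N) => //=; ring: hw.
by apply: (@m 2%N) => //=; ring: hw.
by apply: (@m 5%N) => //=; ring: hw.
by apply: (@m 3%N) => //=; ring: hw.
by apply: (@m 0%N) => //=; ring: hw.
by apply: (@m 4%N) => //=; ring: hw.
Qed.

Lemma seq_max (T : eqType) (f : T -> R) (a : T) (s : seq T) :
  exists2 x, x \in a :: s & forall y, y \in a :: s -> f y <= f x.
Proof.
elim: s a => [|b s ih] a; first by exists a => [|y]; rewrite inE// => /eqP ->.
have [x xs hx] := ih b; have [h|h] := lerP (f x) (f a).
  exists a => [|y]; rewrite inE ?eqxx// => /orP[/eqP->//|/hx yx]; exact: le_trans h.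
exists x => [|y]; rewrite inE ?xs ?orbT// => /orP[/eqP->|/hx//]; exact: ltW.
Qed.

(** The unit [e] that maximises [Re (e^* u)] turns [u] to within 30 degrees of the positive real
    axis. *)
Lemma unit_sector (u : C) : exists2 e, e \in units6 &
  let v := e^* * u in - Re v <= sq3 R * Im v /\ sq3 R * Im v <= Re v.
Proof.
have [e he hm] := seq_max (fun e : C => Re (e^* * u)) 1 [:: 1 + w; w; -1; - (1 + w); - w].
exists e => //; have [h1 h2] := units6_rot he; cbv zeta.
have := hm _ h1; have := hm _ h2.
have -> : ((1 + w) * e)^* * u = - w * (e^* * u) by rewrite !cJ; ring.
have -> : (- w * e)^* * u = (1 + w) * (e^* * u) by rewrite !cJ; ring.
by move: (e^* * u) => v; rewrite !ReIm Re_w3 Im_w3 => g1 g2; split; lra.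
Qed.

Definition ured (u : C) := forall e, e \in units6 -> Re (e^* * u) <= 1/2.

(** The lattice point nearest to [- u] is the index of the largest term of a Gaussian sum;
    comparison with its six neighbours gives the inequalities. *)
Lemma exists_ured (u : C) : exists2 b, is_eis b & ured (u + b).
Proof.
have [M hM] := @bsum_cut R 1 u ltr01.
have [b _ hb] := bsum_max (fun i => expR_gt0 _) hM (I : (fun _ : eis => True) (0, 0)).
exists (ei R b); first by apply/is_eisP; exists b.
move=> e /units6_eis[he e1]; have /is_eisP[a ea] := he.
have := hb (addE b (oppE a)) I; rewrite ler_expR !mulN1r lerN2 ei_add ei_opp -ea.
have -> : u + ei R b = ei R b + u by rewrite addrC.
move: (ei R b) => c; have e1' : cabs e ^+ 2 = 1 by apply: complexI; rewrite -mulcJ e1.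
have -> : c - e + u = c + u - e by ring.
move: (c + u) e1' => v; rewrite !cabs_sqr !ReIm => e1' h; lra.
Qed.

(** The circle conditions are taken at [tau], at [tau - th], and at the units with [m = - w], which
    has trace 1. If the point is neither near nor high, the larger transverse coordinate contradicts
    [L_real]. *)
Lemma geom_reduced (t u2 u3 : C) (y : R) : ured u2 -> ured u3 -> 0 <= Im t <= sq3 R ->
  (forall b2 b3 m : C, is_eis b2 -> is_eis b3 -> is_eis m -> m + m^* = b2 * b2^* + b3 * b3^* ->
     1 <= cabs (t + m - b2^* * u2 - b3^* * u3)) ->
  0 < y -> y = 2 * Re t - cabs u2 ^+ 2 - cabs u3 ^+ 2 ->
  1/2 <= Re t /\ (near u2 u3 \/ 11/10 <= y).
Proof.
move=> r2 r3 /andP[i0 i1] H y0 yE; have [s1 s2] := sq3_bounds R; have ss2 := sq3_sqr R.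
have s0 := sq3_gt0 R; have hw := w3_sqr R.
have c0 : 1 <= Re t ^+ 2 + Im t ^+ 2.
  have := H 0 0 0 (is_eis0 R) (is_eis0 R) (is_eis0 R); rewrite !conj0 !(mul0r, addr0, subr0) => /(_ erefl) h.
  by rewrite -cabs_sqr; exact: exprn_ege1.
have c0' : 1 <= Re t ^+ 2 + (sq3 R - Im t) ^+ 2.
  have e : is_eis (- th) by is_eis_tac.
  have := H 0 0 _ (is_eis0 R) (is_eis0 R) e; rewrite !conj0 !(mul0r, addr0, subr0) => /(_ _) h.
  have : 1 <= cabs (t - th) by apply: h; rewrite !cJ; ring.
  by move=> /(exprn_ege1 2); rewrite cabs_sqr !ReIm Re_w3 Im_w3; congr (_ <= _); field.
have cu j (e : C) : e \in units6 -> 1 <= (Re t + 1/2 - Re (e^* * (if j then u2 else u3))) ^+ 2 +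
    (Im t - sq3 R / 2 - Im (e^* * (if j then u2 else u3))) ^+ 2.
  move=> /units6_eis[he e1]; have mw : is_eis (- w) by is_eis_tac.
  have h : 1 <= cabs (t - w - e^* * (if j then u2 else u3)).
    case: j.
      have := H e 0 _ he (is_eis0 R) mw; rewrite !conj0 !(mul0r, addr0, subr0); apply.
      by rewrite e1 !cJ; ring.
    have := H 0 e _ (is_eis0 R) he mw; rewrite !conj0 !(mul0r, addr0, add0r, subr0); apply.
    by rewrite e1 !cJ; ring.
  by have := exprn_ege1 2 h; move: (e^* * _) => v; rewrite cabs_sqr !ReIm Re_w3 Im_w3; congr (_ <= _); field.
have Tp : 0 < Re t by have := sqr_ge0 (cabs u2); have := sqr_ge0 (cabs u3); lra.
have T0 : 1/2 <= Re t.
  clear cu H; have q : 1/4 <= Re t ^+ 2.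
    have [h|h] := lerP (Im t) (sq3 R / 2).
      have : Im t ^+ 2 <= (sq3 R / 2) ^+ 2 by rewrite ler_pXn2r ?nnegrE//; lra.
      by rewrite exprMn ss2; lra.
    have : (sq3 R - Im t) ^+ 2 <= (sq3 R / 2) ^+ 2 by clear - h i1 s0; rewrite ler_pXn2r ?nnegrE//; lra.
    by rewrite exprMn ss2; lra.
  rewrite leNgt; apply/negP => h; have : Re t * Re t < 1/4 by clear -h Tp; nra.
  by rewrite -expr2; lra.
split=> //; rewrite /near; case: lerP => [h|nu]; [by left|right].
rewrite leNgt; apply/negP => hy.
have [j [m mE [m1 m2]]] : exists (j : bool), exists2 m, m = cabs (if j then u2 else u3) ^+ 2 &
    1/64 <= m /\ cabs u2 ^+ 2 + cabs u3 ^+ 2 <= 2 * m.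
  have [h|h] := lerP (cabs u2 ^+ 2) (cabs u3 ^+ 2).
    by exists false; exists (cabs u3 ^+ 2) => //; lra.
  by exists true; exists (cabs u2 ^+ 2) => //; lra.
have rj : ured (if j then u2 else u3) by case: (j).
have {}cu := cu j; move: (if j then u2 else u3) mE rj cu => u mE rj cu.
have [e he [x1 x2]] := unit_sector u; have [er1 er2] := units6_rot he; have [_ e1] := units6_eis he.
have xh := rj _ he; have c1 := cu _ he.
have mv : m = Re (e^* * u) ^+ 2 + Im (e^* * u) ^+ 2.
  rewrite -cabs_sqr cabsM cabsJ exprMn mE; have -> : cabs e ^+ 2 = 1 by apply: complexI; rewrite -mulcJ e1.
  by rewrite mul1r.
have yT : 2 * Re t - (cabs u2 ^+ 2 + cabs u3 ^+ 2) < 11/10 by clear - hy yE; lra.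
have [h|h] := lerP (Im t) (sq3 R / 2).
  have c2 := cu _ er1.
  have ev : ((1 + w) * e)^* * u = - w * (e^* * u) by rewrite !cJ; ring.
  rewrite ev in c2; move: (e^* * u) xh c1 c2 mv x1 x2 => v xh c1 c2 mv x1 x2.
  apply: (@L_real _ (sq3 R) (Re v) (Im v) (sq3 R / 2 - Im t) (Re t) m _ ss2 s1 s2 mv m1 _ _ xh x1 x2 T0 m2 yT).
  by clear - h; lra.
  by clear - i0; lra.
  by apply: le_trans c0 _; rewrite le_eqVlt; apply/orP; left; apply/eqP; field.
  by apply: le_trans c1 _; rewrite le_eqVlt; apply/orP; left; apply/eqP; field.
  by apply: le_trans c2 _; rewrite !ReIm Re_w3 Im_w3 le_eqVlt; apply/orP; left; apply/eqP; field.
(* In the upper half of the strip everything is reflected in its middle line: [J] changes sign and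
   the other neighbouring unit is used. *)
have c2 := cu _ er2.
have ev : (- w * e)^* * u = (1 + w) * (e^* * u) by rewrite !cJ; ring.
rewrite ev in c2; move: (e^* * u) xh c1 c2 mv x1 x2 => v xh c1 c2 mv x1 x2.
have mv' : m = Re v ^+ 2 + (- Im v) ^+ 2 by rewrite sqrrN.
apply: (@L_real _ (sq3 R) (Re v) (- Im v) (Im t - sq3 R / 2) (Re t) m _ ss2 s1 s2 mv' m1 _ _ xh _ _ T0 m2 yT).
by clear - h; lra.
by clear - i1; lra.
by clear - x2; lra.
by clear - x1; lra.
by apply: le_trans c0' _; rewrite le_eqVlt; apply/orP; left; apply/eqP; field.
by apply: le_trans c1 _; rewrite le_eqVlt; apply/orP; left; apply/eqP; field.
by apply: le_trans c2 _; rewrite !ReIm Re_w3 Im_w3 le_eqVlt; apply/orP; left; apply/eqP; field.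
Qed.

Definition uu2 z := z o2 ord0 / cA z.
Definition uu3 z := z o3 ord0 / cA z.

Lemma tau_eich (b2 b3 m : C) z : cA z != 0 -> let x := eich b2 b3 m *m z in
  [/\ cA x = cA z, tau_ x = tau_ z + m + b2^* * uu2 z + b3^* * uu3 z, uu2 x = uu2 z + b2 & uu3 x = uu3 z + b3].
Proof.
move=> A0 x; have xE : x = cusp4 (cB z + m * cA z + b2^* * z o2 ord0 + b3^* * z o3 ord0) (cA z)
    (z o2 ord0 + cA z * b2) (z o3 ord0 + cA z * b3) by rewrite /x -{1}(cuspK z) eichE.
by split; rewrite /tau_ /uu2 /uu3 xE ?cA_cusp ?cB_cusp ?V4E//; field.
Qed.

Lemma hy_real z : 0 < hn z -> hy z = 2 * Re (tau_ z) - cabs (uu2 z) ^+ 2 - cabs (uu3 z) ^+ 2.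
Proof.
move=> hz; have := congr1 (@complex.Re R) (hyE hz); rewrite -/(uu2 z) -/(uu3 z) !mulcJ.
by move: (tau_ z) (uu2 z) (uu3 z) => t a b; rewrite !ReIm; lra.
Qed.

Definition zred z := 1/2 <= Re (tau_ z) /\ (near (uu2 z) (uu3 z) \/ 11/10 <= hy z).

Lemma exists_zred z : 0 < hn z -> exists2 g, G3 g & zred (g *m z).
Proof.
move=> hz; have [g hg hm] := exists_hmin hz; have hz1 : 0 < hn (g *m z) by rewrite hn_G3.
have A0 := cA_neq0 hz1.
have [b2 e2 r2] := exists_ured (uu2 (g *m z)); have [b3 e3 r3] := exists_ured (uu3 (g *m z)).
have /is_eisP[a2 ea2] := e2; have /is_eisP[a3 ea3] := e3.
pose n := (en a2 + en a3).
pose T0 := Im (tau_ (g *m z) - n%:~R * w + b2^* * uu2 (g *m z) + b3^* * uu3 (g *m z)).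
pose k := Num.floor (T0 / sq3 R).
have s0 := sq3_gt0 R.
(* [- n w] has the prescribed trace [n]; the multiple of [th], of trace 0, moves [Im tau] into
   [[0, sqrt 3]]. *)
pose m : C := - n%:~R * w - th * k%:~R.
have hT : G3 (eich b2 b3 m).
  apply: G3_eich => //; first by rewrite /m; is_eis_tac.
  by rewrite ea2 ea3 -!enC /m !cJ /n intrD; ring.
have [h1 h2 h3 h4] := tau_eich b2 b3 m A0.
exists (eich b2 b3 m *m g); first exact: G3M.
rewrite -mulmxA; move: (eich b2 b3 m *m (g *m z)) (hn_G3 (g *m z) hT) (@hmin_G3 _ _ (g *m z) hT) h1 h2 h3 h4.
move=> x hx mx h1 h2 h3 h4; have {}mx := mx (congr1 (@cabs R) h1) hm.
rewrite /zred; have hx0 : 0 < hn x by rewrite hx.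
have [] // := @geom_reduced (tau_ x) (uu2 x) (uu3 x) (hy x).
  by rewrite h3.
  by rewrite h4.
  have -> : Im (tau_ x) = T0 - sq3 R * k%:~R.
    by rewrite h2 /T0 /m; move: (b2^* * _) (b3^* * _) (tau_ _) => *; rewrite !ReIm Re_w3 Im_w3; field.
  have k1 : k%:~R <= T0 / sq3 R by exact: ge_floor.
  have k2 : T0 / sq3 R < k%:~R + 1 by rewrite -intrD1; exact: floorD1_gt.
  rewrite ler_pdivlMr// in k1; rewrite ltr_pdivrMr// in k2.
  by clearbody k T0; clear -k1 k2; apply/andP; split; lra.
  by move=> c2 c3 m' *; exact: hmin_ge1.
  exact: hy_gt0.
exact: hy_real.
Qed.

End Zeros.

(** * The zero set of the invariant sum *)

Section ZeroSet.
Variable R : realType.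
Local Notation C := R[i].
Local Notation w := (w3 R).
Local Notation hh := (hh R).
Local Notation th := (1 + 2 * w3 R).
Implicit Types (z x r p : 'cV[C]_4) (A B g : 'M[C]_4).

Lemma NN0_Phi (a b c d : C) z : 0 < hn z -> NN0 (hh *: cusp4 a b c d) z = 0 ->
  Phi (tau_ z) (uu2 z) (uu3 z) (hh * a) (hh * b) (hh * c) (hh * d) = 0.
Proof. by move=> hz /(NN0_eq0 _ hz); rewrite cuspZ cA_cusp cB_cusp !V4E. Qed.

Lemma yeq_z z : 0 < hn z -> yeq (tau_ z) (uu2 z) (uu3 z) (hy z).
Proof. by move=> hz; split; [exact: hy_gt0|exact: hyE]. Qed.

(** For all [u2, u3] the point [(1 + w, 1, u2, u3)] lies on the mirror of the vector [(w, 1, 0, 0)]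
    of norm -1. This is the known zero with which critical points are compared. *)
Lemma crit_Phi (a b c d u2 u3 : C) : near u2 u3 -> is_eis (hh * (w^* * b + a)) ->
  Phi (1 + w) u2 u3 (hh * a) (hh * b) (hh * c) (hh * d) = 0.
Proof.
rewrite /near => nu he; pose z := cusp4 (1 + w) 1 u2 u3.
have hz : 0 < hn z.
  rewrite -ltcR -hnE hform_cusp ![_^* * u2]mulrC ![_^* * u3]mulrC !mulcJ !cJ.
  have -> : (1 + (-1 - w)) * 1 + 1 * (1 + w) - (cabs u2 ^+ 2)%:C - (cabs u3 ^+ 2)%:C =
     (1 - cabs u2 ^+ 2 - cabs u3 ^+ 2)%:C by rewrite !CD !CN C1; ring.
  by rewrite ltcR; lra.
have h : NN0 (hh *: cusp4 a b c d) z = 0.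
  have l1 : lat (cusp4 w 1 0 0) by apply: lat_cusp4; is_eis_tac.
  apply: (@NN0_mirror _ _ (cusp4 w 1 0 0)) => //.
  by rewrite hform_cusp !cJ; ring.
  by rewrite hform_bv2 V4E oppr0.
  rewrite hformZr hform_cusp !conj0 conj1 !mul0r !subr0 mul1r; exact: he.
  by rewrite hform_cusp !cJ; ring.
have := NN0_Phi hz h; rewrite /tau_ /uu2 /uu3 cA_cusp cB_cusp !V4E !divr1.
by [].
Qed.

Lemma root_tau p z (k : int) : 0 < hn z -> tau_ z = 1 + w + th * k%:~R ->
  is_eis (hh * ((cB p)^* + (cA p)^* * (w + th * k%:~R))) -> root p z.
Proof.
move=> hz tE he; have A0 := cA_neq0 hz; pose r := cusp4 (w + th * k%:~R) 1 0 0.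
have lr : lat r by apply: lat_cusp4; is_eis_tac.
have o : hform (bv R o2) r = 0 by rewrite hform_bv2 V4E oppr0.
have n1 : hform r r = -1 by rewrite hform_cusp !cJ; ring.
exists (swp r); first exact: swp_G3.
rewrite swp_bv//; split.
  by rewrite -(cuspK p) hform_cusp mulr1 !mulr0 !subr0.
rewrite -(cuspK z) hform_cusp !conj0 !mul0r !subr0 conj1 mul1r.
have -> : cB z = (1 + w + th * k%:~R) * cA z by rewrite -tE divfK.
by rewrite !cJ; ring.
Qed.

Lemma eich_ex (b : C) : is_eis b -> exists2 m, is_eis m & m + m^* = b * b^*.
Proof.
move=> /is_eisP[a ->]; exists (- (en a)%:~R * w); first by is_eis_tac.
by rewrite -enC !cJ; ring.
Qed.

Lemma root_u2 z : 0 < hn z -> is_eis (hh * uu2 z) -> root (cusp4 (-1) 1 0 0) z.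
Proof.
move=> hz he; have A0 := cA_neq0 hz; have h1 := third_theta R.
have [m hm em] : exists2 m, is_eis m & m + m^* = uu2 z * (uu2 z)^*.
  apply: eich_ex; have -> : uu2 z = th * (hh * uu2 z) by rewrite mulrA [th * hh]mulrC h1 mul1r.
  by is_eis_tac.
have e2 : is_eis (uu2 z).
  have -> : uu2 z = th * (hh * uu2 z) by rewrite mulrA [th * hh]mulrC h1 mul1r.
  by is_eis_tac.
exists (eich (uu2 z) 0 m).
  by apply: G3_eich => //; [is_eis_tac|rewrite em mul0r addr0].
rewrite bv_cusp2 eichE !hform_cusp !(mulr0, mul0r, mulr1, add0r, addr0, conj0, conj1, subr0, mul1r); split.
  have -> : hh * (uu2 z)^* = - (hh * uu2 z)^* by rewrite conjM hhJ; ring.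
  by is_eis_tac.
rewrite -[z in hform _ z]cuspK hform_cusp conjKc !(mulr0, mul0r, mulr1, add0r, addr0, conj0, conj1, subr0, mul1r).
by rewrite /uu2 divfK// subrr.
Qed.

Lemma root_u3 z : 0 < hn z -> is_eis (hh * uu3 z) -> root (cusp4 (-1) 1 0 0) z.
Proof.
move=> hz he; have A0 := cA_neq0 hz; have h1 := third_theta R.
have e2 : is_eis (uu3 z).
  have -> : uu3 z = th * (hh * uu3 z) by rewrite mulrA [th * hh]mulrC h1 mul1r.
  by is_eis_tac.
have [m hm em] := eich_ex e2.
have o : hform (bv R o2) (bv R o3) = 0 by rewrite hform_bv2 bvE oppr0.
have n1 : hform (bv R o3) (bv R o3) = -1 by rewrite hform_bv3 bvkk.
exists (eich 0 (uu3 z) m *m swp (bv R o3)).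
  apply: G3M; first by apply: G3_eich => //; [is_eis_tac|rewrite em mul0r add0r].
  by apply: swp_G3 => //; exact: lat_bv.
rewrite -mulmxA swp_bv// bv_cusp3 eichE !hform_cusp !(mulr0, mul0r, mulr1, add0r, addr0, conj0, conj1, subr0, mul1r); split.
  have -> : hh * (uu3 z)^* = - (hh * uu3 z)^* by rewrite conjM hhJ; ring.
  by is_eis_tac.
rewrite -[z in hform _ z]cuspK hform_cusp conjKc !(mulr0, mul0r, mulr1, add0r, addr0, conj0, conj1, subr0, mul1r).
by rewrite /uu3 divfK// subrr.
Qed.

Lemma ZS_I (s : int) z : 0 < hn z -> zred z -> s \in [:: 0; 1; -1] -> ZS (cusp4 s%:~R 0 1 1) z.
Proof.
move=> hz [t0 [nu|far]] hs n0; have := NN0_Phi hz n0; rewrite mulr0 mulr1 => h; last first.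
  by have := typeI_far (yeq_z hz) far h.
have c0 : Phi (1 + w) (uu2 z) (uu3 z) 0 0 hh hh = 0.
  have e0 : is_eis (hh * (w^* * 0 + 0)) by rewrite mulr0 addr0 mulr0; is_eis_tac.
  by have := @crit_Phi 0 0 1 1 _ _ nu e0; rewrite mulr0 mulr1.
have [s0|s1] := eqVneq s 0.
  rewrite s0 mulr0z mulr0 in h.
  have [k tE] := X_eq (typeI_crit nu (yeq_z hz) t0 c0 h).
  apply: (root_tau hz tE); rewrite cB_cusp cA_cusp s0 mulr0z conj0 mul0r addr0 mulr0; is_eis_tac.
have k2 : (s%:~R : R) ^+ 2 = 1.
  by move: hs; rewrite !inE (negbTE s1) /= => /orP[]/eqP ->; rewrite ?intrN ?sqrrN expr1n.
by have := typeI_char k2 nu (yeq_z hz) t0 c0; rewrite Cint mulrC h.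
Qed.

(** The third alternative arises when a point of [near] is translated by a vector with an entry 1 or
    -1, which places [hh * u] next to a hole. *)
Definition zII z := [\/ 11/10 <= hy z, near (uu2 z) (uu3 z) /\ 1/2 <= Re (tau_ z) |
  31/32 <= hy z /\ ((forall x : C, rho x <= 287/100 * rho (hh * uu2 z)) \/
                    (forall x : C, rho x <= 287/100 * rho (hh * uu3 z)))].

Lemma ZS_II z : 0 < hn z -> zII z -> ZS (cusp4 (-1) 1 0 0) z.
Proof.
move=> hz hr n0; have := NN0_Phi hz n0; rewrite mulr0 mulr1 mulrN1 => h.
have R2 := root_u2 hz; have R3 := root_u3 hz.
case: hr => [far|[nu t0]|[y0 hole]].
  by case: (typeII_far (yeq_z hz) far h).
  have hw := w3_sqr R; have h1 := third_theta R.
  have e0 : is_eis (hh * (w^* * 1 + -1)).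
    have -> : w^* * 1 + -1 = th * w by rewrite !cJ; ring: hw.
    by rewrite mulrA h1 mul1r; is_eis_tac.
  have c0 := @crit_Phi (-1) 1 0 0 _ _ nu e0; rewrite mulr0 mulr1 mulrN1 in c0.
  case: (typeII_crit nu (yeq_z hz) t0 c0 h) => [/R2//|/R3//|/X_eq[k tE]].
  apply: (root_tau hz tE); rewrite cB_cusp cA_cusp !cJ mul1r.
  have -> : -1 + (w + th * k%:~R) = th * (1 + w + k%:~R) by ring: hw.
  by rewrite mulrA h1 mul1r; is_eis_tac.
by case: (typeII_hole (yeq_z hz) y0 hole h).
Qed.

Lemma F2_coord z : [/\ tau_ (F2 R *m z) = tau_ z, uu2 (F2 R *m z) = - uu2 z & uu3 (F2 R *m z) = uu3 z].
Proof.
have e := F2E (cB z) (cA z) (z o2 ord0) (z o3 ord0); rewrite cuspK in e.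
by rewrite /tau_ /uu2 /uu3 e cA_cusp cB_cusp !V4E mulNr.
Qed.
Lemma F3_coord z : [/\ tau_ (F3 R *m z) = tau_ z, uu2 (F3 R *m z) = uu2 z & uu3 (F3 R *m z) = - uu3 z].
Proof.
have e := F3E (cB z) (cA z) (z o2 ord0) (z o3 ord0); rewrite cuspK in e.
by rewrite /tau_ /uu2 /uu3 e cA_cusp cB_cusp !V4E mulNr.
Qed.
Lemma N1_coord z : [/\ tau_ (- z) = tau_ z, uu2 (- z) = uu2 z & uu3 (- z) = uu3 z].
Proof.
have e : - z = cusp4 (- cB z) (- cA z) (- z o2 ord0) (- z o3 ord0) by rewrite -[in LHS](cuspK z) cuspN.
by rewrite /tau_ /uu2 /uu3 e cA_cusp cB_cusp !V4E !invrN !mulrNN.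
Qed.

Lemma zred_eq z x : 0 < hn z -> 0 < hn x -> tau_ x = tau_ z -> cabs (uu2 x) = cabs (uu2 z) ->
  cabs (uu3 x) = cabs (uu3 z) -> zred z -> zred x.
Proof. by move=> hz hx e1 e2 e3; rewrite /zred /near !hy_real// e1 e2 e3. Qed.

Lemma ZS_flip z (sm s2 s3 : int) : 0 < hn z -> zred z -> sm \in [:: 0; 1; -1] ->
  s2 ^+ 2 = 1 -> s3 ^+ 2 = 1 -> ZS (cusp4 sm%:~R 0 s2%:~R s3%:~R) z.
Proof.
move=> hz zr hs h2 h3.
have [k2|k2] : s2 = 1 \/ s2 = -1 by move: h2; rewrite expr2; nia.
all: have [k3|k3] : s3 = 1 \/ s3 = -1 by move: h3; rewrite expr2; nia.
all: rewrite k2 k3 ?intrN.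
by apply: ZS_I.
  apply: (ZS_G3 (G3_F3 R)); rewrite F3E opprK; apply: ZS_I => //; first by rewrite hn_G3//; exact: G3_F3.
  have [e1 e2 e3] := F3_coord z.
  by apply: (zred_eq hz) => //; rewrite ?e1 ?e2 ?e3 ?cabsN// hn_G3//; exact: G3_F3.
  apply: (ZS_G3 (G3_F2 R)); rewrite F2E opprK; apply: ZS_I => //; first by rewrite hn_G3//; exact: G3_F2.
  have [e1 e2 e3] := F2_coord z.
  by apply: (zred_eq hz) => //; rewrite ?e1 ?e2 ?e3 ?cabsN// hn_G3//; exact: G3_F2.
have hz2 : 0 < hn (F2 R *m z) by rewrite hn_G3//; exact: G3_F2.
have hz3 : 0 < hn (F3 R *m (F2 R *m z)) by rewrite hn_G3//; exact: G3_F3.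
apply: (ZS_G3 (G3_F2 R)); rewrite F2E opprK; apply: (ZS_G3 (G3_F3 R)); rewrite F3E opprK; apply: (ZS_I hz3 _ hs).
have [e1 e2 e3] := F2_coord z; have [f1 f2 f3] := F3_coord (F2 R *m z).
by apply: (zred_eq hz) => //; rewrite ?f1 ?f2 ?f3 ?e1 ?e2 ?e3 ?cabsN.
Qed.

Lemma not_eis_hh (s : int) : s \in [:: 1; -1] -> ~ is_eis (hh * s%:~R).
Proof. by move=> hs /theta_dvd[m]; move: hs; rewrite !inE => /orP[]/eqP ->; lia. Qed.

(** Translation by [- (s2, s3)] clears the last two entries; the norm, congruent to 1 modulo 3, then
    forces the first entry to be -1 modulo [th], which is type II. *)
Lemma ZS_eich z (sm s2 s3 k : int) : 0 < hn z -> zred z -> s2 \in [:: 0; 1; -1] -> s3 \in [:: 0; 1; -1] ->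
  2 * sm - s2 ^+ 2 - s3 ^+ 2 = 1 + 3 * k -> ZS (cusp4 sm%:~R 1 s2%:~R s3%:~R) z.
Proof.
move=> hz zr h2 h3 e; have hw := w3_sqr R; have A0 := cA_neq0 hz.
pose n := s2 ^+ 2 + s3 ^+ 2; pose m : C := - n%:~R * w.
have hT : G3 (eich (- s2%:~R) (- s3%:~R) m).
  apply: G3_eich; rewrite /m; [is_eis_tac..|].
  by rewrite !cJ /n intrD !expr2 ?intrM; ring.
apply: (ZS_G3 hT); rewrite eichE !mulr1 !mul1r !subrr.
have hz' : 0 < hn (eich (- s2%:~R) (- s3%:~R) m *m z) by rewrite hn_G3.
have [d1 d2 d3 d4] := tau_eich (- s2%:~R) (- s3%:~R) m A0.
pose c : C := - th * (1 + 2 * k%:~R - sm%:~R) - n%:~R * (1 + w).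
apply: (@ZS_modE _ _ (cusp4 (-1) 1 0 0) (cusp4 c 0 0 0)).
  by apply: lat_cusp4; rewrite /c; is_eis_tac.
  rewrite cuspZ cuspD !mulr0 !addr0; congr cusp4.
  have nE : n%:~R = 2 * sm%:~R - 1 - 3 * k%:~R :> C.
    have : n = 2 * sm - 1 - 3 * k by rewrite /n; lia.
    by move=> ->; rewrite !intrD !intrN !intrM.
  have e2 : (- s2%:~R)^* * s2%:~R + (- s3%:~R)^* * s3%:~R = - n%:~R :> C.
    by rewrite !cJ /n intrD !expr2 ?intrM; ring.
  by rewrite -addrA e2 /m /c nE; ring: hw.
apply: ZS_II => //; have hyx : hy (eich (- s2%:~R) (- s3%:~R) m *m z) = hy z by rewrite /hy hn_G3// d1.
case: zr => t0 [nu|far]; last by constructor 1; rewrite hyx.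
have y1 : 31/32 <= hy z by rewrite hy_real//; move: nu; rewrite /near; lra.
have nu' : cabs (uu2 z) ^+ 2 <= 1/32 /\ cabs (uu3 z) ^+ 2 <= 1/32.
  by move: nu; rewrite /near; have := sqr_ge0 (cabs (uu2 z)); have := sqr_ge0 (cabs (uu3 z)); lra.
have [z2|n2] := eqVneq s2 0; last first.
  constructor 3; rewrite hyx d3; split=> //; left; apply: (@rho_hole _ (- s2%:~R)); first by is_eis_tac.
    rewrite -intrN; apply: not_eis_hh; move: h2; rewrite !inE (negbTE n2) /= => /orP[]/eqP ->; by rewrite ?opprK eqxx ?orbT.
  by rewrite addrK; case: nu'.
have [z3|n3] := eqVneq s3 0; last first.
  constructor 3; rewrite hyx d4; split=> //; right; apply: (@rho_hole _ (- s3%:~R)); first by is_eis_tac.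
    rewrite -intrN; apply: not_eis_hh; move: h3; rewrite !inE (negbTE n3) /= => /orP[]/eqP ->; by rewrite ?opprK eqxx ?orbT.
  by rewrite addrK; case: nu'.
have m0 : m = 0.
  rewrite /m; have -> : n = 0 by rewrite /n z2 z3.
  by rewrite mulr0z oppr0 mul0r.
constructor 2; rewrite d2 d3 d4 m0 z2 z3 !mulr0z !oppr0 !conj0 !mul0r !addr0.
by split.
Qed.

Lemma lat_split p : lat p -> exists (sm sa s2 s3 : int) (q : 'cV[C]_4),
  [/\ lat q, p = cusp4 sm%:~R sa%:~R s2%:~R s3%:~R + th *: q, sm \in [:: 0; 1; -1], sa \in [:: 0; 1; -1]
   & (s2 \in [:: 0; 1; -1]) && (s3 \in [:: 0; 1; -1])].
Proof.
move=> hp; have [hB hA] := lat_coord hp.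
have [sm [c1 [e1 h1 k1]]] := eis_cases hB; have [sa [c2 [e2 h2 k2]]] := eis_cases hA.
have [s2 [c3 [e3 h3 k3]]] := eis_cases (hp o2); have [s3 [c4 [e4 h4 k4]]] := eis_cases (hp o3).
exists sm, sa, s2, s3, (cusp4 c1 c2 c3 c4); split=> //; last by rewrite k3 k4.
  by apply: lat_cusp4.
by rewrite cuspZ cuspD -h1 -h2 -h3 -h4 cuspK.
Qed.

(** Modulo [th] the entry [sa] decides the type: [sa = 0] forces both transverse entries to be 1 or
    -1 because of the norm, which is type I, while for [sa = -1] a change of sign leads to
    [ZS_eich]. *)
Lemma ZS_all p z (k : int) : 0 < hn z -> lat p -> hform p p = (1 + 3 * k)%:~R -> ZS p z.
Proof.
move=> hz; have [g hg zr] := exists_zred hz; move=> hp pk.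
apply: (ZS_G3 hg); have : lat (g *m p) by exact: G3_lat.
have : hform (g *m p) (g *m p) = (1 + 3 * k)%:~R by have [_ _ _ ->] := hg.
have : 0 < hn (g *m z) by rewrite hn_G3.
move: (g *m p) (g *m z) zr => {hg pk hp hz} {}p {}z zr hz pk hp {g}.
have [sm [sa [s2 [s3 [q [hq pE k1 k2 /andP[k3 k4]]]]]]] := lat_split hp.
apply: (ZS_modE hq pE).
have ls : lat (cusp4 sm%:~R sa%:~R s2%:~R s3%:~R : 'cV[C]_4) by apply: lat_cusp4; is_eis_tac.
have [k' ke] := hform_mod ls hq; rewrite -pE pk in ke.
have e : 2 * sm * sa - s2 ^+ 2 - s3 ^+ 2 = 1 + 3 * (k - k').
  apply: (@intr_inj C); have -> : (1 + 3 * (k - k'))%:~R = (1 + 3 * k)%:~R - (3 * k')%:~R :> C.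
    by rewrite -intrB; congr (_%:~R); ring.
  by rewrite ke addrK hform_cusp !cJ !expr2 !intrB !intrM; ring.
have [a0|[a1|a1]] : sa = 0 \/ sa = 1 \/ sa = -1.
  by move: k2; rewrite !inE => /orP[|/orP[]]/eqP; tauto.
  rewrite a0 mulr0z; apply: ZS_flip => //; move: e k3 k4; rewrite a0 mulr0 !inE.
    by move=> e /orP[|/orP[]]/eqP k3 /orP[|/orP[]]/eqP k4; move: e; rewrite k3 k4 // !expr2; lia.
  by move=> e /orP[|/orP[]]/eqP k3 /orP[|/orP[]]/eqP k4; move: e; rewrite k3 k4 // !expr2; lia.
  by rewrite a1; apply: (@ZS_eich _ _ _ _ (k - k')) => //; rewrite -e a1 mulr1.
have N1 := G3_N1 R; apply: (ZS_G3 N1); rewrite !mN1E.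
have hzN : 0 < hn (- z) by rewrite -mN1E hn_G3.
have zrN : zred (- z).
  by have [e1 e2 e3] := N1_coord z; apply: (zred_eq hz) => //; rewrite ?e1 ?e2 ?e3.
rewrite cuspN -!intrN a1 opprK; apply: (@ZS_eich _ _ _ _ (k - k')) => //.
  by move: k3; rewrite !inE => /orP[|/orP[]]/eqP ->.
  by move: k4; rewrite !inE => /orP[|/orP[]]/eqP ->.
by rewrite -e a1 !sqrrN; ring.
Qed.
End ZeroSet.

(** * The congruence subgroup and its orbits of mirrors *)

Section Congruence.
Variable R : realType.
Local Notation C := R[i].
Local Notation hh := (hh R).
Local Notation th := (1 + 2 * w3 R).
Local Notation bv := (bv R).
Implicit Types (z x y r v : 'cV[C]_4) (A B g G K : 'M[C]_4).

Lemma sqrtm3E : sqrtm3 R = th.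
Proof.
have -> : th = iu R * (sq3 R)%:C by apply: complexP; rewrite !ReIm Re_w3 Im_w3; field.
by rewrite /sqrtm3 sq3E.
Qed.

Lemma in_idealP (x : C) : in_ideal (sqrtm3 R) x <-> is_eis (hh * x).
Proof.
rewrite sqrtm3E; have h := third_theta R; split=> [[y [hy' ->]]|hx].
  by rewrite mulrA h mul1r.
by exists (hh * x); split=> //; rewrite mulrA [th * hh]mulrC h mul1r.
Qed.

Definition eqv x y := forall k, is_eis (hh * (x k ord0 - y k ord0)).

Lemma eqv_refl x : eqv x x. Proof. by move=> k; rewrite subrr mulr0; is_eis_tac. Qed.
Lemma eqv_sym x y : eqv x y -> eqv y x.
Proof. by move=> h k; rewrite -opprB mulrN; apply: is_eisN. Qed.
Lemma eqv_trans y x z : eqv x y -> eqv y z -> eqv x z.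
Proof.
move=> h1 h2 k; have -> : hh * (x k ord0 - z k ord0) = hh * (x k ord0 - y k ord0) + hh * (y k ord0 - z k ord0) by ring.
exact: is_eisD.
Qed.
Lemma eqv_mul A x y : (forall k l, is_eis (A k l)) -> eqv x y -> eqv (A *m x) (A *m y).
Proof.
move=> hA h k; have -> : hh * ((A *m x) k ord0 - (A *m y) k ord0) = \sum_j A k j * (hh * (x j ord0 - y j ord0)).
  by rewrite !mxE -sumrB mulr_sumr; apply: eq_bigr => j _; ring.
by apply: is_eis_sum => j; exact: is_eisM.
Qed.
Lemma eqv_hform v x y : lat v -> eqv x y -> is_eis (hh * (hform v x - hform v y)).
Proof.
move=> hv h; have -> : hh * (hform v x - hform v y) = \sum_k sg4 R k * (v k ord0)^* * (hh * (x k ord0 - y k ord0)).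
  by rewrite !hform_sg -sumrB mulr_sumr; apply: eq_bigr => j _; ring.
apply: is_eis_sum => j; apply: is_eisM => //; apply: is_eisM; [exact: sg4_eis|exact: is_eisJ].
Qed.

Lemma GamP g : G3cong (sqrtm3 R) g <-> G3 g /\ forall k, eqv (g *m bv k) (bv k).
Proof.
split=> -[hg h]; split=> // k l; first by rewrite mulmx_bv bvE; apply/in_idealP.
by apply/in_idealP; have := h l k; rewrite mulmx_bv bvE.
Qed.

Lemma eqv_Gam g x : G3cong (sqrtm3 R) g -> lat x -> eqv (g *m x) x.
Proof.
move=> /GamP[hg h] hx k; have -> : hh * ((g *m x) k ord0 - x k ord0) =
    \sum_j (hh * ((g *m bv j) k ord0 - bv j k ord0)) * x j ord0.
  rewrite !mxE; have -> : x k ord0 = \sum_j bv j k ord0 * x j ord0.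
    by rewrite (bigD1 k)//= big1 ?bvkk ?mul1r ?addr0// => j jk; rewrite bvE eq_sym (negbTE jk) mul0r.
  rewrite -sumrB mulr_sumr; apply: eq_bigr => j _; rewrite mulmx_bv; ring.
by apply: is_eis_sum => j; apply: is_eisM => //; exact: h.
Qed.

Lemma Gam_inv g : G3cong (sqrtm3 R) g -> G3cong (sqrtm3 R) (invmx g).
Proof.
move=> /GamP[hg h]; apply/GamP; split; first exact: G3V.
move=> k; apply: eqv_sym; rewrite -{1}(G3K (bv k) hg); apply: eqv_mul; first by case: hg.
exact: h.
Qed.

Lemma Gam_conj g P : G3 P -> G3cong (sqrtm3 R) g -> G3cong (sqrtm3 R) (P *m g *m invmx P).
Proof.
move=> hP hg; have [h _] := hg; have hV := G3V hP; apply/GamP; split; first by apply: G3M => //; exact: G3M.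
move=> k; rewrite -!mulmxA -{2}(G3VK (bv k) hP); apply: eqv_mul; first by case: hP.
by apply: eqv_Gam => //; apply: G3_lat => //; exact: lat_bv.
Qed.

Lemma sg4_int m (k : int) : sg4 R m = k%:~R -> k = if m == ord0 then 1 else -1.
Proof. by rewrite /sg4; case: ifP => _ h; apply: (@intr_inj C); rewrite -h ?intrN. Qed.

Definition sgn3 : seq int := [:: 0; 1; -1].

Lemma split4 v : lat v -> exists (s0 s1 s2 s3 k : int),
  [/\ [&& s0 \in sgn3, s1 \in sgn3, s2 \in sgn3 & s3 \in sgn3],
      eqv v (V4 s0%:~R s1%:~R s2%:~R s3%:~R) &
      hform v v = (s0 ^+ 2 - s1 ^+ 2 - s2 ^+ 2 - s3 ^+ 2 + 3 * k)%:~R].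
Proof.
move=> hv; have h1' := third_theta R.
have [s0 [c0 [e0 h0 k0]]] := eis_cases (hv ord0); have [s1 [c1 [e1 h1 k1]]] := eis_cases (hv o1).
have [s2 [c2 [e2 h2 k2]]] := eis_cases (hv o2); have [s3 [c3 [e3 h3 k3]]] := eis_cases (hv o3).
have ls : lat (V4 s0%:~R s1%:~R s2%:~R s3%:~R : 'cV[C]_4) by apply: ord4P; rewrite V4E; is_eis_tac.
have lc : lat (V4 c0 c1 c2 c3) by apply: ord4P; rewrite V4E.
have vE : v = V4 s0%:~R s1%:~R s2%:~R s3%:~R + th *: V4 c0 c1 c2 c3.
  by apply: vec4P; rewrite [RHS]mxE [X in _ + X]mxE !V4E.
have [k hk] := hform_mod ls lc; exists s0, s1, s2, s3, k; split; first by rewrite k0 k1 k2 k3.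
  move=> j; have -> : v j ord0 = V4 s0%:~R s1%:~R s2%:~R s3%:~R j ord0 + th * V4 c0 c1 c2 c3 j ord0.
    by rewrite {1}vE [LHS]mxE [X in _ + X]mxE.
  by rewrite addrAC subrr add0r mulrA h1' mul1r; exact: lc.
rewrite {1 2}vE hk hformE !V4E !cJ !expr2 !intrD !intrN !intrM; ring.
Qed.

Lemma eqv_coord0 v (s : int) y k : eqv v y -> y k ord0 = s%:~R -> is_eis (hh * v k ord0) -> s \in sgn3 -> s = 0.
Proof.
move=> h yk hv hs; have : is_eis (hh * s%:~R).
  have -> : hh * s%:~R = hh * v k ord0 - hh * (v k ord0 - y k ord0) by rewrite yk; ring.
  by apply: is_eisD => //; apply: is_eisN.
by move=> /theta_dvd[m]; move: hs; rewrite !inE => /orP[|/orP[]]/eqP ->//; lia.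
Qed.

Definition fixes (L : seq 'I_4) G := forall k, k \in L -> eqv (G *m bv k) (bv k).

(** Coordinates are products with basis vectors, and [G] preserves both the form and, modulo [th],
    the vector [bv k]. *)
Lemma fixes_coord L G m k : G3 G -> fixes L G -> k \in L -> m != k ->
  is_eis (hh * (invmx G *m bv m) k ord0).
Proof.
move=> hG hL kL mk; have h := eqv_hform (lat_bv R m) (hL k kL).
rewrite -hform_adjV// hform_bvl bvE (negbTE mk) mulr0 subr0 in h.
have := is_eisJ h; rewrite conjM hformJ hform_bvl hhJ => h2.
have -> : hh * (invmx G *m bv m) k ord0 = - (sg4 R k * (- hh * (sg4 R k * (invmx G *m bv m) k ord0))).
  by rewrite mulNr mulrN opprK mulrCA [sg4 R k * (_ * _)]mulrA sg4_sqr mul1r.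
by apply: is_eisN; apply: is_eisM => //; exact: sg4_eis.
Qed.

Lemma adjust L G m K : G3 G -> fixes L G -> G3 K -> (forall k, k \in L -> K *m bv k = bv k) ->
  eqv (K *m bv m) (invmx G *m bv m) -> fixes (m :: L) (G *m K).
Proof.
move=> hG hL hK hf hm k; rewrite inE -mulmxA => /orP[/eqP->|kL]; last by rewrite hf//; exact: hL.
by rewrite -{2}(G3VK (bv m) hG); apply: eqv_mul => //; case: hG.
Qed.

Lemma norm_inv G m : G3 G -> lat (invmx G *m bv m) /\ hform (invmx G *m bv m) (invmx G *m bv m) = sg4 R m.
Proof.
move=> /G3V hV; split; first by apply: G3_lat => //; exact: lat_bv.
by have [_ _ _ ->] := hV; rewrite hform_bvl bvkk mulr1.
Qed.

Lemma V4_bv (a b c d : C) : V4 a b c d = a *: bv ord0 + b *: bv o1 + c *: bv o2 + d *: bv o3.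
Proof. by apply: vec4P; rewrite !mxE /=; ring. Qed.

Lemma bv_orth k l : k != l -> hform (bv k) (bv l) = 0.
Proof. by move=> kl; rewrite hform_bvl bvE (negbTE kl) mulr0. Qed.
Lemma bv_norm k : hform (bv k) (bv k) = sg4 R k.
Proof. by rewrite hform_bvl bvkk mulr1. Qed.

Lemma flip_bv k : k != ord0 -> G3 (refl (bv k) 2) /\ (forall l, refl (bv k) 2 *m bv l = if l == k then - bv k else bv l).
Proof.
move=> k0; have n : hform (bv k) (bv k) = -1 by rewrite bv_norm /sg4 (negbTE k0).
split; first by apply: G3_refl; [exact: lat_bv|is_eis_tac|rewrite n !cJ; ring].
move=> l; rewrite reflE; case: eqVneq => [->|lk].
  by rewrite n mulrN1 scaleNr scaler_nat mulr2n opprD addrA subrr add0r.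
by rewrite bv_orth 1?eq_sym// mulr0 scale0r addr0.
Qed.

Lemma step0 G : G3 G -> fixes [:: o2] G -> exists2 K, G3 K & K *m bv o2 = bv o2 /\ fixes [:: ord0; o2] (G *m K).
Proof.
move=> hG hL; have [lv nv] := norm_inv ord0 hG.
have [s0 [s1 [s2 [s3 [k [/and4P[k0 k1 k2 k3] ev nE]]]]]] := split4 lv.
have z2 : s2 = 0 by apply: (eqv_coord0 (k := o2) ev) => //; [rewrite V4E|exact: (fixes_coord hG hL)].
rewrite nv z2 in nE ev; have e : s0 ^+ 2 - s1 ^+ 2 - s3 ^+ 2 + 3 * k = 1.
  by have := sg4_int nE; rewrite /= !expr2; lia.
suff [K hK [K2 K0]] : exists2 K, G3 K & K *m bv o2 = bv o2 /\ eqv (K *m bv ord0) (V4 s0%:~R s1%:~R 0%:~R s3%:~R).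
  exists K => //; split=> //; apply: adjust => //; first by move=> l; rewrite inE => /eqP->.
  by apply: eqv_trans K0 _; exact: eqv_sym.
have [S|[S|S]] : (s0 = 1 /\ s1 = 0 /\ s3 = 0) \/ (s0 = -1 /\ s1 = 0 /\ s3 = 0) \/ (s0 = 0 /\ s1 ^+ 2 = 1 /\ s3 ^+ 2 = 1).
  move: k0 k1 k3 e; rewrite !inE !expr2 => /orP[|/orP[]]/eqP-> /orP[|/orP[]]/eqP-> /orP[|/orP[]]/eqP->; lia.
  move: S => [-> [-> ->]]; exists 1%:M; first exact: G3_1.
  rewrite !mul1mx; split=> //; rewrite V4_bv mulr1z !mulr0z scale1r !scale0r !addr0; exact: eqv_refl.
  move: S => [-> [-> ->]]; exists (refl (bv ord0) (- 2)).
    by apply: G3_refl; [exact: lat_bv|is_eis_tac|rewrite bv_norm /sg4 eqxx !cJ; ring].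
  rewrite !reflE bv_orth// mulr0 scale0r addr0; split=> //.
  rewrite V4_bv intrN mulr1z !mulr0z !scale0r !addr0 bv_norm /sg4 eqxx mulr1 scaleNr scaleN1r scaler_nat mulr2n opprD addrA subrr add0r.
  exact: eqv_refl.
(* [s] has norm -1, and its reflection sends [e_0] to [e_0 + 2 s = (3, - 2 s1, 0, - 2 s3)], which is
   the wanted residue modulo 3. *)
move: S => [-> [q1 q3]]; pose s := V4 1 (- s1%:~R) 0 (- s3%:~R) : 'cV[C]_4.
have ls : lat s by apply: ord4P; rewrite V4E; is_eis_tac.
have q1' : s1%:~R * s1%:~R = 1 :> C by rewrite -intrM -expr2 q1.
have q3' : s3%:~R * s3%:~R = 1 :> C by rewrite -intrM -expr2 q3.
exists (refl s 2).
  apply: G3_refl => //; first by is_eis_tac.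
  by rewrite hformE !V4E !cJ; ring: q1' q3'.
rewrite !reflE; have -> : hform s (bv o2) = 0 by rewrite -hformJ hform_bvl V4E mulr0 conj0.
have -> : hform s (bv ord0) = 1 by rewrite -hformJ hform_bvl V4E /sg4 eqxx mulr1 conj1.
rewrite mulr0 scale0r addr0 mulr1; split=> // j.
have -> : hh * ((bv ord0 + 2 *: s) j ord0 - V4 0%:~R s1%:~R 0%:~R s3%:~R j ord0) = hh * 3 * s j ord0.
  by move: j; apply: ord4P; rewrite !mxE /=; ring.
apply: is_eisM => //; have -> : hh * 3 = - th by rewrite hhE; field.
by is_eis_tac.
Qed.

Definition bvo := (bv_orth (isT : o1 != o3), bv_orth (isT : o3 != o1), bv_orth (isT : o1 != o2),
  bv_orth (isT : o3 != o2), bv_orth (isT : o1 != ord0), bv_orth (isT : o3 != ord0)).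

Lemma step1 G : G3 G -> fixes [:: ord0; o2] G -> exists2 K, G3 K & K *m bv o2 = bv o2 /\ fixes [:: o1; ord0; o2] (G *m K).
Proof.
move=> hG hL; have [lv nv] := norm_inv o1 hG.
have [s0 [s1 [s2 [s3 [k [/and4P[k0 k1 k2 k3] ev nE]]]]]] := split4 lv.
have z2 : s2 = 0 by apply: (eqv_coord0 (k := o2) ev) => //; [rewrite V4E|exact: (fixes_coord hG hL)].
have z0 : s0 = 0 by apply: (eqv_coord0 (k := ord0) ev) => //; [rewrite V4E|exact: (fixes_coord hG hL)].
rewrite nv z2 z0 in nE ev; have e : s1 ^+ 2 + s3 ^+ 2 = 1 + 3 * k.
  by have := sg4_int nE; rewrite /= !expr2; lia.
suff [K hK [K2 K0 K1]] : exists2 K, G3 K & [/\ K *m bv o2 = bv o2, K *m bv ord0 = bv ord0 & eqv (K *m bv o1) (V4 0%:~R s1%:~R 0%:~R s3%:~R)].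
  exists K => //; split=> //; apply: adjust => //; first by move=> l; rewrite !inE => /orP[]/eqP->.
  by apply: eqv_trans K1 _; exact: eqv_sym.
have [S|[S|[S|S]]] : (s1 = 1 /\ s3 = 0) \/ (s1 = -1 /\ s3 = 0) \/ (s1 = 0 /\ s3 = 1) \/ (s1 = 0 /\ s3 = -1).
  move: k1 k3 e; rewrite !inE !expr2 => /orP[|/orP[]]/eqP-> /orP[|/orP[]]/eqP->; lia.
  move: S => [-> ->]; exists 1%:M; first exact: G3_1.
  rewrite !mul1mx; split=> //; rewrite V4_bv mulr1z !mulr0z scale1r !scale0r !addr0 add0r; exact: eqv_refl.
  move: S => [-> ->]; have [f1 f2] := @flip_bv o1 isT; exists (refl (bv o1) 2) => //; rewrite !f2 /=; split=> //.
  rewrite V4_bv intrN mulr1z !mulr0z scaleN1r !scale0r !addr0 add0r; exact: eqv_refl.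
  move: S => [-> ->]; exists (refl (bv o1 - bv o3) 1).
    apply: G3_refl; [by apply: latD; [exact: lat_bv|apply: latN; exact: lat_bv]|by is_eis_tac|].
    by rewrite !hformL !bvo !bv_norm /sg4 /= !cJ; ring.
  rewrite !reflE !hformL !bvo !bv_norm /sg4 /= !oppr0 !addr0 !mulr0 !scale0r !addr0; split=> //.
  rewrite mul1r scaleN1r opprB addrC subrK V4_bv !mulr0z mulr1z scale1r !scale0r !add0r; exact: eqv_refl.
move: S => [-> ->]; exists (refl (bv o1 + bv o3) 1).
  apply: G3_refl; [by apply: latD; exact: lat_bv|by is_eis_tac|].
  by rewrite !hformL !bvo !bv_norm /sg4 /= !cJ; ring.
rewrite !reflE !hformL !bvo !bv_norm /sg4 /= !addr0 !mulr0 !scale0r !addr0; split=> //.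
rewrite mul1r scaleN1r opprD addrA subrr add0r V4_bv intrN !mulr0z mulr1z scaleN1r !scale0r !add0r; exact: eqv_refl.
Qed.

Lemma step3 G : G3 G -> fixes [:: o1; ord0; o2] G -> exists2 K, G3 K & K *m bv o2 = bv o2 /\ fixes [:: o3; o1; ord0; o2] (G *m K).
Proof.
move=> hG hL; have [lv nv] := norm_inv o3 hG.
have [s0 [s1 [s2 [s3 [k [/and4P[k0 k1 k2 k3] ev nE]]]]]] := split4 lv.
have z2 : s2 = 0 by apply: (eqv_coord0 (k := o2) ev) => //; [rewrite V4E|exact: (fixes_coord hG hL)].
have z0 : s0 = 0 by apply: (eqv_coord0 (k := ord0) ev) => //; [rewrite V4E|exact: (fixes_coord hG hL)].
have z1 : s1 = 0 by apply: (eqv_coord0 (k := o1) ev) => //; [rewrite V4E|exact: (fixes_coord hG hL)].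
rewrite nv z2 z0 z1 in nE ev; have e : s3 ^+ 2 = 1 + 3 * k.
  by have := sg4_int nE; rewrite /= !expr2; lia.
suff [K hK [K3 K4]] : exists2 K, G3 K & (forall l, l != o3 -> K *m bv l = bv l) /\ eqv (K *m bv o3) (V4 0%:~R 0%:~R 0%:~R s3%:~R).
  exists K => //; split; first exact: K3.
  apply: adjust => //; last by apply: eqv_trans K4 _; exact: eqv_sym.
  by move=> l; rewrite !inE => /orP[|/orP[]]/eqP->; rewrite K3.
have [S|S] : s3 = 1 \/ s3 = -1.
  move: k3 e; rewrite !inE !expr2 => /orP[|/orP[]]/eqP->; lia.
  rewrite S; exists 1%:M; first exact: G3_1.
  split; first by move=> l _; rewrite mul1mx.
  rewrite !mul1mx V4_bv mulr1z !mulr0z scale1r !scale0r !addr0 add0r; exact: eqv_refl.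
rewrite S; have [f1 f2] := @flip_bv o3 isT; exists (refl (bv o3) 2) => //; split.
  by move=> l /negbTE lk; rewrite f2 lk.
rewrite f2 eqxx V4_bv intrN mulr1z !mulr0z scaleN1r !scale0r !addr0 add0r; exact: eqv_refl.
Qed.

(** The images of [e_0], [e_1], [e_3] are corrected one after the other by isometries that do not
    disturb those already treated. [K] fixes [e_2] exactly, so the vector [G e_2] and its mirror are
    kept. *)
Lemma lift2 G : G3 G -> eqv (G *m bv o2) (bv o2) -> exists2 K, K *m bv o2 = bv o2 & G3cong (sqrtm3 R) (G *m K).
Proof.
move=> hG h2; have f0 : fixes [:: o2] G by move=> k; rewrite inE => /eqP->.
have [K0 g0 [e0 f1]] := step0 hG f0; have G1 := G3M hG g0.
have [K1 g1 [e1 f2]] := step1 G1 f1; have G2 := G3M G1 g1.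
have [K2 g2 [e2 f3]] := step3 G2 f2; have G3' := G3M G2 g2.
exists (K0 *m K1 *m K2); first by rewrite -!mulmxA e2 e1 e0.
rewrite !mulmxA; apply/GamP; split=> //; apply: ord4P; exact: f3.
Qed.

(** Modulo [th] the root has entry 0 at [e_0] and norm -1, so exactly one entry survives and it is
    congruent to some [e_j] up to sign. [lift2] turns this congruence into an element of the
    congruence subgroup. *)
Lemma root_orbit z : root (bv ord0) z -> exists g k, [/\ G3cong (sqrtm3 R) g, k != ord0 & (invmx g *m z) k ord0 = 0].
Proof.
move=> [G hG [h0 hz]]; set r := G *m bv o2 in h0 hz.
have lr : lat r by apply: G3_lat => //; exact: lat_bv.
have nr : hform r r = sg4 R o2 by rewrite /r; have [_ _ _ ->] := hG; rewrite bv_norm.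
have [s0 [s1 [s2 [s3 [k [/and4P[k0 k1 k2 k3] ev nE]]]]]] := split4 lr.
have z0 : s0 = 0.
  apply: (eqv_coord0 (k := ord0) ev) => //; first by rewrite V4E.
  by move: h0; rewrite hform_bvl /sg4 eqxx mul1r.
rewrite nr z0 in nE ev; have e : s1 ^+ 2 + s2 ^+ 2 + s3 ^+ 2 = 1 + 3 * k.
  by have := sg4_int nE; rewrite /= !expr2; lia.
have [j [s [j0 se ej]]] : exists (j : 'I_4) (s : int), [/\ j != ord0, s = 1 \/ s = -1 & eqv r (s%:~R *: bv j)].
  have [S|[S|S]] : (s1 != 0 /\ s2 = 0 /\ s3 = 0) \/ (s2 != 0 /\ s1 = 0 /\ s3 = 0) \/ (s3 != 0 /\ s1 = 0 /\ s2 = 0).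
    move: k1 k2 k3 e; rewrite !inE !expr2 => /orP[|/orP[]]/eqP-> /orP[|/orP[]]/eqP-> /orP[|/orP[]]/eqP->; lia.
    move: S => [q [a b]]; exists o1, s1; split=> //.
      by move: k1 q; rewrite !inE => /orP[|/orP[]]/eqP->//; [left|right].
    by move: ev; rewrite a b V4_bv !mulr0z !scale0r !addr0 add0r.
    move: S => [q [a b]]; exists o2, s2; split=> //.
      by move: k2 q; rewrite !inE => /orP[|/orP[]]/eqP->//; [left|right].
    by move: ev; rewrite a b V4_bv !mulr0z !scale0r !addr0 !add0r.
  move: S => [q [a b]]; exists o3, s3; split=> //.
    by move: k3 q; rewrite !inE => /orP[|/orP[]]/eqP->//; [left|right].
  by move: ev; rewrite a b V4_bv !mulr0z !scale0r !add0r.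
have [P hP Pj] : exists2 P, G3 P & P *m bv o2 = bv j.
  have [->|j2] := eqVneq j o2; first by exists 1%:M; [exact: G3_1|rewrite mul1mx].
  have o : hform (bv o2) (bv j) = 0 by rewrite bv_orth// eq_sym.
  exists (swp (bv j)); last exact: swp_bv.
  by apply: swp_G3 => //; [exact: lat_bv|rewrite bv_norm /sg4 (negbTE j0)].
have [E hE Ex] : exists2 E : 'M[C]_4, G3 E & forall x, E *m x = s%:~R *: x.
  case: se => ->; first by exists 1%:M; [exact: G3_1|move=> x; rewrite mul1mx scale1r].
  by exists (- 1%:M); [exact: G3_N1|move=> x; rewrite mN1E intrN scaleN1r].
have ss1 : s%:~R * s%:~R = 1 :> C by case: se => ->; rewrite ?intrN ?mulrNN mulr1.
have hV := G3V hP; have hG1 : G3 (E *m (invmx P *m G)) by apply: G3M => //; exact: G3M.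
have [|K K2 hg] := lift2 hG1.
  rewrite -!mulmxA Ex -/r; have -> : bv o2 = s%:~R *: (invmx P *m (s%:~R *: bv j)).
    by rewrite -scalemxAr scalerA ss1 scale1r -Pj G3K.
  by rewrite -(Ex (invmx P *m r)) -(Ex (invmx P *m _)); apply: eqv_mul; [case: hE|apply: eqv_mul; [case: hV|exact: ej]].
pose g := P *m (E *m (invmx P *m G) *m K) *m invmx P.
have Gg : G3cong (sqrtm3 R) g by exact: Gam_conj.
exists g, j; split=> //; have [hg3 _] := Gg.
have gj : g *m bv j = s%:~R *: r.
  rewrite /g -!mulmxA -Pj (G3K _ hP) K2 -/r Ex -scalemxAr G3VK//.
have : hform (g *m bv j) z = 0 by rewrite gj hformZl hz mulr0.
rewrite hform_adj// hform_bvl /sg4 (negbTE j0) mulN1r => /eqP; rewrite oppr_eq0 => /eqP //.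
Qed.
End Congruence.

(** * Complex differentiability with quadratic remainder *)

Section HolomorphicCalculus.
Variable R : realType.
Local Notation C := R[i].

Definition nrm n (h : 'cV[C]_n) : R := \sum_k cabs (h k ord0).

Lemma nrm_ge0 n (h : 'cV[C]_n) : 0 <= nrm h.
Proof. by apply: sumr_ge0 => k _; exact: cabs_ge0. Qed.
Lemma nrm_coord n (h : 'cV[C]_n) k : cabs (h k ord0) <= nrm h.
Proof. by rewrite /nrm (bigD1 k)//= lerDl; apply: sumr_ge0 => j _; exact: cabs_ge0. Qed.

Lemma lin_bound n (d : 'I_n -> C) (h : 'cV[C]_n) :
  cabs (\sum_k d k * h k ord0) <= (\sum_k cabs (d k)) * nrm h.
Proof.
apply: le_trans (cabs_sum _ _) _; rewrite /nrm mulr_sumr; apply: ler_sum => k _; rewrite cabsM.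
rewrite ler_wpM2r ?cabs_ge0// (bigD1 k)//= lerDl; apply: sumr_ge0 => j _; exact: cabs_ge0.
Qed.

(* complex differentiability with a quadratic remainder *)
Definition HD n (f : 'cV[C]_n -> C) x := exists (d : 'I_n -> C) (M e : R), [/\ 0 < e, 0 <= M &
  forall h, nrm h <= e -> cabs (f (x + h) - f x - \sum_k d k * h k ord0) <= M * nrm h ^+ 2].

Lemma HD_lip n (f : 'cV[C]_n -> C) x : HD f x -> exists K e : R, [/\ 0 < e, 0 <= K &
  forall h, nrm h <= e -> cabs (f (x + h) - f x) <= K * nrm h].
Proof.
move=> [d [M [e [e0 M0 H]]]]; exists (\sum_k cabs (d k) + M * e), e; split=> //.
  by rewrite addr_ge0 ?mulr_ge0 ?(ltW e0)//; apply: sumr_ge0 => j _; exact: cabs_ge0.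
move=> h hh; have n0 := nrm_ge0 h; have := H h hh; have := lin_bound d h.
move: (\sum_k d k * _) => L h1 h2.
have := cabsD (f (x + h) - f x - L) L; rewrite subrK => /le_trans; apply.
rewrite mulrDl; have : M * nrm h ^+ 2 <= M * e * nrm h by rewrite expr2 mulrA ler_wpM2r// ler_wpM2l.
lra.
Qed.

Lemma HD_ext n (f g : 'cV[C]_n -> C) x e : 0 < e -> (forall h, nrm h <= e -> f (x + h) = g (x + h)) ->
  HD g x -> HD f x.
Proof.
move=> e0 fg [d [M [e' [e0' M0 H]]]]; exists d, M, (Num.min e e'); split=> //; first by rewrite lt_min e0.
have f0 : f x = g x by have := fg 0; rewrite addr0; apply; rewrite /nrm big1 ?(ltW e0)// => k _; rewrite mxE cabs0.
by move=> h; rewrite le_min => /andP[h1 h2]; rewrite fg// f0; exact: H.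
Qed.

Lemma HD_lin n (c : 'I_n -> C) x : HD (fun z => \sum_k c k * z k ord0) x.
Proof.
exists c, 0, 1; split=> // h _; rewrite mul0r.
rewrite (_ : _ - _ = 0) ?cabs0//; apply/eqP; rewrite subr_eq0 subr_eq addrC -big_split/=; apply/eqP.
by apply: eq_bigr => k _; rewrite mxE mulrDr.
Qed.

Lemma HD_coord n k x : HD (fun z : 'cV[C]_n => z k ord0) x.
Proof.
rewrite (_ : (fun z => _) = fun z : 'cV[C]_n => \sum_j (j == k)%:R * z j ord0); first exact: HD_lin.
apply/funext => z; rewrite (bigD1 k)//= eqxx mul1r big1 ?addr0// => j /negbTE ->; exact: mul0r.
Qed.

Lemma HD_mul n (f g : 'cV[C]_n -> C) x : HD f x -> HD g x -> HD (fun z => f z * g z) x.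
Proof.
move=> hf hg; have [Kf [e1 [e10 Kf0 Lf]]] := HD_lip hf.
case: hf => df [Mf [e2 [e20 Mf0 Hf]]]; case: hg => dg [Mg [e3 [e30 Mg0 Hg]]].
pose Dg := \sum_k cabs (dg k); have Dg0 : 0 <= Dg by apply: sumr_ge0 => j _; exact: cabs_ge0.
exists (fun k => f x * dg k + g x * df k), ((cabs (f x) + Kf * e1) * Mg + Kf * Dg + cabs (g x) * Mf),
  (Num.min e1 (Num.min e2 e3)); split.
  by rewrite !lt_min e10 e20.
  by rewrite !addr_ge0 ?mulr_ge0 ?addr_ge0 ?cabs_ge0 ?mulr_ge0 ?(ltW e10).
move=> h; rewrite !le_min => /and3P[h1 h2 h3]; have n0 := nrm_ge0 h.
have := Lf h h1; have := Hf h h2; have := Hg h h3; have := lin_bound dg h; rewrite -/Dg.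
have -> : \sum_k (f x * dg k + g x * df k) * h k ord0 =
    f x * (\sum_k dg k * h k ord0) + g x * (\sum_k df k * h k ord0).
  by rewrite !mulr_sumr -big_split/=; apply: eq_bigr => k _; ring.
move: (\sum_k dg k * _) (\sum_k df k * _) (f x) (g x) (f (x + h)) (g (x + h)) => lg lf a b a' b' b1 b2 b3 b4.
have -> : a' * b' - a * b - (a * lg + b * lf) = a' * (b' - b - lg) + (a' - a) * lg + b * (a' - a - lf) by ring.
have a1 : cabs a' <= cabs a + Kf * e1.
  have := cabsD (a' - a) a; rewrite subrK; have := ler_wpM2l Kf0 h1; lra.
apply: le_trans (cabsD _ _) _; apply: le_trans (lerD (cabsD _ _) (lexx _)) _; rewrite !cabsM !mulrDl.
have c1 := ler_pM (cabs_ge0 _) (cabs_ge0 _) a1 b2; have c2 := ler_pM (cabs_ge0 _) (cabs_ge0 _) b4 b1.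
have c3 := ler_wpM2l (cabs_ge0 b) b3.
have c2' : Kf * nrm h * (Dg * nrm h) = Kf * Dg * nrm h ^+ 2 by ring.
rewrite c2' in c2; move: c1 c2 c3; rewrite !mulrA !mulrDl; lra.
Qed.

Lemma HD_inv n (f : 'cV[C]_n -> C) x : f x != 0 -> HD f x -> HD (fun z => (f z)^-1) x.
Proof.
move=> f0 hf; have [K [e1 [e10 K0 L]]] := HD_lip hf; case: hf => d [M [e2 [e20 M0 H]]].
pose D := \sum_k cabs (d k); have D0 : 0 <= D by apply: sumr_ge0 => j _; exact: cabs_ge0.
have a0 : 0 < cabs (f x) by rewrite cabs_gt0.
pose e3 := cabs (f x) / (2 * (K + 1)).
have K1 : 0 < K + 1 by lra.
have e30 : 0 < e3 by rewrite divr_gt0// mulr_gt0.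
exists (fun k => - (d k) / f x ^+ 2), ((cabs (f x) * M + K * D) / (cabs (f x) ^+ 3 / 2)),
  (Num.min e1 (Num.min e2 e3)); split.
  by rewrite !lt_min e10 e20.
  by rewrite divr_ge0 ?addr_ge0 ?mulr_ge0 ?exprn_ge0 ?(ltW a0)//; lra.
move=> h; rewrite !le_min => /and3P[h1 h2 h3]; have n0 := nrm_ge0 h.
have := L h h1; have := H h h2; have := lin_bound d h; rewrite -/D.
have -> : \sum_k - d k / f x ^+ 2 * h k ord0 = - (\sum_k d k * h k ord0) / f x ^+ 2.
  by rewrite -sumrN mulr_suml; apply: eq_bigr => k _; ring.
have : K * nrm h <= cabs (f x) / 2.
  apply: (@le_trans _ _ ((K + 1) * e3)); first by apply: ler_pM => //; lra.
  by rewrite /e3 le_eqVlt; apply/orP; left; apply/eqP; field; lra.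
clear e3 e30 h3 L H; move: (\sum_k d k * _) (f x) f0 a0 (f (x + h)) => l a f0 a0 b b0 b1 b2 b3.
have b4 : cabs a / 2 <= cabs b by have := cabs_leB a (a - b); rewrite opprB addrCA subrr addr0 cabsB; lra.
have bn : b != 0 by rewrite -cabs_gt0; lra.
have -> : b^-1 - a^-1 - - l / a ^+ 2 = (- (a * (b - a - l)) + (b - a) * l) / (a ^+ 2 * b).
  by field; rewrite ?f0 ?bn.
rewrite cabsM cabsV [cabs (_ * b)]cabsM cabsX.
have den : cabs a ^+ 3 / 2 <= cabs a ^+ 2 * cabs b.
  by rewrite exprSr -mulrA ler_wpM2l// exprn_ge0 ?cabs_ge0.
have den0 : 0 < cabs a ^+ 3 / 2 by rewrite divr_gt0// exprn_gt0.
have den1 : 0 < cabs a ^+ 2 * cabs b := lt_le_trans den0 den.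
have num : cabs (- (a * (b - a - l)) + (b - a) * l) <= (cabs a * M + K * D) * nrm h ^+ 2.
  apply: le_trans (cabsD _ _) _; rewrite cabsN !cabsM mulrDl.
  have c1 := ler_wpM2l (cabs_ge0 a) b2; have c2 := ler_pM (cabs_ge0 _) (cabs_ge0 _) b3 b1.
  have c2' : K * nrm h * (D * nrm h) = K * D * nrm h ^+ 2 by ring.
  by rewrite c2' in c2; rewrite -[cabs a * M * _]mulrA; exact: lerD.
have N0 : 0 <= cabs a * M + K * D by rewrite addr_ge0 ?mulr_ge0 ?cabs_ge0.
move: (cabs a ^+ 2 * cabs b) (cabs a ^+ 3 / 2) (cabs a * M + K * D) den den0 den1 num N0 => B A N den den0 den1 num N0.
rewrite ler_pdivrMr//; apply: le_trans num _.
have -> : N * nrm h ^+ 2 = N / A * nrm h ^+ 2 * A by field; rewrite gt_eqF.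
by rewrite ler_wpM2l// mulr_ge0 ?exprn_ge0// divr_ge0// ltW.
Qed.

Lemma finite_lb m (e : 'I_m -> R) : (forall j, 0 < e j) -> exists2 a : R, 0 < a & forall j, a <= e j.
Proof.
move=> e0; pose s := \sum_j (e j)^-1; have s0 : 0 <= s by apply: sumr_ge0 => j _; rewrite invr_ge0 ltW.
exists (s + 1)^-1 => [|j]; first by rewrite invr_gt0; lra.
rewrite -[e j]invrK lef_pV2 ?posrE ?invr_gt0//; last by lra.
have : (e j)^-1 <= s by rewrite /s (bigD1 j)//= lerDl; apply: sumr_ge0 => k _; rewrite invr_ge0 ltW.
lra.
Qed.

Lemma HD_comp n m (F : 'cV[C]_m -> C) (G : 'cV[C]_n -> 'cV[C]_m) x : HD F (G x) ->
  (forall j, HD (fun z => G z j ord0) x) -> HD (fun z => F (G z)) x.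
Proof.
move=> [c [M [e [e0 M0 H]]]] hG.
have /choice[KL hKL] : forall j, exists p : R * R, [/\ 0 < p.2, 0 <= p.1 & forall h, nrm h <= p.2 ->
    cabs (G (x + h) j ord0 - G x j ord0) <= p.1 * nrm h].
  by move=> j; have [K [e' H']] := HD_lip (hG j); exists (K, e').
have /choice[dM hdM] : forall j, exists p : ('I_n -> C) * R * R, [/\ 0 < p.2, 0 <= p.1.2 & forall h, nrm h <= p.2 ->
    cabs (G (x + h) j ord0 - G x j ord0 - \sum_k p.1.1 k * h k ord0) <= p.1.2 * nrm h ^+ 2].
  by move=> j; have [d [M' [e' H']]] := hG j; exists (d, M', e').
have kl0 j : 0 < (KL j).2 by case: (hKL j).
have dm0 j : 0 < (dM j).2 by case: (hdM j).
have [a a0 ha] := finite_lb kl0; have [b b0 hb] := finite_lb dm0.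
pose K := \sum_j (KL j).1; have K0 : 0 <= K by apply: sumr_ge0 => j _; case: (hKL j).
pose N := \sum_j cabs (c j) * (dM j).1.2.
have N0 : 0 <= N by apply: sumr_ge0 => j _; rewrite mulr_ge0 ?cabs_ge0//; case: (hdM j).
have K1 : 0 < K + 1 by lra.
exists (fun k => \sum_j c j * (dM j).1.1 k), (M * K ^+ 2 + N), (Num.min a (Num.min b (e / (K + 1)))); split.
  by rewrite !lt_min a0 b0 divr_gt0.
  by rewrite addr_ge0// mulr_ge0// exprn_ge0.
move=> h; rewrite !le_min => /and3P[h1 h2 h3]; have n0 := nrm_ge0 h.
set k := G (x + h) - G x; have kE j : k j ord0 = G (x + h) j ord0 - G x j ord0 by rewrite !mxE.
have nk : nrm k <= K * nrm h.
  rewrite /nrm -/(nrm h) mulr_suml; apply: ler_sum => j _; rewrite kE.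
  by have [_ _ H'] := hKL j; apply: H'; exact: le_trans (ha j).
have nke : nrm k <= e.
  apply: le_trans nk _; apply: (@le_trans _ _ ((K + 1) * (e / (K + 1)))).
    by apply: ler_pM => //; lra.
  by rewrite mulrCA mulfV ?mulr1// gt_eqF.
have := H k nke; have -> : G x + k = G (x + h) by rewrite addrC subrK.
move=> Hk.
have E : cabs (\sum_j c j * k j ord0 - \sum_i (\sum_j c j * (dM j).1.1 i) * h i ord0) <= N * nrm h ^+ 2.
  have -> : \sum_i (\sum_j c j * (dM j).1.1 i) * h i ord0 = \sum_j c j * (\sum_i (dM j).1.1 i * h i ord0).
    under eq_bigr do rewrite mulr_suml; rewrite exchange_big/=; apply: eq_bigr => j _.
    by rewrite mulr_sumr; apply: eq_bigr => i _; rewrite mulrA.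
  rewrite -sumrB; apply: le_trans (cabs_sum _ _) _; rewrite /N mulr_suml; apply: ler_sum => j _.
  rewrite -mulrBr cabsM -mulrA ler_wpM2l ?cabs_ge0// kE.
  by have [_ _ H'] := hdM j; apply: H'; exact: le_trans (hb j).
have := lerD Hk E; set A := \sum_j c j * _; set B := \sum_i _ => S.
have -> : F (G (x + h)) - F (G x) - B = (F (G (x + h)) - F (G x) - A) + (A - B) by ring.
apply: le_trans (cabsD _ _) _; apply: le_trans S _; rewrite mulrDl lerD2r -mulrA ler_wpM2l//.
rewrite -exprMn lerXn2r ?nnegrE ?nrm_ge0// mulr_ge0//.
Qed.

Local Notation V4c := 'cV[(C : numFieldType)]_4.

Lemma mx_norm_coord (h : V4c) k : `|h k ord0| <= `|h|.
Proof.
have -> : `|h| = mx_norm h by [].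
by rewrite mx_normE -[leLHS]nngE num_le; exact: (@le_bigmax _ _ _ _ (fun i => `|h i.1 i.2|%:nng) (k, ord0)).
Qed.

(** After the linear part [L] is subtracted, the differential to exhibit is the zero map. The sum
    norm is at most four times the maximum norm, hence the constant [16 M]. *)
Lemma HD_differentiable (f : 'cV[C]_4 -> C) (z : V4c) : HD f z ->
  differentiable (f : 'cV[C]_4 -> C^o) z.
Proof.
move=> [d [M [e [e0 M0 H]]]].
pose L (x : V4c) : C^o := d ord0 * x ord0 ord0 + d o1 * x o1 ord0 + d o2 * x o2 ord0 + d o3 * x o3 ord0.
pose G (x : V4c) : C^o := f x - L x.
have dL : differentiable L z.
  have dc k : differentiable (fun x : V4c => (d k * x k ord0 : C^o)) z.
    exact: (differentiableZ (d k) (differentiable_coord z k ord0)).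
  exact: (differentiableD (differentiableD (differentiableD (dc ord0) (dc o1)) (dc o2)) (dc o3)).
have dG : differentiable G z.
  have c0 : continuous (\0 : V4c -> C^o) by move=> x; first [exact: cst_continuous | apply: cst_continuous | exact: (@cvg_cst C^o) | apply: cvg_cst; exact: nbhs_filter].
  have o : G \o shift z = cst (G z) + (\0 : {linear V4c -> C^o}) +o_ (0 : V4c) id.
    apply/eqaddoP => eps eps0.
    have epsE : eps = (Re eps)%:C by apply: complexP; rewrite ?ReC ?ImC//; move: eps0; rewrite ltcE /= => /andP[/eqP].
    have er0 : 0 < Re eps by move: eps0; rewrite epsE ltcR.
    pose r := Num.min (e / 4) (Re eps / (16 * M + 1)).
    have m1 : 0 < 16 * M + 1 by lra.
    have r0 : 0 < r by rewrite lt_min !divr_gt0.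
    have rC : 0 < r%:C by rewrite ltcR.
    have := @nbhs0_lt _ V4c _ rC; apply: filterS => h hr.
    have hE : `|h| = (Re `|h|)%:C.
      have : 0 <= `|h| by [].
      by rewrite lecE => /andP[/eqP i0 _]; apply: complexP; rewrite ?ReC ?ImC.
    rewrite hE ltcR in hr; set rho := Re `|h| in hE hr.
    have hc k : cabs (h k ord0) <= rho by rewrite -lecR -cabsE -hE; exact: mx_norm_coord.
    have rho0 : 0 <= rho := le_trans (cabs_ge0 _) (hc ord0).
    have n4 : nrm h <= 4 * rho.
      rewrite /nrm !big_ord_recl big_ord0.
      by have := hc ord0; have := hc (lift ord0 ord0); have := hc (lift ord0 (lift ord0 ord0));
        have := hc (lift ord0 (lift ord0 (lift ord0 ord0))); lra.
    have re : r <= e / 4 by rewrite ge_min lexx.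
    have rq : r <= Re eps / (16 * M + 1) by rewrite ge_min lexx orbT.
    have ne : nrm h <= e by lra.
    have := H h ne; rewrite !fctE /= /G.
    have -> : f (h + z) - L (h + z) - (f z - L z + 0) = f (z + h) - f z - \sum_k d k * h k ord0.
      by rewrite sum4 [h + z]addrC /L !mxE; ring.
    move=> b; rewrite [`|id h|]hE epsE -CM cabsE lecR; apply: le_trans b _.
    have q : M * nrm h ^+ 2 <= M * (4 * rho) ^+ 2 by rewrite ler_wpM2l// lerXn2r ?nnegrE ?nrm_ge0//; lra.
    apply: le_trans q _; rewrite (_ : M * (4 * rho) ^+ 2 = 16 * M * rho * rho); last by ring.
    rewrite ler_wpM2r//; rewrite ler_pdivlMr// in rq.
    have : rho * (16 * M + 1) <= r * (16 * M + 1) by rewrite ler_wpM2r ?(ltW m1)// ltW.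
    by have := mulr_ge0 rho0 M0; lra.
  apply/diff_locallyP; rewrite (@diff_unique _ _ _ G (\0 : {linear V4c -> C^o}) z c0 o).
  by split.
have -> : (f : V4c -> C^o) = G + L by apply/funext => x; rewrite /G !fctE subrK.
exact: differentiableD.
Qed.
End HolomorphicCalculus.

(** * Taylor bounds for the complex exponential *)

Section ExpTaylor.
Variable R : realType.
Local Notation C := R[i].

Lemma is_derive_mulr (t c : R) : is_derive t (1 : R) (fun x : R => x * c) c.
Proof. by apply: trigger_derive; rewrite /GRing.scale /= ?mulr0 ?mulr1 ?add0r ?addr0. Qed.

Lemma cexp_line (d : C) (x : R) : Re (cexp (x%:C * d)) = expR (x * Re d) * cos (x * Im d) /\
  Im (cexp (x%:C * d)) = expR (x * Re d) * sin (x * Im d).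
Proof.
have [r i] : Re (x%:C * d) = x * Re d /\ Im (x%:C * d) = x * Im d by rewrite ReM ImM ReC ImC; split; ring.
split; first by transitivity (expR (Re (x%:C * d)) * cos (Im (x%:C * d))); [|rewrite r i].
by transitivity (expR (Re (x%:C * d)) * sin (Im (x%:C * d))); [|rewrite r i].
Qed.

Lemma is_derive_Re_cexp (d : C) (t : R) :
  is_derive t (1 : R) (fun x : R => Re (cexp (x%:C * d))) (Re (d * cexp (t%:C * d))).
Proof.
have -> : (fun x : R => Re (cexp (x%:C * d))) = fun x => expR (x * Re d) * cos (x * Im d).
  by apply/funext => x; have [-> _] := cexp_line d x.
have h1 := @is_derive1_comp R expR (fun x : R => x * Re d) t _ _ (is_derive_expR (t * Re d)) (is_derive_mulr t (Re d)).
have h2 := @is_derive1_comp R (@cos R) (fun x : R => x * Im d) t _ _ (is_derive_cos (t * Im d)) (is_derive_mulr t (Im d)).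
have h3 := is_deriveM h1 h2; apply: is_derive_eq h3 _.
by have [e1 e2] := cexp_line d t; rewrite ReM e1 e2 /GRing.scale /=; ring.
Qed.

Lemma is_derive_Im_cexp (d : C) (t : R) :
  is_derive t (1 : R) (fun x : R => Im (cexp (x%:C * d))) (Im (d * cexp (t%:C * d))).
Proof.
have -> : (fun x : R => Im (cexp (x%:C * d))) = fun x => expR (x * Re d) * sin (x * Im d).
  by apply/funext => x; have [_ ->] := cexp_line d x.
have h1 := @is_derive1_comp R expR (fun x : R => x * Re d) t _ _ (is_derive_expR (t * Re d)) (is_derive_mulr t (Re d)).
have h2 := @is_derive1_comp R (@sin R) (fun x : R => x * Im d) t _ _ (is_derive_sin (t * Im d)) (is_derive_mulr t (Im d)).
have h3 := is_deriveM h1 h2; apply: is_derive_eq h3 _.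
by have [e1 e2] := cexp_line d t; rewrite ImM e1 e2 /GRing.scale /=; ring.
Qed.

Lemma mvt01 (g dg : R -> R) (B : R) : (forall x, is_derive x (1 : R) g (dg x)) -> g 0 = 0 ->
  (forall x, 0 <= x -> x <= 1 -> `|dg x| <= B) -> `|g 1| <= B.
Proof.
move=> hd g0 hB; have [|c] := @MVT_segment R g dg 0 1 ler01 (fun x _ => hd x).
  by apply: derivable_within_continuous => x _; exact: ex_derive.
by rewrite in_itv/= => /andP[c0 c1]; rewrite g0 !subr0 mulr1 => ->; exact: hB.
Qed.

(** The mean value theorem is applied to the real and the imaginary part separately, at the cost of
    a factor 2. Each Taylor bound follows from the preceding one by this lemma. *)
Lemma cmvt01 (G H : R -> C) (d : C) (B : R) :
  (forall t, is_derive t (1 : R) (fun x => Re (G x)) (Re (d * H t))) ->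
  (forall t, is_derive t (1 : R) (fun x => Im (G x)) (Im (d * H t))) -> G 0 = 0 ->
  (forall t, 0 <= t -> t <= 1 -> cabs (H t) <= B) -> cabs (G 1) <= 2 * cabs d * B.
Proof.
move=> h1 h2 G0 hB; have b t : 0 <= t -> t <= 1 -> cabs (d * H t) <= cabs d * B.
  by move=> t0 t1; rewrite cabsM ler_wpM2l ?cabs_ge0// hB.
have r1 : `|Re (G 1)| <= cabs d * B.
  apply: (mvt01 h1); first by rewrite G0.
  by move=> x x0 x1; apply: le_trans (Re_le_cabs _) (b x x0 x1).
have r2 : `|Im (G 1)| <= cabs d * B.
  apply: (mvt01 h2); first by rewrite G0.
  by move=> x x0 x1; apply: le_trans (Im_le_cabs _) (b x x0 x1).
by have := cabs_leRI (G 1); lra.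
Qed.

Lemma cabs_cexp_le (d : C) : cabs (cexp d) <= expR (cabs d).
Proof. by rewrite cabs_cexp ler_expR; apply: le_trans (Re_le_cabs d); exact: ler_norm. Qed.

Lemma cabs_td (t : R) (d : C) : 0 <= t -> t <= 1 -> cabs (t%:C * d) <= cabs d.
Proof. by move=> t0 t1; rewrite cabsM cabsC ger0_norm// ler_piMl ?cabs_ge0. Qed.

Lemma cexp_taylor1 (d : C) : cabs (cexp d - 1) <= 2 * cabs d * expR (cabs d).
Proof.
have := @cmvt01 (fun t => cexp (t%:C * d) - 1) (fun t => cexp (t%:C * d)) d (expR (cabs d)).
rewrite mul1r; apply.
  move=> t; have h := is_deriveB (is_derive_Re_cexp d t) (is_derive_cst (1 : R) t 1); rewrite subr0 in h.
  rewrite (_ : (fun x => _) = (fun x => Re (cexp (x%:C * d))) - cst 1) //.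
  move=> t; have h := is_derive_Im_cexp d t.
  by rewrite (_ : (fun x => _) = (fun x => Im (cexp (x%:C * d)))) //; apply/funext => x; rewrite ImD ImN Im1 subr0.
  by rewrite mul0r cexp0 subrr.
by move=> t t0 t1; apply: le_trans (cabs_cexp_le _) _; rewrite ler_expR cabs_td.
Qed.

Lemma cexp_taylor2 (d : C) : cabs (cexp d - 1 - d) <= 4 * cabs d ^+ 2 * expR (cabs d).
Proof.
have := @cmvt01 (fun t => cexp (t%:C * d) - 1 - t%:C * d) (fun t => cexp (t%:C * d) - 1) d (2 * cabs d * expR (cabs d)).
rewrite !mul1r (_ : 2 * cabs d * (2 * cabs d * expR (cabs d)) = 4 * cabs d ^+ 2 * expR (cabs d)); last by ring.
apply.
  move=> t; have h := is_deriveB (is_deriveB (is_derive_Re_cexp d t) (is_derive_cst (1 : R) t 1)) (is_derive_mulr t (Re d)).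
  rewrite (_ : (fun x => _) = (fun x => Re (cexp (x%:C * d))) - cst 1 - (fun x => x * Re d)); last first.
    by apply/funext => x; rewrite !fctE !ReD !ReN ReM ReC ImC mul0r subr0.
  by apply: is_derive_eq h _; rewrite mulrBr mulr1 ReD ReN subr0.
  move=> t; have h := is_deriveB (is_derive_Im_cexp d t) (is_derive_mulr t (Im d)).
  rewrite (_ : (fun x => _) = (fun x => Im (cexp (x%:C * d))) - (fun x => x * Im d)); last first.
    by apply/funext => x; rewrite !fctE !ImD !ImN ImM ReC ImC mul0r addr0 Im1 subr0.
  by apply: is_derive_eq h _; rewrite mulrBr mulr1 ImD ImN.
  by rewrite mul0r cexp0 subrr subr0.
move=> t t0 t1; apply: le_trans (cexp_taylor1 _) _; have c := cabs_td d t0 t1.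
by apply: ler_pM => //; rewrite ?mulr_ge0 ?cabs_ge0 ?expR_ge0 ?ler_expR// ler_wpM2l.
Qed.

Lemma cexp_taylor3 (d : C) : cabs (cexp d - 1 - d - d ^+ 2 / 2) <= 8 * cabs d ^+ 3 * expR (cabs d).
Proof.
have := @cmvt01 (fun t => cexp (t%:C * d) - 1 - t%:C * d - (t%:C * d) ^+ 2 / 2) (fun t => cexp (t%:C * d) - 1 - t%:C * d) d
  (4 * cabs d ^+ 2 * expR (cabs d)).
rewrite !mul1r (_ : 2 * cabs d * (4 * cabs d ^+ 2 * expR (cabs d)) = 8 * cabs d ^+ 3 * expR (cabs d)); last by ring.
have sq (t : R) (c : R) : is_derive t (1 : R) (fun x : R => x * x * c) (2 * t * c).
  by apply: trigger_derive; rewrite /GRing.scale /= ?mulr0 ?mulr1 ?add0r ?addr0; ring.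
have e (x : R) : (x%:C * d) ^+ 2 / 2 = (x * x)%:C * (d ^+ 2 / 2) by rewrite CM; ring.
apply.
  move=> t; have h := is_deriveB (is_deriveB (is_deriveB (is_derive_Re_cexp d t) (is_derive_cst (1 : R) t 1)) (is_derive_mulr t (Re d)))
     (sq t (Re (d ^+ 2 / 2))).
  rewrite (_ : (fun x => _) = (fun x => Re (cexp (x%:C * d))) - cst 1 - (fun x => x * Re d) - (fun x => x * x * Re (d ^+ 2 / 2))); last first.
    by apply/funext => x; rewrite e !fctE !ReD !ReN !(ReM (_%:C)) !ReC !ImC !mul0r !subr0.
  apply: is_derive_eq h _; rewrite !mulrBr mulr1 !ReD !ReN subr0; congr (_ - _).
  have -> : d * (t%:C * d) = (2 * t)%:C * (d ^+ 2 / 2) by rewrite CM Cnat; field.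
  by rewrite [RHS]ReM ReC ImC mul0r subr0.
  move=> t; have h := is_deriveB (is_deriveB (is_derive_Im_cexp d t) (is_derive_mulr t (Im d))) (sq t (Im (d ^+ 2 / 2))).
  rewrite (_ : (fun x => _) = (fun x => Im (cexp (x%:C * d))) - (fun x => x * Im d) - (fun x => x * x * Im (d ^+ 2 / 2))); last first.
    by apply/funext => x; rewrite e !fctE !ImD !ImN !(ImM (_%:C)) !ReC !ImC !mul0r !addr0 ?Im1 ?oppr0 ?addr0.
  apply: is_derive_eq h _; rewrite !mulrBr mulr1 !ImD !ImN; congr (_ - _).
  have -> : d * (t%:C * d) = (2 * t)%:C * (d ^+ 2 / 2) by rewrite CM Cnat; field.
  by rewrite [RHS]ImM ReC ImC mul0r addr0.
  by rewrite mul0r cexp0 subrr subr0 expr0n /= mul0r subr0.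
move=> t t0 t1; apply: le_trans (cexp_taylor2 _) _; have c := cabs_td d t0 t1.
apply: ler_pM => //; rewrite ?mulr_ge0 ?exprn_ge0 ?cabs_ge0 ?expR_ge0 ?ler_expR// ler_wpM2l//.
by rewrite lerXn2r ?nnegrE ?cabs_ge0.
Qed.
End ExpTaylor.

(** * The theta series as a sum of exponentials of quadratic polynomials *)

Section ExponentialSums.
Variable R : realType.
Local Notation C := R[i].
Local Notation w := (w3 R).
Local Notation th := (1 + 2 * w3 R).
Local Notation s_ := ((ss R)%:C : C).
Local Notation ei := (ei R).
Variables (pm pa : C).

(** A point of the outer series and the indices of the two series [sg]; fully expanded, termwise
    differentiation in all three variables becomes possible. *)
Definition I3 := (eis * (int * int))%type.
Implicit Types (i : I3) (x h : 'cV[C]_3).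

Definition c0 : 'I_3 := ord0.
Definition c1 : 'I_3 := @Ordinal 3 1 isT.
Definition c2 : 'I_3 := @Ordinal 3 2 isT.

Lemma sum3 (f : 'I_3 -> C) : \sum_k f k = f c0 + f c1 + f c2.
Proof.
rewrite !big_ord_recl big_ord0 addr0 !addrA.
by congr (_ + f _ + f _); apply: val_inj.
Qed.
Lemma nrm3 h : nrm h = cabs (h c0 ord0) + cabs (h c1 ord0) + cabs (h c2 ord0).
Proof.
rewrite /nrm !big_ord_recl big_ord0 addr0 !addrA.
by congr (_ + cabs (h _ _) + cabs (h _ _)); apply: val_inj.
Qed.

Definition mu i : C := ei i.1 + pa.
Definition k2 i : R := 2 * i.2.1%:~R + 1.
Definition k3 i : R := 2 * i.2.2%:~R + 1.
(** A weight that dominates linearly all coefficients of the exponent and of its derivatives. *)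
Definition NI i : R := 1 + cabs (mu i) ^+ 2 + k2 i ^+ 2 + k3 i ^+ 2.

Definition kc (K : R) : C := - th * K%:C / 2 - (2 + w) * K%:C ^+ 2 / 4.
Definition qq i x : C := 2 * s_ * ((mu i)^* * pm - mu i * pm^*) + s_ * kc (k2 i) + s_ * kc (k3 i)
  - 2 * s_ * (mu i * (mu i)^*) * x c0 ord0 + s_ * mu i ^+ 2 * (x c1 ord0 ^+ 2 + x c2 ord0 ^+ 2)
  + s_ * th * mu i * ((k2 i)%:C * x c1 ord0 + (k3 i)%:C * x c2 ord0).
Definition Tm i x : C := cexp (qq i x).

Definition ld i x (k : 'I_3) : C := if k == c0 then - (2 * s_ * (mu i * (mu i)^*)) else
  if k == c1 then s_ * mu i ^+ 2 * 2 * x c1 ord0 + s_ * th * mu i * (k2 i)%:C else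
  s_ * mu i ^+ 2 * 2 * x c2 ord0 + s_ * th * mu i * (k3 i)%:C.

Definition qr i h : C := s_ * mu i ^+ 2 * (h c1 ord0 ^+ 2 + h c2 ord0 ^+ 2).

Lemma qqD i x h : qq i (x + h) = qq i x + (\sum_k ld i x k * h k ord0 + qr i h).
Proof. by rewrite sum3 /ld /= /qq /qr !mxE; ring. Qed.

Lemma NI_ge1 i : 1 <= NI i.
Proof. by rewrite /NI; have := sqr_ge0 (cabs (mu i)); have := sqr_ge0 (k2 i); have := sqr_ge0 (k3 i); lra. Qed.
Lemma NI_ge0 i : 0 <= NI i. Proof. by have := NI_ge1 i; lra. Qed.

Lemma cabs_th : cabs th <= 2.
Proof.
have t2 := sq3_sqr R; rewrite -(@ler_pXn2r _ 2) ?nnegrE ?cabs_ge0// cabs_sqr !ReIm Re_w3 Im_w3; lra.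
Qed.
Lemma cabs_s : cabs s_ = ss R. Proof. by rewrite cabsC ger0_norm// ltW ?ss_gt0. Qed.

Lemma mu2_le i : cabs (mu i) ^+ 2 <= NI i.
Proof. by rewrite /NI; have := sqr_ge0 (k2 i); have := sqr_ge0 (k3 i); lra. Qed.

Lemma muk_le i (K : R) : K ^+ 2 <= NI i - 1 - cabs (mu i) ^+ 2 -> cabs (mu i) * `|K| <= NI i / 2.
Proof.
move=> h; have := sqr_ge0 (cabs (mu i) - `|K|); rewrite sqrrB real_normK ?num_real//; move: h.
rewrite -mulr_natl; lra.
Qed.
Lemma muk2_le i : cabs (mu i) * `|k2 i| <= NI i / 2.
Proof. by apply: muk_le; rewrite /NI; have := sqr_ge0 (k3 i); lra. Qed.
Lemma muk3_le i : cabs (mu i) * `|k3 i| <= NI i / 2.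
Proof. by apply: muk_le; rewrite /NI; have := sqr_ge0 (k2 i); lra. Qed.

Definition U x : R := cabs (x c1 ord0) + cabs (x c2 ord0).
Definition LL x : R := ss R * (2 * U x + 3).
Lemma U_ge0 x : 0 <= U x. Proof. by rewrite addr_ge0 ?cabs_ge0. Qed.
Lemma LL_ge x : ss R <= LL x.
Proof. rewrite /LL; have := mulr_ge0 (ltW (ss_gt0 R)) (U_ge0 x); have := ss_gt0 R; lra. Qed.

Lemma be_le i (K : R) : cabs (mu i) * `|K| <= NI i / 2 -> cabs (s_ * th * mu i * K%:C) <= ss R * NI i.
Proof.
move=> hk; rewrite !cabsM cabs_s cabsC -!mulrA ler_wpM2l ?(ltW (ss_gt0 R))//.
apply: le_trans (ler_wpM2r _ cabs_th) _; first by rewrite mulr_ge0 ?cabs_ge0.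
lra.
Qed.
Lemma ga_le i : cabs (s_ * mu i ^+ 2) <= ss R * NI i.
Proof. by rewrite cabsM cabs_s cabsX ler_wpM2l ?(ltW (ss_gt0 R))// mu2_le. Qed.

Lemma ld_le i x k : cabs (ld i x k) <= ss R * (2 * U x + 2) * NI i.
Proof.
have s0 := ss_gt0 R; have u0 := U_ge0 x; have n1 := NI_ge1 i; have sN : 0 <= ss R * NI i by rewrite mulr_ge0 ?NI_ge0 ?ltW.
have aux (c : C) (K : R) : cabs c <= U x -> cabs (mu i) * `|K| <= NI i / 2 ->
    cabs (s_ * mu i ^+ 2 * 2 * c + s_ * th * mu i * K%:C) <= ss R * (2 * U x + 2) * NI i.
  move=> hc hK; apply: le_trans (cabsD _ _) _.
  have -> : ss R * (2 * U x + 2) * NI i = ss R * NI i * 2 * U x + ss R * NI i * 2 by ring.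
  apply: lerD; last by apply: le_trans (be_le hK) _; lra.
  rewrite cabsM [cabs (_ * 2)]cabsM (_ : cabs (2 : C) = 2); last by rewrite -(Cnat R 2) cabsC normr_nat.
  apply: ler_pM => //; [by rewrite mulr_ge0 ?cabs_ge0|exact: cabs_ge0|].
  by rewrite ler_wpM2r// ga_le.
rewrite /ld; case: ifP => _.
  rewrite cabsN mulcJ !cabsM cabs_s cabsC (ger0_norm (sqr_ge0 _)) (_ : cabs (2 : C) = 2); last by rewrite -(Cnat R 2) cabsC normr_nat.
  have := ler_wpM2l (ltW s0) (mu2_le i); have := mulr_ge0 sN u0; lra.
case: ifP => _; apply: aux; [by rewrite /U lerDl cabs_ge0|exact: muk2_le|by rewrite /U lerDr cabs_ge0|exact: muk3_le].
Qed.

Lemma lin_le i x h : cabs (\sum_k ld i x k * h k ord0) <= ss R * (2 * U x + 2) * NI i * nrm h.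
Proof.
have L k : cabs (ld i x k * h k ord0) <= ss R * (2 * U x + 2) * NI i * cabs (h k ord0).
  by rewrite cabsM ler_wpM2r ?cabs_ge0 ?ld_le.
rewrite sum3 nrm3; have := L c0; have := L c1; have := L c2; move: (ss R * _ * NI i) => A.
move: (ld i x c0 * _) (ld i x c1 * _) (ld i x c2 * _) => a b c ha hb hc.
by have := cabsD (a + b) c; have := cabsD a b; rewrite !mulrDr; lra.
Qed.

Lemma qr_le i h : cabs (qr i h) <= ss R * NI i * nrm h ^+ 2.
Proof.
have a := cabs_ge0 (h c0 ord0); have b := cabs_ge0 (h c1 ord0); have c := cabs_ge0 (h c2 ord0).
rewrite cabsM; apply: ler_pM; rewrite ?cabs_ge0 ?ga_le//.
apply: le_trans (cabsD _ _) _; rewrite !cabsX nrm3.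
by move: (cabs _) (cabs _) (cabs _) a b c => p q r p0 q0' r0; nra.
Qed.

Lemma DD_le i x h : nrm h <= 1 -> cabs (\sum_k ld i x k * h k ord0 + qr i h) <= LL x * NI i * nrm h.
Proof.
move=> h1; have n0 := nrm_ge0 h; have sN : 0 <= ss R * NI i by rewrite mulr_ge0 ?NI_ge0 ?ltW ?ss_gt0.
apply: le_trans (cabsD _ _) _; apply: le_trans (lerD (lin_le _ _ _) (qr_le _ _)) _.
have : ss R * NI i * nrm h ^+ 2 <= ss R * NI i * nrm h.
  by rewrite ler_wpM2l// expr2 ler_piMl.
by rewrite /LL; lra.
Qed.

Lemma bsum_odd (c : R) : 0 < c -> exists M, bsum (fun k : int => expR (- c * (2 * k%:~R + 1) ^+ 2)) M.
Proof.
move=> c_gt0; have c4 : 0 < 4 * c by lra.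
have [M hM] := bsum_int_shift c4; exists M; apply: bsum_le (hM (- (1 / 2))) => k.
by rewrite ler_expR le_eqVlt; apply/orP; left; apply/eqP; field.
Qed.

Lemma bsum_NI (c : R) : 0 < c -> exists M, bsum (fun i => expR (- c * NI i)) M.
Proof.
move=> c_gt0; have [M1 h1] := bsum_cut pa c_gt0; have [M2 h2] := bsum_odd c_gt0.
have h3 := bsum_prodM (fun _ => expR_ge0 _) (fun _ => expR_ge0 _) h2 h2.
have h4 := bsum_prodM (fun _ => expR_ge0 _) (fun _ => mulr_ge0 (expR_ge0 _) (expR_ge0 _)) h1 h3.
exists (M1 * (M2 * M2)); apply: bsum_le h4 => i; rewrite -!expRD ler_expR /NI /mu /k2 /k3; lra.
Qed.

Lemma pow_exp (n : nat) (e : R) : 0 < e -> exists2 A : R, 0 <= A & forall N, 0 <= N -> N ^+ n <= A * expR (e * N).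
Proof.
move=> e0; case: n => [|n]; first by exists 1 => // N N0; rewrite expr0 mul1r -[1]expR0 ler_expR mulr_ge0// ltW.
have n0 : 0 < n.+1%:R :> R by rewrite ltr0n.
exists ((n.+1%:R / e) ^+ n.+1) => [|N N0]; first by rewrite exprn_ge0 ?divr_ge0 ?ltW.
have -> : expR (e * N) = expR (e * N / n.+1%:R) ^+ n.+1 by rewrite -expRM_natl; congr expR; field; rewrite gt_eqF.
have b : N <= n.+1%:R / e * expR (e * N / n.+1%:R).
  have ne : 0 <= n.+1%:R / e by rewrite divr_ge0 ?ltW.
  apply: le_trans (ler_wpM2l ne (expR_ge1Dx _)); rewrite mulrDr mulr1.
  have -> : n.+1%:R / e * (e * N / n.+1%:R) = N by field; rewrite !gt_eqF.
  by rewrite lerDr.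
by rewrite -exprMn lerXn2r ?nnegrE// (le_trans N0 b).
Qed.

Definition yy x : R := 2 * Re (x c0 ord0) - cabs (x c1 ord0) ^+ 2 - cabs (x c2 ord0) ^+ 2.

Lemma Re_kc (K : R) (v : C) : Re (kc K + v ^+ 2 + th * K%:C * v) =
  cabs v ^+ 2 - 3 / 8 * (K + 4 / sq3 R * Im v) ^+ 2.
Proof.
have t2 := sq3_sqr R; have t0 := sq3_neq0 R.
have -> : Re (kc K + v ^+ 2 + th * K%:C * v) = Re (v ^+ 2) - 3 / 8 * K ^+ 2 - sq3 R * K * Im v.
  have -> : kc K = (- (K / 2))%:C * th - ((K ^+ 2) / 4)%:C * (2 + w).
    by rewrite /kc !(CM, CN, CV, CX, Cnat); ring.
  have -> : th * K%:C * v = K%:C * (th * v) by ring.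
  by rewrite !ReIm Re_w3 Im_w3; field.
by rewrite cabs_sqr expr2 ReM; move: (sq3 R) t2 t0 => t t2 t0; field: t2.
Qed.

Lemma cabs_Tm i x : cabs (Tm i x) = expR (- (ss R * (yy x * cabs (mu i) ^+ 2 +
  3 / 8 * ((k2 i + 4 / sq3 R * Im (mu i * x c1 ord0)) ^+ 2 + (k3 i + 4 / sq3 R * Im (mu i * x c2 ord0)) ^+ 2)))).
Proof.
rewrite /Tm cabs_cexp; congr expR.
have -> : qq i x = 2 * s_ * ((mu i)^* * pm - mu i * pm^*) +
    s_ * (kc (k2 i) + (mu i * x c1 ord0) ^+ 2 + th * (k2 i)%:C * (mu i * x c1 ord0)) +
    s_ * (kc (k3 i) + (mu i * x c2 ord0) ^+ 2 + th * (k3 i)%:C * (mu i * x c2 ord0)) -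
    2 * s_ * ((mu i * (mu i)^*) * x c0 ord0) by rewrite /qq; ring.
have sk (v : C) : Re (s_ * v) = ss R * Re v by rewrite ReM ReC ImC mul0r subr0.
rewrite !ReD ReN !Re_2s !sk !Re_kc mulcJ [Re (_%:C * _)]ReM ReC ImC mul0r subr0 !cabsM !exprMn /yy.
have -> : Re ((mu i)^* * pm - mu i * pm^*) = 0 by rewrite !ReIm; ring.
by ring.
Qed.

Lemma sq_lower (k i l : R) : 0 <= l <= 1 -> l * (k ^+ 2 / 2 - i ^+ 2) <= (k + i) ^+ 2.
Proof.
move=> /andP[l0 l1]; have h : k ^+ 2 / 2 - i ^+ 2 <= (k + i) ^+ 2 by have := sqr_ge0 (k + 2 * i); rewrite !expr2; lra.
have [n|p] := lerP (k ^+ 2 / 2 - i ^+ 2) 0.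
  by apply: le_trans (sqr_ge0 _); rewrite mulr_ge0_le0.
by apply: le_trans h; rewrite ler_piMl// ltW.
Qed.

Lemma Tm_gauss x : 0 < yy x -> exists c : R, 0 < c /\ forall i, cabs (Tm i x) <= expR (c - c * NI i).
Proof.
move=> y0; have s0 := ss_gt0 R; have t2 := sq3_sqr R; have t0 := sq3_neq0 R.
pose u2 := cabs (x c1 ord0) ^+ 2; pose u3 := cabs (x c2 ord0) ^+ 2.
have u20 : 0 <= u2 := sqr_ge0 _. have u30 : 0 <= u3 := sqr_ge0 _.
(* Separating [k2, k3] from [mu] costs at most [4 l (u2 + u3)] in the coefficient of [|mu|^2]; this
   choice keeps the cost below [yy x / 2]. *)
pose l := yy x / (yy x + 8 * (u2 + u3)).
have den : 0 < yy x + 8 * (u2 + u3) by lra.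
have l0 : 0 < l by rewrite divr_gt0.
have l1 : l <= 1 by rewrite ler_pdivrMr// mul1r; lra.
have lu : l * (4 * (u2 + u3)) <= yy x / 2.
  by rewrite /l mulrAC ler_pdivrMr//; have := mulr_ge0 (ltW y0) (addr_ge0 u20 u30); have := sqr_ge0 (yy x); rewrite expr2; lra.
clearbody l; clear den; pose c := Num.min (yy x / 4) (3 / 32 * l).
have c_gt0 : 0 < c by rewrite lt_min; apply/andP; split; lra.
exists (ss R * c); split; first exact: mulr_gt0.
move=> i; rewrite cabs_Tm ler_expR /NI.
have c1' : c <= yy x / 4 by rewrite ge_min lexx.
have c2' : c <= 3 / 32 * l by rewrite ge_min lexx orbT.
clearbody c; have ll : 0 <= l <= 1 by rewrite (ltW l0).
have h2 := sq_lower (k2 i) (4 / sq3 R * Im (mu i * x c1 ord0)) ll.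
have h3 := sq_lower (k3 i) (4 / sq3 R * Im (mu i * x c2 ord0)) ll.
have im (v : C) : (4 / sq3 R * Im (mu i * v)) ^+ 2 <= 16 / 3 * (cabs (mu i) ^+ 2 * cabs v ^+ 2).
  have -> : (4 / sq3 R * Im (mu i * v)) ^+ 2 = 16 / 3 * Im (mu i * v) ^+ 2.
    by rewrite exprMn expr_div_n t2; ring.
  rewrite ler_wpM2l//.
  by rewrite -exprMn -cabsM cabs_sqr lerDr sqr_ge0.
have i2 := im (x c1 ord0); have i3 := im (x c2 ord0); rewrite -/u2 -/u3 in i2 i3.
have m0 := sqr_ge0 (cabs (mu i)); have k20 := sqr_ge0 (k2 i); have k30 := sqr_ge0 (k3 i).
move: h2 h3 i2 i3.
set A2 := (k2 i + _) ^+ 2; set A3 := (k3 i + _) ^+ 2; set J2 := (4 / sq3 R * _) ^+ 2; set J3 := (4 / sq3 R * _) ^+ 2.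
clearbody A2 A3 J2 J3; move: (cabs (mu i) ^+ 2) (k2 i ^+ 2) (k3 i ^+ 2) m0 k20 k30 => m K2 K3 m0 k20 k30.
clearbody u2 u3; move: (yy x) y0 lu c1' => y y0 lu c1'.
clear -s0 l0 m0 k20 k30 u20 u30 y0 lu c1' c2'.
move=> h2 h3 i2 i3; have f2 := ler_wpM2l (ltW l0) i2; have f3 := ler_wpM2l (ltW l0) i3.
have e1 := ler_wpM2r m0 lu; have e2 := ler_wpM2r m0 c1'; have e3 := ler_wpM2r k20 c2'; have e4 := ler_wpM2r k30 c2'.
suff S : c * (m + K2 + K3) <= y * m + 3 / 8 * (A2 + A3).
  by have := ler_wpM2l (ltW s0) S; lra.
have g1 := mulr_ge0 (ltW l0) k20; have g2 := mulr_ge0 (ltW l0) k30; have g3 := mulr_ge0 (ltW y0) m0.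
by lra.
Qed.

(** The power of [NI] pays for coefficients and derivatives; the exponential margin makes the bound
    hold on a whole neighbourhood of [x], by [Tm_near]. *)
Definition good n (e : R) x := exists M, bsum (fun i => cabs (Tm i x) * NI i ^+ n * expR (e * NI i)) M.

Lemma good_ex n x : 0 < yy x -> exists2 e : R, 0 < e & good n e x.
Proof.
move=> /Tm_gauss[c [c_gt0 hc]]; have c4 : 0 < c / 4 by lra.
have [A A0 hA] := pow_exp n c4; have c2' : 0 < c / 2 by lra.
have [M hM] := bsum_NI c2'; exists (c / 4) => //; exists (A * expR c * M).
have K : 0 <= A * expR c by rewrite mulr_ge0 ?expR_ge0.
apply: bsum_le (bsumZ K hM) => i; have N0 := NI_ge0 i.
have := ler_pM (cabs_ge0 _) (exprn_ge0 n N0) (hc i) (hA _ N0) => /(ler_wpM2r (expR_ge0 (c / 4 * NI i))) /le_trans; apply.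
have -> : expR (c - c * NI i) * (A * expR (c / 4 * NI i)) * expR (c / 4 * NI i) =
   A * (expR (c - c * NI i) * expR (c / 4 * NI i) * expR (c / 4 * NI i)) by ring.
have -> : expR (c - c * NI i) * expR (c / 4 * NI i) * expR (c / 4 * NI i) = expR c * expR (- (c / 2) * NI i).
  by rewrite -!expRD; congr expR; field.
by rewrite mulrA.
Qed.

Variable (al : I3 -> C) (A : R) (n : nat).
Hypothesis A_ge0 : 0 <= A.
Hypothesis al_le : forall i, cabs (al i) <= A * NI i ^+ n.

Definition Fa x : C := csum (fun i => al i * Tm i x).

Lemma TmD i x h : Tm i (x + h) = Tm i x * cexp (\sum_k ld i x k * h k ord0 + qr i h).
Proof. by rewrite /Tm qqD cexpD. Qed.

Lemma Tm_near i x h (e : R) : nrm h <= 1 -> LL x * nrm h <= e -> cabs (Tm i (x + h)) <= cabs (Tm i x) * expR (e * NI i).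
Proof.
move=> h1 he; rewrite TmD cabsM ler_wpM2l ?cabs_ge0//; apply: le_trans (cabs_cexp_le _) _; rewrite ler_expR.
by apply: le_trans (DD_le _ _ h1) _; rewrite mulrAC ler_wpM2r ?NI_ge0.
Qed.

Lemma Fa_sum x h (e : R) : good n e x -> nrm h <= 1 -> LL x * nrm h <= e ->
  has_sum (fun i => al i * Tm i (x + h)) (Fa (x + h)).
Proof.
move=> [M hM] h1 he; apply: (@csumP _ _ _ (A * M)); apply: bsum_le (bsumZ A_ge0 hM) => i.
rewrite cabsM; apply: le_trans (ler_pM (cabs_ge0 _) (cabs_ge0 _) (al_le i) (Tm_near i h1 he)) _.
by rewrite le_eqVlt; apply/orP; left; apply/eqP; ring.
Qed.

(** The quadratic Taylor remainder of a term costs [NI^2], hence [good] at [n + 2]. The coefficients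
    [al] allow the same lemma to treat the derivative series [F1] and [FF2]. *)
Lemma Fa_HD x : 0 < yy x -> HD Fa x.
Proof.
move=> y0; have s0 := ss_gt0 R; have [e e0 g2] := good_ex n.+2 y0; have [M hM] := g2.
have L0 : 0 < LL x by apply: lt_le_trans (LL_ge x).
have gn : good n e x.
  exists M; apply: bsum_le hM => i; rewrite ler_wpM2r ?expR_ge0// ler_wpM2l ?cabs_ge0//.
  by apply: ler_weXn2l; [exact: NI_ge1|lia].
pose dl := Num.min 1 (e / LL x); have dl0 : 0 < dl by rewrite lt_min ltr01 divr_gt0.
have M0 : 0 <= M := bsum_ge0 hM.
have dlL h : nrm h <= dl -> nrm h <= 1 /\ LL x * nrm h <= e.
  by rewrite le_min ler_pdivlMr// mulrC => /andP[].
pose B := 4 * LL x ^+ 2 + ss R; have B0 : 0 <= B by rewrite /B; have := sqr_ge0 (LL x); lra.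
have dP k : has_sum (fun i => al i * Tm i x * ld i x k) (csum (fun i => al i * Tm i x * ld i x k)).
  pose D := A * (ss R * (2 * U x + 2)).
  have D0 : 0 <= D by rewrite !mulr_ge0 ?(ltW s0)//; have := U_ge0 x; lra.
  apply: (@csumP _ _ _ (D * M)); apply: bsum_le (bsumZ D0 hM) => i; have N1 := NI_ge1 i; have N0 := NI_ge0 i.
  rewrite !cabsM; have h1 := ler_pM (cabs_ge0 _) (cabs_ge0 _) (al_le i) (lexx (cabs (Tm i x))).
  have h2 := ler_pM (mulr_ge0 (cabs_ge0 (al i)) (cabs_ge0 (Tm i x))) (cabs_ge0 _) h1 (ld_le i x k).
  apply: le_trans h2 _.
  have -> : A * NI i ^+ n * cabs (Tm i x) * (ss R * (2 * U x + 2) * NI i) = D * (cabs (Tm i x) * NI i ^+ n.+1 * 1).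
    by rewrite /D exprSr; ring.
  rewrite ler_wpM2l//; apply: ler_pM; rewrite ?mulr_ge0 ?cabs_ge0 ?exprn_ge0//.
    by rewrite ler_wpM2l ?cabs_ge0//; apply: ler_weXn2l => //; lia.
  by rewrite -[leLHS]expR0 ler_expR mulr_ge0 ?(ltW e0).
exists (fun k => csum (fun i => al i * Tm i x * ld i x k)), (A * B * M), dl; split=> //.
  by rewrite !mulr_ge0.
move=> h hdl; have [h1 he] := dlL h hdl; have n0 := nrm_ge0 h.
have x0 : nrm (0 : 'cV[C]_3) = 0 by rewrite /nrm big1// => k _; rewrite mxE cabs0.
have S1 := Fa_sum gn h1 he.
have S0 : has_sum (fun i => al i * Tm i x) (Fa x).
  by have := @Fa_sum x 0 e gn; rewrite x0 addr0 mulr0; apply; rewrite ?(ltW e0).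
have Sd : has_sum (fun i => \sum_k (al i * Tm i x * ld i x k) * h k ord0)
    (\sum_k csum (fun i => al i * Tm i x * ld i x k) * h k ord0).
  rewrite sum3; have E k := has_sumZ (h k ord0) (dP k).
  rewrite ![csum _ * _]mulrC; apply: eq_has_sum (has_sumD (has_sumD (E c0) (E c1)) (E c2)) => i.
  by rewrite sum3; ring.
have St := has_sumD (has_sumD S1 (has_sumN S0)) (has_sumN Sd).
apply: has_sum_bound St _; have nn := exprn_ge0 2 n0.
have K : 0 <= A * B * nrm h ^+ 2 by rewrite !mulr_ge0.
rewrite mulrAC; apply: bsum_le (bsumZ K hM) => i; have N1 := NI_ge1 i; have N0 := NI_ge0 i.
have -> : al i * Tm i (x + h) - al i * Tm i x - \sum_k al i * Tm i x * ld i x k * h k ord0 =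
    al i * Tm i x * (cexp (\sum_k ld i x k * h k ord0 + qr i h) - 1 - \sum_k ld i x k * h k ord0).
  by rewrite TmD !sum3; ring.
rewrite cabsM cabsM; set l := \sum_k _.
have r : cabs (cexp (l + qr i h) - 1 - l) <= B * (NI i ^+ 2 * expR (e * NI i)) * nrm h ^+ 2.
  have -> : cexp (l + qr i h) - 1 - l = (cexp (l + qr i h) - 1 - (l + qr i h)) + qr i h by ring.
  apply: le_trans (cabsD _ _) _; have d1 := DD_le i x h1; rewrite -/l in d1.
  have t := cexp_taylor2 (l + qr i h).
  have d2 : cabs (l + qr i h) ^+ 2 <= (LL x * NI i * nrm h) ^+ 2.
    by rewrite lerXn2r ?nnegrE ?cabs_ge0//; exact: le_trans (cabs_ge0 _) d1.
  have d3 : expR (cabs (l + qr i h)) <= expR (e * NI i).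
    by rewrite ler_expR; apply: le_trans d1 _; rewrite mulrAC ler_wpM2r.
  have d4 := ler_pM (sqr_ge0 _) (expR_ge0 _) d2 d3.
  have d5 := qr_le i h.
  have E1 : 1 <= expR (e * NI i) by rewrite -[leLHS]expR0 ler_expR mulr_ge0 ?(ltW e0).
  have d6 : ss R * NI i * nrm h ^+ 2 <= ss R * (NI i ^+ 2 * expR (e * NI i)) * nrm h ^+ 2.
    rewrite ler_wpM2r// ler_wpM2l ?(ltW s0)// -[leLHS]mulr1; apply: ler_pM => //.
    by rewrite expr2 ler_peMl.
  rewrite /B; have := le_trans d5 d6; move: t d4; rewrite !exprMn; lra.
have a1 := ler_pM (cabs_ge0 _) (cabs_ge0 _) (al_le i) (lexx (cabs (Tm i x))).
have a2 := ler_pM (mulr_ge0 (cabs_ge0 (al i)) (cabs_ge0 (Tm i x))) (cabs_ge0 _) a1 r.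
apply: le_trans a2 _; rewrite le_eqVlt; apply/orP; left; apply/eqP.
by rewrite -[n.+2]addn2 exprD; ring.
Qed.
End ExponentialSums.

(** * Expansion transversal to the mirror [u2 = 0] *)

Section Mirror.
Variable R : realType.
Local Notation C := R[i].
Local Notation th := (1 + 2 * w3 R).
Local Notation s_ := ((ss R)%:C : C).
Variables (pm pa : C).
Implicit Types (i : I3) (x h : 'cV[C]_3).
Local Notation NI := (NI pa).
Local Notation Tm := (Tm pm pa).

Definition be i : C := s_ * th * mu pa i * (k2 R i)%:C.
Definition ga i : C := s_ * mu pa i ^+ 2.
Definition z1 x : 'cV[C]_3 := \col_k (if k == c1 then 0 else x k ord0).

Lemma Tm_mirror i x : Tm i x = Tm i (z1 x) * cexp (be i * x c1 ord0 + ga i * x c1 ord0 ^+ 2).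
Proof. by rewrite /Tm -cexpD; congr cexp; rewrite /qq /be /ga !mxE /=; ring. Qed.

Lemma mir_term i (v : C) : cabs v <= 1 ->
  cabs (cexp (be i * v + ga i * v ^+ 2) - 1 - be i * v - (ga i + be i ^+ 2 / 2) * v ^+ 2) <=
  (64 * ss R ^+ 3 + 2 * ss R ^+ 2) * NI i ^+ 3 * expR (2 * ss R * NI i * cabs v) * cabs v ^+ 3.
Proof.
move=> v1; have v0 := cabs_ge0 v; have s0 := ss_gt0 R; have N1 := NI_ge1 pa i; have N0 := NI_ge0 pa i.
have b := be_le (muk2_le pa i); rewrite -/(be i) in b; have g := ga_le pa i; rewrite -/(ga i) in g.
have b0 := cabs_ge0 (be i); have g0 := cabs_ge0 (ga i).
set D := be i * v + ga i * v ^+ 2.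
have sN : 0 <= ss R * NI i by rewrite mulr_ge0 ?(ltW s0).
have hD : cabs D <= 2 * ss R * NI i * cabs v.
  apply: le_trans (cabsD _ _) _; rewrite (cabsM (be i)) (cabsM (ga i)) cabsX.
  have h1 : cabs (be i) * cabs v <= ss R * NI i * cabs v by rewrite ler_wpM2r.
  have h2 : cabs (ga i) * cabs v ^+ 2 <= ss R * NI i * cabs v.
    by apply: ler_pM => //; [exact: sqr_ge0|rewrite expr2 ler_piMl].
  lra.
have -> : cexp D - 1 - be i * v - (ga i + be i ^+ 2 / 2) * v ^+ 2 =
    (cexp D - 1 - D - D ^+ 2 / 2) + (be i * ga i + ga i ^+ 2 * v / 2) * v ^+ 3 by rewrite /D; field.
apply: le_trans (cabsD _ _) _; set E := expR (2 * ss R * NI i * cabs v).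
have E1 : 1 <= E by rewrite /E -[leLHS]expR0 ler_expR mulr_ge0 // -mulrA mulr_ge0.
have t := cexp_taylor3 D.
have t1 : cabs D ^+ 3 * expR (cabs D) <= (2 * ss R * NI i * cabs v) ^+ 3 * E.
  apply: ler_pM; rewrite ?exprn_ge0 ?cabs_ge0 ?expR_ge0 ?ler_expR//.
  by rewrite lerXn2r ?nnegrE ?cabs_ge0//; apply: le_trans hD; exact: cabs_ge0.
have t2 : cabs ((be i * ga i + ga i ^+ 2 * v / 2) * v ^+ 3) <= 2 * ss R ^+ 2 * NI i ^+ 3 * E * cabs v ^+ 3.
  rewrite cabsM cabsX ler_wpM2r ?exprn_ge0//; apply: le_trans (cabsD _ _) _.
  rewrite (cabsM (be i)) (cabsM _ (2^-1)) (cabsM (_ ^+ 2)) cabsV cabsX (_ : cabs (2 : C) = 2); last by rewrite -(Cnat R 2) cabsC normr_nat.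
  have u1 := ler_pM b0 g0 b g.
  have u2 : cabs (ga i) ^+ 2 * cabs v <= (ss R * NI i) ^+ 2.
    by rewrite -[leRHS]mulr1; apply: ler_pM => //; rewrite ?sqr_ge0// lerXn2r ?nnegrE.
  have u3 : 2 * (ss R * NI i) ^+ 2 <= 2 * ss R ^+ 2 * NI i ^+ 3 * E.
    have -> : 2 * (ss R * NI i) ^+ 2 = 2 * ss R ^+ 2 * NI i ^+ 2 * 1 by ring.
    have q : 0 <= 2 * ss R ^+ 2 by have := sqr_ge0 (ss R); lra.
    apply: (@le_trans _ _ (2 * ss R ^+ 2 * NI i ^+ 3 * 1)).
      by rewrite !mulr1 ler_wpM2l//; apply: ler_weXn2l => //; lia.
    by rewrite ler_wpM2l// mulr_ge0// exprn_ge0.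
  by have := sqr_ge0 (ss R * NI i); move: u1 u2 u3; rewrite -!expr2; lra.
have t3 : (2 * ss R * NI i * cabs v) ^+ 3 * E = 8 * ss R ^+ 3 * NI i ^+ 3 * E * cabs v ^+ 3 by ring.
by rewrite t3 in t1; lra.
Qed.

Definition F0 := Fa pm pa (fun _ => 1).
Definition F1 := Fa pm pa be.
Definition FF2 := Fa pm pa (fun i => ga i + be i ^+ 2 / 2).

Lemma one_le i : cabs (1 : C) <= 1 * NI i ^+ 0. Proof. by rewrite cabs1 mulr1. Qed.
Lemma be_le' i : cabs (be i) <= ss R * NI i ^+ 1.
Proof. by rewrite expr1; exact: be_le (muk2_le pa i). Qed.
Lemma gb_le i : cabs (ga i + be i ^+ 2 / 2) <= (ss R + ss R ^+ 2) * NI i ^+ 2.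
Proof.
have s0 := ss_gt0 R; have N1 := NI_ge1 pa i; have N0 := NI_ge0 pa i.
apply: le_trans (cabsD _ _) _; rewrite mulrDl; apply: lerD.
  by apply: le_trans (ga_le pa i) _; rewrite ler_wpM2l ?(ltW s0)// expr2 ler_peMl.
rewrite (cabsM _ (2^-1)) cabsV cabsX (_ : cabs (2 : C) = 2); last by rewrite -(Cnat R 2) cabsC normr_nat.
have : cabs (be i) ^+ 2 <= (ss R * NI i) ^+ 2.
  by rewrite lerXn2r ?nnegrE ?cabs_ge0 ?mulr_ge0 ?(ltW s0)//; exact: be_le (muk2_le pa i).
by rewrite exprMn; have := sqr_ge0 (cabs (be i)); lra.
Qed.

Lemma F0_HD x : 0 < yy x -> HD F0 x. Proof. exact: Fa_HD ler01 one_le _. Qed.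
Lemma F1_HD x : 0 < yy x -> HD F1 x. Proof. exact: Fa_HD (ltW (ss_gt0 R)) be_le' _. Qed.
Lemma F2_HD x : 0 < yy x -> HD FF2 x.
Proof. by apply: Fa_HD gb_le _; rewrite addr_ge0 ?sqr_ge0 ?(ltW (ss_gt0 R)). Qed.

Lemma F0_sum x : 0 < yy x -> has_sum (fun i => Tm i x) (F0 x).
Proof.
move=> y0; have [e e0 g] := good_ex pm pa 0 y0.
have := @Fa_sum _ pm pa _ 1 0 ler01 one_le x 0 e g; rewrite addr0.
have -> : nrm (0 : 'cV[C]_3) = 0 by rewrite /nrm big1// => k _; rewrite mxE cabs0.
rewrite mulr0 => /(_ ler01 (ltW e0)); apply: eq_has_sum => i; exact: mul1r.
Qed.

Lemma nrm_z1 h : nrm (z1 h) <= nrm h.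
Proof. by rewrite !nrm3 !mxE /= cabs0; have := cabs_ge0 (h c1 ord0); lra. Qed.

(** Third order is needed because the series is later divided by the transverse coordinate, and a
    quadratic remainder has to be left. *)
Lemma mirror_sum x : 0 < yy x -> x c1 ord0 = 0 -> exists M e : R, [/\ 0 < e, 0 <= M & forall h, nrm h <= e ->
  cabs (F0 (x + h) - F0 (x + z1 h) - h c1 ord0 * F1 (x + z1 h) - h c1 ord0 ^+ 2 * FF2 (x + z1 h)) <=
  M * cabs (h c1 ord0) ^+ 3].
Proof.
move=> y0 x0; have s0 := ss_gt0 R; have [e e0 g] := good_ex pm pa 3 y0; have [M hM] := g.
have gm n : (n <= 3)%N -> good pm pa n e x.
  move=> n3; exists M; apply: bsum_le hM => i; rewrite ler_wpM2r ?expR_ge0// ler_wpM2l ?cabs_ge0//.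
  by apply: ler_weXn2l => //; exact: NI_ge1.
have M0 := bsum_ge0 hM; pose B := 64 * ss R ^+ 3 + 2 * ss R ^+ 2.
have B0 : 0 <= B by rewrite addr_ge0 ?mulr_ge0 ?exprn_ge0 ?(ltW s0).
have L0 : 0 < LL x by apply: lt_le_trans (LL_ge x).
pose dl := Num.min 1 (Num.min (e / 2 / LL x) (e / 4 / ss R)).
have dl0 : 0 < dl by rewrite !lt_min ltr01 !divr_gt0.
exists (B * M), dl; split=> //; first exact: mulr_ge0.
move=> h; rewrite !le_min => /and3P[h1 h2 h3]; have n0 := nrm_ge0 h; have hz := nrm_z1 h.
rewrite ler_pdivlMr// mulrC in h2; rewrite ler_pdivlMr// mulrC in h3.
have he : LL x * nrm h <= e by lra.
have hz1 : nrm (z1 h) <= 1 by lra.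
have hze : LL x * nrm (z1 h) <= e / 2 by have := ler_wpM2l (ltW L0) hz; lra.
have hze' : LL x * nrm (z1 h) <= e by lra.
have S0 := @Fa_sum _ pm pa _ 1 0 ler01 one_le x h e (gm 0 isT) h1 he.
have S0' := @Fa_sum _ pm pa _ 1 0 ler01 one_le x _ e (gm 0 isT) hz1 hze'.
have S1 := @Fa_sum _ pm pa _ _ 1 (ltW s0) be_le' x _ e (gm 1 isT) hz1 hze'.
have sp : 0 <= ss R + ss R ^+ 2 by rewrite addr_ge0 ?sqr_ge0 ?(ltW s0).
have S2 := @Fa_sum _ pm pa _ _ 2 sp gb_le x _ e (gm 2 isT) hz1 hze'.
have S := has_sumD (has_sumD (has_sumD S0 (has_sumN S0')) (has_sumN (has_sumZ (h c1 ord0) S1))) (has_sumN (has_sumZ (h c1 ord0 ^+ 2) S2)).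
apply: has_sum_bound S _; have v0 := cabs_ge0 (h c1 ord0).
have K : 0 <= B * cabs (h c1 ord0) ^+ 3 by rewrite mulr_ge0 ?exprn_ge0.
rewrite mulrAC; apply: bsum_le (bsumZ K hM) => i; have N0 := NI_ge0 pa i.
have zE : z1 (x + h) = x + z1 h by apply/colP => k; rewrite !mxE; case: eqP => [->|//]; rewrite x0 addr0.
have vE : (x + h) c1 ord0 = h c1 ord0 by rewrite mxE x0 add0r.
rewrite !mul1r Tm_mirror zE vE; have vn := nrm_coord h c1; move: (h c1 ord0) v0 vn K => v v0 vn K.
have -> : Tm i (x + z1 h) * cexp (be i * v + ga i * v ^+ 2) - Tm i (x + z1 h) - v * (be i * Tm i (x + z1 h)) -
    v ^+ 2 * ((ga i + be i ^+ 2 / 2) * Tm i (x + z1 h)) =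
    Tm i (x + z1 h) * (cexp (be i * v + ga i * v ^+ 2) - 1 - be i * v - (ga i + be i ^+ 2 / 2) * v ^+ 2) by ring.
rewrite cabsM; have v1 : cabs v <= 1 := le_trans vn h1.
apply: le_trans (ler_pM (cabs_ge0 _) (cabs_ge0 _) (Tm_near _ _ i hz1 hze) (mir_term i v1)) _; rewrite -/B.
have Ev : expR (2 * ss R * NI i * cabs v) <= expR (e / 2 * NI i).
  rewrite ler_expR mulrAC ler_wpM2r//; have := ler_wpM2l (ltW s0) vn; lra.
have -> : cabs (Tm i x) * expR (e / 2 * NI i) * (B * NI i ^+ 3 * expR (2 * ss R * NI i * cabs v) * cabs v ^+ 3) =
   B * cabs v ^+ 3 * (cabs (Tm i x) * NI i ^+ 3 * (expR (e / 2 * NI i) * expR (2 * ss R * NI i * cabs v))) by ring.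
rewrite ler_wpM2l// ler_wpM2l ?mulr_ge0 ?cabs_ge0 ?exprn_ge0//.
apply: le_trans (ler_wpM2l (expR_ge0 _) Ev) _; rewrite -expRD ler_expR; lra.
Qed.
End Mirror.

(** * The form and its quotient by the equation of a mirror *)

Section Form.
Variable R : realType.
Local Notation C := R[i].
Local Notation w := (w3 R).
Local Notation hh := (hh R).
Local Notation ei := (ei R).
Local Notation bv := (bv R).
Implicit Types (z : 'cV[C]_4) (x h : 'cV[C]_3).

Definition pi0 : 'cV[C]_4 := hh *: bv ord0.
Definition pm0 : C := cB pi0.
Definition pa0 : C := cA pi0.
Lemma pi0_2 : pi0 o2 ord0 = 0. Proof. by rewrite !mxE mulr0. Qed.
Lemma pi0_3 : pi0 o3 ord0 = 0. Proof. by rewrite !mxE mulr0. Qed.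

Lemma Tm_Pht (pm pa : C) p (k l : int) x : Tm pm pa (p, (k, l)) x =
  Ph1 (x c0 ord0) (x c1 ord0) (x c2 ord0) pm pa 0 0 p *
  (sgt ((ei p + pa) * x c1 ord0) k * sgt ((ei p + pa) * x c2 ord0) l).
Proof.
rewrite /Tm /Ph1 /sgt -!cexpD; congr cexp; rewrite /qq /mu /k2 /k3 /kc /=.
have e (m : int) : ((2 * m%:~R + 1 : R))%:C = 2 * m%:~R + 1 by rewrite CD CM Cnat Cint C1.
by rewrite !e conj0; ring.
Qed.

Lemma F0_Pht (pm pa : C) x : 0 < yy x ->
  has_sum (Pht (x c0 ord0) (x c1 ord0) (x c2 ord0) pm pa 0 0) (F0 pm pa x).
Proof.
move=> y0; apply: (has_sum_fubini (F0_sum pm pa y0)) => p.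
have [M1 h1] := sgt_bsum ((ei p + pa) * x c1 ord0); have [M2 h2] := sgt_bsum ((ei p + pa) * x c2 ord0).
have := has_sumZ (Ph1 (x c0 ord0) (x c1 ord0) (x c2 ord0) pm pa 0 0 p)
  (has_sum_mul (sgP ((ei p + pa) * x c1 ord0)) (sgP ((ei p + pa) * x c2 ord0)) h1 h2).
rewrite /Pht !subr0; apply: eq_has_sum => -[k l]; exact: esym (Tm_Pht _ _ _ _ _ _).
Qed.

Lemma F0_Phi (pm pa : C) x : 0 < yy x -> Phi (x c0 ord0) (x c1 ord0) (x c2 ord0) pm pa 0 0 = F0 pm pa x.
Proof. by move=> y0; exact: csumE (F0_Pht pm pa y0). Qed.

Lemma F0_mirror (pm pa : C) x : 0 < yy x -> x c1 ord0 = 0 -> F0 pm pa x = 0.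
Proof.
move=> y0 x0; apply: (has_sum_unique (F0_Pht pm pa y0)).
have -> : Pht (x c0 ord0) (x c1 ord0) (x c2 ord0) pm pa 0 0 = fun=> 0.
  by apply/funext => p; rewrite /Pht x0 mulr0 subr0 sg0 mul0r mulr0.
by move=> e e0; exists [::] => // s _ _; rewrite big1 // subrr cabs0 ltW.
Qed.

Definition xz z : 'cV[C]_3 := \col_k (if k == c0 then tau_ z else if k == c1 then uu2 z else uu3 z).
Lemma xz0 z : xz z c0 ord0 = tau_ z. Proof. by rewrite mxE. Qed.
Lemma xz1 z : xz z c1 ord0 = uu2 z. Proof. by rewrite mxE. Qed.
Lemma xz2 z : xz z c2 ord0 = uu3 z. Proof. by rewrite mxE. Qed.

Lemma yy_xz z : 0 < hn z -> yy (xz z) = hy z.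
Proof. by move=> hz; rewrite /yy xz0 xz1 xz2 hy_real. Qed.
Lemma yy_gt0 z : 0 < hn z -> 0 < yy (xz z).
Proof. by move=> hz; rewrite yy_xz// hy_gt0. Qed.

(** The division by [cA z] gives homogeneity of degree -1 and makes [h(z,z) |ff z|^2] a constant
    multiple of the invariant sum. *)
Definition ff z : C := F0 pm0 pa0 (xz z) / cA z.

Lemma ff_Phi z : 0 < hn z -> ff z = Phi (tau_ z) (uu2 z) (uu3 z) pm0 pa0 0 0 / cA z.
Proof. by move=> hz; have := F0_Phi pm0 pa0 (yy_gt0 hz); rewrite xz0 xz1 xz2 /ff => <-. Qed.

Definition cN : R := Kp R ^+ 2 / (sq3 R * ss R) * Ks R ^+ 2.
Lemma cN_gt0 : 0 < cN.
Proof.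
exact: mulr_gt0 (divr_gt0 (exprn_gt0 _ (Kp_gt0 R)) (mulr_gt0 (sq3_gt0 R) (ss_gt0 R))) (exprn_gt0 _ (Ks_gt0 R)).
Qed.

Lemma Kz0 (y : R) : 0 < y -> Kz 0 0 y = cN * y.
Proof.
move=> y0; rewrite /Kz /Kq /cN cabs0 expr0n /= addr0 mulr0 oppr0 expR0 mulr1.
have s0 := ss_gt0 R; have q0 := sq3_gt0 R.
by field; rewrite !gt_eqF.
Qed.

Lemma NN0_ff z : 0 < hn z -> NN0 pi0 z = (cN * hn z * cabs (ff z) ^+ 2)%:C.
Proof.
move=> hz; have A0 : 0 < cabs (cA z) by rewrite cabs_gt0 cA_neq0.
rewrite NN0E// pi0_2 pi0_3 Kz0 ?hy_gt0// ff_Phi// cabsM cabsV /hy; congr (_%:C).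
by field; rewrite gt_eqF.
Qed.

Lemma ff_eq0 z : 0 < hn z -> (ff z = 0) <-> (NN0 pi0 z = 0).
Proof.
move=> hz; rewrite NN0_ff//; split=> [->|]; first by rewrite cabs0 expr0n /= mulr0.
move=> /(congr1 (@complex.Re R)); rewrite ReC Re0 => /eqP.
by rewrite mulf_eq0 (gt_eqF (mulr_gt0 cN_gt0 hz)) /= sqrf_eq0 cabs_eq0 => /eqP.
Qed.

Lemma ff_cabs G z : 0 < hn z -> G3 G -> (forall z', NN0 (G *m pi0) z' = NN0 pi0 z') ->
  cabs (ff (G *m z)) = cabs (ff z).
Proof.
move=> hz hG e; have hz' : 0 < hn (G *m z) by rewrite hn_G3.
have : NN0 pi0 (G *m z) = NN0 pi0 z by rewrite -e NN0_G3.
rewrite !NN0_ff// hn_G3// => /(congr1 (@complex.Re R)); rewrite !ReC => h.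
have c : cN * hn z != 0 by rewrite gt_eqF// mulr_gt0 ?cN_gt0.
by apply/eqP; rewrite -(@eqrXn2 _ 2) ?cabs_ge0//; apply/eqP; apply: (mulfI c).
Qed.

Lemma ffZ (t : C) z : t != 0 -> 0 < hn z -> ff (t *: z) = t^-1 * ff z.
Proof.
move=> t0 hz; have A0 := cA_neq0 hz.
have cAZ : cA (t *: z) = t * cA z by rewrite /cA !mxE mulrBr.
have xE : xz (t *: z) = xz z.
  apply/colP => k; rewrite !mxE /tau_ /uu2 /uu3 cAZ.
  have -> : cB (t *: z) = t * cB z by rewrite /cB !mxE; ring.
  by rewrite !mxE; do 2?[case: ifP => _]; field; rewrite t0 A0.
by rewrite /ff xE cAZ invfM mulrCA.
Qed.

Lemma HD_cA z : HD (@cA R) z.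
Proof.
have -> : @cA R = fun z => \sum_k (if k == ord0 then 1 else if k == o1 then -1 else 0) * z k ord0.
  by apply/funext => v; rewrite sum4 /=; rewrite /cA; ring.
exact: HD_lin.
Qed.
Lemma HD_cB z : HD (@cB R) z.
Proof.
have -> : @cB R = fun z => \sum_k (if k == ord0 then - w else if k == o1 then 1 + w else 0) * z k ord0.
  by apply/funext => v; rewrite sum4 /=; rewrite /cB; ring.
exact: HD_lin.
Qed.

Lemma HD_xz z : 0 < hn z -> forall j, HD (fun z => xz z j ord0) z.
Proof.
move=> hz j; have A0 := cA_neq0 hz; have iA := HD_inv A0 (HD_cA z).
case: (altP (j =P c0)) => [->|j0]; [|case: (altP (j =P c1)) => [->|j1]].
  rewrite (_ : (fun _ => _) = fun z => cB z * (cA z)^-1); first exact: HD_mul (HD_cB z) iA.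
  by apply/funext => v; rewrite xz0.
  rewrite (_ : (fun _ => _) = fun z => z o2 ord0 * (cA z)^-1); first exact: HD_mul (HD_coord o2 z) iA.
  by apply/funext => v; rewrite xz1.
  rewrite (_ : (fun _ => _) = fun z => z o3 ord0 * (cA z)^-1); first exact: HD_mul (HD_coord o3 z) iA.
  by apply/funext => v; rewrite mxE (negbTE j0) (negbTE j1).
Qed.

Lemma HD_ff z : 0 < hn z -> HD ff z.
Proof.
move=> hz; apply: (HD_mul (HD_comp (F0_HD pm0 pa0 (yy_gt0 hz)) (HD_xz hz))).
exact: HD_inv (cA_neq0 hz) (HD_cA z).
Qed.

Lemma yy_near x : 0 < yy x -> exists2 e : R, 0 < e & forall h, nrm h <= e -> 0 < yy (x + h).
Proof.
move=> y0; pose U := cabs (x c1 ord0) + cabs (x c2 ord0).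
have U0 : 0 <= U by rewrite addr_ge0 ?cabs_ge0.
pose K := 2 * U + 4; have K0 : 0 < K by rewrite /K; lra.
exists (Num.min 1 (yy x / (2 * K))); first by rewrite lt_min ltr01 divr_gt0// mulr_gt0.
move=> h; rewrite le_min ler_pdivlMr ?mulr_gt0// => /andP[h1 h2].
have n0 := nrm_ge0 h; have a0 := nrm_coord h c0; have a1 := nrm_coord h c1; have a2 := nrm_coord h c2.
have q k : cabs (x k ord0 + h k ord0) ^+ 2 <= cabs (x k ord0) ^+ 2 + (2 * cabs (x k ord0) + 1) * cabs (h k ord0).
  have b0 := cabs_ge0 (h k ord0); have b1 := nrm_coord h k; have b2 : cabs (h k ord0) <= 1 by lra.
  have t := cabsD (x k ord0) (h k ord0); have p0 := cabs_ge0 (x k ord0).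
  have : cabs (x k ord0 + h k ord0) ^+ 2 <= (cabs (x k ord0) + cabs (h k ord0)) ^+ 2.
    by rewrite lerXn2r ?nnegrE ?cabs_ge0 ?addr_ge0.
  have : cabs (h k ord0) * cabs (h k ord0) <= cabs (h k ord0) by rewrite ler_piMl.
  rewrite !expr2; lra.
have q1 := q c1; have q2 := q c2; have r := Re_le_cabs (h c0 ord0); have := ler_norm (- Re (h c0 ord0)); rewrite normrN => r'.
rewrite /yy !mxE ReD.
have e1 : (2 * cabs (x c1 ord0) + 1) * cabs (h c1 ord0) + (2 * cabs (x c2 ord0) + 1) * cabs (h c2 ord0) <= (2 * U + 2) * nrm h.
  have p1 := cabs_ge0 (x c1 ord0); have p2 := cabs_ge0 (x c2 ord0).
  have f1 : (2 * cabs (x c1 ord0) + 1) * cabs (h c1 ord0) <= (2 * cabs (x c1 ord0) + 1) * nrm h by rewrite ler_wpM2l//; lra.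
  have f2 : (2 * cabs (x c2 ord0) + 1) * cabs (h c2 ord0) <= (2 * cabs (x c2 ord0) + 1) * nrm h by rewrite ler_wpM2l//; lra.
  rewrite /U; lra.
move: y0 h2; rewrite /yy /K; lra.
Qed.

Definition Q3 x : C := if x c1 ord0 == 0 then F1 pm0 pa0 x else F0 pm0 pa0 x / x c1 ord0.

(** At a point of the mirror the differential is that of [F1] along the mirror and [FF2] across it;
    the expansion of [mirror_sum], divided by the transverse coordinate, leaves a quadratic
    remainder. *)
Lemma Q3_HD x : 0 < yy x -> HD Q3 x.
Proof.
move=> y0; have [x0|x0] := eqVneq (x c1 ord0) 0; last first.
  have n0 : 0 < cabs (x c1 ord0) / 2 by rewrite divr_gt0// cabs_gt0.
  apply: (HD_ext n0 _ (HD_mul (F0_HD pm0 pa0 y0) (HD_inv x0 (HD_coord c1 x)))) => h hn; rewrite /Q3 ifN//.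
  rewrite -cabs_gt0 mxE; have := cabs_leD (x c1 ord0) (h c1 ord0); have := nrm_coord h c1; lra.
have [M [e1 [e10 M0 H]]] := mirror_sum pm0 pa0 y0 x0.
have [d [M1 [e2 [e20 M10 H1]]]] := F1_HD pm0 pa0 y0.
have [K [e3 [e30 K0 H2]]] := HD_lip (F2_HD pm0 pa0 y0); have [e4 e40 H4] := yy_near y0.
exists (fun k => if k == c1 then FF2 pm0 pa0 x else d k), (M + K + M1), (Num.min (Num.min e1 e2) (Num.min e3 e4)); split.
  by rewrite !lt_min e10 e20 e30.
  by rewrite !addr_ge0.
move=> h; rewrite !le_min => /andP[/andP[h1 h2] /andP[h3 h4]]; have n0 := nrm_ge0 h; have nz := nrm_z1 h.
have vn := nrm_coord h c1; have v0 := cabs_ge0 (h c1 ord0).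
have Qx : Q3 x = F1 pm0 pa0 x by rewrite /Q3 x0 eqxx.
have z0 : F0 pm0 pa0 (x + z1 h) = 0.
  by apply: F0_mirror; [apply: H4; exact: le_trans h4|rewrite !mxE /= x0 addr0].
have m := H h h1; rewrite z0 subr0 in m.
have m1 := H1 _ (le_trans nz h2); have m2 := H2 _ (le_trans nz h3).
have nz2 : nrm (z1 h) ^+ 2 <= nrm h ^+ 2 by rewrite lerXn2r ?nnegrE ?nrm_ge0.
have vE : (x + h) c1 ord0 = h c1 ord0 by rewrite mxE x0 add0r.
rewrite sum3 !mxE /= mulr0 addr0 in m1; rewrite sum3 /= Qx.
have Qh : cabs (Q3 (x + h) - F1 pm0 pa0 (x + z1 h) - h c1 ord0 * FF2 pm0 pa0 (x + z1 h)) <= M * cabs (h c1 ord0) ^+ 2.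
  rewrite /Q3 vE; have [v0'|vn0] := eqVneq (h c1 ord0) 0.
    have -> : x + z1 h = x + h by congr (_ + _); apply/colP => k; rewrite mxE; case: eqP => [->|//]; rewrite v0'.
    by rewrite v0' mul0r subrr subr0 cabs0 expr0n /= mulr0.
  have vp : 0 < cabs (h c1 ord0) by rewrite cabs_gt0.
  rewrite -(ler_pM2l vp) -cabsM.
  have -> : h c1 ord0 * (F0 pm0 pa0 (x + h) / h c1 ord0 - F1 pm0 pa0 (x + z1 h) - h c1 ord0 * FF2 pm0 pa0 (x + z1 h)) =
     F0 pm0 pa0 (x + h) - h c1 ord0 * F1 pm0 pa0 (x + z1 h) - h c1 ord0 ^+ 2 * FF2 pm0 pa0 (x + z1 h) by field.
  apply: le_trans m _; move: (cabs (h c1 ord0)) => t; rewrite le_eqVlt; apply/orP; left; apply/eqP; ring.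
move: (Q3 (x + h)) (F1 pm0 pa0 (x + z1 h)) (FF2 pm0 pa0 (x + z1 h)) (F1 pm0 pa0 x) (FF2 pm0 pa0 x) m1 m2 Qh {m} => q a b a' b' m1 m2 Qh.
have -> : q - a' - (d c0 * h c0 ord0 + b' * h c1 ord0 + d c2 * h c2 ord0) =
  (q - a - h c1 ord0 * b) + (h c1 ord0 * (b - b')) + (a - a' - (d c0 * h c0 ord0 + d c2 * h c2 ord0)) by ring.
apply: le_trans (cabsD _ _) _; rewrite mulrDl; apply: lerD; last by apply: le_trans m1 _; rewrite ler_wpM2l.
apply: le_trans (cabsD _ _) _; rewrite mulrDl; apply: lerD.
  by apply: le_trans Qh _; rewrite ler_wpM2l// lerXn2r ?nnegrE.
rewrite cabsM expr2 mulrCA; apply: ler_pM => //; first exact: cabs_ge0.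
by apply: le_trans m2 _; rewrite ler_wpM2l.
Qed.

Definition q2 z : C := Q3 (xz z) * ((cA z)^-1 * (cA z)^-1).

Lemma HD_q2 z : 0 < hn z -> HD q2 z.
Proof.
move=> hz; have iA := HD_inv (cA_neq0 hz) (HD_cA z).
exact: HD_mul (HD_comp (Q3_HD (yy_gt0 hz)) (HD_xz hz)) (HD_mul iA iA).
Qed.

Lemma ff_q2 z : 0 < hn z -> ff z = z o2 ord0 * q2 z.
Proof.
move=> hz; have A0 := cA_neq0 hz; rewrite /q2 /ff /Q3 xz1.
have [u0|u0] := eqVneq (uu2 z) 0.
  have -> : z o2 ord0 = 0 by have := congr1 ( *%R^~ (cA z)) u0; rewrite /uu2 divfK// mul0r.
  by rewrite mul0r F0_mirror ?mul0r ?yy_gt0// xz1.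
rewrite /uu2 in u0 *; have z0 : z o2 ord0 != 0 by apply: contraNneq u0 => ->; rewrite mul0r.
by field; rewrite A0 z0.
Qed.
End Form.

(** * Constancy of the ratio [ff (g z) / ff z] *)

Section Multiplier.
Variable R : realType.
Local Notation C := R[i].
Local Notation hh := (hh R).
Local Notation th := (1 + 2 * w3 R).
Local Notation ei := (ei R).
Local Notation bv := (bv R).
Local Notation ff := (@ff R).
Implicit Types (z : 'cV[C]_4).

Lemma nrmZ n (k : C) (h : 'cV[C]_n) : nrm (k *: h) = cabs k * nrm h.
Proof. by rewrite /nrm mulr_sumr; apply: eq_bigr => j _; rewrite mxE cabsM. Qed.

(** A nonzero linear part would increase the modulus to first order in a suitable direction, so it
    vanishes and only the quadratic remainder is left. *)
Lemma HD_unimodular n (r : 'cV[C]_n -> C) x e : 0 < e -> (forall h, nrm h <= e -> cabs (r (x + h)) = 1) ->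
  HD r x -> exists M e' : R, [/\ 0 < e', 0 <= M & forall h, nrm h <= e' -> cabs (r (x + h) - r x) <= M * nrm h ^+ 2].
Proof.
move=> e0 r1 [d [M [e1 [e10 M0 H]]]].
suff L0 (h : 'cV[C]_n) : \sum_k d k * h k ord0 = 0.
  by exists M, e1; split=> // h hh; have := H h hh; rewrite L0 subr0.
apply/eqP/negPn/negP => Ln0; pose L := \sum_k d k * h k ord0; pose l := cabs L; pose N := nrm h.
have l0 : 0 < l by rewrite cabs_gt0.
have N0 : 0 <= N := nrm_ge0 h; have MN : 0 <= M * N ^+ 2 by rewrite mulr_ge0 ?sqr_ge0.
have rx : cabs (r x) = 1 by have := r1 0; rewrite addr0; apply; rewrite /nrm big1 ?(ltW e0)// => k _; rewrite mxE cabs0.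
have lN : 0 < l * N + 1 by have := mulr_ge0 (ltW l0) N0; lra.
pose s := Num.min (1 / (2 * (M * N ^+ 2 + 1))) (Num.min e e1 / (l * N + 1)).
have em : 0 < Num.min e e1 by rewrite lt_min e0.
have D0 : 0 < 2 * (M * N ^+ 2 + 1) by lra.
have s0 : 0 < s by rewrite lt_min !divr_gt0.
have s1 : s * (2 * (M * N ^+ 2 + 1)) <= 1 by rewrite -ler_pdivlMr// ge_min lexx.
have s2 : s * (l * N + 1) <= Num.min e e1 by rewrite -ler_pdivlMr// ge_min lexx orbT.
(* With this phase [k L] is a positive multiple of [r x], so the linear part adds [s |L|^2] to the
   modulus; [s] is small enough for the quadratic remainder to be smaller. *)
pose k : C := s%:C * (L^* * r x).
have kl : cabs k = s * l by rewrite !cabsM cabsJ rx mulr1 cabsC gtr0_norm.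
have kN : nrm (k *: h) <= Num.min e e1.
  by apply: le_trans s2; rewrite nrmZ kl -/N mulrDr mulr1 mulrA lerDl ltW.
move: kN; rewrite le_min => /andP[h1 h2].
have := H _ h2; have := r1 _ h1.
have -> : \sum_j d j * (k *: h) j ord0 = k * L by rewrite mulr_sumr; apply: eq_bigr => j _; rewrite mxE mulrCA.
have kE : cabs (r x + k * L) = 1 + s * l ^+ 2.
  have -> : r x + k * L = r x * (1 + s%:C * (L * L^*)) by rewrite /k; ring.
  by rewrite mulcJ -CM -C1 -CD cabsM cabsC rx mul1r gtr0_norm// addr_gt0 ?mulr_gt0 ?exprn_gt0.
rewrite nrmZ kl -/N => r2 h3.
have := cabsD (r (x + k *: h)) (- (r (x + k *: h) - r x - k * L)); rewrite cabsN.
have -> : r (x + k *: h) + - (r (x + k *: h) - r x - k * L) = r x + k * L by ring.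
rewrite kE r2 => h4.
have h5 : s * l ^+ 2 <= M * (s * l * N) ^+ 2 by lra.
have h6 : M * (s * l * N) ^+ 2 = s * l ^+ 2 * (s * (M * N ^+ 2)) by ring.
have h7 : 0 < s * l ^+ 2 by rewrite mulr_gt0 ?exprn_gt0.
have h8 : 1 <= s * (M * N ^+ 2) by rewrite -(ler_pM2l h7) mulr1 -h6.
lra.
Qed.

Lemma is_derive_quad (g : R -> R) (t M e : R) : 0 < e -> 0 <= M ->
  (forall s, `|s| <= e -> `|g (t + s) - g t| <= M * s ^+ 2) -> is_derive t (1 : R) g 0.
Proof.
move=> e0 M0 H.
have c : ((fun h : R => h^-1 *: ((g \o shift t) (h *: (1 : R)) - g t)) @ 0^' --> (0 : R))%classic.
  apply/cvgrPdist_le => eps eps0; near=> h.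
  have h0 : h != 0 by near: h; exact: nbhs_dnbhs_neq.
  have h1 : `|h| <= e by near: h; apply: dnbhs0_le.
  have h2 : `|h| <= eps / (M + 1) by near: h; apply: dnbhs0_le; rewrite divr_gt0// ltr_wpDl.
  have hp : 0 < `|h| by rewrite normr_gt0.
  rewrite sub0r normrN /GRing.scale /= mulr1 [h + t]addrC normrM normfV mulrC ler_pdivrMr//.
  apply: le_trans (H h h1) _; rewrite -(real_normK (num_real h)) expr2 mulrA ler_wpM2r//.
  move: h2; rewrite ler_pdivlMr ?ltr_wpDl//; lra.
by apply: DeriveDef; [apply/cvg_ex; exists 0|exact: cvg_lim c].
Unshelve. all: by end_near.
Qed.

Lemma segment_const (phi : R -> C) : (forall t, 0 <= t -> t <= 1 -> exists M e : R, [/\ 0 < e, 0 <= M &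
  forall s, `|s| <= e -> cabs (phi (t + s) - phi t) <= M * s ^+ 2]) -> phi 1 = phi 0.
Proof.
move=> H; have real (g : R -> R) : (forall x y, `|g x - g y| <= cabs (phi x - phi y)) -> g 1 = g 0.
  move=> hg; have d x : x \in `[0 : R, 1] -> is_derive x (1 : R) g 0.
    rewrite in_itv /= => /andP[x0 x1]; have [M [e [e0 M0 h]]] := H x x0 x1.
    by apply: (is_derive_quad e0 M0) => s hs; apply: le_trans (hg _ _) (h s hs).
  have d' x : x \in `]0 : R, 1[ -> is_derive x (1 : R) g ((fun=> 0 : R) x).
    by move=> xi; apply: d; exact: subset_itv_oo_cc xi.
  have [|c _] := @MVT_segment R g (fun=> 0) 0 1 ler01 d'.
    by apply: derivable_within_continuous => x xi; have dx := d x xi; exact: ex_derive.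
  by rewrite mul0r => /eqP; rewrite subr_eq0 => /eqP.
apply: complexP; [apply: (real (fun t => Re (phi t))) => x y|apply: (real (fun t => Im (phi t))) => x y].
  by have := Re_le_cabs (phi x - phi y); rewrite ReD ReN.
by have := Im_le_cabs (phi x - phi y); rewrite ImD ImN.
Qed.

Lemma hn_near z : 0 < hn z -> exists2 e : R, 0 < e & forall h, nrm h <= e -> 0 < hn (z + h).
Proof.
move=> hz; pose U := nrm z; have U0 : 0 <= U := nrm_ge0 z.
pose K := 8 * U + 3; have K0 : 0 < K by rewrite /K; lra.
exists (Num.min 1 (hn z / (2 * K))); first by rewrite lt_min ltr01 divr_gt0// mulr_gt0.
move=> h; rewrite le_min ler_pdivlMr ?mulr_gt0// => /andP[h1 h2].
have n0 := nrm_ge0 h.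
have q k : cabs (z k ord0 + h k ord0) ^+ 2 <= cabs (z k ord0) ^+ 2 + (2 * U + 1) * nrm h.
  have b0 := cabs_ge0 (h k ord0); have b1 := nrm_coord h k.
  have t := cabsD (z k ord0) (h k ord0); have p0 := cabs_ge0 (z k ord0); have p1 := nrm_coord z k.
  have : cabs (z k ord0 + h k ord0) ^+ 2 <= (cabs (z k ord0) + nrm h) ^+ 2.
    rewrite lerXn2r ?nnegrE ?cabs_ge0 ?addr_ge0//; lra.
  have : nrm h * nrm h <= nrm h by rewrite ler_piMl.
  have : cabs (z k ord0) * nrm h <= U * nrm h by rewrite ler_wpM2r.
  rewrite !expr2; lra.
have q0 : cabs (z ord0 ord0) ^+ 2 <= cabs (z ord0 ord0 + h ord0 ord0) ^+ 2 + 2 * U * nrm h.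
  have b1 := nrm_coord h ord0; have p0 := cabs_ge0 (z ord0 ord0); have p1 := nrm_coord z ord0.
  have t := cabs_leD (z ord0 ord0) (h ord0 ord0); have a0 := cabs_ge0 (z ord0 ord0 + h ord0 ord0).
  have m : cabs (z ord0 ord0) * nrm h <= U * nrm h by rewrite ler_wpM2r.
  have [pb|pb] := lerP (nrm h) (cabs (z ord0 ord0)).
    have : (cabs (z ord0 ord0) - nrm h) ^+ 2 <= cabs (z ord0 ord0 + h ord0 ord0) ^+ 2.
      by rewrite lerXn2r ?nnegrE ?subr_ge0//; lra.
    have := sqr_ge0 (nrm h); rewrite !expr2; lra.
  have := ler_wpM2l p0 (ltW pb); have := sqr_ge0 (cabs (z ord0 ord0 + h ord0 ord0)); have := mulr_ge0 U0 n0.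
  rewrite !expr2; lra.
have q1 := q o1; have q2 := q o2; have q3 := q o3.
rewrite !hn_coord in hz h2 *; rewrite !mxE.
have : K * nrm h = 8 * (U * nrm h) + 3 * nrm h by rewrite /K; ring.
lra.
Qed.

(** A direction without [e_0] component is negative for [h], so [hn] is concave along it: the ball
    is convex in the affine chart. *)
Lemma hn_seg (x d : 'cV[C]_4) (t : R) : d ord0 ord0 = 0 -> 0 < hn x -> 0 < hn (x + d) -> 0 <= t -> t <= 1 -> 0 < hn (x + t%:C *: d).
Proof.
move=> d0 hx hxd t0 t1.
have e (s : R) : hn (x + s%:C *: d) = hn x + 2 * s * Re (hform x d) + s ^+ 2 * hn d.
  rewrite /hn !hformL -[hform d x]hformJ; move: (hform x x) (hform x d) (hform d d) => a b c.
  rewrite !ReIm; ring.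
have := e 1; rewrite scale1r => e1; rewrite e.
have hd : hn d <= 0.
  rewrite hn_coord d0 cabs0; have := sqr_ge0 (cabs (d o1 ord0)); have := sqr_ge0 (cabs (d o2 ord0)).
  by have := sqr_ge0 (cabs (d o3 ord0)); lra.
have -> : hn x + 2 * t * Re (hform x d) + t ^+ 2 * hn d = (1 - t) * hn x + t * hn (x + d) + t * (1 - t) * - hn d.
  by rewrite e1; ring.
have : 0 <= t * (1 - t) * - hn d by rewrite !mulr_ge0 ?oppr_ge0 ?subr_ge0.
have [th|th] := lerP t (1 / 2).
  have : 0 < (1 - t) * hn x by rewrite mulr_gt0//; lra.
  have := mulr_ge0 t0 (ltW hxd).
  lra.
have t1' : 0 <= 1 - t by lra.
have := mulr_ge0 t1' (ltW hx).
have : 0 < t * hn (x + d) by rewrite mulr_gt0//; lra.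
lra.
Qed.

Lemma ff_zero z : 0 < hn z -> (ff z = 0) <-> root (bv ord0) z.
Proof.
move=> hz; rewrite (ff_eq0 hz); split=> [h|[G hG [h1 h2]]].
  by apply: (@ZS_all R (bv ord0) z 0) => //; [exact: lat_bv|rewrite bv_norm].
rewrite -(NN0_G3 _ _ (G3V hG)); have hz' : 0 < hn (invmx G *m z) by rewrite hn_G3//; exact: G3V.
apply: NN0_mirror2 => //.
  have -> : (invmx G *m pi0 R) o2 ord0 = - (hh * hform (G *m bv o2) (bv ord0)).
    by rewrite -[LHS]opprK -hform_bv2 -hform_adj// /pi0 hformZr.
  rewrite -hformJ; apply: is_eisN.
  have -> : hh * (hform (bv ord0) (G *m bv o2))^* = - (hh * hform (bv ord0) (G *m bv o2))^*.
    by rewrite conjM hhJ mulNr opprK.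
  by apply: is_eisN; apply: is_eisJ.
by rewrite -[LHS]opprK -hform_bv2 -hform_adj// h2 oppr0.
Qed.

Section Ratio.
Variable G : 'M[C]_4.
Hypothesis hG : G3 G.
Hypothesis ffG : forall z, 0 < hn z -> cabs (ff (G *m z)) = cabs (ff z).
Definition rt_ z := ff (G *m z) * (ff z)^-1.

Lemma HD_mulmx n m (F : 'cV[C]_m -> C) (A : 'M[C]_(m, n)) (z : 'cV[C]_n) : HD F (A *m z) -> HD (fun x => F (A *m x)) z.
Proof.
move=> h; apply: (HD_comp h) => j.
rewrite (_ : (fun _ => _) = fun x : 'cV[C]_n => \sum_k A j k * x k ord0); first exact: HD_lin.
by apply/funext => x; rewrite mxE.
Qed.

Lemma ratio_quad z : 0 < hn z -> ff z != 0 -> exists M e' : R, [/\ 0 < e', 0 <= M &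
  forall h, nrm h <= e' -> cabs (rt_ (z + h) - rt_ z) <= M * nrm h ^+ 2].
Proof.
move=> hz f0; have [e1 e10 H1] := hn_near hz; have [K [e2 [e20 K0 H2]]] := HD_lip (HD_ff hz).
have c0 : 0 < cabs (ff z) by rewrite cabs_gt0.
have hGz : 0 < hn (G *m z) by rewrite hn_G3.
have e0 : 0 < Num.min e1 (Num.min e2 (cabs (ff z) / (2 * (K + 1)))).
  by rewrite !lt_min e10 e20 divr_gt0// mulr_gt0// ltr_wpDl.
apply: (HD_unimodular e0) => [h|]; last exact: HD_mul (HD_mulmx (HD_ff hGz)) (HD_inv f0 (HD_ff hz)).
rewrite !le_min => /and3P[h1 h2]; rewrite ler_pdivlMr ?mulr_gt0 ?ltr_wpDl// => h3.
have a := H2 h h2; have b := cabs_leD (ff z) (ff (z + h) - ff z).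
rewrite [ff z + _]addrC subrK in b; have n0 := nrm_ge0 h.
have fn : 0 < cabs (ff (z + h)) by lra.
by rewrite /rt_ cabsM cabsV ffG ?H1// mulfV// gt_eqF.
Qed.

Lemma ratio_seg (a d : 'cV[C]_4) : (forall t : R, 0 <= t -> t <= 1 -> 0 < hn (a + t%:C *: d) /\ ff (a + t%:C *: d) != 0) ->
  rt_ (a + d) = rt_ a.
Proof.
move=> H; have := @segment_const (fun t => rt_ (a + t%:C *: d)).
rewrite scale1r C0 scale0r addr0; apply=> t t0 t1; have [h1 h2] := H t t0 t1.
have [M [e [e0 M0 h]]] := ratio_quad h1 h2; have n0 := nrm_ge0 d.
exists (M * nrm d ^+ 2), (e / (nrm d + 1)); split; [by rewrite divr_gt0// ltr_wpDl|by rewrite mulr_ge0 ?sqr_ge0|].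
move=> s; rewrite ler_pdivlMr ?ltr_wpDl// => hs.
have -> : a + (t + s)%:C *: d = (a + t%:C *: d) + s%:C *: d by rewrite CD scalerDl addrA.
have ns : nrm (s%:C *: d) = `|s| * nrm d by rewrite nrmZ cabsC.
apply: le_trans (h _ _) _; first by rewrite ns; have := normr_ge0 s; lra.
by rewrite ns exprMn real_normK ?num_real// le_eqVlt; apply/orP; left; apply/eqP; ring.
Qed.

Definition lvec (f : {ffun 'I_4 -> int * int}) : 'cV[C]_4 := \col_k ei (f k).
Lemma lvecP r : lat r -> exists f, r = lvec f.
Proof.
move=> hr; have /choice[f hf] : forall k, exists b, r k ord0 = ei b by move=> k; apply/is_eisP.
by exists [ffun k => f k]; apply/colP => k; rewrite mxE ffunE.
Qed.

(* the bad heights [x] for which the path [0 -> 1/2 + i x -> 1] in the complex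
   line through [a] and [a + d] meets a mirror *)
Definition bad (a d : 'cV[C]_4) (p : {ffun 'I_4 -> int * int} * bool) : R :=
  let m := - hform (lvec p.1) a / hform (lvec p.1) d in
  if p.2 then Im m / (2 * Re m) else Im m / (2 * (1 - Re m)).

(** There are countably many bad heights, and an interval has positive Lebesgue measure. *)
Lemma good_height a d (e : R) : 0 < e -> exists x : R, [/\ 0 < x, x <= e & forall p, x != bad a d p].
Proof.
move=> e0; apply/not_existsP => H.
have cb : countable (range (bad a d)) := card_le_trans (card_image_le _ _) (countableP _).
have cI : countable [set` `]0, e[] by apply: sub_countable cb; apply: subset_card_le => x /=; rewrite in_itv /= => /andP[x0 xe];
  apply: contrapT => nb; apply: (H x); split=> //; [exact: ltW|]; move=> p; apply/eqP => xb; apply: nb; exists p.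
have := countable_lebesgue_measure0 cI; rewrite lebesgue_measure_itv /= lte_fin e0 oppr0 adde0 => -[]; lra.
Qed.

Lemma height_ReIm (x : R) : Re ((1 / 2 : R)%:C + iu R * x%:C) = 1 / 2 /\ Im ((1 / 2 : R)%:C + iu R * x%:C) = x.
Proof.
split; first by rewrite ReD ReC ReM ReI mul0r ImC mulr0 subr0 addr0.
by rewrite ImD ImC ImM ReI mul0r add0r ImI mul1r ReC add0r.
Qed.
Lemma path_ReIm (t x : R) (la : C) : Re la = 1 / 2 -> Im la = x -> Re (t%:C * la) = t / 2 /\ Im (t%:C * la) = t * x.
Proof. by rewrite ReM ImM ReC ImC => -> ->; split; field. Qed.
Lemma path_ReIm' (t x : R) (la : C) : Re la = 1 / 2 -> Im la = x ->
  Re (la + t%:C * (1 - la)) = (1 + t) / 2 /\ Im (la + t%:C * (1 - la)) = x * (1 - t).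
Proof.
move=> a b; have [c d] := path_ReIm t a b; rewrite mulrBr mulr1.
have -> : Re (la + (t%:C - t%:C * la)) = 1/2 + (t - t / 2) by rewrite ReD ReD ReN c a ReC.
have -> : Im (la + (t%:C - t%:C * la)) = x + (0 - t * x) by rewrite ImD ImD ImN d b ImC.
by split; field.
Qed.

(** The segment from [a] to [a + d] may meet zeros of [ff], so it is replaced by a detour through
    [a + (1/2 + i x) d] in the complex line. Each mirror meets this line at most once, as it misses
    [a] and [a + d], and lies on the detour for a single height at most. *)
Lemma ratio_const (a d : 'cV[C]_4) : d ord0 ord0 = 0 -> 0 < hn a -> 0 < hn (a + d) -> ff a != 0 -> ff (a + d) != 0 ->
  rt_ (a + d) = rt_ a.
Proof.
move=> d0 ha hb fa fb.
have hm : 0 < hn (a + (1 / 2 : R)%:C *: d) by apply: hn_seg => //; lra.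
have [e e0 he] := hn_near hm; have n0 := nrm_ge0 d.
have e1 : 0 < e / (nrm d + 1) by rewrite divr_gt0// ltr_wpDl.
have [x [x0 xe xg]] := good_height a d e1.
pose la : C := (1 / 2 : R)%:C + iu R * x%:C; have [la1 la2] : Re la = 1 / 2 /\ Im la = x := height_ReIm x.
have hq : 0 < hn (a + la *: d).
  rewrite scalerDl addrA; apply: he; rewrite nrmZ cabsM cabsC gtr0_norm//.
  have -> : cabs (iu R) = 1 by rewrite /cabs !ReIm /= expr0n add0r expr1n sqrtr1.
  by move: xe; rewrite mul1r ler_pdivlMr ?ltr_wpDl//; lra.
have mir (G' : 'M[C]_4) : G3 G' -> is_eis (hh * hform (bv ord0) (G' *m bv o2)) ->
    exists2 f, G' *m bv o2 = lvec f & hform (lvec f) a != 0 /\ hform (lvec f) a + hform (lvec f) d != 0.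
  move=> h1 h2; have [f hf] := lvecP (G3_lat h1 (lat_bv R o2)); exists f => //; rewrite -hf -hformDr.
  by split; [apply: contraNneq fa => h; apply/eqP/(ff_zero ha)|apply: contraNneq fb => h; apply/eqP/(ff_zero hb)]; exists G'.
have nz (mu : C) : 0 < hn (a + mu *: d) -> (forall f, - hform (lvec f) a / hform (lvec f) d = mu -> mu != 0 -> mu != 1 -> false) ->
    ff (a + mu *: d) != 0.
  move=> hmu Hm; apply/eqP => /(ff_zero hmu)[G' h1 [h2]]; have [f -> [n1 n2]] := mir G' h1 h2.
  rewrite hformDr hformZr => h3; have n3 : hform (lvec f) d != 0.
    by apply: contraNneq n1 => h; move: h3; rewrite h mulr0 addr0 => ->.
  have muE : - hform (lvec f) a / hform (lvec f) d = mu.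
    by apply: (mulIf n3); rewrite divfK//; apply/eqP; rewrite eq_sym -subr_eq0 opprK addrC h3.
  suff : false by []; apply: (Hm f muE).
    by apply: contraNneq n1 => h; move: h3; rewrite h mul0r addr0 => ->.
  by apply: contraNneq n2 => h; move: h3; rewrite h mul1r => ->.
have r1 : rt_ (a + la *: d) = rt_ a.
  apply: ratio_seg => t t0 t1; have hs : 0 < hn (a + t%:C *: (la *: d)) by apply: hn_seg => //; rewrite mxE d0 mulr0.
  split=> //; rewrite scalerA in hs *; apply: nz => // f fE m0 _.
  have := xg (f, true); rewrite /bad /= fE => /eqP[].
  have tn : t != 0 by apply: contraNneq m0 => ->; rewrite mul0r.
  have [-> ->] := path_ReIm t la1 la2.
  by field.
rewrite -r1.
have dE : a + la *: d + (1 - la) *: d = a + d by rewrite -addrA -scalerDl [la + _]addrC subrK scale1r.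
rewrite -dE.
apply: ratio_seg => t t0 t1.
have hs : 0 < hn (a + la *: d + t%:C *: ((1 - la) *: d)).
  by apply: hn_seg; rewrite ?dE// mxE d0 mulr0.
split=> //; rewrite scalerA -addrA -scalerDl in hs *; apply: nz => // f fE _ m1.
have := xg (f, false); rewrite /bad /= fE => /eqP[].
have tn : 1 - t != 0.
  apply: contraNneq m1 => /eqP; rewrite subr_eq0 => /eqP <-.
  by rewrite C1 mul1r addrC subrK.
have [-> ->] := path_ReIm' t la1 la2.
have -> : 2 * (1 - (1 + t) / 2) = 1 - t by field.
by rewrite mulfK.
Qed.

Lemma ratioZ (k : C) z : k != 0 -> 0 < hn z -> rt_ (k *: z) = rt_ z.
Proof.
move=> k0 hz; have hz' : 0 < hn (G *m z) by rewrite hn_G3.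
rewrite /rt_ -scalemxAr !ffZ//; have [->|f0] := eqVneq (ff z) 0; first by rewrite mulr0 invr0 !mulr0.
by rewrite invfM invrK; move: (ff (G *m z)) (ff z) f0 => p q f0; field; rewrite k0 f0.
Qed.

Lemma hn_z0 z : 0 < hn z -> z ord0 ord0 != 0.
Proof.
rewrite hn_coord; apply: contraTneq => ->; rewrite cabs0.
by have := sqr_ge0 (cabs (z o1 ord0)); have := sqr_ge0 (cabs (z o2 ord0)); have := sqr_ge0 (cabs (z o3 ord0)); lra.
Qed.

(** Both points are first scaled to first coordinate 1, where [ratio_const] applies; at zeros of
    [ff] the equality of moduli suffices. *)
Lemma ff_mult a : 0 < hn a -> ff a != 0 -> forall z, 0 < hn z -> ff (G *m z) = rt_ a * ff z.
Proof.
move=> ha fa z hz; have [f0|f0] := eqVneq (ff z) 0.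
  by rewrite f0 mulr0; apply/eqP; rewrite -cabs_eq0 ffG// f0 cabs0.
have a0 := hn_z0 ha; have z0 := hn_z0 hz.
have i1 : (a ord0 ord0)^-1 != 0 by rewrite invr_neq0. have i2 : (z ord0 ord0)^-1 != 0 by rewrite invr_neq0.
pose a' := (a ord0 ord0)^-1 *: a; pose z' := (z ord0 ord0)^-1 *: z.
have hn' (k : C) (x : 'cV[C]_4) : k != 0 -> 0 < hn x -> 0 < hn (k *: x) by move=> k0 hx; rewrite hnZ mulr_gt0// exprn_gt0// cabs_gt0.
have ha' := hn' _ _ i1 ha; have hz' := hn' _ _ i2 hz.
have dE : a' + (z' - a') = z' by rewrite addrC subrK.
suff <- : rt_ z = rt_ a by rewrite /rt_ divfK.
rewrite -(ratioZ i1 ha) -(ratioZ i2 hz) -/a' -/z' -[z' in LHS]dE; apply: ratio_const; rewrite ?dE//.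
  by rewrite !mxE !mulVf// subrr.
  by rewrite ffZ// mulf_neq0// invrK.
  by rewrite ffZ// mulf_neq0// invrK.
Qed.
End Ratio.
End Multiplier.

(** * Lower bounds: the form is not zero and vanishes to first order *)

Section LowerBound.
Variable R : realType.
Local Notation C := R[i].
Local Notation w := (w3 R).
Local Notation hh := (hh R).
Local Notation th := (1 + 2 * w3 R).
Local Notation s_ := ((ss R)%:C : C).
Local Notation bv := (bv R).
Local Notation ff := (@ff R).
Implicit Types (z : 'cV[C]_4).

(** Quantitative form of [typeII_far]: three equal leading terms minus a remainder of at most
    [3 * 1.019 * 0.942] times one of them. *)
Lemma typeII_lower (tau u2 u3 : C) (y : R) : yeq tau u2 u3 y -> 11/10 <= y ->
  1/10 * cabs (Pht tau u2 u3 (- hh) hh 0 0 (0, 0)) <= cabs (Phi tau u2 u3 (- hh) hh 0 0).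
Proof.
move=> yE hy; have Q1 := Q_far hy; have Q0 := expR_ge0 (- (ss R * y)); have [y0 yE'] := yE.
pose P := Pht tau u2 u3 (- hh) hh 0 0.
have KP : 0 <= kW R * cabs (P (0, 0)) by rewrite mulr_ge0 ?cabs_ge0 ?kW_ge0.
have H := bsumZ KP (bsum_half (fun n => GII_ge0 n (@cl_ge0 R) Q0) (erefl _) (sum_far Q0 Q1)).
have hs := has_sum_off (isT : uniq P3) (PhiP (- hh) hh 0 0 y0 yE').
rewrite PhtII_sum in hs.
have B : bsum (fun i => cabs (if i \in P3 then 0 else P i)) (kW R * cabs (P (0, 0)) * (3 * (942/1000))).
  apply: bsum_le H => p; case: ifP => [_|/negbT p3]; first by rewrite cabs0 mulr_ge0 ?GII_ge0//; exact: cl_ge0.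
  have k0 := p3; rewrite kE_eq0 in k0.
  rewrite /GII nb_aE; have -> : (3 < 1 + 3 * kE p)%N by move: k0; case: (kE p) => // k _; lia.
  have -> : ((1 + 3 * kE p) %% 3 == 1)%N by lia.
  have -> : ((1 + 3 * kE p).-1 %/ 3 = kE p)%N by rewrite add1n /= mulKn.
  rewrite /=; apply: le_trans (PhtII_cl p yE) _; rewrite nb_aE le_eqVlt; apply/orP; left; apply/eqP; rewrite /P; ring.
have b := has_sum_bound hs B; rewrite -/P in b *.
have := cabs_leB (3 * P (0, 0)) (Phi tau u2 u3 (- hh) hh 0 0).
have -> : cabs (3 * P (0, 0) - Phi tau u2 u3 (- hh) hh 0 0) = cabs (Phi tau u2 u3 (- hh) hh 0 0 - 3 * P (0, 0)).
  by rewrite -cabsN opprB.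
have -> : cabs (3 * P (0, 0)) = 3 * cabs (P (0, 0)) by rewrite cabsM -(Cnat R 3) cabsC normr_nat.
move: b; rewrite kWE; have := cabs_ge0 (P (0, 0)).
move: (cabs (P (0, 0))) (cabs (Phi tau u2 u3 (- hh) hh 0 0 - 3 * P (0, 0))) (cabs (Phi tau u2 u3 (- hh) hh 0 0)) => a b c.
lra.
Qed.

Lemma bv_cusp0 : bv ord0 = cusp4 (- w) 1 0 0.
Proof. by rewrite -[LHS]cuspK /cA /cB !bvE /=; congr cusp4; ring. Qed.

(** In cusp coordinates [e_0] is [(- w, 1, 0, 0)], congruent to [(-1, 1, 0, 0)] modulo [th]; so the
    form itself is of type II. *)
Lemma pi0_II z : NN0 (hh *: cusp4 (-1) 1 0 0) z = NN0 (pi0 R) z.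
Proof.
have -> : hh *: cusp4 (-1) 1 0 0 = pi0 R + cusp4 (1 + w) 0 0 0.
  rewrite /pi0 bv_cusp0 !cuspZ cuspD; congr cusp4; rewrite ?mulr0 ?addr0//.
  have t := third_theta R; have hw := w3_sqr R.
  have -> : 1 + w = hh * (th * (1 + w)) by rewrite mulrA t mul1r.
  ring: hw.
by rewrite NN0D//; apply: lat_cusp4; is_eis_tac.
Qed.

Lemma ff_PhiII z : 0 < hn z -> cabs (ff z) * cabs (cA z) = cabs (Phi (tau_ z) (uu2 z) (uu3 z) (- hh) hh 0 0).
Proof.
move=> hz; have A0 : 0 < cabs (cA z) by rewrite cabs_gt0 cA_neq0.
have := NN0_ff hz; rewrite -pi0_II NN0E//.
rewrite cuspZ cB_cusp cA_cusp !V4E !mulr0 mulr1 mulrN1 Kz0 ?hy_gt0// => /(congr1 (@complex.Re R)); rewrite !ReC.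
rewrite -/(uu2 z) -/(uu3 z); move: (cabs (Phi _ _ _ _ _ _ _)) (cabs_ge0 (Phi (tau_ z) (uu2 z) (uu3 z) (- hh) hh 0 0)) => p p0 e.
apply/eqP; rewrite -(@eqrXn2 _ 2) ?mulr_ge0 ?cabs_ge0//; apply/eqP.
have c : cN R * hn z != 0 by rewrite gt_eqF// mulr_gt0 ?cN_gt0.
apply: (mulfI c); rewrite exprMn mulrA -e /hy; move: (cabs (cA z)) A0 (cN R) (hn z) => A A0 n h; field; rewrite gt_eqF//.
Qed.

(** [n] copies of [hh / n] add up to [hh], so the word inequality bounds [VV true hh] by [n^2] times
    its value at [hh / n]. Hence [sg] decreases at most linearly towards its zero at 0. *)
Lemma sg_small : exists2 c : R, 0 < c & forall n : nat, (0 < n)%N -> c <= (n%:R * cabs (sg (hh * n%:R^-1))) ^+ 2.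
Proof.
have K0 := Ks_gt0 R; have r0 := rho_hh_gt0 R.
exists (rho hh / (Ks R * 2)); first by rewrite divr_gt0// mulr_gt0.
move=> n n0; have nC : n%:R != 0 :> C by rewrite pnatr_eq0 -lt0n.
have n0' : 0 < n%:R ^+ 2 :> R by rewrite exprn_gt0// ltr0n.
have := word_nat n (@word1 R) (hh * n%:R^-1); rewrite mulr1.
have -> : n%:R * (hh * n%:R^-1) = hh by rewrite mulrCA mulfV// mulr1.
move=> h1; have h2 := VV_odd_le (hh * n%:R^-1); have h3 := rho_le_VV hh.
have h4 := cabs_sg (hh * n%:R^-1).
have h5 : rho (hh * n%:R^-1) <= Ks R * cabs (sg (hh * n%:R^-1)) ^+ 2.
  rewrite h4 ler_peMr ?rho_ge0// -[1]expR0 ler_expR; apply: mulr_ge0 (sqr_ge0 _).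
  by rewrite mulr_ge0 ?(ltW (ss_gt0 R)).
rewrite ler_pdivrMr; last by rewrite mulr_gt0.
apply: le_trans h3 _; apply: le_trans h1 _.
have -> : (n%:R * cabs (sg (hh / n%:R))) ^+ 2 * (Ks R * 2) = n%:R ^+ 2 * (cabs (sg (hh / n%:R)) ^+ 2 * (Ks R * 2)) by ring.
by rewrite ler_wpM2l ?(ltW n0')//; move: h2 h5 (rho_ge0 (hh / n%:R)); lra.
Qed.

(** A curve crossing the mirror [u2 = 0] at [c = 0], of height [3 - |c|^2], hence in the range of
    [typeII_lower] for [|c| <= 1]; the entry 1 keeps the other factor [sg] at [hh]. *)
Definition zc (c : C) : 'cV[C]_4 := cusp4 2 1 c 1.
Lemma hn_zc c : hn (zc c) = 3 - cabs c ^+ 2.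
Proof.
by rewrite /hn hform_cusp !cJ -[c^* * c]mulrC mulcJ !ReIm; ring.
Qed.

Lemma ff_lower : exists2 c : R, 0 < c & forall n : nat, (0 < n)%N -> c <= n%:R * cabs (ff (zc n%:R^-1)).
Proof.
have [c c0 H] := sg_small.
pose b := cabs (cexp (- (2 * s_ / 3 * 2))) * cabs (sg hh).
have b0 : 0 < b by rewrite mulr_gt0 ?cabs_gt0 ?cexp_neq0 ?sg_hh_neq0.
exists (1/10 * (b * Num.sqrt c)); first by apply: mulr_gt0; [lra|rewrite mulr_gt0 ?sqrtr_gt0].
move=> n n0; have n1 : 1 <= n%:R :> R by rewrite ler1n.
have ci : cabs (n%:R^-1 : C) <= 1 by rewrite cabsV -(Cnat R) cabsC normr_nat invf_le1// ltr0n.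
have ci2 : cabs (n%:R^-1 : C) ^+ 2 <= 1 by rewrite expr_le1 ?cabs_ge0.
have hz : 0 < hn (zc n%:R^-1) by rewrite hn_zc; lra.
have A1 : cA (zc n%:R^-1) = 1 by rewrite cA_cusp.
have y1 : hy (zc n%:R^-1) = 3 - cabs (n%:R^-1 : C) ^+ 2 by rewrite /hy A1 hn_zc cabs1 expr1n divr1.
have := typeII_lower (yeq_z hz); rewrite y1 -ff_PhiII// A1 cabs1 mulr1.
rewrite PhtII0 /tau_ /uu2 /uu3 A1 !divr1 cB_cusp !V4E mulr1 => h.
have {}h := h ltac:(lra).
have sb : Num.sqrt c <= n%:R * cabs (sg (hh / n%:R)).
  have n0' : 0 <= n%:R * cabs (sg (hh / n%:R)) by rewrite mulr_ge0 ?cabs_ge0.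
  by rewrite -[leRHS]ger0_norm// -sqrtr_sqr ler_wsqrtr// H.
apply: le_trans (ler_wpM2l (ler0n _ _) h); rewrite cabsM [cabs (sg _ * _)]cabsM -/b.
have -> : n%:R * (1 / 10 * (cabs (cexp (- (2 * s_ / 3 * 2))) * (cabs (sg (hh / n%:R)) * cabs (sg hh)))) =
  1/10 * (b * (n%:R * cabs (sg (hh / n%:R)))) by rewrite /b; ring.
by rewrite !ler_wpM2l ?(ltW b0)//; lra.
Qed.

Definition zs : 'cV[C]_4 := zc 1.
Lemma hn_zs : 0 < hn zs. Proof. by rewrite hn_zc cabs1; lra. Qed.
Lemma ff_zs : ff zs != 0.
Proof. by have [c c0 /(_ 1%N isT)] := ff_lower; rewrite invr1 mul1r -cabs_gt0 /zs; lra. Qed.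

Lemma hn_zc0 : 0 < hn (zc 0). Proof. by rewrite hn_zc cabs0; lra. Qed.
(** A zero of [q2] would give [n |ff (zc (1/n))| = O(1/n)], against [ff_lower]. *)
Lemma q2_zc0 : q2 (zc 0) != 0.
Proof.
apply/eqP => q0; have [c c0 H] := ff_lower; have [K [e [e0 K0 L]]] := HD_lip (HD_q2 hn_zc0).
pose n := (Num.trunc ((e^-1) + K / c)).+1; have n0 : 0 < n%:R :> R by rewrite ltr0n.
have nb : e^-1 + K / c < n%:R by rewrite /n; apply: truncnS_gt.
have Kc : 0 <= K / c by rewrite divr_ge0// ltW.
have ei0 : 0 < e^-1 by rewrite invr_gt0.
have nC : cabs (n%:R^-1 : C) = n%:R^-1 by rewrite cabsV -(Cnat R) cabsC normr_nat.
have zE : zc n%:R^-1 = zc 0 + n%:R^-1 *: bv o2.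
  by rewrite bv_cusp2 cuspZ cuspD; congr cusp4; ring.
have nn : nrm (n%:R^-1 *: bv o2) = n%:R^-1.
  rewrite nrmZ nC /nrm (bigD1 o2)//= bvkk cabs1 big1 ?addr0 ?mulr1// => k /negbTE h.
  by rewrite bvE h cabs0.
have ni : n%:R^-1 <= e by rewrite -[e]invrK lef_pV2 ?posrE//; lra.
have := L (n%:R^-1 *: bv o2); rewrite nn -zE q0 subr0 => /(_ ni) h.
have ci : n%:R^-1 <= 1 :> R by rewrite invf_le1// ler1n.
have ci2 : cabs (n%:R^-1 : C) ^+ 2 <= 1 by rewrite nC expr_le1// invr_ge0 ltW.
have hz : 0 < hn (zc n%:R^-1) by rewrite hn_zc; lra.
have := H n isT; rewrite ff_q2// V4E cabsM nC mulrA mulfV ?mul1r ?gt_eqF// => h'.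
have : c <= K / n%:R by exact: le_trans h' h.
rewrite ler_pdivlMr// => h2.
have : K < c * n%:R by rewrite -ltr_pdivrMl// mulrC; lra.
lra.
Qed.
End LowerBound.

(** * Regularity at the cusps *)

Section Cusps.
Variable R : realType.
Local Notation C := R[i].
Local Notation hh := (hh R).
Local Notation ei := (ei R).
Local Notation ff := (@ff R).
Implicit Types (z : 'cV[C]_4).

Lemma cabs_hhs (s : int) : s \in [:: 0; 1; -1] -> cabs (hh * s%:~R) ^+ 2 <= 1.
Proof.
have h := cabs_hh R; rewrite cabsM exprMn h !inE => /orP[/eqP->|/orP[]/eqP->].
  by rewrite mulr0z cabs0 expr0n /= mulr0.
  by rewrite mulr1z cabs1 expr1n; lra.
by rewrite mulrN1z cabsN cabs1 expr1n; lra.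
Qed.

(** After reduction modulo [th] only three values of [pa] occur, and the bound on [rho] removes the
    dependence on [u2, u3]; one Gaussian sum at height [31/32] remains. *)
Lemma Phi_bounded : exists2 B : R, 0 <= B & forall (tau u2 u3 : C) (y : R) (sm sa s2 s3 : int),
  yeq tau u2 u3 y -> 31/32 <= y -> sa \in [:: 0; 1; -1] -> s2 \in [:: 0; 1; -1] -> s3 \in [:: 0; 1; -1] ->
  cabs (Phi tau u2 u3 (hh * sm%:~R) (hh * sa%:~R) (hh * s2%:~R) (hh * s3%:~R)) <= B.
Proof.
have [B' [B0' hB]] := rho_bounded R; have s0 := ss_gt0 R.
pose B := B' / Ks R; have B0 : 0 <= B by rewrite divr_ge0 ?(ltW (Ks_gt0 R)).
have c0 : 0 < ss R * (31/32) by rewrite mulr_gt0//; lra.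
have [M1 h1] := bsum_cut (hh * (0 : int)%:~R) c0; have [M2 h2] := bsum_cut (hh * (1 : int)%:~R) c0.
have [M3 h3] := bsum_cut (hh * (-1 : int)%:~R) c0.
have [n1 n2 n3] : [/\ 0 <= M1, 0 <= M2 & 0 <= M3].
  by split; apply: (bsum_ge0 (g := fun b => expR _)); [exact: h1|exact: h2|exact: h3].
have hM (sa : int) : sa \in [:: 0; 1; -1] ->
    bsum (fun b : eis => expR (- (ss R * (31/32)) * cabs (ei b + hh * sa%:~R) ^+ 2)) (M1 + M2 + M3).
  rewrite !inE => /orP[/eqP->|/orP[]/eqP->]; [apply: bsum_weaken h1|apply: bsum_weaken h2|apply: bsum_weaken h3]; lra.
pose E := expR (ss R * 2); have BE : 0 <= B * E by rewrite mulr_ge0 ?expR_ge0.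
exists (B * E * (M1 + M2 + M3)); first by rewrite mulr_ge0 ?addr_ge0.
move=> tau u2 u3 y sm sa s2 s3 yE y1 ha h2' h3'; have [y0 yE'] := yE.
apply: (has_sum_bound (PhiP _ _ _ _ y0 yE')); apply: bsum_le (bsumZ BE (hM sa ha)) => p.
apply: le_trans (Pht_bound _ _ _ _ yE' B0' hB p) _; apply: ler_pM; [exact: mulr_ge0 B0 (expR_ge0 _)|exact: expR_ge0| |].
  rewrite ler_wpM2l// ler_expR ler_wpM2l ?(ltW s0)//.
  by have := cabs_hhs h2'; have := cabs_hhs h3'; lra.
rewrite ler_expR !mulNr lerN2 ler_wpM2r ?sqr_ge0// ler_wpM2l ?(ltW s0)//.
Qed.

Lemma zred_hy z : 0 < hn z -> zred z -> 31/32 <= hy z.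
Proof. by move=> hz; rewrite /zred /near hy_real//; case=> t; case; lra. Qed.

Lemma Kz_le (p2 p3 : C) (y : R) : 0 < y -> Kz p2 p3 y <= cN R * y.
Proof.
move=> y0; rewrite -Kz0// /Kz cabs0 expr0n /= addr0 mulr0 oppr0 expR0 mulr1 ler_piMr//.
  have := Kz0 y0; rewrite /Kz cabs0 expr0n /= addr0 mulr0 oppr0 expR0 mulr1 => ->.
  by rewrite mulr_ge0 ?(ltW y0) ?(ltW (cN_gt0 R)).
rewrite -expR0 ler_expR oppr_le0 !mulr_ge0 ?addr_ge0 ?sqr_ge0 ?(ltW (ss_gt0 R))//.
Qed.

(** By invariance the sum at [z] equals the one at the reduced point [g z] with [g e_0] in place of
    [e_0]; reduced modulo [th], this is covered by [Phi_bounded]. *)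
Lemma ff_bound : exists2 B : R, 0 <= B & forall z g, 0 < hn z -> G3 g -> zred (g *m z) ->
  cabs (ff z) * cabs (cA (g *m z)) <= B.
Proof.
have [B B0 H] := Phi_bounded; exists B => // z g hz hg zr.
have hx : 0 < hn (g *m z) by rewrite hn_G3.
have A0 : 0 < cabs (cA (g *m z)) by rewrite cabs_gt0 cA_neq0.
have [sm [sa [s2 [s3 [q [hq pE _ ha /andP[h2 h3]]]]]]] := lat_split (G3_lat hg (lat_bv R ord0)).
have y1 := zred_hy hx zr; have b := H _ _ _ _ sm sa s2 s3 (yeq_z hx) y1 ha h2 h3.
have := NN0_G3 (pi0 R) z hg; rewrite NN0_ff//.
have -> : g *m pi0 R = hh *: cusp4 sm%:~R sa%:~R s2%:~R s3%:~R + q.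
  by rewrite /pi0 -scalemxAr pE scalerDr scalerA third_theta scale1r.
rewrite NN0D// NN0E// cuspZ cB_cusp cA_cusp !V4E => /(congr1 (@complex.Re R)); rewrite !ReC -/(uu2 _) -/(uu3 _).
move: b (cabs_ge0 (Phi (tau_ (g *m z)) (uu2 (g *m z)) (uu3 (g *m z)) (hh * sm%:~R) (hh * sa%:~R) (hh * s2%:~R) (hh * s3%:~R))).
move: (cabs (Phi _ _ _ _ _ _ _)) => P PB P0 e.
have k := Kz_le (hh * s2%:~R) (hh * s3%:~R) (hy_gt0 hx).
apply: le_trans PB; rewrite -(@ler_pXn2r _ 2) ?nnegrE ?mulr_ge0 ?cabs_ge0//.
have c : 0 < cN R * hn z by rewrite mulr_gt0 ?cN_gt0.
rewrite -(ler_pM2l c) exprMn mulrA -e.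
have A2 : 0 < cabs (cA (g *m z)) ^+ 2 by rewrite exprn_gt0.
rewrite -ler_pdivlMr//; have -> : cN R * hn z * P ^+ 2 / cabs (cA (g *m z)) ^+ 2 = cN R * hy (g *m z) * P ^+ 2.
  by rewrite /hy hn_G3//; field; rewrite gt_eqF.
by rewrite ler_wpM2r ?sqr_ge0.
Qed.

Lemma eis_cabs_ge1 (a : C) : is_eis a -> a != 0 -> 1 <= cabs a.
Proof.
move=> /is_eisP[m ->] m0; rewrite -(@ler_pXn2r _ 2) ?nnegrE ?cabs_ge0// expr1n.
have : 0 < cabs (ei m) ^+ 2 by rewrite exprn_gt0// cabs_gt0.
by rewrite -en_cabs -nbR ltr0n ler1n.
Qed.

Lemma hn_cA0 z : cA z = 0 -> hn z = - (cabs (z o2 ord0) ^+ 2 + cabs (z o3 ord0) ^+ 2).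
Proof.
rewrite hn_coord /cA => /eqP; rewrite subr_eq0 => /eqP ->; ring.
Qed.

Lemma hnB (c x : 'cV[C]_4) : hn (c - x) = hn c + hn x - 2 * Re (hform c x).
Proof.
rewrite /hn !hformL -[hform x c]hformJ; move: (hform c c) (hform c x) (hform x x) => p q r.
by rewrite !ReD !ReN ReJ; ring.
Qed.

(** Scaled to [cA = 1], the two vectors differ by a vector orthogonal to [e], on which [h] is
    nonpositive. *)
Lemma isotropic_pair (c x : 'cV[C]_4) : cA c != 0 -> cA x != 0 -> hform c c = 0 ->
  hn x * cabs (cA c) <= 2 * cabs (hform c x) * cabs (cA x).
Proof.
move=> c0 x0 iso; pose c' := (cA c)^-1 *: c; pose x' := (cA x)^-1 *: x.
have a0 : 0 < cabs (cA c) by rewrite cabs_gt0. have b0 : 0 < cabs (cA x) by rewrite cabs_gt0.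
have e : cA (c' - x') = 0.
  have lin (k : C) (v : 'cV[C]_4) : cA (k *: v) = k * cA v by rewrite /cA !mxE mulrBr.
  have -> : cA (c' - x') = cA c' - cA x' by rewrite /cA !mxE; ring.
  by rewrite !lin !mulVf// subrr.
have := hn_cA0 e; have := sqr_ge0 (cabs ((c' - x') o2 ord0)); have := sqr_ge0 (cabs ((c' - x') o3 ord0)).
have -> : hn (c' - x') = hn c' + hn x' - 2 * Re (hform c' x').
  exact: hnB.
have -> : hn c' = 0 by rewrite hnZ /hn iso Re0 mulr0.
rewrite hnZ cabsV => p1 p2 p3.
have p4 := le_trans (ler_norm _) (Re_le_cabs (hform c' x')).
have hE : cabs (hform c' x') = (cabs (cA c))^-1 * ((cabs (cA x))^-1 * cabs (hform c x)).
  by rewrite hformZl hformZr cabsM cabsJ cabsV [cabs (_^-1 * _)]cabsM cabsV.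
rewrite hE in p4; move: (hform c x) p4 {hE} => h p4.
have p5 : (cabs (cA x))^-1 ^+ 2 * hn x <= 2 * ((cabs (cA c))^-1 * ((cabs (cA x))^-1 * cabs h)) by lra.
have k0 : 0 < cabs (cA x) ^+ 2 * cabs (cA c) by rewrite mulr_gt0 ?exprn_gt0.
move: p5; rewrite -(ler_pM2l k0).
have -> : cabs (cA x) ^+ 2 * cabs (cA c) * ((cabs (cA x))^-1 ^+ 2 * hn x) = hn x * cabs (cA c).
  by move: (cabs (cA x)) b0 (cabs (cA c)) (hn x) => ? ? ? ?; field; rewrite gt_eqF.
have -> // : cabs (cA x) ^+ 2 * cabs (cA c) * (2 * ((cabs (cA c))^-1 * ((cabs (cA x))^-1 * cabs h))) = 2 * cabs h * cabs (cA x).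
by move: (cabs (cA x)) b0 (cabs (cA c)) a0 => ? ? ? ?; field; rewrite !gt_eqF.
Qed.

(** If [h(e, g c)] is not 0, it is an Eisenstein integer of modulus at least 1 and [isotropic_pair]
    applies. Otherwise [g c] is a multiple of [e], with a factor bounded by the entries of [c], and
    [h(c,z) = 1] gives the estimate. *)
Lemma cA_lower (c : 'cV[C]_4) z g : lat c -> c != 0 -> hform c c = 0 -> 2 < hn z -> hform c z = 1 -> G3 g ->
  1 <= cabs (cA (g *m z)) * (1 + nrm c).
Proof.
move=> lc cn0 iso hz cz hg; have [_ _ _ hf] := hg.
have hx : 0 < hn (g *m z) by rewrite hn_G3//; lra.
have A0 : 0 < cabs (cA (g *m z)) by rewrite cabs_gt0 cA_neq0.
have iso' : hform (g *m c) (g *m c) = 0 by rewrite hf.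
have cz' : hform (g *m c) (g *m z) = 1 by rewrite hf.
have lc' := G3_lat hg lc; have [hB hA] := lat_coord lc'; have n0 := nrm_ge0 c.
have [a0|a0] := eqVneq (cA (g *m c)) 0; last first.
  have := isotropic_pair a0 (cA_neq0 hx) iso'; rewrite cz' cabs1 mulr1 hn_G3// => h.
  have a1 := eis_cabs_ge1 hA a0; have hz' : 0 <= hn z by lra.
  have h1 : hn z <= hn z * cabs (cA (g *m c)) by rewrite ler_peMr.
  have := mulr_ge0 (ltW A0) n0; rewrite mulrDr mulr1; lra.
have cE : g *m c = cB (g *m c) *: ec R.
  have := hn_cA0 a0; rewrite /hn iso' Re0 => s.
  have [s1 s2] : cabs ((g *m c) o2 ord0) ^+ 2 = 0 /\ cabs ((g *m c) o3 ord0) ^+ 2 = 0.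
    by have := sqr_ge0 (cabs ((g *m c) o2 ord0)); have := sqr_ge0 (cabs ((g *m c) o3 ord0)); split; lra.
  have zz (v : C) : cabs v ^+ 2 = 0 -> v = 0 by move/eqP; rewrite sqrf_eq0 cabs_eq0 => /eqP.
  by rewrite -[LHS]cuspK a0 (zz _ s1) (zz _ s2) /ec cuspZ !mulr0 mulr1.
have t1 : cabs (cB (g *m c)) * cabs (cA (g *m z)) = 1.
  by have := congr1 (@cabs R) cz'; rewrite {1}cE hformZl hform_ec cabsM cabsJ cabs1.
have cE' : c = cB (g *m c) *: (invmx g *m ec R) by rewrite scalemxAr -cE G3K.
have le : lat (invmx g *m ec R).
  by apply: G3_lat (G3V hg) _; apply: lat_cusp4; is_eis_tac.
have [k nk] : exists k, c k ord0 != 0.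
  apply: contrapT => /forallNP F; move/eqP: cn0; apply; apply/colP => k; rewrite mxE.
  by apply/eqP/negPn/negP; exact: F.
have tk : cabs (cB (g *m c)) <= nrm c.
  apply: le_trans (nrm_coord c k); rewrite [in leRHS]cE' mxE cabsM ler_peMr ?cabs_ge0//.
  apply: eis_cabs_ge1 (le k) _; apply: contraNneq nk => h; by rewrite cE' mxE h mulr0.
have := ler_wpM2r (ltW A0) tk; rewrite t1 => h; lra.
Qed.

Lemma ff_regular : regular_at_cusps ff.
Proof.
have [B B0 H] := ff_bound => c lc cn0 iso; exists 2, (B * (1 + nrm c)) => z /ballconeE hz cz.
rewrite hnE ltcR => hz2; have [g hg zr] := exists_zred hz.
have h1 := cA_lower lc cn0 iso hz2 cz hg; have h2 := H z g hz hg zr.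
rewrite cabsE lecR; have n0 : 0 <= 1 + nrm c by have := nrm_ge0 c; lra.
have := ler_wpM2r n0 h2; rewrite -mulrA; have := ler_wpM2l (cabs_ge0 (ff z)) h1; lra.
Qed.
End Cusps.

(** * The character, the divisor and its multiplicities *)

Section Divisor.
Variable R : realType.
Local Notation C := R[i].
Local Notation hh := (hh R).
Local Notation bv := (bv R).
Local Notation ff := (@ff R).
Local Notation Gam := (G3cong (sqrtm3 R)).
Implicit Types (z : 'cV[C]_4) (g : 'M[C]_4).

Definition fixes_pi0 g := forall z, NN0 (g *m pi0 R) z = NN0 (pi0 R) z.

Lemma Gam_pi0 g : Gam g -> fixes_pi0 g.
Proof.
move=> hg z; have h := eqv_Gam hg (lat_bv R ord0).
have -> : g *m pi0 R = pi0 R + hh *: (g *m bv ord0 - bv ord0) by rewrite /pi0 -scalemxAr -scalerDr addrC subrK.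
by rewrite NN0D// => k; rewrite !mxE; have := h k; rewrite !mxE.
Qed.

(** The ratio is evaluated at [zs], a point where [ff] is known to be nonzero. *)
Definition mult g : C := rt_ g (zs R).

Section Fixed.
Variable g : 'M[C]_4.
Hypotheses (hg : G3 g) (pg : fixes_pi0 g).

Lemma multE z : 0 < hn z -> ff (g *m z) = mult g * ff z.
Proof. exact: (ff_mult hg (fun z hz => ff_cabs hz hg pg) (hn_zs R) (ff_zs R)). Qed.

Lemma mult_neq0 : mult g != 0.
Proof.
have f0 : ff (g *m zs R) != 0 by rewrite -cabs_gt0 (ff_cabs (hn_zs R) hg pg) cabs_gt0; exact: ff_zs.
exact: mulf_neq0 f0 (invr_neq0 (ff_zs R)).
Qed.
End Fixed.

Lemma mult_character : is_character Gam mult.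
Proof.
split=> [g [hg hc]|g g' hg hg']; first exact: mult_neq0 hg (Gam_pi0 (conj hg hc)).
have [h1 _] := hg; have [h2 _] := hg'.
rewrite {1}/mult /rt_ -mulmxA (multE h1 (Gam_pi0 hg)) ?hn_G3 ?hn_zs// (multE h2 (Gam_pi0 hg')) ?hn_zs//.
by rewrite mulrA mulfK ?ff_zs.
Qed.

Lemma exists_swap k : k != ord0 -> exists P : 'M[C]_4, [/\ G3 P, P *m bv o2 = bv k & P *m bv ord0 = bv ord0].
Proof.
move=> k0; have [->|k2] := eqVneq k o2; first by exists 1%:M; rewrite !mul1mx; split=> //; exact: G3_1.
have o : hform (bv o2) (bv k) = 0 by apply: bv_orth; rewrite eq_sym.
have n1 : hform (bv k) (bv k) = -1 by rewrite bv_norm /sg4 (negbTE k0).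
exists (swp (bv k)); split; [exact: swp_G3 (lat_bv R k) n1 o|exact: swp_bv|].
by rewrite reflE hformDl hformNl !bv_orth// subrr mulr0 scale0r addr0.
Qed.

Lemma HD_cst n (c : C) (x : 'cV[C]_n) : HD (fun=> c) x.
Proof.
exists (fun=> 0), 0, 1; split=> // h _; rewrite subrr big1 ?subr0 ?cabs0 ?mul0r// => k _; exact: mul0r.
Qed.

(** [P] carries [e_2] to [e_k] and fixes [e_0], so [M] fixes [pi0] modulo the lattice and transports
    the factorisation of [ff] at the mirror [z_2 = 0] to the component [g {w_k = 0}]. *)
Lemma ff_factor g k : Gam g -> k != ord0 -> exists q : 'cV[C]_4 -> C,
  [/\ holo_on (@ballcone R) q, forall z, 0 < hn z -> ff z = (invmx g *m z) k ord0 * q z &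
      exists z, [/\ 0 < hn z, (invmx g *m z) k ord0 = 0 & q z != 0]].
Proof.
move=> hg k0; have [P [hP P2 P0]] := exists_swap k0; have hgi := Gam_inv hg; have [h1 _] := hgi.
pose M := invmx P *m invmx g; have hM : G3 M := G3M (G3V hP) h1.
have pM : fixes_pi0 M.
  move=> z; rewrite -(NN0_G3 _ _ hP) -mulmxA G3VK// (Gam_pi0 hgi).
  have {1}-> : pi0 R = P *m pi0 R by rewrite /pi0 -scalemxAr P0.
  exact: NN0_G3.
have M2 z : (M *m z) o2 ord0 = (invmx g *m z) k ord0.
  rewrite -[LHS]opprK -hform_bv2 -mulmxA -hform_adj// P2 hform_bvl /sg4 (negbTE k0) mulN1r opprK//.
have hMz z : 0 < hn z -> 0 < hn (M *m z) by rewrite hn_G3.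
have v0 := mult_neq0 hM pM.
exists (fun z => (mult M)^-1 * q2 (M *m z)); split.
  move=> z /ballconeE hz; apply: HD_differentiable; apply: HD_mul; first exact: HD_cst.
  by apply: HD_mulmx; apply: HD_q2; exact: hMz.
  move=> z hz; rewrite -M2 mulrCA -ff_q2 ?hMz// (multE hM pM)// mulKf//.
  exists (invmx M *m zc 0); rewrite -M2 G3VK//; split; [by rewrite hn_G3; [exact: hn_zc0|exact: G3V]|by rewrite V4E|].
  exact: mulf_neq0 (invr_neq0 v0) (q2_zc0 R).
Qed.

Lemma ff_divisor z : 0 < hn z -> ff z = 0 <-> exists g k (x : 'cV[C]_4),
  [/\ Gam g, k != ord0, @ballcone R x, x k ord0 = 0 & z = g *m x].
Proof.
move=> hz; split=> [/(ff_zero hz)/root_orbit[g [k [hg k0 h]]]|[g [k [x [hg k0 _ h zE]]]]].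
  have [h1 _] := hg; exists g, k, (invmx g *m z); split=> //; last by rewrite G3VK.
  by apply/ballconeE; rewrite hn_G3//; exact: G3V.
have [q [_ H _]] := ff_factor hg k0; have [h1 _] := hg.
by rewrite H// zE G3K// h mul0r.
Qed.

Lemma mirrors_distinct (k l : 'I_4) g : k != ord0 -> l != ord0 -> k != l -> Gam g ->
  exists z, [/\ @ballcone R z, z k ord0 = 0 & (g *m z) l ord0 != 0].
Proof.
move=> k0 l0 kl [hg hc]; have [g0|g0] := eqVneq (g l ord0) 0; last first.
  exists (bv ord0); rewrite mulmx_bv bvE (negbTE k0); split=> //.
  by apply/ballconeE; rewrite /hn bv_norm /sg4 eqxx Re1 ltr01.
(* If the entry [(l, 0)] of [g] vanishes, the entry [(l, l)], congruent to 1 modulo [th], cannot;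
   the factor [1/2] keeps the point in the ball. *)
exists (bv ord0 + (1 / 2 : R)%:C *: bv l); split.
  apply/ballconeE; rewrite /hn !hformL !bv_norm [hform (bv l) _]bv_orth// [hform (bv ord0) _]bv_orth 1?eq_sym//.
  by rewrite /sg4 eqxx (negbTE l0) !ReIm; lra.
  by rewrite !mxE /= (negbTE k0) (negbTE kl) mulr0 addr0.
rewrite mulmxDr -scalemxAr mxE mulmx_bv g0 add0r mxE mulmx_bv; apply/mulf_neq0.
  by rewrite -cabs_gt0 cabsC normr_gt0; apply/eqP; lra.
apply/eqP => gl; have := hc l l; rewrite gl eqxx sub0r => /in_idealP h.
by apply: (@not_eis_hh R (-1)) => //; rewrite mulrN1z.
Qed.
End Divisor.

Theorem theorem5p8 (R : realType) :
  let Gam := G3cong (sqrtm3 R) in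
  exists (v : 'M[R[i]]_4 -> R[i]) (f : 'cV[R[i]]_4 -> R[i]),
    [/\ is_character Gam v,
        modular_form Gam 1 v f,
        (* zero set = union of the Gam-orbits of the hyperplanes w_k = 0 *)
        forall z, (@ballcone R) z ->
          (f z = 0 <-> exists (g : 'M[R[i]]_4) (k : 'I_4) (w : 'cV[R[i]]_4),
             [/\ Gam g, k != ord0, (@ballcone R) w, w k ord0 = 0 & z = g *m w]),
        (* multiplicity one along each component g.{w_k = 0} *)
        forall (g : 'M[R[i]]_4) (k : 'I_4), Gam g -> k != ord0 ->
          exists q : 'cV[R[i]]_4 -> R[i],
            [/\ holo_on (@ballcone R) q,
                forall z, (@ballcone R) z -> f z = (invmx g *m z) k ord0 * q z &
                exists z, [/\ (@ballcone R) z, (invmx g *m z) k ord0 = 0 & q z != 0]] &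
        (* the three orbits are distinct *)
        forall (k l : 'I_4), k != ord0 -> l != ord0 -> k != l ->
          forall g, Gam g ->
            exists z, [/\ (@ballcone R) z, z k ord0 = 0 & (g *m z) l ord0 != 0]].
Proof.
move=> Gam; exists (@mult R), (@ff R); split.
  exact: mult_character.
  split; last exact: ff_regular.
    by move=> z /ballconeE hz; apply: HD_differentiable; exact: HD_ff.
    by move=> t z t0 /ballconeE hz; rewrite ffZ.
    by move=> g z hg /ballconeE hz; apply: multE hz; [case: hg|exact: Gam_pi0].
  by move=> z /ballconeE; exact: ff_divisor.
  move=> g k hg k0; have [q [h1 h2 [z [z1 z2 z3]]]] := ff_factor hg k0.
  exists q; split=> // [x /ballconeE|]; first exact: h2.
  by exists z; split=> //; apply/ballconeE.
  by move=> k l k0 l0 kl g; exact: mirrors_distinct.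
Qed.
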